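(* Let $q$ be a power of a prime, $G=\mathrm{GL}_{3,\mathbb{F}_q}$ with $\mu(x)=\mathrm{diag}(x,x,1)$ and $T,B$ as in the context, and $(S,\zeta)$ satisfying conditions (a), (b), (c) of the context. Let $\lambda=(a_1,a_2,a_3)\in\mathbb{Z}^3$ and $f\in H^0(S,\mathcal{V}_I(\lambda))$. If $a_1-a_3>0$, then $f$ is divisible by the partial Hasse invariant $\mathrm{Ha}_{\alpha_2}$, $\alpha_2=e_2-e_3$.
   Context: Notation: $k=\overline{\mathbb{F}}_q$, $\sigma$ the $q$-power Frobenius. For a connected reductive group $G$ over $\mathbb{F}_q$ and a cocharacter $\mu\colon\mathbb{G}_{m,k}\to G_k$: let $P=P_-(\mu)$ (resp. $P_+(\mu)$) be the parabolic subgroup of $G_k$ consisting of $g$ such that $t\mapsto\mu(t)^{-1}g\mu(t)$ (resp. $t\mapsto\mu(t)g\mu(t)^{-1}$) extends to a morphism $\mathbb{A}^1_k\to G_k$; $L$ the centralizer of $\mu$; $Q=(P_+(\mu))^{(q)}$, $M=L^{(q)}$, $\varphi\colon L\to M$ the $q$-Frobenius. The zip group is $E=\{(x,y)\in P\times Q:\varphi(\bar x)=\bar y\}$ ($\bar x$, $\bar y$ the Levi components), acting on $G_k$ by $(x,y)\cdot g=xgy^{-1}$; $G\text{-}\mathtt{Zip}^\mu:=[E\backslash G_k]$. Fix a Borel pair $(B,T)$ over $\mathbb{F}_q$ with $B\subset P$; positive roots are those with root groups in the opposite Borel $B^+$; $\Delta$ the simple roots, $I$ the simple roots of $L$, $W$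 the Weyl group, $s_\alpha$ reflections, $w_0$ the longest element, $w_{0,I}$ the longest element of $W_I$, $\le$ the Bruhat order, $z=\sigma(w_{0,I})w_0$. For $\lambda\in X^*(T)$, $V_I(\lambda)=\mathrm{Ind}_B^P(\lambda)$ and $\mathcal{V}_I(\lambda)$ its vector bundle on $G\text{-}\mathtt{Zip}^\mu$. The zip flag stack $G\text{-}\mathtt{ZipFlag}^\mu=[E'\backslash G_k]$, $E'=E\cap(B\times G_k)$, with projection $\pi$, carries the line bundle $\mathcal{V}_{\mathrm{flag}}(\lambda)$ attached to the character $(x,y)\mapsto\lambda(x)$ of $E'$, with $\pi_*\mathcal{V}_{\mathrm{flag}}(\lambda)=\mathcal{V}_I(\lambda)$. Flag strata: $\mathcal{F}_w=[E'\backslash BwBz^{-1}]$, with closure $\bigcup_{w'\le w}\mathcal{F}_{w'}$. For $\alpha\in\Delta$, a partial Hasse invariant $\mathrm{Ha}_\alpha$ is a global section over $G\text{-}\mathtt{ZipFlag}^\mu$ of some $\mathcal{V}_{\mathrm{flag}}(\lambda_\alpha)$ whose divisor is exactly $\overline{\mathcal{F}}_{w_0s_\alpha}$ with multiplicity one. Condition on $(S,\zeta)$, $\zeta\colon S\to G\text{-}\mathtt{Zip}^\mu$ a morphism from a $k$-scheme: (a) $\zeta$ smooth; (b) surjective on each connected component; (c) for each $w$ of length 1, $\overline{\mathrm{Flag}(S)}_w$ is pseudo-complete, where $\mathrm{Flag}(S)=S\times_{G\text{-}\mathtt{Zip}^\mu}G\text{-}\mathtt{ZipFlag}^\mu$ with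 projection $\zeta_{\mathrm{flag}}$ and $\mathrm{Flag}(S)_w=\zeta_{\mathrm{flag}}^{-1}(\mathcal{F}_w)$. Bundles on $S$, $\mathrm{Flag}(S)$ are pullbacks; $H^0(S,\mathcal{V}_I(\lambda))=H^0(\mathrm{Flag}(S),\mathcal{V}_{\mathrm{flag}}(\lambda))$, $f\mapsto f_{\mathrm{flag}}$, and $f$ is divisible by $\mathrm{Ha}_\alpha$ if $f_{\mathrm{flag}}$ is divisible by $\zeta_{\mathrm{flag}}^*\mathrm{Ha}_\alpha$. Specifics: $T$ diagonal, $B$ lower-triangular in $\mathrm{GL}_3$, $X^*(T)=\mathbb{Z}^3$ via $\prod x_i^{a_i}$, basis $e_i$, simple roots $\alpha_1=e_1-e_2$, $\alpha_2=e_2-e_3$. The weight of $\mathrm{Ha}_{\alpha_2}$ is $(1,-q,0)$. *)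

(* Defs.v *)
(* Schemes over k and quotient stacks by their functors of points
   (Demazure-Gabriel; Jantzen, Representations of Algebraic Groups, I.1). *)
From HB Require Import structures.
From mathcomp Require Import all_boot all_order all_fingroup all_algebra.
From mathcomp Require Import mpoly.

Set Implicit Arguments.
Unset Strict Implicit.
Unset Printing Implicit Defensive.

Import Order.TTheory GRing.Theory Num.Theory.
Local Open Scope ring_scope.

(* The subfield F_q of k is the set of the c with c ^+ q = c. *)
Definition algebraic_closure_Fq (p q : nat) (k : closedFieldType) : Prop :=
  p \in [pchar k] /\
  forall x : k, exists P : {poly k},
    [/\ P != 0, forall i, P`_i ^+ q = P`_i & root P x].

Section Functors.

Variable k : closedFieldType.

(* comAlgType excludes the zero algebra. Every scheme has exactly one point
   over the zero algebra, so no information is lost; "the ideal generated by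
   I becomes the unit ideal" and "x lies in a closed subscheme" need no
   special treatment. *)
Notation kalg := (comAlgType k).

Definition unique_solution (T : Type) (P : T -> Prop) : Prop :=
  exists2 x, P x & forall y, P y -> y = x.

(* The two functor laws, with equality of algebra morphisms read pointwise. *)
Record kfunctor : Type := KFunctor {
  points :> kalg -> Type;
  fmap : forall R R' : kalg, {lrmorphism R -> R'} -> points R -> points R';
  fmap_id : forall (R : kalg) (f : {lrmorphism R -> R}) (x : points R),
    f =1 id -> fmap f x = x;
  fmap_comp : forall (R R' R'' : kalg) (f : {lrmorphism R -> R'})
      (g : {lrmorphism R' -> R''}) (h : {lrmorphism R -> R''}) (x : points R),
    h =1 g \o f -> fmap h x = fmap g (fmap f x) }.

Record kmor (X Y : kfunctor) : Type := KMor {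
  kmor_fun :> forall R : kalg, X R -> Y R;
  kmor_nat : forall (R R' : kalg) (f : {lrmorphism R -> R'}) (x : X R),
    kmor_fun (fmap f x) = fmap f (kmor_fun x) }.

Definition A1 : kfunctor.
Proof.
by refine (@KFunctor (fun R : kalg => R) (fun R R' f x => f x) _ _) => *.
Defined.

Definition subf (X : kfunctor) : Type := forall R : kalg, X R -> Prop.

Definition is_field (R : kalg) : Prop :=
  forall x : R, x != 0 -> exists y, x * y = 1.

Definition unit_ideal (R R' : kalg) (f : R -> R') (I : R -> Prop) : Prop :=
  exists n (r : 'I_n -> R) (c : 'I_n -> R'),
    (forall i, I (r i)) /\ \sum_i c i * f (r i) = 1.

Definition open_sub (X : kfunctor) (U : subf X) : Prop :=
  forall (R : kalg) (x : X R), exists I : R -> Prop,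
    forall (R' : kalg) (f : {lrmorphism R -> R'}),
      U R' (fmap f x) <-> unit_ideal f I.

Definition closed_sub (X : kfunctor) (Z : subf X) : Prop :=
  forall (R : kalg) (x : X R), exists I : R -> Prop,
    forall (R' : kalg) (f : {lrmorphism R -> R'}),
      Z R' (fmap f x) <-> forall r, I r -> f r = 0.

(* By Yoneda, a point a : X A is a morphism Sp A -> X; here it is an
   isomorphism of Sp A onto the open subfunctor U. *)
Definition affine_open (X : kfunctor) (U : subf X) (A : kalg) (a : X A) : Prop :=
  [/\ open_sub U,
      forall (R : kalg) (x : X R),
        U R x <-> exists f : {lrmorphism A -> R}, fmap f a = x
    & forall (R : kalg) (f g : {lrmorphism A -> R}),
        fmap f a = fmap g a -> f =1 g].

Definition is_localization (R R' : kalg) (s : R) (f : {lrmorphism R -> R'}) :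
    Prop :=
  (exists y, f s * y = 1) /\
  forall (A : kalg) (g : {lrmorphism R -> A}), (exists y, g s * y = 1) ->
    (exists h : {lrmorphism R' -> A}, g =1 h \o f) /\
    (forall h h' : {lrmorphism R' -> A}, g =1 h \o f -> g =1 h' \o f -> h =1 h').

(* Sheaf condition for the covers Sp R = \bigcup_i Sp R_{s_i}. The localizations
   at nilpotent s_i are zero and may be omitted from a cover. *)
Definition zariski_sheaf (X : kfunctor) : Prop :=
  forall (R : kalg) (n : nat) (s : 'I_n -> R) (Rs : 'I_n -> kalg)
      (f : forall i, {lrmorphism R -> Rs i}) (x : forall i, X (Rs i)),
    (forall i, is_localization (s i) (f i)) ->
    (exists c : 'I_n -> R, \sum_i c i * s i = 1) ->
    (forall i j (A : kalg) (g : {lrmorphism Rs i -> A})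
        (h : {lrmorphism Rs j -> A}),
      g \o f i =1 h \o f j -> fmap g (x i) = fmap h (x j)) ->
    unique_solution (fun y : X R => forall i, fmap (f i) y = x i).

Definition is_scheme (X : kfunctor) : Prop :=
  zariski_sheaf X /\
  forall (K : kalg) (x : X K), is_field K ->
    exists (U : subf X) (A : kalg) (a : X A), affine_open U a /\ U K x.

Definition finitely_presented (R R' : kalg) (f : {lrmorphism R -> R'}) : Prop :=
  exists n (x : 'I_n -> R') m (rel : 'I_m -> {mpoly R[n]}),
    (forall y : R', exists P : {mpoly R[n]}, mmap f x P = y) /\
    (forall P : {mpoly R[n]}, mmap f x P = 0 <->
       exists c : 'I_m -> {mpoly R[n]}, P = \sum_i c i * rel i).

(* Flatness by the equational criterion: every linear relation in R' with
   coefficients in R comes from relations in R. *)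
Definition flat (R R' : kalg) (f : {lrmorphism R -> R'}) : Prop :=
  forall n (r : 'rV[R]_n) (x : 'cV[R']_n), map_mx f r *m x = 0 ->
    exists m (M : 'M[R]_(n, m)) (y : 'cV[R']_m),
      x = map_mx f M *m y /\ r *m M = 0.

(* A flat morphism is faithfully flat when proper ideals of R generate proper
   ideals of R'. *)
Definition faithfully_flat (R R' : kalg) (f : {lrmorphism R -> R'}) : Prop :=
  flat f /\ forall I : R -> Prop, unit_ideal f I -> unit_ideal (@id R) I.

Definition fppf_cover (R R' : kalg) (f : {lrmorphism R -> R'}) : Prop :=
  faithfully_flat f /\ finitely_presented f.

Definition locally_fp (X Y : kfunctor) (f : kmor X Y) : Prop :=
  forall (K : kalg) (x : X K), is_field K ->
    exists (U : subf X) (A : kalg) (a : X A)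
           (V : subf Y) (B : kalg) (b : Y B) (phi : {lrmorphism B -> A}),
      [/\ affine_open U a, affine_open V b, U K x,
          f A a = fmap phi b & finitely_presented phi].

Definition formally_smooth (X Y : kfunctor) (f : kmor X Y) : Prop :=
  forall (A A0 : kalg) (pi : {lrmorphism A -> A0}) (x0 : X A0) (y : Y A),
    (forall r : A0, exists s, pi s = r) ->
    (forall r s : A, pi r = 0 -> pi s = 0 -> r * s = 0) ->
    f A0 x0 = fmap pi y ->
    exists x : X A, fmap pi x = x0 /\ f A x = y.

Definition smooth (X Y : kfunctor) (f : kmor X Y) : Prop :=
  locally_fp f /\ formally_smooth f.

(* A point of the topological space |X| is a class of field-valued points of X
   modulo field extension, so a subset of |X| is a predicate on field-valued
   points that is insensitive to field extension. *)
Definition point_set (X : kfunctor) (A : subf X) : Prop :=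
  forall (K K' : kalg) (f : {lrmorphism K -> K'}) (x : X K),
    is_field K -> is_field K' -> A K x <-> A K' (fmap f x).

Definition included (X : kfunctor) (A A' : subf X) : Prop :=
  forall (K : kalg) (x : X K), is_field K -> A K x -> A' K x.

Definition meets (X : kfunctor) (A A' : subf X) : Prop :=
  exists (K : kalg) (x : X K), [/\ is_field K, A K x & A' K x].

Definition connected_set (X : kfunctor) (A : subf X) : Prop :=
  [/\ point_set A, meets A A &
      forall U V : subf X, open_sub U -> open_sub V ->
        included A (fun K x => U K x \/ V K x) ->
        meets A U -> meets A V -> meets A (fun K x => U K x /\ V K x)].

Definition connected_component (X : kfunctor) (C : subf X) : Prop :=
  connected_set C /\
  forall A : subf X, connected_set A -> included C A -> included A C.

(* The closure of A in |X| with its reduced structure is the smallest closed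
   subscheme of X whose underlying set contains A. *)
Definition reduced_closure (X : kfunctor) (A : subf X) : subf X :=
  fun R x => forall Z : subf X, closed_sub Z -> included A Z -> Z R x.

(* Values of h outside the closed subscheme Z are irrelevant: h stands for an
   element of H^0(Z, O_Z). Its local constancy is for the Zariski topology. *)
Definition pseudo_complete (X : kfunctor) (Z : subf X) : Prop :=
  forall h : (forall R : kalg, X R -> R),
    (forall (R R' : kalg) (f : {lrmorphism R -> R'}) (x : X R), Z R x ->
       h R' (fmap f x) = f (h R x)) ->
    forall (K : kalg) (x : X K), is_field K -> Z K x ->
      exists (U : subf X) (c : k), [/\ open_sub U, U K x &
        forall (R : kalg) (y : X R), Z R y -> U R y -> h R y = c%:A].

(* A matrix with its inverse; the inverse is unique, so this is GL_n(R). *)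
Definition GLmx (n : nat) (R : kalg) : Type :=
  {g : 'M[R]_n * 'M[R]_n | g.1 *m g.2 == 1%:M}.

Definition mx n (R : kalg) (g : GLmx n R) : 'M[R]_n := (val g).1.
Definition imx n (R : kalg) (g : GLmx n R) : 'M[R]_n := (val g).2.

Lemma mxK n (R : kalg) (g : GLmx n R) : mx g *m imx g = 1%:M.
Proof. exact: (eqP (valP g)). Qed.

Lemma imxK n (R : kalg) (g : GLmx n R) : imx g *m mx g = 1%:M.
Proof. exact: (mulmx1C (mxK g)). Qed.

Definition mkGL n (R : kalg) (a b : 'M[R]_n) (H : a *m b = 1%:M) : GLmx n R :=
  exist _ (a, b) (introT eqP H).

Fact gl1_subproof n (R : kalg) : (1%:M : 'M[R]_n) *m 1%:M = 1%:M.
Proof. exact: mulmx1. Qed.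
Definition gl1 n (R : kalg) : GLmx n R := mkGL (gl1_subproof n R).

Fact glM_subproof n (R : kalg) (g h : GLmx n R) :
  (mx g *m mx h) *m (imx h *m imx g) = 1%:M.
Proof. by rewrite mulmxA -(mulmxA (mx g)) mxK mulmx1 mxK. Qed.
Definition glM n (R : kalg) (g h : GLmx n R) : GLmx n R :=
  mkGL (glM_subproof g h).

Definition glV n (R : kalg) (g : GLmx n R) : GLmx n R := mkGL (imxK g).

Fact glmap_subproof n (R R' : kalg) (f : {lrmorphism R -> R'}) (g : GLmx n R) :
  map_mx f (mx g) *m map_mx f (imx g) = 1%:M.
Proof. by rewrite -map_mxM mxK map_mx1. Qed.
Definition glmap n (R R' : kalg) (f : {lrmorphism R -> R'}) (g : GLmx n R) :
  GLmx n R' := mkGL (glmap_subproof f g).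

Definition GLn (n : nat) : kfunctor.
Proof.
refine (@KFunctor (GLmx n) (@glmap n) _ _).
- move=> R f [[a b] H] E; apply: val_inj; rewrite /= /mx /imx /=.
  by congr pair; apply/matrixP=> i j; rewrite mxE E.
- move=> R R' R'' f g h [[a b] H] E; apply: val_inj; rewrite /= /mx /imx /=.
  by congr pair; apply/matrixP=> i j; rewrite !mxE E.
Defined.

Definition GL3 : kfunctor := GLn 3.

Fact mu_subproof (R : kalg) (a : GLmx 1 R) :
  diag_mx (\row_(i < 3) if (i < 2)%N then mx a 0 0 else 1) *m
  diag_mx (\row_(i < 3) if (i < 2)%N then imx a 0 0 else 1) = 1%:M.
Proof.
have E : mx a 0 0 * imx a 0 0 = 1.
  have := congr1 (fun A : 'M_1 => A 0 0) (mxK a).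
  by rewrite !mxE big_ord1.
rewrite mulmx_diag -diag_const_mx; congr diag_mx.
by apply/rowP=> i; rewrite !mxE; case: ifP; rewrite ?mulr1.
Qed.

(* mu(x) = diag(x, x, 1), with G_m = GL_1. *)
Definition mu (R : kalg) (a : GLmx 1 R) : GL3 R := mkGL (mu_subproof a).

Inductive side := Minus | Plus.

Definition conj_mu (s : side) (R : kalg) (a : GLmx 1 R) (g : GL3 R) : GL3 R :=
  match s with
  | Minus => glM (glM (glV (mu a)) g) (mu a)
  | Plus => glM (glM (mu a) g) (glV (mu a))
  end.

(* The morphism G_{m,R} -> G_R, a |-> conj_mu s a g, extends to a morphism
   F : A^1_R -> G_R, and F(0) = l. *)
Definition limit_mu (s : side) (R : kalg) (g l : GL3 R) : Prop :=
  exists F : (forall A : kalg, {lrmorphism R -> A} -> A -> GL3 A),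
    [/\ forall (A A' : kalg) (f : {lrmorphism R -> A}) (h : {lrmorphism A -> A'})
          (f' : {lrmorphism R -> A'}) (a : A),
          f' =1 h \o f -> F A' f' (h a) = fmap h (F A f a),
        forall (A : kalg) (f : {lrmorphism R -> A}) (a : GLmx 1 A),
          F A f (mx a 0 0) = conj_mu s a (fmap f g)
      & forall f : {lrmorphism R -> R}, f =1 id -> F R f 0 = l].

Definition parabolic (s : side) (R : kalg) (g : GL3 R) : Prop :=
  exists l, limit_mu s g l.

Definition levi (R : kalg) (g : GL3 R) : Prop :=
  forall (A : kalg) (f : {lrmorphism R -> A}) (a : GLmx 1 A),
    glM (fmap f g) (mu a) = glM (mu a) (fmap f g).

(* Points of the unipotent radical of P_-(mu), resp. P_+(mu). *)
Definition unip_radical (s : side) (R : kalg) (u : GL3 R) : Prop :=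
  limit_mu s u (gl1 3 R).

Definition levi_component (s : side) (R : kalg) (g l : GL3 R) : Prop :=
  levi l /\ exists2 u, unip_radical s u & g = glM l u.

(* Since mu is defined over F_q, the q-Frobenius twists of P_+(mu) and of L are
   these groups themselves, and the relative Frobenius of L is the entrywise
   q-th power. *)
Definition zip_group (q : nat) (R : kalg) (x y : GL3 R) : Prop :=
  [/\ parabolic Minus x, parabolic Plus y &
      exists l m, [/\ levi_component Minus x l, levi_component Plus y m &
                      mx m = map_mx (fun r => r ^+ q) (mx l)]].

Definition borel (R : kalg) (b : GL3 R) : Prop :=
  forall i j : 'I_3, (i < j)%N -> mx b i j = 0.

Definition zip_group_flag (q : nat) (R : kalg) (x y : GL3 R) : Prop :=
  zip_group q x y /\ borel x.

(* The extension to B of the character t |-> \prod_i t_i ^ (lam_i) of T; the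
   diagonal of the inverse of b consists of the inverses of the b_ii. *)
Definition character (lam : 'rV[int]_3) (R : kalg) (b : GL3 R) : R :=
  \prod_(i < 3) match lam 0 i with
                | Posz n => mx b i i ^+ n
                | Negz n => imx b i i ^+ n.+1
                end.

(* p : X -> Y is an fppf torsor under the subgroup functor H of GL_3 x GL_3.
   Only the values act R x y with H R x y are meaningful. *)
Definition torsor (H : forall R : kalg, GL3 R -> GL3 R -> Prop)
    (X Y : kfunctor) (act : forall R : kalg, GL3 R -> GL3 R -> X R -> X R)
    (p : kmor X Y) : Prop :=
  [/\ forall (R : kalg) (t : X R), act R (gl1 3 R) (gl1 3 R) t = t,
      forall (R : kalg) (x y x' y' : GL3 R) (t : X R), H R x y -> H R x' y' ->
        act R (glM x x') (glM y y') t = act R x y (act R x' y' t),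
      forall (R R' : kalg) (f : {lrmorphism R -> R'}) (x y : GL3 R) (t : X R),
        H R x y -> fmap f (act R x y t) = act R' (fmap f x) (fmap f y) (fmap f t),
      forall (R : kalg) (t t' : X R), p R t = p R t' <->
        exists x y, H R x y /\ t' = act R x y t
    & (forall (R : kalg) (x y x' y' : GL3 R) (t : X R),
         H R x y -> H R x' y' -> act R x y t = act R x' y' t ->
         x = x' /\ y = y') /\
      (forall (R : kalg) (s : Y R), exists (R' : kalg) (f : {lrmorphism R -> R'})
         (t : X R'), fppf_cover f /\ p R' t = fmap f s)].

(* A morphism S -> [E \ G_k]: an E-torsor on S with an E-equivariant morphism
   to G_k, where (x, y) . g = x g y^-1. Torsors under the affine group E are
   representable by schemes. *)
Record gzip_map (q : nat) (S : kfunctor) : Type := GZipMap {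
  zt : kfunctor;
  zproj : kmor zt S;
  zact : forall R : kalg, GL3 R -> GL3 R -> zt R -> zt R;
  zmor : kmor zt GL3;
  zt_scheme : is_scheme zt;
  zt_torsor : torsor (@zip_group q) zact zproj;
  zmor_equiv : forall (R : kalg) (x y : GL3 R) (t : zt R), zip_group q x y ->
    zmor R (zact x y t) = glM (glM x (zmor R t)) (glV y) }.

(* Smoothness is tested after base change along the atlas G_k -> [E \ G_k]. *)
Definition zip_smooth q (S : kfunctor) (zeta : gzip_map q S) : Prop :=
  smooth (zmor zeta).

(* By equivariance it is equivalent to reach, over a field extension, the point
   g of G_k itself or only its image in [E \ G_k]. *)
Definition zip_surjective_on_components q (S : kfunctor) (zeta : gzip_map q S) :
    Prop :=
  forall C : subf S, connected_component C ->
  forall (K : kalg) (g : GL3 K), is_field K ->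
    exists (K' : kalg) (f : {lrmorphism K -> K'}) (t : zt zeta K'),
      [/\ is_field K', C K' (zproj zeta K' t) & zmor zeta K' t = fmap f g].

(* Flag(S) = S x_[E\G] [E'\G] is the quotient of the E-torsor of zeta by E'. *)
Definition is_flag_space q (S : kfunctor) (zeta : gzip_map q S) (Fl : kfunctor)
    (pi : kmor (zt zeta) Fl) : Prop :=
  is_scheme Fl /\ torsor (@zip_group_flag q) (@zact _ _ zeta) pi.

Definition s1 : 'S_3 := tperm ord0 (inord 1).
Definition s2 : 'S_3 := tperm (inord 1) ord_max.
Definition w0 : 'S_3 := perm (@rev_ord_inj 3).

(* I = {e_1 - e_2}, so w_{0,I} = s1; sigma acts trivially on W. *)
Definition zperm : 'S_3 := (s1 * w0)%g.

Definition weyl_length (w : 'S_3) : nat :=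
  #|[set ij : 'I_3 * 'I_3 | (ij.1 < ij.2)%N && (w ij.2 < w ij.1)%N]|.

(* B w B z^-1, with w represented by perm_mx w (a group morphism in w). *)
Definition flag_cell (w : 'S_3) : subf GL3 := fun K g =>
  exists b b' : GL3 K, [/\ borel b, borel b' &
    mx g = mx b *m perm_mx w *m mx b' *m perm_mx (zperm^-1)%g].

Definition flag_stratum q (S : kfunctor) (zeta : gzip_map q S) (Fl : kfunctor)
    (pi : kmor (zt zeta) Fl) (w : 'S_3) : subf Fl := fun K x =>
  exists (K' : kalg) (f : {lrmorphism K -> K'}) (t : zt zeta K'),
    [/\ is_field K', pi K' t = fmap f x & flag_cell w (zmor zeta K' t)].

Definition length1_strata_pseudo_complete q (S : kfunctor) (zeta : gzip_map q S)
    (Fl : kfunctor) (pi : kmor (zt zeta) Fl) : Prop :=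
  forall w : 'S_3, weyl_length w = 1%N ->
    pseudo_complete (reduced_closure (flag_stratum pi w)).

(* H^0(Flag(S), V_flag(lam)). *)
Definition flag_section q (S : kfunctor) (zeta : gzip_map q S)
    (lam : 'rV[int]_3) (h : kmor (zt zeta) A1) : Prop :=
  forall (R : kalg) (x y : GL3 R) (t : zt zeta R), zip_group_flag q x y ->
    h R (zact x y t) = (character lam x * h R t : R).

(* H^0(S, V_I(lam)): V_I(lam) = Ind_B^P lam consists of the functions u on P
   with u(a b) = lam(b)^-1 u(a), where p acts by (p u)(a) = u(p^-1 a), and a
   section over S is an E-equivariant function t |-> f(t, -) from the torsor to
   Ind_B^P lam, E acting through its first projection to P.
   The values f(t, a) with a outside P are irrelevant. *)
Definition V_I_section q (S : kfunctor) (zeta : gzip_map q S) (lam : 'rV[int]_3)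
    (f : forall R : kalg, zt zeta R -> GL3 R -> R) : Prop :=
  [/\ forall (R R' : kalg) (phi : {lrmorphism R -> R'}) (t : zt zeta R)
          (a : GL3 R), parabolic Minus a ->
        f R' (fmap phi t) (fmap phi a) = phi (f R t a),
      forall (R : kalg) (t : zt zeta R) (a b : GL3 R),
        parabolic Minus a -> borel b ->
        f R t (glM a b) = character lam (glV b) * f R t a
    & forall (R : kalg) (x y : GL3 R) (t : zt zeta R) (a : GL3 R),
        zip_group q x y -> parabolic Minus a ->
        f R (zact x y t) a = f R t (glM (glV x) a)].

(* f |-> f_flag is evaluation of Ind_B^P lam at the identity. *)
Definition to_flag q (S : kfunctor) (zeta : gzip_map q S)
    (f : forall R : kalg, zt zeta R -> GL3 R -> R) (R : kalg) (t : zt zeta R) : R :=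
  f R t (gl1 3 R).

(* Ha is a partial Hasse invariant of weight lam for the simple root with
   reflection s. Sections over [E' \ G_k] are the semi-invariant functions on
   G_k. The divisor is exactly the closure of the stratum of w0 s, with multiplicity one, when the scheme
   of zeros of Ha is that closure with its reduced structure. *)
Definition partial_hasse_invariant (q : nat) (s : 'S_3) (lam : 'rV[int]_3)
    (Ha : kmor GL3 A1) : Prop :=
  (forall (R : kalg) (x y g : GL3 R), zip_group_flag q x y ->
     Ha R (glM (glM x g) (glV y)) = (character lam x * Ha R g : R)) /\
  (forall (R : kalg) (g : GL3 R),
     Ha R g = (0 : R) <-> reduced_closure (flag_cell (w0 * s)%g) g).

Definition divisible_by q (S : kfunctor) (zeta : gzip_map q S)
    (lam lamHa : 'rV[int]_3) (f : forall R : kalg, zt zeta R -> GL3 R -> R)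
    (Ha : kmor GL3 A1) : Prop :=
  exists2 h : kmor (zt zeta) A1, flag_section (lam - lamHa) h &
    forall (R : kalg) (t : zt zeta R),
      to_flag f t = (h R t : R) * Ha R (zmor zeta R t).

End Functors.

Definition weight (a1 a2 a3 : int) : 'rV[int]_3 :=
  \row_(i < 3) nth 0 [:: a1; a2; a3] i.

(* Main.v *)
Require Import Defs.
From HB Require Import structures.
From Stdlib Require Import Classical ClassicalEpsilon.
From mathcomp Require Import all_boot all_order all_fingroup all_algebra mpoly.
From mathcomp Require classical_sets boolp.
From mathcomp Require Import ring zify.
Set Implicit Arguments.
Unset Strict Implicit.
Unset Printing Implicit Defensive.
Import GRing.Theory Num.Theory.
Local Open Scope ring_scope.

(** [Ha] divides g_01 because its zero scheme is the reduced closure of a cell on which g_01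
    vanishes. Exponents: on D the functions g_00 and g_11 have weights (1-q, 0, 0) and (0, 1-q, 0);
    on g_00 = 0 the unit g_02 has weight (1, 0, -q), and det g has weight (1-q)(1, 1, 1). With N =
    q^2 - 1 the weight of f'^N g_02^al (det g)^ga g_11^M vanishes for integers al, ga, M that are
    then forced. Pseudo-completeness asks for a function on a whole closed stratum, but f' exists
    only near F1. What makes a continuation by 0 possible is that not factoring is an open condition
    on the curve. Divisibility of F by g_01 near a point cannot be propagated: it is automatic where
    g_01 is invertible, so it is not a closed condition. Hence the passage to E-orbits, which also
    makes the property constant on the fibres of X -> S, as condition (b) on components of S
    requires. Smoothness is given as infinitesimal lifting; from it the charts of X, D and the
    curves are shown to be locally integral domains, and this takes the place of regularity. *)

(* Let X -> S be the E-torsor of zeta, g : X -> GL_3 its equivariant morphism and F : X -> A^1 the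
   semi-invariant function corresponding to f_flag. Ha divides the entry g_01, so F has to be
   divided by g_01.
   In the divisor D = (g_01 = 0) the closures of the two strata of length 1 are the curves g_00 = 0
   and g_11 = 0, which meet in the closed stratum F1. Near F1 write F = g_00^i g_11^j f' on D, where
   f' has weight (b_1, b_2, a_3), b_1 = a_1 + i(q-1), b_2 = a_2 + j(q-1). If
   M = (q+1) b_2 - q b_1 - a_3 > 0, then the product of f'^(q^2-1), g_11^M and suitable powers of
   the units g_02 and det g is an E'-invariant function on the curve g_00 = 0. It descends to the
   flag space, is locally constant by pseudo-completeness and vanishes on F1; hence g_00 divides f'.
   Likewise g_11 divides f' if (q+1) b_1 - q a_3 - b_2 > 0, and one of the two inequalities always
   holds because b_1 >= a_1 > a_3. By Krull's intersection theorem F vanishes on D near F1.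
   Elimination of the unipotent parameter then shows that g_01 divides F along all the E-orbits
   near F1. This property is E-invariant, open and closed (X is smooth, and g_01 has unit content as
   a polynomial in the unipotent parameter), so it holds above a union of connected components of S; by condition
   (b) it holds above each of them. *)

(** * Quotients, localizations and polynomials over k-algebras *)

Section Algebras.
Variable k : closedFieldType.
Notation kalg := (comAlgType k).

Lemma lrmorphism_of (R R' : kalg) (f : R -> R') :
  (forall x y, f (x + y) = f x + f y) -> f 1 = 1 ->
  (forall x y, f (x * y) = f x * f y) -> (forall c : k, f c%:A = c%:A) ->
  {g : {lrmorphism R -> R'} | g =1 f}.
Proof.
move=> fD f1 fM fA.
have lin : linear f by move=> a x y; rewrite fD -mulr_algl fM fA mulr_algl.
pose L := GRing.isLinear.Build k R R' *:%R f lin.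
pose M := GRing.isMonoidMorphism.Build R R' f (f1, fM).
by exists (HB.pack f L M : {lrmorphism R -> R'}).
Qed.

(** A synonym of [A], so that the k-algebra structure through [phi] gets instances of its own;
    quotients and polynomial rings become k-algebras in this way. *)
Definition kalg_carrier (A : comNzRingType) (phi : {rmorphism k -> A}) : Type := A.

Section KalgOf.
Variables (A : comNzRingType) (phi : {rmorphism k -> A}).
Local Notation T := (kalg_carrier phi).
HB.instance Definition _ := GRing.ComNzRing.on T.
Let scale (a : k) (x : T) : T := (phi a : A) * x.
Fact kscaleA a b v : scale a (scale b v) = scale (a * b) v.
Proof. by rewrite /scale rmorphM mulrA. Qed.
Fact kscale1 : left_id 1 scale.
Proof. by move=> x; rewrite /scale rmorph1 mul1r. Qed.
Fact kscaleDr : right_distributive scale +%R.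
Proof. by move=> a x y; rewrite /scale mulrDr. Qed.
Fact kscaleDl v : {morph scale^~ v : a b / a + b}.
Proof. by move=> a b; rewrite /scale rmorphD mulrDl. Qed.
HB.instance Definition _ :=
  GRing.Zmodule_isLmodule.Build k T kscaleA kscale1 kscaleDr kscaleDl.
Fact kscaleAl (a : k) (u v : T) : a *: (u * v) = a *: u * v.
Proof. by rewrite /GRing.scale /= /scale mulrA. Qed.
HB.instance Definition _ := GRing.Lmodule_isLalgebra.Build k T kscaleAl.
HB.instance Definition _ := GRing.Lalgebra_isComAlgebra.Build k T.
Definition kalg_of : kalg := T.
End KalgOf.

Lemma kalg_ofA (A : comNzRingType) (phi : {rmorphism k -> A}) (c : k) :
  (c%:A : kalg_of phi) = phi c.
Proof. by rewrite /GRing.scale /= mulr1. Qed.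

Definition ideal (R : comNzRingType) (I : R -> Prop) :=
  [/\ I 0, forall x y, I x -> I y -> I (x + y) & forall a x, I x -> I (a * x)].

Section Quot.
Variables (R : kalg) (I : R -> Prop).
Hypothesis II : ideal I.
Hypothesis I1 : ~ I 1.
Definition quot_pred : {pred R} := fun x => boolp.asbool (I x).
Fact quot_predP : idealr_closed quot_pred.
Proof.
case: II => I0 ID IM; split.
- exact/boolp.asboolP.
- exact/boolp.asboolPn.
- move=> a u v /boolp.asboolP Iu /boolp.asboolP Iv.
  by apply/boolp.asboolP; apply: ID => //; apply: IM.
Qed.
HB.instance Definition _ := isIdealr.Build R quot_pred quot_predP.
Let Q : comNzRingType := {ideal_quot quot_pred}.
Fact quot_rmorph : exists p : {rmorphism R -> Q},
  (forall y, exists x, p x = y) /\ (forall r, p r = 0 <-> I r).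
Proof.
pose p (x : R) : Q := (\pi_Q x)%qT.
have pD : zmod_morphism p.
  by move=> x y; rewrite /p !piE.
have pM : monoid_morphism p by split; [rewrite /p !piE | move=> x y; rewrite /p !piE].
pose L := GRing.isZmodMorphism.Build R Q p pD.
pose M := GRing.isMonoidMorphism.Build R Q p pM.
exists (HB.pack p L M : {rmorphism R -> Q}); split.
- by move=> y; exists (generic_quotient.repr y); rewrite /= /p reprK.
- move=> r /=; rewrite /p; have -> : 0 = (\pi_Q 0 : Q)%qT by rewrite !piE.
  split.
    move=> /eqP; rewrite -Quotient.idealrBE subr0 => /boolp.asboolP; exact.
  by move=> Ir; apply/eqP; rewrite -Quotient.idealrBE subr0; apply/boolp.asboolP.
Qed.

(** Quotients are characterized by surjectivity and kernel only. The zero ring is not a k-algebra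
    here, so each use first excludes [I 1]. *)
Lemma quot_ex : exists (Q : kalg) (p : {lrmorphism R -> Q}),
  (forall y, exists x, p x = y) /\ (forall r, p r = 0 <-> I r).
Proof.
have [p [ps pk]] := quot_rmorph.
pose phi : {rmorphism k -> Q} := p \o (in_alg R).
have [g gE] := @lrmorphism_of R (kalg_of phi) p (rmorphD p) (rmorph1 p) (rmorphM p)
  (fun c => esym (kalg_ofA phi c)).
exists (kalg_of phi), g; split=> [y|r]; last by rewrite gE.
by have [x xy] := ps y; exists x; rewrite gE.
Qed.
End Quot.

Lemma quot_lift (R Q R' : kalg) (p : {lrmorphism R -> Q}) (g : {lrmorphism R -> R'}) :
  (forall y, exists x, p x = y) -> (forall r, p r = 0 -> g r = 0) ->
  exists h : {lrmorphism Q -> R'}, forall r, h (p r) = g r.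
Proof.
move=> ps pk.
pose f y := g (proj1_sig (constructive_indefinite_description _ (ps y))).
have fE r : f (p r) = g r.
  rewrite /f; case: constructive_indefinite_description => x /= xr.
  by apply/eqP; rewrite -subr_eq0 -rmorphB; apply/eqP/pk; rewrite rmorphB /= xr subrr.
have [||||h hE] := @lrmorphism_of Q R' f.
- move=> x y; have [a <-] := ps x; have [b <-] := ps y.
  by rewrite -rmorphD !fE rmorphD.
- by rewrite -(rmorph1 p) fE rmorph1.
- move=> x y; have [a <-] := ps x; have [b <-] := ps y.
  by rewrite -rmorphM !fE rmorphM.
- by move=> c; rewrite -(rmorph_alg p) fE rmorph_alg.
by exists h => r; rewrite hE fE.
Qed.

Lemma lr_surj_eq (R Q R' : kalg) (p : {lrmorphism R -> Q}) (g h : {lrmorphism Q -> R'}) :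
  (forall y, exists x, p x = y) -> g \o p =1 h \o p -> g =1 h.
Proof. by move=> ps gh y; have [x <-] := ps y; apply: gh. Qed.

Lemma ideal_max (R : kalg) (I : R -> Prop) : ideal I -> ~ I 1 ->
  exists M : R -> Prop, [/\ ideal M, ~ M 1, forall x, I x -> M x &
    forall x, ~ M x -> exists y, M (x * y - 1)].
Proof.
move=> II I1.
pose T := {J : R -> Prop | [/\ ideal J, ~ J 1 & forall x, I x -> J x]}.
pose le (J J' : T) := boolp.asbool (forall x, proj1_sig J x -> proj1_sig J' x).
have [||A Atot|[M [MI M1 IM]] Mmax] := @classical_sets.ZL_preorder T (exist _ I (And3 II I1 (fun _ h => h))) le.
- by move=> J; apply/boolp.asboolP.
- move=> J1 J2 J3 /boolp.asboolP h1 /boolp.asboolP h2.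
  by apply/boolp.asboolP => x /h1 /h2.
- case: (classic (exists J0, A J0)) => [[J0 AJ0]|nA]; last first.
    by exists (exist _ I (And3 II I1 (fun _ h => h))) => s As; case: nA; exists s.
  pose U x := exists2 J, A J & proj1_sig J x.
  have UI : [/\ ideal U, ~ U 1 & forall x, I x -> U x].
    split.
    + split.
      * by exists J0 => //; case: (proj2_sig J0) => [[]].
      * move=> x y [J1 A1 x1] [J2 A2 x2].
        have [] := Atot _ _ A1 A2 => /boolp.asboolP h.
          exists J2 => //; case: (proj2_sig J2) => [[_ aD _] _ _].
          by apply: aD => //; apply: h.
        exists J1 => //; case: (proj2_sig J1) => [[_ aD _] _ _].
        by apply: aD => //; apply: h.
      * move=> a x [J1 A1 x1]; exists J1 => //.
        by case: (proj2_sig J1) => [[_ _ aM] _ _]; apply: aM.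
    + by case=> J _; case: (proj2_sig J) => [_ h _]; apply: h.
    + by move=> x Ix; exists J0 => //; case: (proj2_sig J0) => [_ _]; apply.
  exists (exist _ U UI) => s As; apply/boolp.asboolP => x sx; by exists s.
exists M; split=> // x nMx; apply: NNPP => nex.
case: (MI) => M0 MD MM.
pose M' z := exists2 y, M y & exists a, z = y + a * x.
have M'I : [/\ ideal M', ~ M' 1 & forall x, I x -> M' x].
  split.
  - split.
    + by exists 0 => //; exists 0; rewrite mul0r addr0.
    + move=> _ _ [y1 h1 [b1 ->]] [y2 h2 [b2 ->]]; exists (y1 + y2); first exact: MD.
      by exists (b1 + b2); rewrite mulrDl addrACA.
    + move=> a _ [y h [b ->]]; exists (a * y); first exact: MM.
      by exists (a * b); rewrite mulrDr mulrA.
  - case=> y h [a aE]; apply: nex; exists a.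
    by rewrite mulrC aE opprD addrCA subrr addr0 -mulN1r; apply: MM.
  - by move=> z Iz; exists z; [exact: (IM z Iz) | exists 0; rewrite mul0r addr0].
have /Mmax /boolp.asboolP h : le (exist _ M (And3 MI M1 IM)) (exist _ M' M'I).
  by apply/boolp.asboolP => z /= Mz; exists z => //; exists 0; rewrite mul0r addr0.
by apply: nMx; apply: h => /=; exists 0 => //; exists 1; rewrite mul1r add0r.
Qed.

Lemma field_pt_max (R : kalg) (I : R -> Prop) : ideal I -> ~ I 1 ->
  exists (K : kalg) (g : {lrmorphism R -> K}),
    [/\ is_field K, forall x, I x -> g x = 0 & forall y, exists x, g x = y].
Proof.
move=> II I1; have [M [MI M1 IM Mmax]] := ideal_max II I1.
have [K [g [gs gk]]] := quot_ex MI M1.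
exists K, g; split=> // [x|x /IM /gk //].
have [r <-] := gs x => /eqP r0.
have /Mmax [y] : ~ M r by move/gk.
by move/gk/eqP; rewrite rmorphB rmorphM rmorph1 subr_eq0 => /eqP; exists (g y).
Qed.

Lemma kalg_nz1 (R : kalg) : (1 : R) <> 0.
Proof. by apply/eqP; exact: oner_neq0. Qed.

(** The local-global principle of the development: applied to the ideal of all [s] for which a claim
    holds after multiplication by [s], it reduces the claim to neighbourhoods of field-valued
    points. *)
Lemma unit_ideal_local (R : kalg) (I : R -> Prop) : ideal I ->
  (forall (K : kalg) (g : {lrmorphism R -> K}), is_field K ->
     exists2 r, I r & g r <> 0) -> I 1.
Proof.
move=> II h; apply: NNPP => I1; have [K [g [Kf gI _]]] := field_pt_max II I1.
by have [r /gI] := h K g Kf.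
Qed.

Lemma fieldM (K : kalg) (x y : K) : is_field K -> x * y = 0 -> x = 0 \/ y = 0.
Proof.
move=> Kf xy; have [->|/Kf [z xz]] := eqVneq x 0; [by left|right].
by rewrite -[y]mul1r -xz mulrAC xy mul0r.
Qed.

Lemma fieldX (K : kalg) (x : K) n : is_field K -> x ^+ n = 0 -> x = 0.
Proof.
move=> Kf; elim: n => [|n IH]; first by rewrite expr0 => /kalg_nz1.
by rewrite exprS => /(fieldM Kf) [].
Qed.

End Algebras.

Section Polys.
Variable k : closedFieldType.
Notation kalg := (comAlgType k).
Implicit Types (R A L K : kalg).

Definition pphi R : {rmorphism k -> {poly R}} := polyC \o (in_alg R).
Definition pK R : kalg := kalg_of (pphi R).

Lemma pKA R (c : k) : (c%:A : pK R) = (c%:A)%:P.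
Proof. exact: (kalg_ofA (pphi R)). Qed.

Lemma pC_subproof R : {g : {lrmorphism R -> pK R} | g =1 (@polyC R : R -> pK R)}.
Proof.
apply: lrmorphism_of; [exact: polyCD | by [] | exact: polyCM | ].
by move=> c; rewrite pKA.
Qed.
Definition pC R := proj1_sig (pC_subproof R).
Lemma pCE R (r : R) : pC R r = r%:P.
Proof. exact: (proj2_sig (pC_subproof R)). Qed.

Definition peval R A (g : {lrmorphism R -> A}) (x : A) (p : {poly R}) : A :=
  (map_poly g p).[x].

Lemma pev_subproof R A (g : {lrmorphism R -> A}) (x : A) :
  {h : {lrmorphism pK R -> A} | h =1 (peval g x : pK R -> A)}.
Proof.
rewrite /peval; apply: lrmorphism_of.
- by move=> p q; rewrite rmorphD hornerD.
- by rewrite rmorph1 hornerC.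
- by move=> p q; rewrite rmorphM hornerM.
- by move=> c; rewrite pKA map_polyC hornerC /= rmorph_alg.
Qed.
Definition pev R A (g : {lrmorphism R -> A}) (x : A) := proj1_sig (pev_subproof g x).
Lemma pevE R A (g : {lrmorphism R -> A}) (x : A) (p : {poly R}) :
  pev g x p = (map_poly g p).[x].
Proof. exact: (proj2_sig (pev_subproof g x)). Qed.
Lemma pevC R A (g : {lrmorphism R -> A}) (x : A) (r : R) : pev g x r%:P = g r.
Proof. by rewrite pevE map_polyC hornerC. Qed.
Lemma pevX R A (g : {lrmorphism R -> A}) (x : A) : pev g x 'X = x.
Proof. by rewrite pevE map_polyX hornerX. Qed.

Definition mphi R n : {rmorphism k -> {mpoly R[n]}} := @mpolyC n R \o (in_alg R).
Definition mpK R n : kalg := kalg_of (mphi R n).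

Lemma mpKA R n (c : k) : (c%:A : mpK R n) = (c%:A)%:MP.
Proof. exact: (kalg_ofA (mphi R n)). Qed.

Lemma mC_subproof R n : {g : {lrmorphism R -> mpK R n} | g =1 (@mpolyC n R : R -> mpK R n)}.
Proof.
apply: lrmorphism_of; [exact: mpolyCD | by [] | exact: mpolyCM | ].
by move=> c; rewrite mpKA.
Qed.
Definition mC R n := proj1_sig (mC_subproof R n).
Lemma mCE R n (r : R) : mC R n r = r%:MP.
Proof. exact: (proj2_sig (mC_subproof R n)). Qed.

Lemma mev_subproof R A n (g : {lrmorphism R -> A}) (x : 'I_n -> A) :
  {h : {lrmorphism mpK R n -> A} | h =1 (mmap g x : mpK R n -> A)}.
Proof.
apply: lrmorphism_of.
- exact: rmorphD.
- exact: rmorph1.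
- exact: rmorphM.
- by move=> c; rewrite mpKA mmapC /= rmorph_alg.
Qed.
Definition mev R A n (g : {lrmorphism R -> A}) (x : 'I_n -> A) :=
  proj1_sig (mev_subproof g x).
Lemma mevE R A n (g : {lrmorphism R -> A}) (x : 'I_n -> A) (p : {mpoly R[n]}) :
  mev g x p = mmap g x p.
Proof. exact: (proj2_sig (mev_subproof g x)). Qed.
Lemma mevC R A n (g : {lrmorphism R -> A}) (x : 'I_n -> A) (r : R) :
  mev g x r%:MP = g r.
Proof. by rewrite mevE mmapC. Qed.
Lemma mevX R A n (g : {lrmorphism R -> A}) (x : 'I_n -> A) i :
  mev g x 'X_i = x i.
Proof. by rewrite mevE mmapX mmap1U. Qed.

Lemma mpK_eq R A n (g h : {lrmorphism mpK R n -> A}) :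
  (forall r : R, g r%:MP = h r%:MP) -> (forall i, g 'X_i = h 'X_i) -> g =1 h.
Proof.
move=> gC gX; apply: mpolyind => [|c m p _ _ IH]; first by rewrite !rmorph0.
rewrite !rmorphD /= IH; congr (_ + _).
rewrite -mul_mpolyC !rmorphM /= gC; congr (_ * _).
rewrite mpolyXE_id !rmorph_prod /=; apply: eq_bigr => i _.
by rewrite !rmorphXn /= gX.
Qed.

Lemma pK_eq R A (g h : {lrmorphism pK R -> A}) :
  (forall r : R, g r%:P = h r%:P) -> g 'X = h 'X -> g =1 h.
Proof.
move=> gC gX; elim/poly_ind => [|p c IH]; first by rewrite !rmorph0.
by rewrite !rmorphD !rmorphM /= IH gX gC.
Qed.

Definition pX R : pK R := 'X.

Lemma pK_ind R (P : pK R -> Prop) : P 0 ->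
  (forall q c, P q -> P (q * pX R + pC R c)) -> forall z, P z.
Proof.
move=> P0 IH; apply: poly_ind => // p c Pp.
by have := IH p c Pp; rewrite pCE.
Qed.

(** Localization by fractions and annihilators, the form in which denominators can be cleared;
    [loc_lift] and [loc_eq] recover the universal property. *)
Definition is_loc R (s : R) L (i : {lrmorphism R -> L}) : Prop :=
  [/\ exists y, i s * y = 1, forall z, exists n r, i s ^+ n * z = i r &
      forall r, i r = 0 -> exists n, s ^+ n * r = 0].

Lemma loc_ex R (s : R) : (forall n, s ^+ n <> 0) ->
  exists L (i : {lrmorphism R -> L}), is_loc s i.
Proof.
move=> snil.
pose I (p : pK R) := exists g : pK R, p = (s *: 'X - 1 : {poly R}) * g.
have II : ideal I.
  split; first by exists 0; rewrite mulr0.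
  - by move=> x y [g ->] [h ->]; exists (g + h); rewrite mulrDr.
  - by move=> a x [g ->]; exists (a * g); rewrite mulrCA.
(* If r = (sX - 1) g, comparing coefficients gives g_i = - s^i r, so s^n r = 0 for n the size of
   g. *)
have kerI (r : R) : I (r%:P : {poly R}) -> exists n, s ^+ n * r = 0.
  case=> g gE.
  have gi (i : nat) : (g : {poly R})`_i = - (s ^+ i * r).
    elim: i => [|i IH].
      have := congr1 (fun p : {poly R} => p`_0) gE.
      rewrite /= mulrBl mul1r coefB -scalerAl coefZ coefXM coefC /= mulr0 sub0r mul1r.
      by move->; rewrite opprK.
    have := congr1 (fun p : {poly R} => p`_i.+1) gE.
    rewrite /= mulrBl mul1r coefB -scalerAl coefZ coefXM coefC /= IH mulrN mulrA -exprS.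
    by move/eqP; rewrite eq_sym subr_eq0 eq_sym => /eqP.
  exists (size (g : {poly R})).
  by apply: oppr_inj; rewrite -gi nth_default // oppr0.
have I1 : ~ I 1.
  by move/(kerI 1) => [n]; rewrite mulr1 => /snil.
have [L [p [ps pk]]] := quot_ex II I1.
have sX : p (pC R s) * p (pX R) = 1.
  rewrite -(rmorphM p) -[RHS](rmorph1 p); apply/eqP; rewrite -subr_eq0 -(rmorphB p); apply/eqP/pk.
  by exists 1; rewrite mulr1 pCE /pX /= -mul_polyC.
pose i : {lrmorphism R -> L} := p \o pC R.
have fr z : exists n (r : R), i s ^+ n * p z = i r.
  elim/pK_ind: z => [|q c [n [r IH]]].
    by exists 0%N, 0; rewrite (rmorph0 p) mulr0 (rmorph0 i).
  exists n.+1, (r + s ^+ n.+1 * c).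
  rewrite (rmorphD p) (rmorphM p) mulrDr (rmorphD i) (rmorphM i) (rmorphXn i); congr (_ + _).
  by rewrite exprSr -mulrA (mulrC (p q)) (mulrA _ (p (pX R))) sX mul1r IH.
exists L, i; split.
- by exists (p (pX R)).
- by move=> z; have [x <-] := ps z; exact: fr.
- by move=> r /=; rewrite pCE => /pk /kerI.
Qed.

Lemma loc_pow R (s : R) L (i : {lrmorphism R -> L}) : is_loc s i ->
  forall n, exists y, i s ^+ n * y = 1.
Proof. by move=> [[y sy] _ _] n; exists (y ^+ n); rewrite -exprMn sy expr1n. Qed.

Lemma unit_cancel R (s y a b : R) : s * y = 1 -> s * a = s * b -> a = b.
Proof.
by move=> sy sab; rewrite -[a]mul1r -[b]mul1r -sy mulrAC sab mulrAC.
Qed.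

Lemma loc_lift R (s : R) L (i : {lrmorphism R -> L}) A (g : {lrmorphism R -> A}) :
  is_loc s i -> (exists y, g s * y = 1) ->
  exists h : {lrmorphism L -> A}, forall r, h (i r) = g r.
Proof.
move=> Hl [y sy]; have lp := loc_pow Hl; case: Hl => _ fr ker.
have gp n : g s ^+ n * y ^+ n = 1 by rewrite -exprMn sy expr1n.
have fr' z : exists nr : nat * R, i s ^+ nr.1 * z = i nr.2.
  by have [n [r h]] := fr z; exists (n, r).
pose w z := proj1_sig (constructive_indefinite_description _ (fr' z)).
have wE z : i s ^+ (w z).1 * z = i (w z).2.
  by rewrite /w; case: constructive_indefinite_description.
(* [key] shows that the value does not depend on the fraction representing [z]; additivity and
   multiplicativity follow by clearing denominators. *)
pose f z := g (w z).2 * y ^+ (w z).1.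
have key n r z : i s ^+ n * z = i r -> g s ^+ n * f z = g r.
  move=> nr.
  have /ker [m m0] : i (s ^+ n * (w z).2 - s ^+ (w z).1 * r) = 0.
    rewrite rmorphB !rmorphM !rmorphXn /= -wE -nr.
    by rewrite !mulrA (mulrC (i s ^+ _)) subrr.
  have := congr1 g m0; rewrite rmorphM rmorphB !rmorphM !rmorphXn /= rmorph0 => m1.
  have {m1} : g s ^+ n * g (w z).2 = g s ^+ (w z).1 * g r.
    apply/eqP; rewrite -subr_eq0; apply/eqP.
    by apply: (unit_cancel (gp m)); rewrite m1 mulr0.
  by rewrite /f mulrA => ->; rewrite mulrAC gp mul1r.
have fi r : f (i r) = g r by rewrite -(key 0 r (i r)) ?expr0 ?mul1r.
have [||||h hE] := @lrmorphism_of k L A f.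
- move=> a b; have ea := wE a; have eb := wE b.
  apply: (unit_cancel (gp ((w a).1 + (w b).1)%N)).
  rewrite (key _ (s ^+ (w b).1 * (w a).2 + s ^+ (w a).1 * (w b).2)); last first.
    rewrite rmorphD !rmorphM !rmorphXn /= -ea -eb exprD; ring.
  rewrite mulrDr rmorphD !rmorphM !rmorphXn /=.
  by rewrite -(key _ _ _ ea) -(key _ _ _ eb) exprD; ring.
- by rewrite -(rmorph1 i) fi rmorph1.
- move=> a b; have ea := wE a; have eb := wE b.
  apply: (unit_cancel (gp ((w a).1 + (w b).1)%N)).
  rewrite (key _ ((w a).2 * (w b).2)); last first.
    by rewrite rmorphM /= -ea -eb exprD; ring.
  by rewrite rmorphM /= -(key _ _ _ ea) -(key _ _ _ eb) exprD; ring.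
- by move=> c; rewrite -(rmorph_alg i) fi rmorph_alg.
by exists h => r; rewrite hE fi.
Qed.

Lemma loc_eq R (s : R) L (i : {lrmorphism R -> L}) A (g h : {lrmorphism L -> A}) :
  is_loc s i -> (forall r, g (i r) = h (i r)) -> g =1 h.
Proof.
move=> Hl gh z; have [n [r nr]] : exists n r, i s ^+ n * z = i r by case: Hl.
have [y ny] := loc_pow Hl n.
have gy : g (i s ^+ n) * g y = 1 by rewrite -rmorphM ny rmorph1.
apply: (unit_cancel gy); rewrite -rmorphM nr /= gh -nr rmorphM; congr (_ * _).
by rewrite !rmorphXn /= gh.
Qed.

Lemma field_pow_nz R K (g : {lrmorphism R -> K}) (s : R) : is_field K ->
  g s <> 0 -> forall n, s ^+ n <> 0.
Proof.
move=> Kf s0 n /(congr1 g); rewrite rmorphXn rmorph0 => /(fieldX Kf); exact: s0.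
Qed.

Lemma loc_at R (s : R) K (g : {lrmorphism R -> K}) : is_field K -> g s <> 0 ->
  exists L (i : {lrmorphism R -> L}) (h : {lrmorphism L -> K}),
    is_loc s i /\ forall r, h (i r) = g r.
Proof.
move=> Kf s0; have [L [i Hl]] := loc_ex (field_pow_nz Kf s0).
have [y sy] : exists y, g s * y = 1 by apply: Kf; apply/eqP.
have [h hE] : exists h : {lrmorphism L -> K}, forall r, h (i r) = g r.
  by apply: (loc_lift Hl); exists y.
by exists L, i, h.
Qed.

End Polys.

Lemma in_tl (T : eqType) (g x : T) s : x \in s -> x \in g :: s.
Proof. by rewrite in_cons => ->; rewrite orbT. Qed.

(** * Noetherian algebras *)

Section Noeth.
Implicit Types R S : comNzRingType.

Fixpoint span R (s : seq R) (r : R) : Prop :=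
  if s is g :: s' then exists c r', r = c * g + r' /\ span s' r' else r = 0.

Lemma span0 R (s : seq R) : span s 0.
Proof. by elim: s => [|g s IH] //=; exists 0, 0; rewrite mul0r addr0. Qed.

Lemma spanD R (s : seq R) x y : span s x -> span s y -> span s (x + y).
Proof.
elim: s x y => [|g s IH] x y /=; first by move=> -> ->; rewrite addr0.
move=> [c [r [-> h]]] [d [t [-> h']]]; exists (c + d), (r + t); split; last exact: IH.
by rewrite mulrDl addrACA.
Qed.

Lemma spanM R (s : seq R) a x : span s x -> span s (a * x).
Proof.
elim: s x => [|g s IH] x /=; first by move=> ->; rewrite mulr0.
move=> [c [r [-> h]]]; exists (a * c), (a * r); split; last exact: IH.
by rewrite mulrDr mulrA.
Qed.

Lemma span_ideal R (s : seq R) : ideal (span s).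
Proof. by split; [exact: span0 | exact: spanD | exact: spanM]. Qed.

Lemma span_sub R (s : seq R) (I : R -> Prop) : ideal I ->
  (forall x, x \in s -> I x) -> forall r, span s r -> I r.
Proof.
move=> [I0 ID IM]; elim: s => [|g s IH] Is r /=; first by move=> ->.
move=> [c [r' [-> h]]]; apply: ID; first by apply/IM/Is; rewrite mem_head.
by apply: IH h => x xs; apply: Is; rewrite in_cons xs orbT.
Qed.

Lemma span_mem R (s : seq R) x : x \in s -> span s x.
Proof.
elim: s => [|g s IH] //=; rewrite in_cons => /orP[/eqP ->|/IH h].
  by exists 1, 0; rewrite mul1r addr0; split=> //; apply: span0.
by exists 0, x; rewrite mul0r add0r.
Qed.

Lemma span_subset R (s t : seq R) r : {subset s <= t} -> span s r -> span t r.
Proof.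
by move=> st; apply: span_sub; [exact: span_ideal | move=> x /st; exact: span_mem].
Qed.

Definition noeth R := forall I : R -> Prop, ideal I ->
  exists s : seq R, (forall x, x \in s -> I x) /\ forall r, I r -> span s r.

Lemma noeth_acc R (L : nat -> R -> Prop) : noeth R -> (forall n, ideal (L n)) ->
  (forall n r, L n r -> L n.+1 r) -> exists n, forall m r, L m r -> L n r.
Proof.
move=> nR LI Lmono.
have Lle m n r : (m <= n)%N -> L m r -> L n r.
  by move=> /subnK <- Lm; elim: (n - m)%N => //= d IH; apply: Lmono.
pose U r := exists n, L n r.
have UI : ideal U.
  split; first by exists 0%N; case: (LI 0%N).
  - move=> x y [m Lm] [n Ln]; exists (m + n)%N; case: (LI (m + n)%N) => _ D _.
    by apply: D; [apply: Lle Lm; rewrite leq_addr | apply: Lle Ln; rewrite leq_addl].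
  - by move=> a x [n Ln]; exists n; case: (LI n) => _ _; apply.
have [s [Us sU]] := nR U UI.
have [n Ln] : exists n, forall x, x \in s -> L n x.
  elim: s Us {sU} => [|g s IH] Us; first by exists 0%N.
  have [n1 h1] := IH (fun x xs => Us x (in_tl _ xs)).
  have [n2 h2] := Us g (mem_head _ _).
  exists (n1 + n2)%N => x; rewrite in_cons => /orP[/eqP -> | /h1 h].
    by apply: Lle h2; rewrite leq_addl.
  by apply: Lle h; rewrite leq_addr.
by exists n => m r Lm; apply: (span_sub (LI n) Ln); apply: sU; exists m.
Qed.

Lemma noeth_surj R S (f : {rmorphism R -> S}) : noeth R ->
  (forall y, exists x, f x = y) -> noeth S.
Proof.
move=> nR fs I [I0 ID IM].
have [s [sI Is]] : exists s : seq R, (forall x, x \in s -> I (f x)) /\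
    forall r, I (f r) -> span s r.
  apply: nR; split; first by rewrite rmorph0.
  - by move=> x y Ix Iy; rewrite rmorphD; apply: ID.
  - by move=> a x Ix; rewrite rmorphM; apply: IM.
exists (map f s); split; first by move=> _ /mapP[x xs ->]; apply: sI.
move=> y; have [x <-] := fs y; move=> /Is.
elim: s x {sI Is} => [|g s IH] x /=; first by move=> ->; rewrite rmorph0.
move=> [c [r [-> h]]]; exists (f c), (f r); rewrite rmorphD rmorphM; split=> //.
exact: IH.
Qed.

Lemma noeth_field (F : fieldType) : noeth F.
Proof.
move=> I [I0 ID IM]; case: (classic (exists2 x, I x & x != 0)) => [[x Ix x0]|h].
  exists [:: x]; split; first by move=> y; rewrite inE => /eqP ->.
  by move=> r _; exists (r / x), 0; rewrite divfK // addr0.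
exists [::]; split=> // r Ir /=; apply/eqP/negP => r0.
by apply: h; exists r => //; apply/negP.
Qed.

Lemma span_seq_choose R S (Q : R -> S -> Prop) (I : S -> Prop) (s : seq R) :
  (forall x, x \in s -> exists2 p, I p & Q x p) ->
  exists t : seq S, (forall p, p \in t -> I p) /\
     forall x, x \in s -> exists2 p, p \in t & Q x p.
Proof.
elim: s => [|g s IH] h; first by exists [::].
have [t [tI tQ]] := IH (fun x xs => h x (in_tl _ xs)).
have [p Ip Qp] := h g (mem_head _ _).
exists (p :: t); split.
  by move=> y; rewrite in_cons => /orP[/eqP -> //|]; apply: tI.
move=> x; rewrite in_cons => /orP[/eqP ->|/tQ [y yt Qy]].
  by exists p => //; rewrite mem_head.
by exists y => //; rewrite in_cons yt orbT.
Qed.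

(** Hilbert's basis theorem. [L n] is the ideal of the coefficients of degree n of the members of
    [I] of degree at most n. The chain is stationary from some [N] on, and lifts of generators of
    [L n] for n <= N generate [I], since they allow lowering the degree of any member. *)
Theorem noeth_poly R : noeth R -> noeth {poly R}.
Proof.
move=> nR I II; have [I0 ID IM] := II.
pose L n c := exists p, [/\ I p, (size p <= n.+1)%N & p`_n = c].
have LI n : ideal (L n).
  split; first by exists 0; rewrite size_poly0 coef0.
  - move=> x y [p [Ip sp <-]] [q [Iq sq <-]]; exists (p + q); rewrite coefD.
    split=> //; first exact: ID.
    by rewrite (leq_trans (size_polyD _ _)) // geq_max sp.
  - move=> a x [p [Ip sp <-]]; exists (a%:P * p); rewrite coefCM; split=> //.
      exact: IM.
    by rewrite mul_polyC (leq_trans (size_scale_leq _ _)).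
have LS n c : L n c -> L n.+1 c.
  move=> [p [Ip sp <-]]; exists ('X * p); rewrite coefXM /=; split=> //; first exact: IM.
  have [->|p0] := eqVneq p 0; first by rewrite mulr0 size_poly0.
  by rewrite mulrC size_mulX.
have [N LN] := noeth_acc nR LI LS.
pose G n (t : seq {poly R}) := (forall p, p \in t -> I p) /\
  forall c, L n c -> exists p, [/\ span t p, (size p <= n.+1)%N & p`_n = c].
have Gn n : exists t, G n t.
  have [s [sL Ls]] := nR (L n) (LI n).
  have [x xs|t [tI tQ]] := @span_seq_choose R {poly R}
    (fun c p => (size p <= n.+1)%N /\ p`_n = c) I s.
    by have [p [Ip sp pn]] := sL x xs; exists p.
  exists t; split=> // c /Ls.
  apply: (@span_sub _ s (fun c => exists p, [/\ span t p, (size p <= n.+1)%N & p`_n = c])).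
    split; first by exists 0; rewrite size_poly0 coef0; split=> //; exact: span0.
    - move=> x y [p [Ip sp <-]] [q [Iq sq <-]]; exists (p + q); rewrite coefD.
      split=> //; first exact: spanD.
      by rewrite (leq_trans (size_polyD _ _)) // geq_max sp.
    - move=> a x [p [Ip sp <-]]; exists (a%:P * p); rewrite coefCM; split=> //.
        exact: spanM.
      by rewrite mul_polyC (leq_trans (size_scale_leq _ _)).
  by move=> x /tQ [p pt [sp pn]]; exists p; split=> //; apply: span_mem.
have [t tG] : exists t, (forall p, p \in t -> I p) /\ forall n, (n <= N)%N ->
    forall c, L n c -> exists p, [/\ span t p, (size p <= n.+1)%N & p`_n = c].
  elim: {LN} N => [|N [t [tI tL]]].
    by have [t [tI tL]] := Gn 0%N; exists t; split=> // n; rewrite leqn0 => /eqP ->.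
  have [u [uI uL]] := Gn N.+1.
  exists (t ++ u); split.
    by move=> p; rewrite mem_cat => /orP[/tI|/uI].
  move=> n; rewrite leq_eqVlt => /orP[/eqP ->|nN] c Lc.
    have [p [ps sp pn]] := uL c Lc; exists p; split=> //.
    by apply: span_subset ps => x xu; rewrite mem_cat xu orbT.
  have [p [ps sp pn]] := tL n nN c Lc; exists p; split=> //.
  by apply: span_subset ps => x xu; rewrite mem_cat xu.
case: tG => tI tL; exists t; split=> // p Ip.
have [n] : exists n, (size p <= n)%N by exists (size p).
elim: n p Ip => [|n IH] p Ip.
  by rewrite leqn0 size_poly_eq0 => /eqP ->; apply: span0.
move=> sp.
have [q [qs sq qn]] : exists q, [/\ span t q, (size q <= n.+1)%N & q`_n = p`_n].
  have Lp : L n p`_n by exists p.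
  case: (leqP n N) => [/tL|/ltnW Nn]; first exact.
  (* Above degree [N] an element of degree at most [N] with the right coefficient is shifted by a
     power of X. *)
  have [q [qs sq qn]] := tL N (leqnn N) _ (LN n _ Lp).
  exists ('X^(n - N) * q); split; first exact: spanM.
    have [->|q0] := eqVneq q 0; first by rewrite mulr0 size_poly0.
    rewrite (leq_trans (size_polyMleq _ _)) // size_polyXn /=.
    by rewrite -(leq_add2l (n - N)) addnS subnK // in sq; rewrite addnC (leq_trans _ sq) // addnC.
  by rewrite coefXnM ltnNge leq_subr /= subKn.
rewrite -(subrK q p); apply: spanD => //; apply: IH.
  apply: ID => //; rewrite -mulN1r; apply: IM; exact: (span_sub II tI).
apply/leq_sizeP => j; rewrite leq_eqVlt => /orP[/eqP <-|nj].
  by rewrite coefB qn subrr.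
by rewrite coefB !nth_default ?subrr // (leq_trans _ nj).
Qed.

End Noeth.

Section NoethK.
Variable k : closedFieldType.
Notation kalg := (comAlgType k).
Implicit Types (R A K : kalg).

Lemma mpK_ind R n (P : mpK R n -> Prop) : (forall c, P (mC R n c)) ->
  (forall i, P ('X_i : {mpoly R[n]})) -> (forall x y, P x -> P y -> P (x + y)) ->
  (forall x y, P x -> P y -> P (x * y)) -> forall z, P z.
Proof.
move=> PC PX PD PM; have P0 : P 0 by have := PC 0; rewrite rmorph0.
have P1 : P 1 by have := PC 1; rewrite rmorph1.
apply: mpolyind => // c m p _ _ Pp; apply: (PD _ p) => //.
have -> : c *: 'X_[m] = mC R n c * ('X_[m] : {mpoly R[n]}) by rewrite mCE -mul_mpolyC.
apply: (PM _ ('X_[m])) => //; rewrite mpolyXE_id.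
apply: (big_ind (P : {mpoly R[n]} -> Prop)) => // i _.
by elim: (m i) => [|j IH]; rewrite ?expr0 // exprS; apply: (PM 'X_i).
Qed.

Lemma noeth_mpoly R n : noeth R -> noeth (mpK R n).
Proof.
move=> nR; elim: n => [|n IH].
  apply: (noeth_surj (f := mC R 0)) => //; apply: mpK_ind.
  - by move=> c; exists c.
  - by case.
  - by move=> _ _ [a <-] [b <-]; exists (a + b); rewrite rmorphD.
  - by move=> _ _ [a <-] [b <-]; exists (a * b); rewrite rmorphM.
pose g := mev (mC R n.+1) (fun i => 'X_(widen_ord (leqnSn n) i) : mpK R n.+1).
apply: (noeth_surj (f := pev g ('X_ord_max : mpK R n.+1)) (R := pK (mpK R n))).
  exact: noeth_poly.
apply: mpK_ind.
- by move=> c; exists (pC _ (mC R n c)); rewrite /= pCE pevC mCE /g mevC mCE.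
- move=> i; case: (unliftP ord_max i) => [j ->|->]; last first.
    by exists (pX _); rewrite /= pevX.
  exists (pC (mpK R n) 'X_j); rewrite /= pCE pevC /g mevX.
  by congr mpolyX; congr mnm1; apply: val_inj; rewrite /= /bump leqNgt ltn_ord.
- by move=> _ _ [a <-] [b <-]; exists (a + b); rewrite rmorphD.
- by move=> _ _ [a <-] [b <-]; exists (a * b); rewrite rmorphM.
Qed.

Definition fgen R A (g : {lrmorphism R -> A}) : Prop :=
  exists n (x : 'I_n -> A), forall a, exists P : mpK R n, mev g x P = a.

Lemma noeth_fgen R A (g : {lrmorphism R -> A}) : noeth R -> fgen g -> noeth A.
Proof.
move=> nR [n [x gx]]; by apply: (noeth_surj (f := mev g x)) => //; apply: noeth_mpoly.
Qed.

(** Krull's intersection theorem at the point [g]. [L n] consists of the b with e^n b in (f) near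
    the point; the chain is stationary, so s f = e^(n+1) b already gives t e^n b = f c. Then (t s -
    e c) f = 0, and t s - e c does not vanish at the point because e does. *)
Lemma krull_principal A K (g : {lrmorphism A -> K}) (e f : A) : noeth A ->
  is_field K -> g e = 0 ->
  (forall n, exists s b, g s <> 0 /\ s * f = e ^+ n * b) ->
  exists2 s, g s <> 0 & s * f = 0.
Proof.
move=> nA Kf e0 h.
pose L n b := exists t c, g t <> 0 /\ t * (e ^+ n * b) = f * c.
have [||n Ln] := noeth_acc nA (L := L).
- move=> n; split.
  + by exists 1, 0; rewrite rmorph1 !mulr0; split=> //; apply: kalg_nz1.
  + move=> x y [t [c [t0 tE]]] [u [d [u0 uE]]]; exists (t * u), (u * c + t * d).
    split; first by rewrite rmorphM => /(fieldM Kf) [].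
    by rewrite !mulrDr !(mulrCA f) -tE -uE; ring.
  + move=> a x [t [c [t0 tE]]]; exists t, (a * c); split=> //.
    by rewrite (mulrCA f) -tE; ring.
- move=> n b [t [c [t0 tE]]]; exists t, (e * c); split=> //.
  by rewrite (mulrCA f) -tE exprS; ring.
have [s [b [s0 sE]]] := h n.+1.
have /Ln [t [c [t0 tE]]] : L n.+1 b by exists 1, s; rewrite rmorph1 mul1r -sE mulrC; split=> //; apply: kalg_nz1.
exists (t * s - e * c).
  by rewrite rmorphB !rmorphM /= e0 mul0r subr0 => /(fieldM Kf) [].
by rewrite mulrBl -(mulrA t) sE -mulrA (mulrC c) -tE exprS; ring.
Qed.

(** Finitely many generators decide, so a product of their annihilators serves for the whole
    ideal. *)
Lemma noeth_kill A K (g : {lrmorphism A -> K}) (J : A -> Prop) : noeth A ->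
  is_field K -> ideal J ->
  (forall j, J j -> exists2 s, g s <> 0 & s * j = 0) ->
  exists2 s, g s <> 0 & forall j, J j -> s * j = 0.
Proof.
move=> nA Kf JI h; have [l [lJ Jl]] := nA J JI.
suff [s s0 sl] : exists2 s, g s <> 0 & forall j, j \in l -> s * j = 0.
  exists s => // j /Jl; apply: (@span_sub _ l (fun j => s * j = 0)) => //; split.
  - by rewrite mulr0.
  - by move=> x y; rewrite mulrDr => -> ->; rewrite addr0.
  - by move=> a x; rewrite mulrCA => ->; rewrite mulr0.
elim: l lJ {Jl} => [|x l IH] lJ.
  by exists 1 => //; rewrite rmorph1; apply: kalg_nz1.
have [s s0 sl] := IH (fun y yl => lJ y (in_tl _ yl)).
have [t t0 tx] := h x (lJ x (mem_head _ _)).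
exists (s * t); first by rewrite rmorphM => /(fieldM Kf) [].
move=> j; rewrite in_cons => /orP[/eqP ->|/sl js]; first by rewrite -mulrA tx mulr0.
by rewrite mulrAC js mul0r.
Qed.

(** Krull's theorem for the ideal (y_1, ..., y_d), read in the polynomial ring. [L n] is generated
    by the forms of degree at most n whose value at [y] is s b with s nonzero at the point. The
    chain is stationary; the degree n+1 part of an expression of [F] by generators of [L n] has
    coefficients of positive degree, whence s b = e b with e vanishing at the point. *)
Lemma krull_homog A K (g : {lrmorphism A -> K}) d (y : 'I_d -> A) (b : A) :
  noeth A -> is_field K -> (forall i, g (y i) = 0) ->
  (forall n, exists s (F : {mpoly A[d]}), [/\ g s <> 0, F \is n.-homog & F.@[y] = s * b]) ->
  exists2 s, g s <> 0 & s * b = 0.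
Proof.
move=> nA Kf y0 h.
pose T n (F : {mpoly A[d]}) := exists m s, [/\ (m <= n)%N, F \is m.-homog, g s <> 0 &
   F.@[y] = s * b].
pose L n (F : {mpoly A[d]}) := exists2 l : seq {mpoly A[d]},
  (forall G, G \in l -> T n G) & span l F.
have [||n Ln] := noeth_acc (noeth_mpoly (n := d) nA) (L := L).
- move=> n; split; first by exists [::].
  + move=> x z [l lT lx] [l' lT' lz]; exists (l ++ l').
      by move=> G; rewrite mem_cat => /orP[/lT|/lT'].
    by apply: spanD; [apply: span_subset lx | apply: span_subset lz] => G Gl;
       rewrite mem_cat Gl ?orbT.
  + by move=> a x [l lT lx]; exists l => //; apply: spanM.
- move=> n F [l lT lF]; exists l => // G /lT [m [s [mn Gm s0 GE]]].
  by exists m, s; split=> //; apply: leqW.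
have [s [F [s0 Fh FE]]] := h n.+1.
have /Ln [l lT lF] : L n.+1 F.
  exists [:: F]; last by apply: span_mem; rewrite mem_head.
  by move=> G; rewrite inE => /eqP ->; exists n.+1, s.
pose pr (F : {mpoly A[d]}) := pihomog mdeg n.+1 F.
(* In degree n+1 a generator of degree m <= n is multiplied by monomials of positive degree, whose
   values at [y] vanish at the point. *)
have key m G t : (m <= n)%N -> G \is m.-homog -> G.@[y] = t * b ->
    forall Q, exists2 e, g e = 0 & (pr (Q * G)).@[y] = e * b.
  move=> mn Gm GE; apply: mpolyind => [|c mm Q _ _ [e e0 eE]].
    by exists 0; rewrite ?rmorph0 // mul0r /pr pihomog0 meval0 mul0r.
  rewrite mulrDl /pr pihomogD mevalD eE.
  have hm : 'X_[mm] * G \is (mdeg mm + m).-homog by apply: dhomogM => //; rewrite dhomogX.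
  rewrite -scalerAl linearZ mevalZ /=.
  have [mE|mE] := eqVneq (mdeg mm + m)%N n.+1.
    rewrite pihomog_dE -?mE // mevalM GE mevalX.
    exists (c * \prod_(i < d) y i ^+ mm i * t + e); last by rewrite mulrDl !mulrA.
    rewrite rmorphD /= e0 addr0 !rmorphM rmorph_prod /=.
    suff -> : \prod_(i < d) g (y i ^+ mm i) = 0 by rewrite mulr0 mul0r.
    have [i mi] : exists i, mm i != 0%N.
      apply: NNPP => hi; suff mm0 : mdeg mm = 0%N.
        by move: mE; rewrite mm0 add0n => mE; rewrite mE ltnn in mn.
      apply/eqP; rewrite mdeg_eq0; apply/eqP/mnmP => i; rewrite mnm0E.
      by apply/eqP/negPn/negP => hh; apply: hi; exists i.
    by rewrite (bigD1 i) //= rmorphXn /= y0 expr0n (negPf mi) mul0r.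
  exists e => //; rewrite (pihomog_ne0 mE hm) meval0 mulr0 add0r //.
have [e e0 eE] : exists2 e, g e = 0 & (pr F).@[y] = e * b.
  suff /(_ 1) : forall Q, exists2 e, g e = 0 & (pr (Q * F)).@[y] = e * b by rewrite mul1r.
  apply: (@span_sub _ l (fun F => forall Q, exists2 e, g e = 0 & (pr (Q * F)).@[y] = e * b)) => //.
  - split.
    + by move=> Q; exists 0; rewrite ?rmorph0 // mulr0 /pr pihomog0 meval0 mul0r.
    + move=> x z hx hz Q; have [e e0 eE] := hx Q; have [e' e0' eE'] := hz Q.
      exists (e + e'); first by rewrite rmorphD /= e0 e0' addr0.
      by rewrite mulrDr /pr pihomogD mevalD eE eE' mulrDl.
    + by move=> a x hx Q; rewrite mulrA.
  - by move=> G /lT [m [t [mn Gm _ GE]]]; exact: (key _ _ _ mn Gm GE).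
exists (s - e); first by rewrite rmorphB /= e0 subr0.
by rewrite mulrBl -eE -FE /pr pihomog_dE // subrr.
Qed.
End NoethK.

(** * Zariski's lemma *)

Section Zariski.
Variable k : closedFieldType.
Notation kalg := (comAlgType k).
Implicit Types (R A B K L Q : kalg).

Definition kk : kalg := k^o.

Lemma kkA (c : k) : c%:A = c :> kk.
Proof. by rewrite /GRing.scale /= mulr1. Qed.

Lemma base_subproof A : {g : {lrmorphism kk -> A} | g =1 (fun c : k => c%:A : A)}.
Proof.
apply: lrmorphism_of.
- by move=> x y; rewrite scalerDl.
- by rewrite scale1r.
- by move=> x y; rewrite -scalerAl mul1r scalerA.
- by move=> c; rewrite kkA.
Qed.
Definition base A := proj1_sig (base_subproof A).
Lemma baseE A (c : k) : base A c = c%:A.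
Proof. exact: (proj2_sig (base_subproof A)). Qed.

Lemma lr_base A B (f : {lrmorphism A -> B}) (c : kk) : f (base A c) = base B c.
Proof. by rewrite !baseE rmorph_alg. Qed.

Lemma scal_unit A (c : k) : c != 0 -> exists y : A, c%:A * y = 1.
Proof. by move=> c0; exists (c^-1)%:A; rewrite -scalerAl mul1r scalerA divff // scale1r. Qed.

Lemma k_fresh (s : seq k) : exists c, c \notin s.
Proof.
have p0 : \prod_(a <- s) ('X - a%:P) != 0 :> {poly k}.
  by apply: monic_neq0; apply: monic_prod_XsubC.
have /closed_nonrootP [c] := p0; rewrite root_prod_XsubC => cs; by exists c.
Qed.

(** The field k is infinite, and differences of distinct elements of k are units in any k-algebra,
    so linear factors can be split off one after the other. *)
Lemma inf_roots A (p : {poly A}) (s : seq k) :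
  (forall c : k, c \notin s -> p.[c%:A] = 0) -> p = 0.
Proof.
have [n] : exists n, (size p <= n)%N by exists (size p).
elim: n p s => [|n IH] p s; first by rewrite leqn0 size_poly_eq0 => /eqP.
move=> sp h; have [c cs] := k_fresh s.
have /factor_theorem [q pE] : root p c%:A by apply/rootP/h.
rewrite pE in sp *; suff -> : q = 0 by rewrite mul0r.
apply: (IH q (c :: s)).
  have [->|q0] := eqVneq q 0; first by rewrite size_poly0.
  by rewrite size_Mmonic ?monicXsubC // size_XsubC addn2 /= in sp.
move=> d; rewrite in_cons negb_or => /andP[dc ds].
have := h d ds; rewrite pE hornerM hornerXsubC -scalerBl mulrC.
have [|y] := @scal_unit A (d - c); first by rewrite subr_eq0.
by move=> cy q0; apply: (unit_cancel cy); rewrite q0 mulr0.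
Qed.

Lemma inf_roots_ker R A (g : {lrmorphism R -> A}) (p : pK R) (s : seq k) :
  (forall c : k, c \notin s -> pev g c%:A p = 0) -> forall x, pev g x p = 0.
Proof.
move=> h x; rewrite pevE; suff -> : map_poly g p = 0 by rewrite horner0.
by apply: (inf_roots (s := s)) => c /h; rewrite pevE.
Qed.

(** Generic integrality: a field finitely generated over [R] is integral over some R[1/s]. The
    induction regards [x ord0] as the image of X under R[X] -> K and applies the hypothesis to R[X]
    with one generator less. *)
Lemma zariski_step n : forall R K (g : {lrmorphism R -> K}) (x : 'I_n -> K),
  is_field K -> (forall a, exists P, mev g x P = a) ->
  exists (s : R) L (i : {lrmorphism R -> L}) (h : {lrmorphism L -> K}),
    [/\ g s <> 0, is_loc s i, forall r, h (i r) = g r & integralRange h].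
Proof.
elim: n => [|n IH] R K g x Kf gx.
  have gs a : exists r, g r = a.
    have [P <-] := gx a; elim/mpK_ind: P => [c|[]//|p q|p q].
    - by exists c; rewrite mCE mevC.
    - by move=> [r rE] [t tE]; exists (r + t); rewrite !rmorphD /= rE tE.
    - by move=> [r rE] [t tE]; exists (r * t); rewrite !rmorphM /= rE tE.
  have g1 : g 1 <> 0 by rewrite rmorph1; apply: kalg_nz1.
  have [L [i [h [il hE]]]] := loc_at Kf g1.
  exists 1, L, i, h; split=> // a; have [r <-] := gs a; rewrite -hE.
  exact: integral_id.
pose g1 := pev g (x ord0).
have [s1 [L1 [i1 [h1 [s1nz il1 hE1 int1]]]]] : exists (s : pK R) L (i : {lrmorphism pK R -> L}) (h : {lrmorphism L -> K}),
    [/\ g1 s <> 0, is_loc s i, forall r, h (i r) = g1 r & integralRange h].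
  apply: (IH _ _ g1 (x \o lift ord0)) => // a; have [P <-] := gx a.
  elim/mpK_ind: P => [c|i|p q|p q].
  - by exists (mC _ _ (pC R c)); rewrite !mCE !mevC pCE pevC.
  - case: (unliftP ord0 i) => [j ->|->]; first by exists 'X_j; rewrite !mevX.
    by exists (mC _ _ (pX R)); rewrite mCE mevC mevX pevX.
  - by move=> [r rE] [t tE]; exists (r + t); rewrite !rmorphD /= rE tE.
  - by move=> [r rE] [t tE]; exists (r * t); rewrite !rmorphM /= rE tE.
(* K is a field integral over L1, so nonzero elements of L1 are units up to ker h1 *)
have inv1 z : h1 z <> 0 -> exists w, h1 z * h1 w = 1.
  move=> z0; have [y zy] := Kf (h1 z) (introN eqP z0).
  have [p pm /rootP] := int1 y.
  rewrite horner_coef size_map_poly_id0; last first.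
    by rewrite (monicP pm) rmorph1 oner_neq0.
  have p0 : p != 0 by apply: monic_neq0.
  rewrite polySpred // big_ord_recr /= coef_map /=.
  have -> : p`_(size p).-1 = 1 by rewrite -lead_coefE (monicP pm).
  rewrite rmorph1 mul1r => py.
  have zyn m : h1 z ^+ m * y ^+ m = 1 by rewrite -exprMn zy expr1n.
  case E : (size p).-1 py => [|d].
    by rewrite big_ord0 add0r expr0 => /kalg_nz1.
  move=> py; exists (- \sum_(i < d.+1) p`_i * z ^+ (d - i)).
  have -> : h1 (- \sum_(i < d.+1) p`_i * z ^+ (d - i)) = y; last exact: zy.
  have yE : y = h1 z ^+ d * y ^+ d.+1 by rewrite exprSr mulrA zyn mul1r.
  rewrite yE; have /eqP := py; rewrite addrC addr_eq0 => /eqP ->.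
  rewrite rmorphN mulrN rmorph_sum mulr_sumr /=; congr (- _); apply: eq_bigr => j _.
  have jd : (j <= d)%N by rewrite -ltnS ltn_ord.
  rewrite rmorphM rmorphXn /= coef_map /= mulrCA; congr (_ * _).
  have -> : h1 z ^+ d = h1 z ^+ (d - j) * h1 z ^+ j by rewrite -exprD subnK.
  by rewrite -mulrA zyn mulr1.
(* Either [x ord0] satisfies an equation over [R] whose top coefficient [a] is invertible in K, or
   it is transcendental, which is refuted at the end. *)
case: (classic (exists p d, [/\ g1 p = 0, (size (p : {poly R}) <= d.+1)%N & g (p : {poly R})`_d <> 0])).
  move=> [p [d [p0 sp pd]]]; set a := (p : {poly R})`_d in pd.
  have [L2 [i2 [h2 [il2 hE2]]]] := loc_at Kf pd.
  have [y2 ay2] : exists y, i2 a * y = 1 by case: il2.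
  have x0int : integralOver h2 (x ord0).
    exists (y2 *: map_poly i2 p).
      have cd : (y2 *: map_poly i2 p)`_d = 1 by rewrite coefZ coef_map /= mulrC.
      have sd : size (y2 *: map_poly i2 p) = d.+1.
        apply/anti_leq/andP; split.
          by rewrite (leq_trans (size_scale_leq _ _)) // (leq_trans (size_poly _ _)).
        rewrite ltnNge; apply/negP => h; move: cd; rewrite nth_default //.
        by move/esym/kalg_nz1.
      by rewrite monicE lead_coefE sd /= cd.
    apply/rootP; rewrite map_polyZ hornerZ -map_poly_comp.
    have -> : map_poly (h2 \o i2) p = map_poly g p by apply: eq_map_poly => r /=.
    by rewrite -(pevE g) -/g1 p0 mulr0.
  have g1int L' (h' : {lrmorphism L' -> K}) (i' : {lrmorphism R -> L'}) :
      (forall r, h' (i' r) = g r) -> integralOver h' (x ord0) -> forall q, integralOver h' (g1 q).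
    move=> hE' xi q; rewrite /g1 pevE; apply: integral_horner => //.
    by apply/integral_poly => j; rewrite coef_map /= -hE'; apply: integral_id.
  (* A monic relation for [g1 s1] with constant term nonzero in K: X is divided out as long as the
     constant term vanishes there. *)
  have [q0 qm [qr qc]] : exists2 q : {poly L2}, q \is monic &
      root (map_poly h2 q) (g1 s1) /\ h2 q`_0 <> 0.
    have [q] := g1int _ _ _ hE2 x0int s1.
    elim/poly_ind: q => [|q c IHq] qm qr.
      by move: qm; rewrite monicE lead_coef0 eq_sym oner_eq0.
    case: (classic (h2 c = 0)) => c0; last first.
      by exists (q * 'X + c%:P) => //; rewrite coefD coefMX coefC /= add0r.
    have qn : q != 0.
      apply/eqP => q0; move: qm; rewrite q0 mul0r add0r monicE lead_coefC => /eqP c1.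
      by move: c0; rewrite c1 rmorph1 => /kalg_nz1.
    apply: IHq.
      move: qm; rewrite !monicE lead_coefDl ?lead_coefMX //.
      rewrite size_mulX // (leq_ltn_trans (size_polyC_leq1 _)) //.
      by rewrite ltnS size_poly_gt0.
    move/rootP: qr; rewrite rmorphD rmorphM /= map_polyC map_polyX /= c0 addr0 hornerMX.
    by move=> /(fieldM Kf) [h|/s1nz//]; apply/rootP.
  have [m [r0 mr]] : exists n r, i2 a ^+ n * q0`_0 = i2 r by case: il2.
  have s0 : g (a * r0) <> 0.
    rewrite rmorphM /= => /(fieldM Kf) [/pd//|]; rewrite -hE2 -mr rmorphM rmorphXn /= hE2.
    by move=> /(fieldM Kf) [/(fieldX Kf)|].
  have [L' [i' [h' [il' hE']]]] := loc_at Kf s0.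
  have [y' ay'] : exists y, i' (a * r0) * y = 1 by case: il'.
  have [e eE] : exists e : {lrmorphism L2 -> L'}, forall r, e (i2 r) = i' r.
    by apply: (loc_lift il2); exists (i' r0 * y'); rewrite mulrA -rmorphM.
  have hE z : h' (e z) = h2 z.
    have := @loc_eq _ _ _ _ _ _ (h' \o e) h2 il2; apply => r.
    by rewrite /= eE hE' hE2.
  exists (a * r0), L', i', h'; split=> //.
  have [v vE] : exists v, e q0`_0 * v = 1.
    have mr' : i' a ^+ m * e q0`_0 = i' r0 by rewrite -!eE -mr rmorphM rmorphXn.
    exists (i' a ^+ m.+1 * y'); rewrite mulrA -ay' rmorphM /= -mr' exprS; ring.
  have [y sy] := Kf (g1 s1) (introN eqP s1nz).
  have x0int' : integralOver h' (x ord0).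
    case: x0int => P Pm Pr; exists (map_poly e P); first exact: monic_map.
    rewrite -map_poly_comp; move: Pr; congr (root _ _).
    by apply: eq_map_poly => z /=; rewrite hE.
  have yint : integralOver h' y.
    have qn : q0 != 0 by apply: monic_neq0.
    pose N := (size q0).-1.
    have NE : size q0 = N.+1 by rewrite /N -polySpred.
    (* The reversed polynomial of [q0], made monic by the inverse [v] of the constant term; the
       inverse [y] of [g1 s1] is its root. *)
    pose T := \poly_(j < N.+1) (v * e q0`_(N - j)).
    have TN : T`_N = 1 by rewrite coef_poly ltnSn subnn mulrC.
    have sT : size T = N.+1.
      apply/anti_leq/andP; split; first exact: size_poly.
      rewrite ltnNge; apply/negP => h; move: TN; rewrite nth_default //.
      by move/esym/kalg_nz1.
    exists T; first by rewrite monicE lead_coefE sT /= TN.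
    apply/rootP; have sy' j : g1 s1 ^+ j * y ^+ j = 1 by rewrite -exprMn sy expr1n.
    rewrite (@horner_coef_wide _ N.+1); last by rewrite (leq_trans (size_poly _ _)) ?sT.
    have -> : \sum_(j < N.+1) (map_poly h' T)`_j * y ^+ j =
       h' v * y ^+ N * \sum_(j < N.+1) h2 q0`_j * g1 s1 ^+ j.
      rewrite mulr_sumr (reindex_inj rev_ord_inj); apply: eq_bigr => j _.
      rewrite coef_map coef_poly /= subSS ltnS leq_subr subKn ?leq_ord // rmorphM /= hE.
      rewrite -!mulrA; congr (_ * _); rewrite mulrCA; congr (_ * _).
      have -> : y ^+ N = y ^+ (N - j) * y ^+ j by rewrite -exprD subnK // leq_ord.
      by rewrite -mulrA (mulrC (y ^+ j)) sy' mulr1.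
    suff -> : \sum_(j < N.+1) h2 q0`_j * g1 s1 ^+ j = 0 by rewrite mulr0.
    move/rootP: qr; rewrite (@horner_coef_wide _ N.+1); last first.
      by rewrite (leq_trans (size_poly _ _)) ?NE.
    by move=> E; rewrite -[RHS]E; apply: eq_bigr => j _; rewrite coef_map.
  move=> b; have [P Pm Pr] := int1 b.
  apply: (integral_root_monic (p := map_poly h1 P)) Pr _; first exact: monic_map.
  apply/integral_poly => j; rewrite coef_map /=; set z := P`_j.
  have [m1 [r1 mr1]] : exists n r, i1 s1 ^+ n * z = i1 r by case: il1.
  have -> : h1 z = y ^+ m1 * g1 r1.
    rewrite -hE1 -mr1 rmorphM rmorphXn /= hE1 mulrA -exprMn (mulrC y) sy expr1n mul1r //.
  apply: integral_mul; last exact: g1int hE' x0int' _.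
  by elim: m1 {mr1} => [|m1 IHm]; rewrite ?expr0 ?exprS; [exact: integral1|exact: integral_mul].
(* Transcendental case: for every c in k the element x - c has an inverse in the image of
   R[X][1/s1], so X - c divides a power of s1 up to coefficients that vanish in K, and s1(c)
   vanishes in K. As k is infinite, s1 vanishes in K, a contradiction. *)
move=> ntr; exfalso.
have kerg (p : {poly R}) : g1 p = 0 -> forall j, g p`_j = 0.
  have [d] : exists d, (size p <= d)%N by exists (size p).
  elim: d p => [|d IHd] p; first by rewrite leqn0 size_poly_eq0 => /eqP -> _ j; rewrite coef0 rmorph0.
  move=> sp p0; have pd : g p`_d = 0.
    by apply: NNPP => h; apply: ntr; exists p, d.
  move=> j; have [->//|jd] := eqVneq j d.
  have := IHd (p - p`_d *: 'X^d).
  have -> : g1 (p - p`_d *: 'X^d) = 0.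
    rewrite /g1 pevE rmorphB /= hornerD hornerN -pevE -/g1 p0 sub0r.
    by rewrite map_polyZ hornerZ /= pd mul0r oppr0.
  have -> : (size (p - p`_d *: 'X^d)%R <= d)%N.
    apply/leq_sizeP => l; rewrite leq_eqVlt coefB coefZ coefXn => /orP[/eqP <-|dl].
      by rewrite eqxx mulr1 subrr.
    rewrite nth_default ?(leq_trans sp) // sub0r; case: eqP => [E|_]; last by rewrite mulr0 oppr0.
    by rewrite E ltnn in dl.
  by move=> /(_ isT erefl j); rewrite coefB coefZ coefXn (negPf jd) mulr0 subr0.
apply: s1nz; apply: (@inf_roots_ker _ _ g s1 [::]) => c _.
have xc : x ord0 - c%:A <> 0.
  move=> E; have := kerg ('X - c%:A%:P); rewrite /g1 pevE map_polyXsubC hornerXsubC /= rmorph_alg.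
  move=> /(_ E 1%N); rewrite coefB coefX coefC subr0 rmorph1; exact: kalg_nz1.
have zE : h1 (i1 (pX R - pC R c%:A)) = x ord0 - c%:A.
  by rewrite hE1 rmorphB /= /g1 pevX pCE pevC /= rmorph_alg.
have [w zw] : exists w, h1 (i1 (pX R - pC R c%:A)) * h1 w = 1 by apply: inv1; rewrite zE.
have [m [r1 mr]] : exists n r, i1 s1 ^+ n * w = i1 r by case: il1.
have E0 : g1 ((pX R - pC R c%:A) * r1 - s1 ^+ m) = 0.
  rewrite rmorphB rmorphM rmorphXn /= -!hE1 -mr rmorphM mulrCA zw mulr1 rmorphXn /=.
  by rewrite subrr.
have E1 : map_poly g ((pX R - pC R c%:A) * r1 - s1 ^+ m) = 0.
  by apply/polyP => j; rewrite coef_map coef0 /= kerg.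
have := congr1 (fun q : {poly K} => q.[c%:A]) E1.
rewrite /= -pevE horner0 rmorphB rmorphM rmorphXn rmorphB /= pevX pCE pevC rmorph_alg.
by rewrite subrr mul0r sub0r => /eqP; rewrite oppr_eq0 => /eqP /(fieldX Kf).
Qed.

Lemma kalg_to_kk A : (forall b : A, exists c : k, b = c%:A) ->
  exists h : {lrmorphism A -> kk}, forall b, (h b : k)%:A = b.
Proof.
move=> hb; pose f b : kk := proj1_sig (constructive_indefinite_description _ (hb b)).
have fE b : (f b : k)%:A = b.
  by rewrite /f; case: constructive_indefinite_description.
have inj (c d : k) : c%:A = d%:A :> A -> c = d.
  move=> /eqP; rewrite -subr_eq0 -scalerBl => /eqP cd; apply/eqP; rewrite -subr_eq0.
  apply/negP => cd0; have [y] := @scal_unit A _ (introN idP cd0).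
  by rewrite cd mul0r => /esym /kalg_nz1.
have [||||h hE] := @lrmorphism_of k A kk f.
- by move=> x y; apply: inj; rewrite fE scalerDl !fE.
- by apply: inj; rewrite fE scale1r.
- move=> x y; apply: inj; rewrite fE.
  have -> : ((f x * f y : kk) : k)%:A = (f x : k)%:A * (f y : k)%:A :> A.
    by rewrite -scalerAl mul1r scalerA.
  by rewrite !fE.
- by move=> c; apply: inj; rewrite fE kkA.
by exists h => b; rewrite hE fE.
Qed.

Lemma zariski K n (x : 'I_n -> K) : is_field K ->
  (forall a, exists P, mev (base K) x P = a) -> forall b : K, exists c : k, b = c%:A.
Proof.
move=> Kf Kx b; have [s [L [i [h [s0 il hE int]]]]] := zariski_step Kf Kx.
have s0' : (s : k) != 0 by apply: contra_not_neq s0 => ->; rewrite rmorph0.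
have Lk z : exists c : k, h z = c%:A.
  have [m [r mr]] : exists n r, i s ^+ n * z = i r by case: il.
  exists ((r : k) / (s : k) ^+ m).
  have := congr1 h mr; rewrite rmorphM rmorphXn /= !hE => E.
  have sm : base K s ^+ m * ((s : k) ^- m)%:A = 1.
    rewrite -rmorphXn /= baseE -scalerAl mul1r scalerA.
    by rewrite divff ?scale1r // expf_neq0.
  by apply: (unit_cancel sm); rewrite E -scalerA -scalerAr sm baseE.
have [P Pm Pr] := int b.
pose f z : k := proj1_sig (constructive_indefinite_description _ (Lk z)).
have fE z : h z = (f z)%:A.
  by rewrite /f; case: constructive_indefinite_description.
pose N := (size P).-1.
have PN : size P = N.+1 by rewrite /N -polySpred // monic_neq0.
pose T : {poly k} := 'X^N + \poly_(j < N) f P`_j.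
have Ts : T \is monic.
  rewrite monicE lead_coefDl ?lead_coefXn // size_polyXn ltnS; exact: size_poly.
have Tb : map_poly (in_alg K) T = map_poly h P.
  apply/polyP => j; rewrite !coef_map /= coefD coefXn coef_poly.
  case: (ltngtP j N) => [jN|jN|->].
  - by rewrite add0r fE.
  - by rewrite addr0 scale0r nth_default ?PN // rmorph0.
  - by rewrite addr0 scale1r /N -lead_coefE (monicP Pm) rmorph1.
have [rs] := closed_field_poly_normal T; rewrite (monicP Ts) scale1r => rsE.
move/rootP: Pr; rewrite -Tb rsE rmorph_prod horner_prod /=.
elim: rs {rsE} => [|c rs IH]; first by rewrite big_nil => /kalg_nz1.
rewrite big_cons => /(fieldM Kf) [|//].
rewrite map_polyXsubC hornerXsubC /= => /eqP; rewrite subr_eq0 => /eqP ->; by exists c.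
Qed.

(** Specialization to a k-point: an element that does not vanish at [h] does not vanish at [g], so a
    statement asking for some [s] nonzero at a point has to be proved at k-points only. *)
Lemma kpoint A K (g : {lrmorphism A -> K}) : fgen (base A) -> is_field K ->
  exists h : {lrmorphism A -> kk}, forall a, g a = 0 -> h a = 0.
Proof.
move=> [n [x Ax]] Kf.
have II : ideal (fun a => g a = 0).
  split; first exact: rmorph0.
  - by move=> a b; rewrite rmorphD /= => -> ->; rewrite addr0.
  - by move=> a b; rewrite rmorphM /= => ->; rewrite mulr0.
have [|K' [g' [Kf' g'I g's]]] := field_pt_max II.
  by rewrite rmorph1; apply: kalg_nz1.
have [|h hE] := @kalg_to_kk K'.
  apply: (@zariski K' n (g' \o x)) => // b; have [a <-] := g's b.
  have [P <-] := Ax a; exists P.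
  elim/mpK_ind: P => [c|i|p q pE qE|p q pE qE].
  - by rewrite mCE !mevC lr_base.
  - by rewrite !mevX.
  - by rewrite !rmorphD /= pE qE.
  - by rewrite !rmorphM /= pE qE.
exists (h \o g') => a /g'I /= ->; exact: rmorph0.
Qed.

Lemma noeth_kk : noeth kk.
Proof. exact: (@noeth_field k). Qed.

Lemma field_kk : is_field kk.
Proof. by move=> x x0; exists (x : k)^-1; apply: (@divff k). Qed.

End Zariski.

(** McCoy's theorem modulo [I]. By descending induction on i all P_i Q_j lie in [I]: first P_i Q_n,
    the top coefficient that is left in P Q, then the others by applying the induction on the size
    to P_i Q without its term of degree n. *)
Lemma mccoy (R : comNzRingType) (I : R -> Prop) (P Q : {poly R}) : ideal I ->
  (forall r, (forall i, I (P`_i * r)) -> I r) ->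
  (forall i, I (P * Q)`_i) -> forall i, I Q`_i.
Proof.
move=> [I0 ID IM] cP.
have IB x y : I x -> I y -> I (x - y).
  by move=> Ix Iy; apply: ID => //; rewrite -mulN1r; apply: IM.
have Isum (T : finType) (p : pred T) (F : T -> R) : (forall t, p t -> I (F t)) -> I (\sum_(t | p t) F t).
  by move=> h; apply: big_ind.
have [n] : exists n, (size Q <= n)%N by exists (size Q).
elim: n Q => [|n IH] Q.
  by rewrite leqn0 size_poly_eq0 => /eqP -> _ i; rewrite coef0.
move=> sQ PQ.
have key i : forall j, I (P`_i * Q`_j).
  have [d] : exists d, (size P <= i + d)%N by exists (size P); rewrite leq_addl.
  elim: d i => [|d IHd] i; first by rewrite addn0 => h j; rewrite nth_default // mul0r.
  rewrite addnS -addSn => sP.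
  have hi a : (i < a)%N -> forall j, I (P`_a * Q`_j).
    move=> ia j; apply: IHd; rewrite (leq_trans sP) // leq_add2r //.
  have hin : I (P`_i * Q`_n).
    have := PQ (i + n)%N; rewrite coefM (bigD1 (Ordinal (leq_addr n i : (i < (i + n).+1)%N))) //=.
    rewrite addKn => h; rewrite -[P`_i * _](addrK (\sum_(j < (i + n).+1 | j != Ordinal (leq_addr n i : (i < (i + n).+1)%N)) P`_j * Q`_(i + n - j))).
    apply: IB => //; apply: Isum => j ji.
    case: (ltngtP j i) => [jlt|/hi //|jE].
    - by rewrite [Q`__]nth_default ?mulr0 // (leq_trans sQ) //; lia.
    - by case/eqP: ji; apply: val_inj.
  pose Q' := (P`_i)%:P * Q - (P`_i * Q`_n)%:P * 'X^n.
  have Q'j j : Q'`_j = P`_i * Q`_j - (P`_i * Q`_n) * (j == n)%:R.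
    by rewrite coefB !coefCM coefXn.
  have hQ' : forall j, I Q'`_j.
    apply: IH.
      apply/leq_sizeP => j; rewrite leq_eqVlt Q'j => /orP[/eqP <-|nj].
        by rewrite eqxx mulr1 subrr.
      by rewrite [Q`_j]nth_default ?(leq_trans sQ) // mulr0 gtn_eqF // mulr0 subr0.
    move=> j; rewrite /Q' mulrBr mulrCA coefB coefCM; apply: IB; first exact: IM.
    by rewrite mulrCA coefCM mulrC; apply: IM.
  move=> j; rewrite -[P`_i * _](subrK (P`_i * Q`_n * (j == n)%:R)) -Q'j.
  by apply: ID => //; rewrite mulrC; apply: IM.
by move=> j; apply: cP => i; apply: key.
Qed.

(** * Faithfully flat base change through explicit tensor products *)

Section Flat.
Variable k : closedFieldType.
Notation kalg := (comAlgType k).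
Implicit Types (R A K L Q : kalg).

(** The first equation is solved by the criterion, the others by induction in the new unknowns. *)
Lemma flat_system R R' (f : {lrmorphism R -> R'}) : flat f ->
  forall a N (rho : 'M[R]_(a, N)) (x : 'cV[R']_N), map_mx f rho *m x = 0 ->
  exists m (M : 'M[R]_(N, m)) (y : 'cV[R']_m), x = map_mx f M *m y /\ rho *m M = 0.
Proof.
move=> Ff; elim=> [|a IH] N rho x h.
  by exists N, 1%:M, x; rewrite map_mx1 mul1mx; split=> //; apply/matrixP => -[].
move: rho h; rewrite -[a.+1]/(1 + a)%N => rho h.
have [m [M [y [xE uM]]]] : exists m (M : 'M[R]_(N, m)) (y : 'cV[R']_m),
    x = map_mx f M *m y /\ usubmx rho *m M = 0.
  apply: Ff; have := congr1 usubmx h; rewrite -mul_usub_mx map_usubmx => ->.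
  by rewrite linear0.
have [|m' [M' [y' [yE dM]]]] := IH m (dsubmx rho *m M) y.
  rewrite map_mxM -mulmxA -xE; have := congr1 dsubmx h.
  by rewrite -mul_dsub_mx map_dsubmx => ->; rewrite linear0.
exists m', (M *m M'), y'; rewrite map_mxM -mulmxA -yE; split=> //.
rewrite -[rho]vsubmxK mulmxA mul_col_mx uM mul_col_mx mul0mx dM.
by rewrite col_mx0.
Qed.

(** The linear form with values [L] on the monomials of bounded degree, after base change along
    [phi]. *)
Definition evL R R1 n d (L : 'X_{1..n < d} -> R) (phi : {lrmorphism R -> R1})
  (F : {mpoly R1[n]}) : R1 := \sum_(m : 'X_{1..n < d}) F@_m * phi (L m).

Lemma evLD R R1 n d (L : 'X_{1..n < d} -> R) (phi : {lrmorphism R -> R1}) F G :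
  evL L phi (F + G) = evL L phi F + evL L phi G.
Proof. by rewrite -big_split; apply: eq_bigr => m _; rewrite mcoeffD mulrDl. Qed.

Lemma evLZ R R1 n d (L : 'X_{1..n < d} -> R) (phi : {lrmorphism R -> R1}) c F :
  evL L phi (c *: F) = c * evL L phi F.
Proof. by rewrite mulr_sumr; apply: eq_bigr => m _; rewrite mcoeffZ mulrA. Qed.

Lemma evL0 R R1 n d (L : 'X_{1..n < d} -> R) (phi : {lrmorphism R -> R1}) :
  evL L phi 0 = 0.
Proof. by rewrite /evL big1 // => m _; rewrite mcoeff0 mul0r. Qed.

Lemma evL_sum R R1 n d (L : 'X_{1..n < d} -> R) (phi : {lrmorphism R -> R1})
  (T : Type) (s : seq T) (F : T -> {mpoly R1[n]}) :
  evL L phi (\sum_(t <- s) F t) = \sum_(t <- s) evL L phi (F t).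
Proof.
elim: s => [|t s IH]; first by rewrite !big_nil evL0.
by rewrite !big_cons evLD IH.
Qed.

Lemma evL_map R R1 n d (L : 'X_{1..n < d} -> R) (phi : {lrmorphism R -> R1}) F :
  evL L phi (map_mpoly phi F) = phi (\sum_(m : 'X_{1..n < d}) F@_m * L m).
Proof.
by rewrite rmorph_sum; apply: eq_bigr => m _; rewrite mcoeff_map_mpoly rmorphM.
Qed.

Lemma flat_monomials R R' (f : {lrmorphism R -> R'}) n (x : 'I_n -> R') d
  (Gs : seq {mpoly R[n]}) : flat f ->
  (forall G, G \in Gs -> (msize G <= d)%N /\ mmap f x G = 0) ->
  exists m (y : 'I_m -> R') (L : 'I_m -> 'X_{1..n < d} -> R),
   (forall mu : 'X_{1..n < d}, mmap1 x mu = \sum_c f (L c mu) * y c) /\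
   forall G, G \in Gs -> forall c, \sum_(mu : 'X_{1..n < d}) G@_mu * L c mu = 0.
Proof.
move=> Ff hG; pose T : finType := 'X_{1..n < d}; pose N := #|T|.
pose G0 i := nth 0 Gs i.
pose rho : 'M[R]_(size Gs, N) := \matrix_(i, j) (G0 i)@_(enum_val j : T).
pose X : 'cV[R']_N := \col_j mmap1 x (enum_val j : T).
have h : map_mx f rho *m X = 0.
  apply/matrixP => i j; rewrite !mxE.
  have [sG Gx] := hG (G0 i) (mem_nth _ (ltn_ord i)).
  rewrite -[RHS]Gx (mmapE _ sG) (reindex (@enum_val T T)) /=; last first.
    exact/onW_bij/enum_val_bij.
  by apply: eq_bigr => l _; rewrite !mxE.
have [m [M [y [XE rM]]]] := flat_system Ff h.
exists m, (fun c => y c 0), (fun c mu => M (enum_rank mu) c); split.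
  move=> mu; have := congr1 (fun A : 'cV_N => A (enum_rank mu) 0) XE.
  by rewrite !mxE enum_rankK => ->; apply: eq_bigr => c _; rewrite mxE.
move=> G Gin c; have Gi : (index G Gs < size Gs)%N by rewrite index_mem.
have := congr1 (fun A : 'M_(size Gs, m) => A (Ordinal Gi) c) rM.
rewrite !mxE => E; rewrite -[RHS]E (reindex (@enum_val T T)) /=; last first.
  exact/onW_bij/enum_val_bij.
by apply: eq_bigr => l _; rewrite mxE /= /G0 nth_index // enum_valK.
Qed.

(** Flatness turned into coordinates. The membership of [F1] involves finitely many monomial
    multiples of relations. The equational criterion for these writes evaluation at [x] through
    linear forms [L j] over [R] that kill them, hence kill [F1] after base change. *)
Lemma tensor_core R R' (f : {lrmorphism R -> R'}) n (x : 'I_n -> R') m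
  (rel : 'I_m -> {mpoly R[n]}) R1 (phi : {lrmorphism R -> R1})
  (F1 : {mpoly R1[n]}) (c : 'I_m -> {mpoly R1[n]}) d0 :
  flat f -> (forall i, mmap f x (rel i) = 0) ->
  F1 = \sum_i c i * map_mpoly phi (rel i) ->
  exists d N (y : 'I_N -> R') (L : 'I_N -> 'X_{1..n < d} -> R),
   [/\ (d0 <= d)%N,
       forall F : {mpoly R[n]}, (msize F <= d)%N ->
         mmap f x F = \sum_j f (\sum_(mu : 'X_{1..n < d}) F@_mu * L j mu) * y j &
       forall j, evL (L j) phi F1 = 0].
Proof.
move=> Ff relx FE.
pose Gs := [seq 'X_[nu] * rel i | i <- enum 'I_m, nu <- msupp (c i)].
pose d := (d0 + \sum_(G <- Gs) msize G)%N.
have hG G : G \in Gs -> (msize G <= d)%N /\ mmap f x G = 0.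
  move=> Gin; split.
    by rewrite /d (big_rem G) //= addnCA leq_addr.
  move/allpairsPdep: Gin => [i [nu [_ _ ->]]].
  by rewrite rmorphM /= relx mulr0.
have [N [y [L [Lx LG]]]] := flat_monomials Ff hG.
exists d, N, y, L; split; first by rewrite leq_addr.
  move=> F sF; rewrite (mmapE _ sF).
  under eq_bigr do rewrite Lx mulr_sumr.
  rewrite exchange_big /=; apply: eq_bigr => j _.
  by rewrite rmorph_sum mulr_suml; apply: eq_bigr => mu _; rewrite mulrA rmorphM.
move=> j; rewrite FE evL_sum big1_seq // => i _.
rewrite [c i]mpolyE mulr_suml evL_sum big1_seq // => nu /andP[_ nuc].
rewrite -scalerAl evLZ -(map_mpolyX phi) -rmorphM evL_map LG ?rmorph0 ?mulr0 //.
by apply/allpairsPdep; exists i, nu; split=> //; rewrite mem_enum.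
Qed.

Lemma ff_sum R R' (f : {lrmorphism R -> R'}) N (y : 'I_N -> R') (a : 'I_N -> R) :
  faithfully_flat f -> \sum_j f (a j) * y j = 1 ->
  exists b : 'I_N -> R, \sum_j a j * b j = 1.
Proof.
move=> [_ Ff] E; have [|n [r [c [ra cr]]]] := Ff (fun z => exists j, z = a j).
  exists N, a, y; split=> [j|]; first by exists j.
  by rewrite -[RHS]E; apply: eq_bigr => j _; rewrite mulrC.
have rj l : {j | r l = a j} := constructive_indefinite_description _ (ra l).
exists (fun j => \sum_(l | sval (rj l) == j) c l).
rewrite -[RHS]cr; under eq_bigr do rewrite mulr_sumr.
rewrite (exchange_big_dep predT) //=; apply: eq_bigr => l _.
rewrite (eq_bigl (fun j => j == sval (rj l))) => [|j]; last exact: eq_sym.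
by rewrite big_pred1_eq mulrC {2}(svalP (rj l)).
Qed.

(** What descent uses of the tensor product Q of R1 and R' over R: R1 embeds, injectivity of [phi]
    is preserved, an element coming from both sides comes from [R], and membership in J Q can be
    read on coefficients in [R]. *)
Definition fppf_tensor R R' R1 (f : {lrmorphism R -> R'}) (phi : {lrmorphism R -> R1})
    Q (i : {lrmorphism R1 -> Q}) (j : {lrmorphism R' -> Q}) : Prop :=
  [/\ forall r, i (phi r) = j (f r),
      injective i,
      (injective phi -> injective j),
      (forall r1 r', i r1 = j r' -> exists r0, r1 = phi r0) &
      (forall (J : R1 -> Prop) r' (s : seq (R1 * Q)), ideal J ->
         (forall a, a \in s -> J a.1) -> j r' = \sum_(a <- s) i a.1 * a.2 ->
         exists N (c : 'I_N -> R) (y : 'I_N -> R'),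
           r' = \sum_l f (c l) * y l /\ forall l, J (phi (c l)))].

Lemma tensor_ex R R' R1 (f : {lrmorphism R -> R'}) (phi : {lrmorphism R -> R1}) :
  fppf_cover f -> exists Q (i : {lrmorphism R1 -> Q}) (j : {lrmorphism R' -> Q}),
    fppf_tensor f phi i j.
Proof.
move=> [Fff [n [x [m [rel [xs xk]]]]]]; have [Ff _] := Fff.
have relx l : mmap f x (rel l) = 0.
  apply/xk; exists (fun l' => (l' == l)%:R).
  by rewrite (bigD1 l) //= eqxx mul1r big1 ?addr0 // => l' /negPf ->; rewrite mul0r.
pose I (F : mpK R1 n) := exists c : 'I_m -> {mpoly R1[n]},
  F = \sum_l c l * map_mpoly phi (rel l).
have II : ideal I.
  split.
  - by exists (fun _ => 0); rewrite big1 // => l _; rewrite mul0r.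
  - move=> a b [c ->] [c' ->]; exists (fun l => c l + c' l).
    by rewrite -big_split; apply: eq_bigr => l _; rewrite mulrDl.
  - move=> a b [c ->]; exists (fun l => (a : {mpoly R1[n]}) * c l).
    by rewrite mulr_sumr; apply: eq_bigr => l _; rewrite mulrA.
(* the coefficient functionals that kill the relations *)
have core F1 (d0 : nat) : I F1 -> exists d N (y : 'I_N -> R') (L : 'I_N -> 'X_{1..n < d} -> R),
   [/\ (d0 <= d)%N,
       forall F : {mpoly R[n]}, (msize F <= d)%N ->
         mmap f x F = \sum_j f (\sum_(mu : 'X_{1..n < d}) F@_mu * L j mu) * y j &
       forall j, evL (L j) phi F1 = 0].
  by move=> [c cE]; apply: (tensor_core d0 Ff relx cE).
have one d N (y : 'I_N -> R') (L : 'I_N -> 'X_{1..n < d} -> R) : (1 < d)%N ->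
   (forall F : {mpoly R[n]}, (msize F <= d)%N ->
         mmap f x F = \sum_j f (\sum_(mu : 'X_{1..n < d}) F@_mu * L j mu) * y j) ->
   exists b : 'I_N -> R, \sum_j (\sum_(mu : 'X_{1..n < d}) (1 : {mpoly R[n]})@_mu * L j mu) * b j = 1.
  move=> d1 /(_ 1); rewrite msize1 => /(_ (ltnW d1)) E.
  by apply: (ff_sum (y := y) Fff); rewrite -E rmorph1.
have evC (r : R1) d (L : 'X_{1..n < d} -> R) :
    evL L phi (r%:MP : {mpoly R1[n]}) = r * phi (\sum_(mu : 'X_{1..n < d}) (1 : {mpoly R[n]})@_mu * L mu).
  by rewrite -evL_map rmorph1 -evLZ -mul_mpolyC mulr1.
(* The values of the forms [L j] at 1 generate the unit ideal by faithful flatness, and r times each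
   of them is 0. *)
have I0 (r : R1) : I (r%:MP : {mpoly R1[n]}) -> r = 0.
  move=> /(core _ 2) [d [N [y [L [d1 Lx LI]]]]].
  have [b bE] := one d N y L d1 Lx.
  rewrite -[r]mulr1 -[1](rmorph1 phi) -bE rmorph_sum mulr_sumr big1 // => j _.
  by rewrite rmorphM mulrA /= -evC LI mul0r.
have I1 : ~ I 1 by move/(I0 1)/kalg_nz1.
have [Q [p [ps pk]]] := quot_ex II I1.
pose i : {lrmorphism R1 -> Q} := p \o mC R1 n.
have [mp mpE] : exists mp : {lrmorphism mpK R n -> mpK R1 n}, forall F, mp F = map_mpoly phi F.
  exists (mev (mC R1 n \o phi) (fun l => 'X_l)) => F; rewrite mevE /map_mpoly.
  by apply: eq_bigr => nu _ /=; rewrite mCE.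
have [j jE] : exists j : {lrmorphism R' -> Q}, forall F, j (mev f x F) = p (mp F).
  apply: (quot_lift (p := mev f x) (g := p \o mp)) => [y|F].
    by have [P PE] := xs y; exists P; rewrite mevE.
  rewrite mevE => /xk [c ->] /=; apply/pk; rewrite mpE; exists (fun l => map_mpoly phi (c l)).
  by rewrite rmorph_sum; apply: eq_bigr => l _; rewrite rmorphM.
have jr r' : exists F : mpK R n, r' = mmap f x F /\ j r' = p (map_mpoly phi F).
  by have [F FE] := xs r'; exists F; rewrite -FE -mpE -jE mevE.
have iE r : i r = p (r%:MP : {mpoly R1[n]}) by rewrite /i /= mCE.
have D (J : R1 -> Prop) r' (s : seq (R1 * Q)) : ideal J ->
         (forall a, a \in s -> J a.1) -> j r' = \sum_(a <- s) i a.1 * a.2 ->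
         exists N (c : 'I_N -> R) (y : 'I_N -> R'),
           r' = \sum_l f (c l) * y l /\ forall l, J (phi (c l)).
  move=> [J0 JD JM] sJ; have [F [-> ->]] := jr r'.
  have [Z [ZE ZJ]] : exists Z : mpK R1 n, p Z = \sum_(a <- s) i a.1 * a.2 /\
     forall d (L : 'X_{1..n < d} -> R), J (evL L phi Z).
    elim: s sJ => [|a s IH] sJ.
      by exists 0; rewrite big_nil rmorph0; split=> // d L; rewrite evL0.
    have [Z [ZE ZJ]] := IH (fun b bs => sJ b (in_tl _ bs)).
    have [W WE] := ps a.2; exists (mC R1 n a.1 * W + Z).
    rewrite big_cons -ZE -WE rmorphD rmorphM; split=> // d L; rewrite evLD.
    apply: JD => //; rewrite mCE mul_mpolyC evLZ mulrC; apply: JM; apply: sJ.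
    exact: mem_head.
  rewrite -ZE => /eqP; rewrite -subr_eq0 -(rmorphB p) => /eqP /pk.
  move=> /(core _ (msize F)) [d [N [y [L [d1 Lx LI]]]]].
  exists N, (fun l => \sum_(mu : 'X_{1..n < d}) F@_mu * L l mu), y; rewrite Lx //; split=> // l.
  rewrite -evL_map -[evL _ _ _](subrK (evL (L l) phi Z)); apply: JD => //.
  rewrite -[evL _ _ Z]mul1r -mulNr -evLZ -evLD scaleN1r.
  have -> : map_mpoly phi F - Z = (map_mpoly phi F : mpK R1 n) - Z by [].
  by rewrite LI.
exists Q, i, j; split=> //.
- move=> r; have -> : f r = mev f x (r%:MP : {mpoly R[n]}) by rewrite mevC.
  by rewrite jE mpE map_mpolyC iE.
- move=> a b; have iB : i (a - b) = i a - i b := rmorphB i a b.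
  move/eqP; rewrite -subr_eq0 -iB iE => /eqP /pk /I0 /eqP.
  by rewrite subr_eq0 => /eqP.
- move=> phi_inj a b /eqP; rewrite -subr_eq0 -(rmorphB j) => /eqP E.
  have JI : ideal (fun z : R1 => z = 0).
    by split=> // [u v -> ->|u v ->]; rewrite ?addr0 ?mulr0.
  have [||N [c [y [abE ce]]]] := D (fun z => z = 0) (a - b) [::] JI.
  + by [].
  + by rewrite big_nil.
  apply/eqP; rewrite -subr_eq0 abE big1 // => l _.
  by rewrite (phi_inj (c l) 0) ?rmorph0 ?mul0r // ce.
- move=> r1 r' E; have [F [_ jF]] := jr r'.
  have /(core _ 2) [d [N [y [L [d1 Lx LI]]]]] : I (map_mpoly phi F - (r1%:MP : {mpoly R1[n]})).
    apply/pk; have pB (a b : mpK R1 n) : p (a - b) = p a - p b := rmorphB p a b.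
    by apply: etrans (pB _ _) _; rewrite -jF -iE E subrr.
  have [b bE] := one d N y L d1 Lx.
  exists (\sum_l (\sum_(mu : 'X_{1..n < d}) F@_mu * L l mu) * b l).
  rewrite -[r1]mulr1 -[1](rmorph1 phi) -bE !rmorph_sum mulr_sumr; apply: eq_bigr => l _.
  rewrite !rmorphM mulrA /= -evC -evL_map; congr (_ * _); apply/eqP.
  by rewrite eq_sym -subr_eq0 -mulN1r -evLZ -evLD scaleN1r LI.
Qed.

End Flat.

(** * Open subfunctors and affine charts *)

Section Functors.
Variable k : closedFieldType.
Notation kalg := (comAlgType k).
Implicit Types (R A B K L Q : kalg) (X Y : kfunctor k).

Lemma fmap_idE X R (x : X R) : fmap (idfun : {lrmorphism R -> R}) x = x.
Proof. exact: fmap_id. Qed.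

Lemma fmap_eq X R B (f g : {lrmorphism R -> B}) (x : X R) : f =1 g -> fmap f x = fmap g x.
Proof.
move=> fg; rewrite (@fmap_comp _ X _ _ _ (idfun : {lrmorphism R -> R}) g f) ?fmap_idE //.
Qed.

Lemma fmapM X R B K (f : {lrmorphism R -> B}) (g : {lrmorphism B -> K}) (x : X R) :
  fmap g (fmap f x) = fmap (g \o f : {lrmorphism R -> K}) x.
Proof. by rewrite -(@fmap_comp _ X _ _ _ f g (g \o f : {lrmorphism R -> K})). Qed.

Lemma fmapC X R B B' K (f : {lrmorphism R -> B}) (g : {lrmorphism B -> K})
  (f' : {lrmorphism R -> B'}) (g' : {lrmorphism B' -> K}) (x : X R) :
  (forall r, g (f r) = g' (f' r)) -> fmap g (fmap f x) = fmap g' (fmap f' x).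
Proof. by move=> h; rewrite !fmapM; apply: fmap_eq. Qed.

Lemma fmapT X R B K (f : {lrmorphism R -> B}) (g : {lrmorphism B -> K})
  (h : {lrmorphism R -> K}) (x : X R) :
  (forall r, g (f r) = h r) -> fmap g (fmap f x) = fmap h x.
Proof. by move=> e; rewrite fmapM; apply: fmap_eq. Qed.

Lemma unit_idealP R B (f : {lrmorphism R -> B}) (I : R -> Prop) :
  unit_ideal f I <-> forall K (g : {lrmorphism B -> K}), is_field K ->
    exists2 r, I r & g (f r) <> 0.
Proof.
split.
  move=> [n [r [c [rI rc]]]] K g Kf; apply: NNPP => h.
  have := congr1 g rc; rewrite rmorph_sum rmorph1 big1.
    by move=> /esym /kalg_nz1.
  move=> i _; rewrite rmorphM /=.
  suff -> : g (f (r i)) = 0 by rewrite mulr0.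
  by apply: NNPP => h'; apply: h; exists (r i).
move=> h; pose J (b : B) := exists s : seq (R * B),
  (forall a, a \in s -> I a.1) /\ b = \sum_(a <- s) a.2 * f a.1.
have [||s [sI sE]] := @unit_ideal_local k B J.
- split; first by exists [::]; rewrite big_nil.
  + move=> _ _ [s [sI ->]] [t [tI ->]]; exists (s ++ t); rewrite big_cat; split=> //.
    by move=> a; rewrite mem_cat => /orP[/sI|/tI].
  + move=> a _ [s [sI ->]]; exists [seq (b.1, a * b.2) | b <- s]; split.
      by move=> _ /mapP[b /sI ? ->].
    by rewrite mulr_sumr big_map; apply: eq_bigr => b _; rewrite mulrA.
- move=> K g Kf; have [r Ir r0] := h K g Kf; exists (f r) => //.
  exists [:: (r, 1)]; rewrite big_seq1 mul1r; split=> //.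
  by move=> a; rewrite inE => /eqP ->.
exists (size s), (fun i => (nth (0, 0) s i).1), (fun i => (nth (0, 0) s i).2).
split; first by move=> i; apply: sI; rewrite mem_nth.
by rewrite sE (big_nth (0, 0)) big_mkord.
Qed.

Lemma unit_ideal_field R K (f : {lrmorphism R -> K}) (I : R -> Prop) : is_field K ->
  unit_ideal f I <-> exists2 r, I r & f r <> 0.
Proof.
move=> Kf; rewrite unit_idealP; split=> [h|[r Ir r0] K' g Kf'].
  by have [r Ir r0] := h K (idfun : {lrmorphism K -> K}) Kf; exists r.
exists r => // gr0; have [y ry] := Kf _ (introN eqP r0).
by have := congr1 g ry; rewrite rmorphM /= gr0 mul0r rmorph1 => /esym /kalg_nz1.
Qed.

Lemma lr_field_inj K A (g : {lrmorphism K -> A}) x : is_field K -> g x = 0 -> x = 0.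
Proof.
move=> Kf gx; apply/eqP/negP => /negP /Kf [y xy].
by have := congr1 g xy; rewrite rmorphM /= gx mul0r rmorph1 => /esym /kalg_nz1.
Qed.

Lemma open_fmap X (U : subf X) R B (f : {lrmorphism R -> B}) (x : X R) :
  open_sub U -> U R x -> U B (fmap f x).
Proof.
move=> Uo Ux; have [I IE] := Uo R x; apply/IE.
have /IE [n [r [c [rI rc]]]] : U R (fmap (idfun : {lrmorphism R -> R}) x).
  by rewrite fmap_idE.
exists n, r, (f \o c); split=> //; rewrite -(rmorph1 f) -rc rmorph_sum.
by apply: eq_bigr => i _; rewrite rmorphM.
Qed.

Lemma openP X (U : subf X) R (x : X R) : open_sub U ->
  (U R x <-> forall K (g : {lrmorphism R -> K}), is_field K -> U K (fmap g x)).
Proof.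
move=> Uo; split=> [Ux K g _|h]; first exact: open_fmap.
have [I IE] := Uo R x; rewrite -[x]fmap_idE; apply/IE/unit_idealP => K g Kf.
by have /IE /(unit_ideal_field _ _ Kf) := h K g Kf.
Qed.

Lemma open_at X (U : subf X) R (x : X R) K (g : {lrmorphism R -> K}) :
  open_sub U -> is_field K -> U K (fmap g x) ->
  exists2 s, g s <> 0 &
    forall B (f : {lrmorphism R -> B}), (exists y, f s * y = 1) -> U B (fmap f x).
Proof.
move=> Uo Kf Ug; have [I IE] := Uo R x.
have /IE /(unit_ideal_field _ _ Kf) [s Is s0] := Ug.
exists s => // B f [y sy]; apply/IE; exists 1%N, (fun _ => s), (fun _ => y).
by rewrite big_ord1 mulrC.
Qed.

(** Openness tested on field-valued points: the functions chosen are the r such that [W] holds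
    wherever r does not vanish. *)
Lemma open_crit X (W : subf X) :
  (forall R (x : X R), W R x <-> forall K (g : {lrmorphism R -> K}), is_field K -> W K (fmap g x)) ->
  (forall R (x : X R) K (g : {lrmorphism R -> K}), is_field K -> W K (fmap g x) ->
     exists2 s, g s <> 0 & forall K' (h : {lrmorphism R -> K'}), is_field K' ->
       h s <> 0 -> W K' (fmap h x)) ->
  open_sub W.
Proof.
move=> Wp Wo R x.
exists (fun r => forall K (h : {lrmorphism R -> K}), is_field K -> h r <> 0 -> W K (fmap h x)).
move=> B f; rewrite unit_idealP Wp; split=> h K g Kf.
  have := h K g Kf; rewrite fmapM => /(Wo _ _ _ _ Kf) [s s0 sW]; by exists s.
by have [r rW r0] := h K g Kf; rewrite fmapM; apply: rW.
Qed.

Lemma open_cap X (U V : subf X) : open_sub U -> open_sub V ->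
  open_sub (fun R x => U R x /\ V R x).
Proof.
move=> Uo Vo; apply: open_crit.
- move=> R x; split=> [[Ux Vx] K g _|h]; first by split; apply: open_fmap.
  by split; apply/openP => // K g Kf; have [] := h K g Kf.
- move=> R x K g Kf [Ux Vx].
  have [s s0 sU] := open_at Uo Kf Ux; have [t t0 tV] := open_at Vo Kf Vx.
  exists (s * t); first by rewrite rmorphM /= => /(fieldM Kf) [].
  move=> K' h Kf'; rewrite rmorphM /= => st0.
  have [y hy] := Kf' _ (introN eqP st0).
  by split; [apply: sU; exists (h t * y) | apply: tV; exists (h s * y)];
    rewrite -[RHS]hy; ring.
Qed.

Lemma open_full X : open_sub (fun R (x : X R) => True).
Proof. by apply: open_crit => // R x K g Kf _; exists 1 => //; rewrite rmorph1; apply: kalg_nz1. Qed.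

Definition locfun X (U : subf X) (phi : forall R, X R -> R) : Prop :=
  forall R B (f : {lrmorphism R -> B}) (x : X R), U R x -> phi B (fmap f x) = f (phi R x).

Lemma open_unit X (U : subf X) phi : open_sub U -> locfun U phi ->
  open_sub (fun R (x : X R) => U R x /\ exists y, phi R x * y = 1).
Proof.
move=> Uo pl; apply: open_crit.
- move=> R x; split=> [[Ux [y xy]] K g _|h].
    split; first exact: open_fmap.
    by exists (g y); rewrite pl // -rmorphM xy rmorph1.
  have Ux : U R x by apply/openP => // K g Kf; have [] := h K g Kf.
  split=> //; suff : exists y, 1 = y * phi R x by case=> y yE; exists y; rewrite mulrC.
  apply: (@unit_ideal_local k R (fun r => exists y, r = y * phi R x)).
    split; first by exists 0; rewrite mul0r.
    - by move=> _ _ [y ->] [z ->]; exists (y + z); rewrite mulrDl.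
    - by move=> a _ [y ->]; exists (a * y); rewrite mulrA.
  move=> K g Kf; exists (phi R x); first by exists 1; rewrite mul1r.
  have [_ [y]] := h K g Kf; rewrite pl // => gy g0.
  by move: gy; rewrite g0 mul0r => /esym /kalg_nz1.
- move=> R x K g Kf [Ux [y xy]].
  have [s s0 sU] := open_at Uo Kf Ux.
  have [L [i [h [il hE]]]] := loc_at Kf s0.
  have Uix : U L (fmap i x) by apply: sU; case: il.
  have [n [r nr]] : exists n r, i s ^+ n * phi L (fmap i x) = i r by case: il.
  have phE : phi K (fmap g x) = h (phi L (fmap i x)).
    by rewrite -pl //; congr (phi _ _); rewrite (fmapT (h := g)).
  exists (s * r).
    rewrite rmorphM /= => /(fieldM Kf) [//|]; rewrite -hE -nr rmorphM rmorphXn /= hE -phE.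
    move=> /(fieldM Kf) [/(fieldX Kf)//|E]; move: xy; rewrite E mul0r => /esym; exact: kalg_nz1.
  move=> K' h' Kf'; rewrite rmorphM /= => sr0.
  have hs0 : h' s <> 0 by move=> E; apply: sr0; rewrite E mul0r.
  have [z sz] := Kf' _ (introN eqP hs0).
  have [h2 h2E] : exists h2 : {lrmorphism L -> K'}, forall r, h2 (i r) = h' r.
    by apply: (loc_lift il); exists z.
  have UK : U K' (fmap h' x) by apply: sU; exists z.
  split=> //; apply: Kf'; apply/eqP => E; apply: sr0.
  rewrite -(h2E r) -nr rmorphM rmorphXn /= -pl // (fmapT (h := h')) // E !mulr0 //.
Qed.

Lemma affine_fact X (U : subf X) A (a : X A) R (x : X R) :
  affine_open U a -> U R x -> exists f : {lrmorphism A -> R}, fmap f a = x.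
Proof. by move=> [_ h _] /h. Qed.

Lemma affine_in X (U : subf X) A (a : X A) R (f : {lrmorphism A -> R}) :
  affine_open U a -> U R (fmap f a).
Proof. by move=> [_ h _]; apply/h; exists f. Qed.

Lemma affine_self X (U : subf X) A (a : X A) : affine_open U a -> U A a.
Proof. by move=> h; rewrite -[a]fmap_idE; apply: affine_in. Qed.

Lemma affine_open_open X (U : subf X) A (a : X A) : affine_open U a -> open_sub U.
Proof. by case. Qed.

Lemma affine_loc X (U : subf X) A (a : X A) (s : A) L (i : {lrmorphism A -> L}) :
  affine_open U a -> is_loc s i ->
  affine_open (fun R (x : X R) => exists f : {lrmorphism L -> R}, fmap f (fmap i a) = x) (fmap i a).
Proof.
move=> [Uo Uf Uu] il; pose W : subf X := fun R x => exists f : {lrmorphism L -> R}, fmap f (fmap i a) = x.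
have WE R (x : X R) : W R x <-> exists2 f : {lrmorphism A -> R}, fmap f a = x & exists y, f s * y = 1.
  split.
    move=> [f fx]; exists (f \o i : {lrmorphism A -> R}); first by rewrite -fmapM.
    by case: il => [[y sy] _ _]; exists (f y); rewrite /= -rmorphM sy rmorph1.
  by move=> [f <- /(loc_lift il) [h hE]]; exists h; apply: fmapT.
split=> // [|R f g fg]; last first.
  by apply: (loc_eq il) => r; apply: (Uu _ (f \o i) (g \o i)); rewrite -!fmapM.
apply: open_crit.
- move=> R x; split.
    by move=> /WE [f <- [y sy]] K g Kf; apply/WE; exists (g \o f : {lrmorphism A -> K});
      [rewrite fmapM | exists (g y); rewrite /= -rmorphM sy rmorph1].
  move=> h; have : U R x.
    apply/openP => // K g Kf; have /WE [f fE _] := h K g Kf.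
    by apply/Uf; exists f.
  move=> /Uf [f fx]; apply/WE; exists f => //.
  suff : exists y, 1 = y * f s by case=> y yE; exists y; rewrite mulrC.
  apply: (@unit_ideal_local k R (fun r => exists y, r = y * f s)).
    split; first by exists 0; rewrite mul0r.
    - by move=> _ _ [y ->] [z ->]; exists (y + z); rewrite mulrDl.
    - by move=> b _ [y ->]; exists (b * y); rewrite mulrA.
  move=> K g Kf; exists (f s); first by exists 1; rewrite mul1r.
  have /WE [f' f'E [y sy]] := h K g Kf.
  have E : g \o f =1 f' by apply: Uu; rewrite -fmapM fx.
  move=> g0; move: sy; rewrite -E /= g0 mul0r => /esym; exact: kalg_nz1.
- move=> R x K g Kf /WE [f fE [y sy]].
  have [|t t0 tU] := open_at Uo Kf (x := x) (g := g); first by apply/Uf; exists f.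
  have [L' [i' [h [il' hE]]]] := loc_at Kf t0.
  have /Uf [f' f'E] : U L' (fmap i' x) by apply: tU; case: il'.
  have [n [r nr]] : exists n r, i' t ^+ n * f' s = i' r by case: il'.
  have ff : h \o f' =1 f by apply: Uu; rewrite -fmapM f'E fE; apply: fmapT.
  exists (t * r).
    rewrite rmorphM /= => /(fieldM Kf) [//|]; rewrite -hE -nr rmorphM rmorphXn /= hE.
    move=> /(fieldM Kf) [/(fieldX Kf)//|E]; move: sy; rewrite -ff /= E mul0r => /esym; exact: kalg_nz1.
  move=> K' h' Kf'; rewrite rmorphM /= => tr0.
  have ht0 : h' t <> 0 by move=> E; apply: tr0; rewrite E mul0r.
  have [z tz] := Kf' _ (introN eqP ht0).
  have [h2 h2E] : exists h2 : {lrmorphism L' -> K'}, forall r, h2 (i' r) = h' r.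
    by apply: (loc_lift il'); exists z.
  apply/WE; exists (h2 \o f' : {lrmorphism A -> K'}); first by rewrite -fmapM f'E; apply: fmapT.
  apply: Kf'; apply/eqP => /= E; apply: tr0.
  by rewrite -(h2E r) -nr rmorphM /= E !mulr0.
Qed.

Lemma fgen_loc A (s : A) L (i : {lrmorphism A -> L}) :
  is_loc s i -> fgen (base A) -> fgen (base L).
Proof.
move=> il [n [x Ax]]; have [y sy] : exists y, i s * y = 1 by case: il.
exists n.+1, (fun j => if unlift ord0 j is Some l then i (x l) else y).
move=> z; have [m [r mr]] : exists m r, i s ^+ m * z = i r by case: il.
have ix r' : exists P, mev (base L) (fun j => if unlift ord0 j is Some l then i (x l) else y) P = i r'.
  have [P <-] := Ax r'; elim/mpK_ind: P => [c|j|p q [p' pE] [q' qE]|p q [p' pE] [q' qE]].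
  - by exists (mC _ _ c); rewrite !mCE !mevC lr_base.
  - by exists 'X_(lift ord0 j); rewrite !mevX liftK.
  - by exists (p' + q'); rewrite !rmorphD /= pE qE.
  - by exists (p' * q'); rewrite !rmorphM /= pE qE.
have [P PE] := ix r; exists (('X_ord0 : mpK (kk k) n.+1) ^+ m * P).
rewrite rmorphM rmorphXn /= PE mevX unlift_none -mr mulrA -exprMn (mulrC y) sy expr1n.
by rewrite mul1r.
Qed.

Definition smooth_k Y : Prop :=
  (forall A B (pi : {lrmorphism A -> B}) (x0 : Y B),
    (forall r, exists s, pi s = r) ->
    (forall r s, pi r = 0 -> pi s = 0 -> r * s = 0) -> exists x, fmap pi x = x0) /\
  (forall K (x : Y K), is_field K -> exists (U : subf Y) A (a : Y A),
    [/\ affine_open U a, fgen (base A) & U K x]).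

Lemma chart_small Y (W : subf Y) K (x : Y K) : smooth_k Y -> is_field K ->
  open_sub W -> W K x ->
  exists (U : subf Y) A (a : Y A), [/\ affine_open U a, fgen (base A), U K x & W A a].
Proof.
move=> [_ Yc] Kf Wo Wx; have [U [A [a [Ua fA Ux]]]] := Yc K x Kf.
have [g gx] := affine_fact Ua Ux.
have [|s s0 sW] := open_at Wo Kf (x := a) (g := g); first by rewrite gx.
have [L [i [h [il hE]]]] := loc_at Kf s0.
exists (fun R (x : Y R) => exists f : {lrmorphism L -> R}, fmap f (fmap i a) = x), L, (fmap i a).
split; first exact: affine_loc Ua il.
- exact: fgen_loc il fA.
- by exists h; rewrite -gx; apply: fmapT.
- by apply: sW; case: il.
Qed.

Lemma mk_locfun Y (U : subf Y) A (a : Y A) (b : A) : affine_open U a ->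
  exists phi, locfun U phi /\ phi A a = b.
Proof.
move=> Ua; have [Uo Uf Uu] := Ua.
pose phi R (x : Y R) : R :=
  if excluded_middle_informative (exists f : {lrmorphism A -> R}, fmap f a = x) is left h
  then proj1_sig (constructive_indefinite_description _ h) b else 0.
have phE R (f : {lrmorphism A -> R}) : phi R (fmap f a) = f b.
  rewrite /phi; case: excluded_middle_informative => [h|[]]; last by exists f.
  case: constructive_indefinite_description => g /= gE.
  by apply: Uu.
exists phi; split; last first.
  by have := phE A (idfun : {lrmorphism A -> A}); rewrite fmap_idE.
by move=> R B f x /Uf [g <-]; rewrite fmapM !phE.
Qed.

Lemma locfun_sub X (U V : subf X) phi : (forall R x, U R x -> V R x) ->
  locfun V phi -> locfun U phi.
Proof. by move=> UV h R B f x /UV; apply: h. Qed.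

(** Field-valued points decide membership in an open subfunctor, and they do not see nilpotents. *)
Lemma nilp_open X (U : subf X) A B (pi : {lrmorphism A -> B}) (x : X A) :
  open_sub U -> (forall r, exists s, pi s = r) ->
  (forall r, pi r = 0 -> exists n, r ^+ n = 0) -> U B (fmap pi x) -> U A x.
Proof.
move=> Uo ps pn Ux; apply/openP => // K g Kf.
have [|h hE] := @quot_lift k A B K pi g ps.
  by move=> r /pn [n rn]; apply: (fieldX (n := n) Kf); rewrite -rmorphXn rn rmorph0.
have -> : fmap g x = fmap h (fmap pi x) by apply/esym/fmapT.
exact: open_fmap.
Qed.

Lemma local_eq R (a b : R) : (forall K (g : {lrmorphism R -> K}), is_field K ->
  exists2 s, g s <> 0 & s * a = s * b) -> a = b.
Proof.
move=> h; rewrite -[a]mul1r -[b]mul1r.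
apply: (@unit_ideal_local k R (fun s => s * a = s * b)).
  split; first by rewrite !mul0r.
  - by move=> x y xE yE; rewrite !mulrDl xE yE.
  - by move=> x y yE; rewrite -!mulrA yE.
by move=> K g Kf; have [s s0 sE] := h K g Kf; exists s.
Qed.

Lemma loc_inj R (s : R) L (i : {lrmorphism R -> L}) (a b : R) : is_loc s i ->
  i a = i b -> exists n, s ^+ n * a = s ^+ n * b.
Proof.
move=> [_ _ ik] /eqP; rewrite -subr_eq0 => /eqP E.
have [n nE] : exists n, s ^+ n * (a - b) = 0 by apply: ik; rewrite rmorphB.
by exists n; apply/eqP; rewrite -subr_eq0 -mulrBr nE.
Qed.

Lemma local_eq_loc R (a b : R) : (forall K (g : {lrmorphism R -> K}), is_field K ->
  exists2 s, g s <> 0 & forall L (i : {lrmorphism R -> L}), is_loc s i -> i a = i b) -> a = b.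
Proof.
move=> h; apply: local_eq => K g Kf; have [s s0 sE] := h K g Kf.
have [L [i [_ [il _]]]] := loc_at Kf s0.
have [n nE] := loc_inj il (sE L i il); exists (s ^+ n) => //.
by rewrite rmorphXn => /(fieldX Kf).
Qed.

End Functors.

Lemma nat_min (P : nat -> Prop) : (exists n, P n) ->
  exists2 n, P n & forall m, (m < n)%N -> ~ P m.
Proof.
move=> [n Pn]; apply: NNPP => h.
have : forall m, ~ P m.
  by elim/ltn_ind => m IH Pm; apply: h; exists m.
by move=> /(_ n).
Qed.

(** * Charts of smooth functors are locally domains *)

Section Trunc.
Variable k : closedFieldType.
Notation kalg := (comAlgType k).
Notation kk := (kk k).
Implicit Types (R A B K L Q T : kalg).

Lemma mpoly_nonroot n (F : {mpoly kk[n]}) : F != 0 -> exists v, F.@[v] != 0.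
Proof.
elim: n F => [|n IH] F F0.
  exists (fun _ => 0); move: F0; apply: contra_neq.
  have [c ->] : exists c : kk, F = c%:MP.
    elim/mpK_ind: F => [c|[]//|p q [c ->] [d ->]|p q [c ->] [d ->]].
    - by exists c; rewrite mCE.
    - by exists (c + d); rewrite mpolyCD.
    - by exists (c * d); rewrite mpolyCM.
  by rewrite mevalC => ->.
pose psi : {lrmorphism mpK kk n.+1 -> pK (mpK kk n)} := mev (pC (mpK kk n) \o mC kk n)
  (fun i => if unlift ord_max i is Some j then pC (mpK kk n) 'X_j else pX (mpK kk n)).
pose chi : {lrmorphism pK (mpK kk n) -> mpK kk n.+1} :=
  pev (mev (mC kk n.+1) (fun j => 'X_(lift ord_max j))) 'X_ord_max.
have chiK G : chi (psi G) = G.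
  apply: (@mpK_eq _ _ _ _ (chi \o psi) (idfun : {lrmorphism mpK kk n.+1 -> mpK kk n.+1})) => [r|i] /=.
    by rewrite /psi mevC /= mCE pCE /chi pevC mevC mCE.
  rewrite /psi mevX; case: unliftP => [j ->|->]; last by rewrite /chi pevX.
  by rewrite pCE /chi pevC mevX.
have psi0 : (psi F : {poly mpK kk n}) != 0.
  by apply: contra_neq F0 => E; rewrite -[F]chiK E rmorph0.
have /IH [v v0] : (lead_coef (psi F : {poly {mpoly kk[n]}})) != 0 by rewrite lead_coef_eq0.
pose ev : {lrmorphism mpK kk n -> kk} := mev (idfun : {lrmorphism kk -> kk}) v.
have evE G : ev G = G.@[v] by rewrite /ev mevE.
have : map_poly ev (psi F : {poly {mpoly kk[n]}}) != 0.
  apply: contraNneq v0 => E; rewrite -evE lead_coefE.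
  by have := congr1 (fun q : {poly kk} => q`_(size (psi F : {poly {mpoly kk[n]}})).-1) E; rewrite coef_map coef0 /= => ->.
move=> /(@closed_nonrootP k) [x x0].
exists (fun i => if unlift ord_max i is Some j then v j else x); apply: contraNneq x0 => E.
have -> : root (map_poly ev (psi F : {poly {mpoly kk[n]}})) x =
  (pev ev (x : kk) (psi F) == 0) by rewrite pevE.
apply/eqP; rewrite -[RHS]E.
pose u (i : 'I_n.+1) : kk := if unlift ord_max i is Some j then v j else x.
transitivity (mev (idfun : {lrmorphism kk -> kk}) u F); last by rewrite mevE.
apply: (@mpK_eq _ _ _ _ (pev ev (x : kk) \o psi)) => [r|i] /=.
  by rewrite /psi !mevC /= mCE pCE pevC /ev mevC.
rewrite /psi !mevX /u; case: unliftP => [j _|_]; last by rewrite pevX.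
by rewrite pCE pevC /ev mevX.
Qed.

Lemma trunc_ex K N : exists T (p : {lrmorphism pK K -> T}),
  (forall y, exists x, p x = y) /\
  (forall q : {poly K}, p q = 0 <-> forall i, (i <= N)%N -> q`_i = 0).
Proof.
apply: (quot_ex (I := fun q : pK K => forall i, (i <= N)%N -> (q : {poly K})`_i = 0)).
  split.
  - by move=> i _; rewrite coef0.
  - by move=> x y hx hy i iN; rewrite coefD hx // hy // addr0.
  - move=> a x hx i iN; rewrite coefM big1 // => j _; rewrite hx ?mulr0 //.
    by rewrite (leq_trans (leq_subr _ _)).
by move=> /(_ 0%N (leq0n _)); rewrite coefC /=; exact: kalg_nz1.
Qed.

(* Lifting a first-order deformation to arbitrary finite order *)
Lemma arc_ex (Y : kfunctor k) (U : subf Y) A (a : Y A) K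
    (g : {lrmorphism A -> K}) (D : A -> K) : smooth_k Y -> affine_open U a ->
  (forall b c, D (b + c) = D b + D c) -> (forall b c, D (b * c) = g b * D c + g c * D b) ->
  (forall c : k, D c%:A = 0) ->
  forall N, exists T (e : {lrmorphism T -> K}) (t : T) (th : {lrmorphism A -> T}),
   [/\ forall b, e (th b) = g b,
       forall b, g b = 0 -> exists2 w, th b = t * w & e w = D b &
       forall z, t ^+ N * z = 0 -> e z = 0].
Proof.
move=> Ys Ua DD DM DA N.
have [T0 [p0 [p0s p0k]]] := trunc_ex K 1.
pose F N T (p : {lrmorphism pK K -> T}) := (forall y, exists x, p x = y) /\
  (forall q : {poly K}, p q = 0 <-> forall i, (i <= N)%N -> q`_i = 0).
have eqp M T (p : {lrmorphism pK K -> T}) (q q' : {poly K}) : F M T p ->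
    p q = p q' <-> forall i, (i <= M)%N -> q`_i = q'`_i.
  move=> [_ pk]; have pB : p (q - q') = p q - p q' := rmorphB p q q'.
  split=> [E i iM|h].
    apply/eqP; rewrite -subr_eq0 -coefB; apply/eqP.
    by apply: (proj1 (pk (q - q'))) => //; rewrite pB E subrr.
  apply/eqP; rewrite -subr_eq0 -pB; apply/eqP/(pk (q - q')) => i iM.
  by rewrite coefB h // subrr.
(* T is K[X]/(X^(M+2)); lifting by one order at a time keeps the first two coefficients [g] and
   [D]. *)
have key : forall M, exists T (p : {lrmorphism pK K -> T}) (th : {lrmorphism A -> T}),
   F M.+1 T p /\ forall b, exists q : {poly K}, [/\ p q = th b, q`_0 = g b & q`_1 = D b].
  elim=> [|M [T [p [th [pF thq]]]]].
    have pF : F 1%N T0 p0 by split.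
    have [||||th thE] := @lrmorphism_of k A T0 (fun b => p0 ((g b)%:P + (D b) *: 'X : {poly K})).
    - move=> b c; rewrite -(rmorphD p0); apply/(eqp 1%N _ _ _ _ pF) => i _.
      by rewrite rmorphD DD !coefD polyCD !coefZ !coefD mulrDl; ring.
    - rewrite -(rmorph1 p0); apply/(eqp 1%N _ _ _ _ pF) => i _.
      have D1 : D 1 = 0 by have := DA 1; rewrite scale1r.
      by rewrite rmorph1 D1 scale0r addr0.
    - move=> b c; rewrite -(rmorphM p0); apply/(eqp 1%N _ _ _ _ pF) => i.
      rewrite rmorphM DM => i1.
      have -> : ((g b)%:P + D b *: 'X : {poly K}) * ((g c)%:P + D c *: 'X) =
        (g b * g c)%:P + (g b * D c + g c * D b) *: 'X + (D b * D c) *: 'X^2.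
        rewrite polyCM -!mul_polyC !polyCD !polyCM expr2; ring.
      rewrite [RHS]coefD [in RHS]coefZ coefXn /=.
      by case: i i1 => [|[|]] // _; rewrite mulr0 addr0.
    - move=> c; have pc : p0 ((c%:A : K)%:P : {poly K}) = c%:A.
        by have := rmorph_alg (p0 \o pC K) c; rewrite /= pCE.
      by rewrite rmorph_alg DA scale0r addr0 pc.
    exists T0, p0, th; split=> // b; exists ((g b)%:P + D b *: 'X); rewrite thE; split=> //.
      by rewrite coefD coefC coefZ coefX mulr0 addr0.
    by rewrite coefD coefC coefZ coefX mulr1 add0r.
  have [T' [p' [p's p'k]]] := trunc_ex K M.+2.
  have p'F : F M.+2 T' p' by split.
  have [|pi piE] := @quot_lift k _ _ _ p' p p's.
    move=> q /p'k qk; apply/(proj2 pF) => i iM; apply: qk; exact: leqW.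
  have pis z : exists s, pi s = z.
    by have [q qE] := proj1 pF z; exists (p' q); rewrite piE.
  have pi0 z : pi z = 0 -> exists2 q : {poly K}, p' q = z & forall i, (i <= M.+1)%N -> q`_i = 0.
    have [q <-] := p's z; rewrite piE => /(proj2 pF) qk; by exists q.
  have pisq u w : pi u = 0 -> pi w = 0 -> u * w = 0.
    move=> /pi0 [q <- qk] /pi0 [r <- rk]; rewrite -(rmorphM p'); apply/(p'k (q * r)) => i iM.
    rewrite coefM big1 // => j _; have [jM|jM] := leqP j M.+1; first by rewrite qk // mul0r.
    by rewrite rk ?mulr0 //; lia.
  have [x xE] := proj1 Ys _ _ pi (fmap th a) pis pisq.
  have Ux : U T' x.
    apply: (nilp_open (pi := pi)) => //; first exact: affine_open_open Ua.
      by move=> r r0; exists 2%N; rewrite expr2; apply: pisq.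
    by rewrite xE; apply: affine_in.
  have [th' th'x] := affine_fact Ua Ux.
  have thE b : pi (th' b) = th b.
    have [_ _ Uu] := Ua; apply: (Uu _ (pi \o th') th).
    by rewrite -xE -th'x fmapM.
  exists T', p', th'; split=> // b.
  have [q qE] := p's (th' b); exists q; split=> //.
    have [q' [q'E <- _]] := thq b.
    by apply: (proj1 (eqp M.+1 _ _ _ _ pF)) => //; rewrite -piE qE thE q'E.
  have [q' [q'E _ <-]] := thq b.
  by apply: (proj1 (eqp M.+1 _ _ _ _ pF)) => //; rewrite -piE qE thE q'E.
have [T [p [th [[ps pk] thq]]]] := key N.
have [|e eE] := @quot_lift k _ _ _ p (pev (idfun : {lrmorphism K -> K}) 0) ps.
  by move=> q /pk /(_ 0%N isT); rewrite pevE map_poly_id // horner_coef0.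
have e0 q : e (p q) = (q : {poly K})`_0 by rewrite eE pevE map_poly_id // horner_coef0.
exists T, e, (p (pX K)), th; split.
- by move=> b; have [q [<- <- _]] := thq b; rewrite e0.
- move=> b b0; have [q [qE q0 q1]] := thq b.
  have qX : q = 'X * \poly_(i < (size q).-1) q`_i.+1.
    apply/polyP => i; rewrite coefXM; case: i => [|i] /=; first by rewrite q0.
    rewrite coef_poly; case: ltnP => // h; rewrite nth_default //; lia.
  exists (p (\poly_(i < (size q).-1) q`_i.+1 : {poly K})).
    by rewrite -qE {1}qX -(rmorphM p).
  by rewrite e0 -q1 [in RHS]qX coefXM.
- move=> z; have [q <-] := ps z; rewrite -(rmorphXn p) -(rmorphM p).
  move=> /pk /(_ N (leqnSn N)); rewrite e0.
  have -> : (pX K ^+ N * q)%R = ('X^N * q : {poly K}) by [].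
  by rewrite coefXnM ltnn subnn.
Qed.

(** Let y_1, ..., y_d be local coordinates at the point. Elements b and c that are not locally zero
    have nonzero leading forms F and F' of degrees n and n'. Choose a tangent vector v with F(v)
    F'(v) nonzero and an arc of order n + n' in direction v. Along the arc b c has leading
    coefficient F(v) F'(v) up to a unit, so b c is not 0. *)
Lemma chart_domain_kk (Y : kfunctor k) (U : subf Y) A (a : Y A)
    (g : {lrmorphism A -> kk}) (b c : A) : smooth_k Y -> affine_open U a ->
  fgen (base A) -> b * c = 0 ->
  (exists2 s, g s <> 0 & s * b = 0) \/ (exists2 s, g s <> 0 & s * c = 0).
Proof.
move=> Ys Ua fA bc0; have Kf := @field_kk k.
have nA : noeth A by apply: (noeth_fgen (@noeth_kk k) fA).
have gI : ideal (fun a => g a = 0).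
  split; first exact: rmorph0.
  - by move=> u v; rewrite rmorphD /= => -> ->; rewrite addr0.
  - by move=> u v; rewrite rmorphM /= => ->; rewrite mulr0.
pose P d := exists (s : A) (y : 'I_d -> A), [/\ g s <> 0, forall i, g (y i) = 0 &
   forall u, g u = 0 -> exists w : 'I_d -> A, s * u = \sum_i w i * y i].
have [d [s [y [s0 y0 sy]]] dmin] : exists2 d, P d & forall m, (m < d)%N -> ~ P m.
  apply: nat_min; have [l [lg gl]] := nA _ gI.
  exists (size l), 1, (fun i => nth 0 l i); split.
  - by rewrite rmorph1; apply: kalg_nz1.
  - by move=> i; apply: lg; rewrite mem_nth.
  - move=> u /gl; rewrite mul1r => {lg gl}; elim: l u => [|z l IH] u /=.
      by move=> ->; exists (fun _ => 0); rewrite big_ord0.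
    move=> [e [r [-> /IH [w ->]]]].
    exists (fun i => if unlift ord0 i is Some j then w j else e).
    by rewrite big_ord_recl unlift_none; congr (_ + _); apply: eq_bigr => i _; rewrite liftK.
have indep (w : 'I_d -> A) : \sum_i w i * y i = 0 -> forall i, g (w i) = 0.
  move=> wy i0; apply: NNPP => w0.
  have d0 : (d.-1 < d)%N by rewrite ltn_predL (leq_ltn_trans (leq0n i0) (ltn_ord i0)).
  apply: (dmin _ d0); exists (s * w i0), (fun j => y (lift i0 j)); split.
  - by rewrite rmorphM /= => /(fieldM Kf) [].
  - by move=> j.
  - move=> u /sy [v vE]; exists (fun j => w i0 * v (lift i0 j) - v i0 * w (lift i0 j)).
    under eq_bigr do rewrite mulrBl -!mulrA.
    rewrite big_split sumrN -!mulr_sumr /=.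
    move: wy vE; rewrite !(@bigD1_ord _ _ _ _ i0) //= => wy vE.
    have -> : \sum_(i < d.-1) w (lift i0 i) * y (lift i0 i) = - (w i0 * y i0).
      by apply/eqP; rewrite -subr_eq0 opprK addrC wy.
    by rewrite mulrAC vE; ring.
(* The derivation with values v on the coordinates y. *)
pose G n z := exists t (F : {mpoly A[d]}), [/\ g t <> 0, F \is n.-homog & F.@[y] = t * z].
have G0 z : G 0%N z.
  exists 1, z%:MP; rewrite rmorph1 mul1r mevalC; split=> //; first exact: kalg_nz1.
  by apply/dhomogP => mu; rewrite msuppC; case: eqP => // _; rewrite inE => /eqP ->; exact: mdeg0.
(* Take the last degree n in which a multiple t z is the value of a form at [y]; it exists by
   Krull's theorem. If all coefficients of that form vanished at the point, they would be
   combinations of the y_i up to [s], and the degree could be raised. *)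
have lead z : (forall t, g t <> 0 -> t * z <> 0) ->
    exists n t (F : {mpoly A[d]}), [/\ g t <> 0, F \is n.-homog, F.@[y] = t * z &
       map_mpoly g F != 0].
  move=> zn; have [n nG nmin] : exists2 n, ~ G n z & forall m, (m < n)%N -> ~ ~ G m z.
    apply: nat_min; apply: NNPP => h.
    have [|t t0 tz] := @krull_homog k A kk g d y z nA Kf y0.
      by move=> n; apply: NNPP => h'; apply: h; exists n.
    exact: (zn t t0).
  case: n nG nmin => [/(_ (G0 z)) //|n nG nmin].
  have [t [F [t0 Fn FE]]] := NNPP _ (nmin n (leqnn _)).
  exists n, t, F; split=> //; apply/eqP => Fg; apply: nG.
  have cw m : exists w : 'I_d -> A, s * F@_m = \sum_i w i * y i.
    by apply: sy; rewrite -mcoeff_map_mpoly Fg mcoeff0.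
  pose cf m := proj1_sig (constructive_indefinite_description _ (cw m)).
  have cfE m : s * F@_m = \sum_i cf m i * y i.
    by rewrite /cf; case: constructive_indefinite_description.
  exists (s * t), (\sum_(m <- msupp F) (\sum_i cf m i *: 'X_i) * 'X_[m]); split.
  - by rewrite rmorphM /= => /(fieldM Kf) [].
  - rewrite big_seq; apply: rpred_sum => m mF; rewrite -add1n; apply: dhomogM.
      by apply: rpred_sum => i _; apply: rpredZ; rewrite dhomogX /= mdeg1.
    by rewrite dhomogX; apply/eqP; apply: (dhomogP _ _ _ Fn).
  - rewrite -mulrA -FE rmorph_sum [in RHS]/meval /mmap mulr_sumr; apply: eq_bigr => m _.
    rewrite rmorphM rmorph_sum /= mulrA cfE mevalX; congr (_ * _).
    by apply: eq_bigr => i _; rewrite mevalZ mevalXU.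
apply: NNPP => h; have [h1 h2] := not_or_and _ _ h.
have [n [t [F [t0 Fn FE F0]]]] : exists n t (F : {mpoly A[d]}), [/\ g t <> 0, F \is n.-homog, F.@[y] = t * b &
       map_mpoly g F != 0].
  by apply: lead => u u0 ub; apply: h1; exists u.
have [n' [t' [F' [t0' Fn' FE' F0']]]] : exists n t (F : {mpoly A[d]}), [/\ g t <> 0, F \is n.-homog, F.@[y] = t * c &
       map_mpoly g F != 0].
  by apply: lead => u u0 ub; apply: h2; exists u.
have [v] := mpoly_nonroot (mulf_neq0 F0 F0').
rewrite mevalM => /eqP Fv.
have Dex z : exists w : 'I_d -> A, s * (z - (g z : k)%:A) = \sum_i w i * y i.
  by apply: sy; rewrite rmorphB /= rmorph_alg kkA subrr.
have [gs gsE] : exists e, g s * e = 1 by apply: Kf; apply/eqP.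
(* s (z - g z) is a combination of the y_i; [D] replaces y_i by v_i and takes values at the point.
   By [indep] the result does not depend on the combination. *)
pose D z : kk := gs * \sum_i g (proj1_sig (constructive_indefinite_description _ (Dex z)) i) * v i.
have DE z (w : 'I_d -> A) : s * (z - (g z : k)%:A) = \sum_i w i * y i ->
    D z = gs * \sum_i g (w i) * v i.
  move=> wE; rewrite /D; case: constructive_indefinite_description => w' /= w'E.
  congr (_ * _); apply: eq_bigr => i _; congr (_ * _).
  apply/eqP; rewrite -subr_eq0 -rmorphB; apply/eqP; apply: (indep (fun i => w' i - w i)).
  by under eq_bigr do rewrite mulrBl; rewrite sumrB -wE -w'E subrr.
have DD z z' : D (z + z') = D z + D z'.
  have [w wE] := Dex z; have [w' wE'] := Dex z'.
  rewrite (DE _ _ wE) (DE _ _ wE') (DE _ (fun i => w i + w' i)).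
    rewrite -mulrDr -big_split; congr (_ * _); apply: eq_bigr => i _.
    by rewrite rmorphD mulrDl.
  under eq_bigr do rewrite mulrDl; rewrite big_split -wE -wE' /= rmorphD scalerDl; ring.
have DM z z' : D (z * z') = g z * D z' + g z' * D z.
  have [w wE] := Dex z; have [w' wE'] := Dex z'.
  rewrite (DE _ _ wE) (DE _ _ wE') (DE _ (fun i => z * w' i + (g z' : k)%:A * w i)).
    have dist (x x' S S' : kk) : x * (gs * S) + x' * (gs * S') = gs * (x * S + x' * S') by ring.
    rewrite dist; congr (_ * _); rewrite !mulr_sumr -big_split; apply: eq_bigr => i _.
    by rewrite rmorphD !rmorphM /= rmorph_alg kkA; ring.
  under eq_bigr do rewrite mulrDl -!mulrA; rewrite big_split -!mulr_sumr /= -wE -wE'.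
  rewrite rmorphM /=; have -> : ((g z * g z' : kk) : k)%:A = (g z : k)%:A * (g z' : k)%:A :> A.
    by rewrite -scalerAl mul1r scalerA.
  ring.
have DA (e : k) : D e%:A = 0.
  rewrite (DE _ (fun _ => 0)).
    by rewrite big1 ?mulr0 // => i _; rewrite rmorph0 mul0r.
  by rewrite rmorph_alg kkA subrr mulr0 big1 // => i _; rewrite mul0r.
have Dy i : D (y i) = v i.
  rewrite (DE _ (fun j => s * (j == i)%:R)).
    rewrite (bigD1 i) //= big1 => [|j /negPf ->]; last by rewrite mulr0 rmorph0 mul0r.
    by rewrite addr0 eqxx mulr1 mulrA (mulrC gs) gsE mul1r.
  rewrite (bigD1 i) //= big1 => [|j /negPf ->]; last by rewrite mulr0 mul0r.
  by rewrite addr0 eqxx mulr1 y0 scale0r subr0.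
have [T [e [tau [th [ethE thy te]]]]] := arc_ex Ys Ua DD DM DA (n + n').
have thy' i : exists w, th (y i) = tau * w /\ e w = v i.
  by have [w wE we] := thy _ (y0 i); exists w; rewrite we Dy.
pose om i := proj1_sig (constructive_indefinite_description _ (thy' i)).
have omE i : th (y i) = tau * om i /\ e (om i) = v i.
  by rewrite /om; case: constructive_indefinite_description.
have arc (H : {mpoly A[d]}) l : H \is l.-homog -> exists2 W, th H.@[y] = tau ^+ l * W &
    e W = (map_mpoly g H).@[v].
  move=> /dhomogP Hl; exists (\sum_(m <- msupp H) th H@_m * \prod_i om i ^+ m i).
    rewrite /meval /mmap rmorph_sum mulr_sumr big_seq [RHS]big_seq; apply: eq_bigr => m /Hl /= <-.
    rewrite rmorphM /= mulrCA; congr (_ * _); rewrite /mmap1 rmorph_prod mdegE.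
    rewrite -prodrXr -big_split /=; apply: eq_bigr => i _.
    by rewrite rmorphXn /= (omE i).1 exprMn.
  rewrite rmorph_sum /map_mpoly.
  have -> : (mmap (@mpolyC d kk \o g) (fun i => 'X_i) H).@[v] = mev g v H.
    have -> : mmap (@mpolyC d kk \o g) (fun i => 'X_i) H = mev (mC kk d \o g) (fun i => 'X_i) H.
      by rewrite mevE; apply: eq_bigr => m _ /=; rewrite mCE.
    have evE G' : G'.@[v] = mev (idfun : {lrmorphism kk -> kk}) v G' by rewrite mevE.
    rewrite evE; apply: (@mpK_eq _ _ _ _ (mev (idfun : {lrmorphism kk -> kk}) v \o mev (mC kk d \o g) (fun i => 'X_i)) (mev g v)) => [z|i] /=.
      by rewrite !mevC /= mCE mevC.
    by rewrite !mevX.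
  rewrite mevE /mmap; apply: eq_bigr => m _.
  rewrite rmorphM /= ethE rmorph_prod; congr (_ * _); apply: eq_bigr => i _.
  by rewrite rmorphXn /= (omE i).2.
have [W WE We] := arc F n Fn; have [W' WE' We'] := arc F' n' Fn'.
apply: Fv; rewrite -We -We' -rmorphM; apply: te.
have -> : tau ^+ (n + n') * (W * W') = th (F.@[y] * F'.@[y]).
  by rewrite rmorphM /= WE WE' exprD; ring.
by rewrite FE FE' mulrACA bc0 mulr0 rmorph0.
Qed.

Lemma chart_domain (Y : kfunctor k) (U : subf Y) A (a : Y A) K
    (g : {lrmorphism A -> K}) (b c : A) : smooth_k Y -> affine_open U a ->
  fgen (base A) -> is_field K -> b * c = 0 ->
  (exists2 s, g s <> 0 & s * b = 0) \/ (exists2 s, g s <> 0 & s * c = 0).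
Proof.
move=> Ys Ua fA Kf bc; have [h hE] := kpoint g fA Kf.
have hg s : h s <> 0 -> g s <> 0 by move=> h0 /hE.
by have [[s /hg]|[s /hg]] := chart_domain_kk h Ys Ua fA bc; [left|right]; exists s.
Qed.

End Trunc.

(** * Local properties, Krull's theorem and gluing *)

Section Near.
Variable k : closedFieldType.
Notation kalg := (comAlgType k).
Implicit Types (R A B K L Q T : kalg) (X Y : kfunctor k).

Definition near Y K (x : Y K) (Q : forall R, Y R -> Prop) : Prop :=
  exists V : subf Y, [/\ open_sub V, V K x & forall R (y : Y R), V R y -> Q R y].

Definition nfun Y K (x : Y K) (phi : forall R, Y R -> R) : Prop :=
  exists V : subf Y, [/\ open_sub V, V K x & locfun V phi].

Lemma near_and Y K (x : Y K) (Q Q' : forall R, Y R -> Prop) :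
  near x Q -> near x Q' -> near x (fun R y => Q R y /\ Q' R y).
Proof.
move=> [V [Vo Vx VQ]] [V' [Vo' Vx' VQ']].
exists (fun R y => V R y /\ V' R y); split=> //; first exact: open_cap.
by move=> R y [/VQ ? /VQ' ?].
Qed.

Lemma near_imp Y K (x : Y K) (Q Q' : forall R, Y R -> Prop) :
  (forall R y, Q R y -> Q' R y) -> near x Q -> near x Q'.
Proof. by move=> QQ [V [Vo Vx VQ]]; exists V; split=> // R y /VQ /QQ. Qed.

Lemma near_pt Y K (x : Y K) (Q : forall R, Y R -> Prop) : near x Q -> Q K x.
Proof. by move=> [V [_ Vx VQ]]; apply: VQ. Qed.

Lemma near_near Y K (x : Y K) (Q : forall R, Y R -> Prop) : near x Q ->
  exists V : subf Y, [/\ open_sub V, V K x & forall K' (x' : Y K'), V K' x' -> near x' Q].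
Proof. by move=> [V [Vo Vx VQ]]; exists V; split=> // K' x' Vx'; exists V. Qed.

Lemma near_fmap Y K K' (x : Y K) (f : {lrmorphism K -> K'}) (Q : forall R, Y R -> Prop) :
  near x Q -> near (fmap f x) Q.
Proof. by move=> [V [Vo Vx VQ]]; exists V; split=> //; apply: open_fmap. Qed.

Lemma near_fmapP Y K K' (x : Y K) (f : {lrmorphism K -> K'}) (Q : forall R, Y R -> Prop) :
  is_field K -> is_field K' -> near (fmap f x) Q -> near x Q.
Proof.
move=> Kf Kf' [V [Vo Vx VQ]]; exists V; split=> //.
have [I IE] := Vo K x; rewrite -[x]fmap_idE; apply/IE/(unit_ideal_field _ _ Kf).
have /IE /(unit_ideal_field _ _ Kf') [r Ir r0] := Vx.
by exists r => //= r0'; apply: r0; rewrite r0' rmorph0.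
Qed.

Lemma near_at Y R (y : Y R) K (g : {lrmorphism R -> K}) (Q : forall R, Y R -> Prop) :
  is_field K -> near (fmap g y) Q ->
  exists2 s, g s <> 0 & forall B (f : {lrmorphism R -> B}), (exists z, f s * z = 1) ->
     Q B (fmap f y).
Proof.
move=> Kf [V [Vo Vx VQ]]; have [s s0 sV] := open_at Vo Kf Vx.
by exists s => // B f fs; apply/VQ/sV.
Qed.

Lemma near_chart Y (U : subf Y) A (a : Y A) K (g : {lrmorphism A -> K})
    (Q : forall R, Y R -> Prop) (s : A) : affine_open U a -> is_field K -> g s <> 0 ->
  (forall L (i : {lrmorphism A -> L}), is_loc s i -> forall R (f : {lrmorphism L -> R}),
     Q R (fmap f (fmap i a))) -> near (fmap g a) Q.
Proof.
move=> Ua Kf s0 sQ; have [L [i [h [il hE]]]] := loc_at Kf s0.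
have Ua' := affine_loc Ua il.
exists (fun R (x : Y R) => exists f : {lrmorphism L -> R}, fmap f (fmap i a) = x); split.
- exact: affine_open_open Ua'.
- by exists h; apply: fmapT.
- by move=> R _ [f <-]; apply: (sQ L i il).
Qed.

Lemma near_chart0 Y (U : subf Y) A (a : Y A) K (g : {lrmorphism A -> K})
    (W : subf Y) (phi : forall R, Y R -> R) : affine_open U a -> is_field K ->
  W A a -> open_sub W -> locfun W phi ->
  near (fmap g a) (fun R y => phi R y = 0) <-> exists2 s, g s <> 0 & s * phi A a = 0.
Proof.
move=> Ua Kf Wa Wo Wl; split.
  move=> /(near_at Kf) [s s0 sQ]; have [L [i [h [il hE]]]] := loc_at Kf s0.
  have E : i (phi A a) = 0 by rewrite -(Wl _ _ i) //; apply: sQ; case: il.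
  have [n nE] : exists n, s ^+ n * phi A a = 0 by case: il => _ _; apply.
  by exists (s ^+ n) => //; rewrite rmorphXn => /(fieldX Kf).
move=> [s s0 sE]; apply: (near_chart Ua Kf s0) => L i il R f.
rewrite (Wl _ _ f); last exact: open_fmap.
rewrite (Wl _ _ i) //; case: il => [[z sz] _ _].
by rewrite (@unit_cancel _ _ (i s) z (i (phi A a)) 0) ?rmorph0 // mulr0 -rmorphM sE rmorph0.
Qed.

Section Smooth.
Variable Y : kfunctor k.
Hypothesis Ys : smooth_k Y.

Lemma chart_near K (x : Y K) (W : subf Y) : is_field K -> open_sub W -> W K x ->
  exists (U : subf Y) A (a : Y A) (g : {lrmorphism A -> K}),
    [/\ affine_open U a, fgen (base A), noeth A, W A a & fmap g a = x].
Proof.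
move=> Kf Wo Wx; have [U [A [a [Ua fA Ux Wa]]]] := chart_small Ys Kf Wo Wx.
have [g gx] := affine_fact Ua Ux; exists U, A, a, g; split=> //.
exact: noeth_fgen (@noeth_kk k) fA.
Qed.

Lemma dom_near K (x : Y K) (phi chi : forall R, Y R -> R) : is_field K ->
  nfun x phi -> nfun x chi -> near x (fun R y => phi R y * chi R y = 0) ->
  near x (fun R y => phi R y = 0) \/ near x (fun R y => chi R y = 0).
Proof.
move=> Kf [V [Vo Vx Vl]] [V' [Vo' Vx' Vl']] [W [Wo Wx W0]].
have [U [A [a [g [Ua fA nA [[Va V'a] Wa] <-]]]]] := chart_near Kf
  (open_cap (open_cap Vo Vo') Wo) (conj (conj Vx Vx') Wx).
have [h|h] := chart_domain g Ys Ua fA Kf (W0 A a Wa).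
  by left; apply/(near_chart0 g Ua Kf Va Vo Vl).
by right; apply/(near_chart0 g Ua Kf V'a Vo' Vl').
Qed.

(** As charts are locally domains, every element of the annihilator of [phi] vanishes near x; by
    noetherianity a single [s] kills the whole annihilator, and no annihilator is left where [s] is
    invertible. *)
Lemma zero_closed K (x : Y K) (phi : forall R, Y R -> R) : is_field K ->
  nfun x phi -> ~ near x (fun R y => phi R y = 0) ->
  exists V : subf Y, [/\ open_sub V, V K x & forall K' (x' : Y K'), is_field K' ->
    V K' x' -> ~ near x' (fun R y => phi R y = 0)].
Proof.
move=> Kf [V [Vo Vx Vl]] nz.
have [U [A [a [g [Ua fA nA Va gx]]]]] := chart_near Kf Vo Vx.
pose J j := j * phi A a = 0.
have [||s s0 sJ] := @noeth_kill k A K g J nA Kf.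
- split; first by rewrite /J mul0r.
  + by rewrite /J => b c hb hc; rewrite mulrDl hb hc addr0.
  + by rewrite /J => b c hc; rewrite -mulrA hc mulr0.
- move=> j Jj; have [//|h] := chart_domain g Ys Ua fA Kf Jj.
  by case: nz; rewrite -gx; apply/(near_chart0 g Ua Kf Va Vo Vl).
have [L [i [h [il hE]]]] := loc_at Kf s0; have Ua' := affine_loc Ua il.
exists (fun R (x : Y R) => exists f : {lrmorphism L -> R}, fmap f (fmap i a) = x); split.
- exact: affine_open_open Ua'.
- by exists h; rewrite -gx; apply: fmapT.
- move=> K' _ Kf' [f <-]; rewrite fmapM => /(near_chart0 _ Ua Kf' Va Vo Vl) [t t0 /sJ st].
  have [z sz] : exists z, i s * z = 1 by case: il.
  have it : i t = 0 by apply: (unit_cancel sz); rewrite mulr0 -rmorphM st rmorph0.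
  by apply: t0; rewrite /= it rmorph0.
Qed.

Lemma nzd_loc (W : subf Y) (e phi : forall R, Y R -> R) : open_sub W ->
  locfun W e -> locfun W phi ->
  (forall K (x : Y K), is_field K -> W K x -> ~ near x (fun R y => e R y = 0)) ->
  (forall R (y : Y R), W R y -> e R y * phi R y = 0) ->
  forall R (y : Y R), W R y -> phi R y = 0.
Proof.
move=> Wo el pl enz ep R y Wy; apply: local_eq_loc => K g Kf.
have Wx : W K (fmap g y) by apply: open_fmap.
have [|||/(enz _ _ Kf Wx)//|] := @dom_near K (fmap g y) e phi Kf.
- by exists W.
- by exists W.
- by exists W.
move=> /(near_at Kf) [s s0 sQ]; exists s => // L i il.
by rewrite rmorph0 -pl //; apply: sQ; case: il.
Qed.

Lemma krull_near K (x : Y K) (e phi : forall R, Y R -> R) : is_field K ->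
  nfun x e -> nfun x phi -> e K x = 0 ->
  (forall n, exists2 chi, nfun x chi & near x (fun R y => phi R y = e R y ^+ n * chi R y)) ->
  near x (fun R y => phi R y = 0).
Proof.
move=> Kf [V [Vo Vx Vl]] [V' [Vo' Vx' Vl']] ex h.
have [U [A [a [g [Ua fA nA [Va V'a] gx]]]]] := chart_near Kf (open_cap Vo Vo') (conj Vx Vx').
rewrite -gx; apply/(near_chart0 g Ua Kf V'a Vo' Vl').
apply: (krull_principal nA Kf (e := e A a)); first by rewrite -Vl // gx.
move=> n; have [chi [W [Wo Wx Wl]] E] := h n.
have := near_and E (ex_intro _ W (And3 Wo Wx (fun R y h => h))).
rewrite -gx => /(near_at Kf) [s s0 sQ].
have [L [i [_ [il _]]]] := loc_at Kf s0.
have [E' Wa] : phi L (fmap i a) = e L (fmap i a) ^+ n * chi L (fmap i a) /\ W L (fmap i a).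
  by apply: sQ; case: il.
rewrite Vl // Vl' // in E'.
have [m [r mr]] : exists m r, i s ^+ m * chi L (fmap i a) = i r by case: il.
have [|l lE] := @loc_inj k A s L i (s ^+ m * phi A a) (e A a ^+ n * r) il.
  by rewrite !rmorphM !rmorphXn /= -mr E'; ring.
exists (s ^+ l * s ^+ m), (s ^+ l * r); split.
  by rewrite -exprD rmorphXn => /(fieldX Kf).
by rewrite -mulrA lE; ring.
Qed.

(** The hypothesis concerns algebra-valued points, so it applies to A/(e), where it says that [phi]
    lies in (e). *)
Lemma div_near K (x : Y K) (e phi : forall R, Y R -> R) : is_field K ->
  nfun x e -> nfun x phi -> near x (fun R y => e R y = 0 -> phi R y = 0) ->
  exists2 chi, nfun x chi & near x (fun R y => phi R y = e R y * chi R y).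
Proof.
move=> Kf [V [Vo Vx Vl]] [V' [Vo' Vx' Vl']] [W [Wo Wx W0]].
have [U [A [a [g [Ua fA nA [[Va V'a] Wa] gx]]]]] := chart_near Kf
  (open_cap (open_cap Vo Vo') Wo) (conj (conj Vx Vx') Wx).
have [b bE] : exists b, phi A a = e A a * b.
  pose I r := exists b, r = e A a * b.
  have II : ideal I.
    split; first by exists 0; rewrite mulr0.
    - by move=> _ _ [y ->] [z ->]; exists (y + z); rewrite mulrDr.
    - by move=> c _ [y ->]; exists (c * y); rewrite mulrCA.
  case: (classic (I 1)) => [[c c1]|I1].
    by exists (c * phi A a); rewrite mulrA -c1 mul1r.
  have [Q [p [ps pk]]] := quot_ex II I1.
  apply/pk; rewrite -Vl' //; apply: W0; first exact: open_fmap.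
  by rewrite Vl //; apply/pk; exists 1; rewrite mulr1.
have [chi [chil chia]] := mk_locfun b Ua; have Uo := affine_open_open Ua.
have Ux : U K x by rewrite -gx; apply: affine_in.
exists chi; first by exists U.
exists U; split=> // R y /(affine_fact Ua) [f <-].
rewrite Vl // Vl' // chil ?chia ?bE ?rmorphM //; exact: affine_self Ua.
Qed.

End Smooth.

Section Glue.
Variables (Y : kfunctor k) (Psi : forall R, Y R -> R -> Prop).
Hypothesis Pf : forall R B (f : {lrmorphism R -> B}) y r, Psi y r -> Psi (fmap f y) (f r).
Hypothesis Pu : forall R (y : Y R) r r', Psi y r -> Psi y r' -> r = r'.

(** Values over different localizations, bundled so that finitely many of them form a list. *)
Record local_value R (y : Y R) := LocalValue {
  lv_s : R; lv_L : kalg; lv_i : {lrmorphism R -> lv_L}; lv_b : lv_L;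
  lv_loc : is_loc lv_s lv_i; lv_psi : Psi (fmap lv_i y) lv_b }.

(** Gluing of a function given only as a functional relation that is locally inhabited. Finitely
    many local values suffice because their denominators have no common zero. *)
Lemma glue_value R (y : Y R) :
  (forall K (g : {lrmorphism R -> K}), is_field K -> exists2 s, g s <> 0 &
     forall L (i : {lrmorphism R -> L}), is_loc s i -> exists r, Psi (fmap i y) r) ->
  exists r, forall B (f : {lrmorphism R -> B}) b, Psi (fmap f y) b -> b = f r.
Proof.
move=> Pl; pose I s := forall L (i : {lrmorphism R -> L}), is_loc s i -> exists r, Psi (fmap i y) r.
have Iu : unit_ideal (idfun : {lrmorphism R -> R}) I.
  by apply/unit_idealP => K g Kf; have [s s0 sI] := Pl K g Kf; exists s.
have [l lP] : exists l : seq (local_value y), forall K (g : {lrmorphism R -> K}), is_field K ->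
    exists2 p, List.In p l & g (lv_s p) <> 0.
  have [n [sv [c [svI svc]]]] := Iu.
  have [t tP] : exists t : seq (local_value y), forall i, i \in enum 'I_n ->
     forall K (g : {lrmorphism R -> K}), is_field K -> g (sv i) <> 0 ->
       exists2 p, List.In p t & g (lv_s p) <> 0.
    elim: (enum 'I_n) => [|i u [t tP]]; first by exists [::].
    case: (classic (exists m, sv i ^+ m = 0)) => [[m sm]|snil].
      exists t => j; rewrite in_cons => /orP[/eqP ->|/tP //] K g Kf gs; case: gs.
      by apply: (fieldX (n := m) Kf); rewrite -rmorphXn sm rmorph0.
    have [|L [io il]] := @loc_ex k R (sv i); first by move=> m sm; apply: snil; exists m.
    have [b bP] := svI i L io il.
    exists (LocalValue il bP :: t) => j; rewrite in_cons => /orP[/eqP ->|/tP h] K g Kf gs.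
      by exists (LocalValue il bP) => //; left.
    by have [p pt p0] := h K g Kf gs; exists p => //; right.
  exists t => K g Kf.
  have [i gi] : exists i, g (sv i) <> 0.
    apply: NNPP => h; have := congr1 g svc; rewrite rmorph_sum rmorph1 big1.
      by move=> /esym /kalg_nz1.
    move=> i _; rewrite rmorphM /=; suff -> : g (sv i) = 0 by rewrite mulr0.
    by apply: NNPP => h'; apply: h; exists i.
  by apply: (tP i) => //; rewrite mem_enum.
(* the ideal of denominators of the glued value *)
pose J s := exists r, forall p, List.In p l -> lv_i p s * lv_b p = lv_i p r.
have [r rE] : J 1.
  apply: unit_ideal_local.
    split; first by exists 0 => p _; rewrite (rmorph0 (lv_i p)) mul0r.
    - by move=> x z [r rE] [t tE]; exists (r + t) => p pl; rewrite !(rmorphD (lv_i p)) mulrDl /= rE // tE.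
    - by move=> a x [r rE]; exists (a * r) => p pl; rewrite !(rmorphM (lv_i p)) -mulrA /= rE.
  move=> K g Kf; have [p0 _ p00] := lP K g Kf.
  have [m [r0 mr]] : exists m r, lv_i p0 (lv_s p0) ^+ m * lv_b p0 = lv_i p0 r by case: (lv_loc p0).
  (* On each piece p the values from p and from p0 agree once [lv_s p0] is inverted, hence up to a
     power of it; the list is finite, so one exponent [M] serves. *)
  suff [M ME] : exists M, forall p, List.In p l ->
      lv_i p (lv_s p0 ^+ M * lv_s p0 ^+ m) * lv_b p = lv_i p (lv_s p0 ^+ M * r0).
    exists (lv_s p0 ^+ M * lv_s p0 ^+ m); first by exists (lv_s p0 ^+ M * r0).
    by rewrite -exprD rmorphXn => /(fieldX Kf).
  elim: (l) => [|p t [M ME]]; first by exists 0%N.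
  have [M' M'E] : exists M', lv_i p (lv_s p0) ^+ M' * (lv_i p (lv_s p0) ^+ m * lv_b p - lv_i p r0) = 0.
    case: (classic (exists a, lv_i p (lv_s p0) ^+ a = 0)) => [[a a0]|anil].
      by exists a; rewrite a0 mul0r.
    have [|L [io il]] := @loc_ex k _ (lv_i p (lv_s p0)); first by move=> a a0; apply: anil; exists a.
    have [h hE] : exists h : {lrmorphism lv_L p0 -> L}, forall z, h (lv_i p0 z) = io (lv_i p z).
      apply: (@loc_lift _ _ _ _ _ _ (io \o lv_i p) (lv_loc p0)).
      by case: il.
    have bb : h (lv_b p0) = io (lv_b p).
      apply: (Pu (y := fmap io (fmap (lv_i p) y))); last exact/Pf/lv_psi.
      by have := Pf h (lv_psi p0); rewrite (fmapC (f' := lv_i p) (g' := io)).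
    have E := congr1 h mr; rewrite rmorphM rmorphXn /= !hE bb in E.
    by case: il => _ _; apply; rewrite rmorphB rmorphM rmorphXn /= E subrr.
  exists (M + M')%N => p' [<-|/ME E].
    rewrite !rmorphM !rmorphXn /= addnC exprD -!mulrA.
    apply/eqP; rewrite -subr_eq0; apply/eqP.
    have -> : forall a b c d e : lv_L p, a * (b * (c * d)) - a * (b * e) = b * (a * (c * d - e)).
      by move=> *; ring.
    by rewrite M'E mulr0.
  rewrite addnC exprD -!mulrA !(rmorphM _ (lv_s p0 ^+ M')) -mulrA /=.
  by congr (_ * _); rewrite -E.
exists r => B f b bP; apply: local_eq_loc => K g Kf.
have [p pl p0] := lP K (g \o f) Kf; exists (f (lv_s p)) => // L i il.
have [h hE] : exists h : {lrmorphism lv_L p -> L}, forall z, h (lv_i p z) = i (f z).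
  by apply: (@loc_lift _ _ _ _ _ _ (i \o f) (lv_loc p)); case: il.
have -> : i b = h (lv_b p).
  apply: (Pu (y := fmap i (fmap f y))); first exact: Pf.
  by have := Pf h (lv_psi p); rewrite (fmapC (f' := f) (g' := i)).
by rewrite -hE -rE // rmorph1 mul1r.
Qed.
End Glue.

Lemma glue Y (Psi : forall R, Y R -> R -> Prop) :
  (forall R B (f : {lrmorphism R -> B}) y r, Psi R y r -> Psi B (fmap f y) (f r)) ->
  (forall R (y : Y R) r r', Psi R y r -> Psi R y r' -> r = r') ->
  (forall R (y : Y R) K (g : {lrmorphism R -> K}), is_field K ->
     exists2 s, g s <> 0 & forall L (i : {lrmorphism R -> L}), is_loc s i ->
       exists r, Psi L (fmap i y) r) ->
  exists h : forall R, Y R -> R, locfun (fun _ _ => True) h /\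
    forall R (y : Y R) r, Psi R y r -> h R y = r.
Proof.
move=> Pf Pu Pl.
have gv R (y : Y R) := glue_value Pf Pu (Pl R y).
pose h R (y : Y R) := proj1_sig (constructive_indefinite_description _ (gv R y)).
have hE R (y : Y R) B (f : {lrmorphism R -> B}) b : Psi B (fmap f y) b -> b = f (h R y).
  by rewrite /h; case: constructive_indefinite_description => r /= rE; apply: rE.
exists h; split; last first.
  move=> R y r yr; have := hE R y R (idfun : {lrmorphism R -> R}) r.
  by rewrite fmap_idE => /(_ yr).
move=> R B f y _; apply: local_eq_loc => K g Kf.
have [s s0 sE] := Pl B (fmap f y) K g Kf; exists s => // L i il.
have [b bP] := sE L i il; rewrite -(hE _ _ _ _ _ bP).
by have := hE R y L (i \o f) b; rewrite -fmapM => /(_ bP).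
Qed.

End Near.

(** * Fppf descent *)

Section Descent.
Variable k : closedFieldType.
Notation kalg := (comAlgType k).
Implicit Types (R A B C K L Q T : kalg).
Variables (X Y : kfunctor k) (p : kmor X Y).
Hypothesis psurj : forall R (s : Y R), exists (R' : kalg) (f : {lrmorphism R -> R'})
  (t : X R'), fppf_cover f /\ p R' t = fmap f s.

(** Over the tensor square of the cover the two pullbacks of the value at [t0] agree because [phi]
    is constant on fibres, so this value comes from [R]. Any other point of the fibre is compared
    with [t0] over a further tensor product. *)
Lemma descend_value R (y : Y R) (phi : forall B, X B -> B) :
  (forall B (f : {lrmorphism R -> B}) t C (g : {lrmorphism B -> C}),
     p B t = fmap f y -> phi C (fmap g t) = g (phi B t)) ->
  (forall B (f : {lrmorphism R -> B}) t t', p B t = fmap f y -> p B t' = fmap f y ->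
     phi B t = phi B t') ->
  exists r, forall B (f : {lrmorphism R -> B}) t, p B t = fmap f y -> phi B t = f r.
Proof.
move=> pn pi; have [R' [f0 [t0 [f0c t0y]]]] := psurj y.
have [Q [i [j [ij _ _ ijE _]]]] := tensor_ex f0 f0c.
have over B (f : {lrmorphism R -> B}) (g : {lrmorphism R' -> B}) :
    (forall r, g (f0 r) = f r) -> p B (fmap g t0) = fmap f y.
  by move=> gf; rewrite kmor_nat t0y; apply: fmapT.
have [r0 r0E] : exists r0, phi R' t0 = f0 r0.
  apply: (ijE (phi R' t0) (phi R' t0)); rewrite -!(pn _ f0) //.
  by apply: (pi _ (i \o f0)); apply: over => r //=; rewrite ij.
exists r0 => B f t ty; have [Q' [i' [j' [ij' i'inj _ _ _]]]] := tensor_ex f f0c.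
apply: i'inj; rewrite -(pn _ f) // ij' -r0E -(pn _ f0) //.
apply: (pi _ (i' \o f)); first by rewrite kmor_nat ty; apply: fmapT.
by apply: over => r /=; rewrite ij'.
Qed.

(** Descent of a function that is invariant only over [Z]; nothing is said of [h] at points whose
    fibre leaves [Z]. This matches pseudo-completeness, which looks at functions on a closed
    subscheme. *)
Lemma descend_on (Z : subf X) (phi : forall B, X B -> B) :
  (forall B C (f : {lrmorphism B -> C}) t, Z B t -> phi C (fmap f t) = f (phi B t)) ->
  (forall B (t t' : X B), Z B t -> Z B t' -> p B t = p B t' -> phi B t = phi B t') ->
  exists2 h : (forall R, Y R -> R),
    (forall R C (f : {lrmorphism R -> C}) (y : Y R),
       (forall B (f : {lrmorphism R -> B}) t, p B t = fmap f y -> Z B t) ->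
       h C (fmap f y) = f (h R y)) &
    forall R t, (forall B (f : {lrmorphism R -> B}) t', p B t' = fmap f (p R t) -> Z B t') ->
       h R (p R t) = phi R t.
Proof.
move=> pn pi; pose ok R (y : Y R) := forall B (f : {lrmorphism R -> B}) t, p B t = fmap f y -> Z B t.
have ex R (y : Y R) : exists r, ok R y ->
    forall B (f : {lrmorphism R -> B}) t, p B t = fmap f y -> phi B t = f r.
  have [oky|] := classic (ok R y); last by exists 0.
  have [||r rE] := @descend_value _ y phi; last by exists r.
    by move=> B f t C g E; apply: pn; apply: oky E.
  by move=> B f t t' E E'; apply: pi; [apply: oky E | apply: oky E' | rewrite E E'].
pose h R (y : Y R) := proj1_sig (constructive_indefinite_description _ (ex R y)).
have hE R (y : Y R) : ok R y -> forall B (f : {lrmorphism R -> B}) t,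
    p B t = fmap f y -> phi B t = f (h R y).
  by rewrite /h; case: constructive_indefinite_description => r /= rE; apply: rE.
exists h => [R B f y oky|R t okt]; last first.
  by rewrite (hE R (p R t) okt R (idfun : {lrmorphism R -> R}) t) ?fmap_idE.
have okfy : ok B (fmap f y) by move=> C g t E; apply: (oky C (g \o f)); rewrite E fmapM.
have [R' [f0 [t0 [f0c t0y]]]] := psurj (fmap f y).
have [Q [i [j [ij iinj _ _ _]]]] := tensor_ex (idfun : {lrmorphism B -> B}) f0c.
apply: iinj; have -> : i (h B (fmap f y)) = j (f0 (h B (fmap f y))) by rewrite -ij.
rewrite -(hE _ _ okfy _ _ _ t0y).
have -> : i (f (h R y)) = j (f0 (f (h R y))) by rewrite -ij.
by congr (j _); apply: (hE R y oky R' (f0 \o f)); rewrite t0y fmapM.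
Qed.

Lemma descend_fun (phi : forall B, X B -> B) :
  locfun (fun _ _ => True) phi -> (forall B (t t' : X B), p B t = p B t' -> phi B t = phi B t') ->
  exists2 h : (forall R, Y R -> R), locfun (fun _ _ => True) h & forall R t, h R (p R t) = phi R t.
Proof.
move=> pn pi; have [||h hn hp] := @descend_on (fun _ _ => True) phi.
- by move=> B C f t _; apply: pn.
- by move=> B t t' _ _; apply: pi.
- by exists h => [R B f y _|R t]; [apply: hn | apply: hp].
Qed.

Section Closed.
Variables e1 e2 : forall B, X B -> B.
Hypothesis e1n : locfun (fun _ _ => True) e1.
Hypothesis e2n : locfun (fun _ _ => True) e2.
Hypothesis e1i : forall B (t t' : X B), p B t = p B t' -> exists a, e1 t' = a * e1 t.
Hypothesis e2i : forall B (t t' : X B), p B t = p B t' -> exists a b, e2 t' = a * e1 t + b * e2 t.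

(** The triangular hypotheses on [e1] and [e2] reflect that g_00 and g_11 are semi-invariant only
    where g_01 vanishes. *)
Definition zero_locus : subf X := fun B t => e1 t = 0 /\ e2 t = 0.
Definition zero_image : subf Y := fun R y =>
  forall B (f : {lrmorphism R -> B}) t, p B t = fmap f y -> zero_locus t.

Lemma zero_locus_inv B (t t' : X B) : p B t = p B t' -> zero_locus t -> zero_locus t'.
Proof.
move=> tt' [h1 h2]; have [a aE] := e1i tt'; have [b [c bE]] := e2i tt'.
by split; rewrite ?aE ?bE h1 ?h2 !mulr0 ?addr0.
Qed.

Lemma zero_locus_fmap B C (g : {lrmorphism B -> C}) (t : X B) :
  zero_locus t -> zero_locus (fmap g t).
Proof. by move=> [h1 h2]; split; rewrite ?e1n ?e2n // ?h1 ?h2 rmorph0. Qed.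

Lemma zero_locus_inj B C (g : {lrmorphism B -> C}) (t : X B) : injective g ->
  zero_locus (fmap g t) -> zero_locus t.
Proof.
by move=> gi [h1 h2]; split; apply: gi; rewrite rmorph0 -?e1n -?e2n.
Qed.

(** The equations are the r whose image lies in the ideal (e1, e2) of the cover. They generate that
    ideal: by invariance its two pullbacks to the tensor square coincide, and the last property of
    [fppf_tensor] then writes e1 and e2 with coefficients from [R]. *)
Lemma zero_image_closed : closed_sub zero_image.
Proof.
move=> R y; have [R' [f0 [t0 [f0c t0y]]]] := psurj y.
pose J r := exists a b, r = a * e1 t0 + b * e2 t0.
have JI : ideal J.
  split; first by exists 0, 0; rewrite !mul0r addr0.
  - by move=> _ _ [a [b ->]] [c [d ->]]; exists (a + c), (b + d); ring.
  - by move=> c _ [a [b ->]]; exists (c * a), (c * b); ring.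
have desc e : (exists Q (i j : {lrmorphism R' -> Q}), fppf_tensor f0 f0 i j /\
     exists a b, j e = i (e1 t0) * a + i (e2 t0) * b) ->
    exists N (c : 'I_N -> R) (y : 'I_N -> R'), e = \sum_l f0 (c l) * y l /\ forall l, J (f0 (c l)).
  move=> [Q [i [j [[_ _ _ _ D] [a [b jE]]]]]].
  apply: (D J e [:: (e1 t0, a); (e2 t0, b)]) => //.
    move=> u; rewrite !inE => /orP[] /eqP -> /=.
      by exists 1, 0; rewrite mul1r mul0r addr0.
    by exists 0, 1; rewrite mul1r mul0r add0r.
  by rewrite !big_cons big_nil addr0.
have [Q [i [j HQ]]] := tensor_ex f0 f0c; have [ij _ _ _ _] := HQ.
have pij : p Q (fmap i t0) = p Q (fmap j t0).
  by rewrite !kmor_nat t0y; apply: fmapC.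
have [a aE] := e1i pij; have [b [c bE]] := e2i pij; rewrite !e1n // !e2n // in aE bE.
have d1 := desc (e1 t0).
have {}d1 : exists N (c : 'I_N -> R) (y : 'I_N -> R'), e1 t0 = \sum_l f0 (c l) * y l /\ forall l, J (f0 (c l)).
  by apply: desc; exists Q, i, j; split=> //; exists a, 0; rewrite aE; ring.
have d2 : exists N (c : 'I_N -> R) (y : 'I_N -> R'), e2 t0 = \sum_l f0 (c l) * y l /\ forall l, J (f0 (c l)).
  by apply: desc; exists Q, i, j; split=> //; exists b, c; rewrite bE; ring.
exists (fun r => J (f0 r)) => B phi; split.
  move=> h r [a' [b' rE]]; have [Q' [i' [j' [ij' i'inj _ _ _]]]] := tensor_ex phi f0c.
  have [h1 h2] : zero_locus (fmap j' t0).
    apply: (h _ i'); rewrite kmor_nat t0y fmapM; apply/esym.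
    by rewrite fmapM; apply: fmap_eq => z /=; rewrite ij'.
  rewrite !e1n // in h1; rewrite !e2n // in h2.
  by apply: i'inj; rewrite ij' rE rmorphD !rmorphM /= h1 h2 !mulr0 addr0 rmorph0.
move=> h C g t tE; have [Q' [i' [j' [ij' i'inj _ _ _]]]] := tensor_ex (g \o phi) f0c.
have j0 e : (exists N (c : 'I_N -> R) (y : 'I_N -> R'), e = \sum_l f0 (c l) * y l /\ forall l, J (f0 (c l))) -> j' e = 0.
  move=> [N [c' [z [-> cJ]]]]; rewrite rmorph_sum big1 // => l _.
  by rewrite rmorphM /= -ij' /= (h _ (cJ l)) !rmorph0 mul0r.
apply: (zero_locus_inj i'inj); apply: (@zero_locus_inv _ (fmap j' t0)).
  rewrite !kmor_nat tE t0y !fmapM; apply: fmap_eq => z /=.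
  by rewrite -ij'.
by split; rewrite ?e1n ?e2n // j0.
Qed.

(** A field extension stays injective after base change to the cover, so one point of the fibre in
    the locus puts the whole fibre into it. *)
Lemma zero_image_field K K' (f : {lrmorphism K -> K'}) (y : Y K) (t : X K') :
  is_field K -> p K' t = fmap f y -> zero_locus t -> zero_image y.
Proof.
move=> Kf ty tz; have [R' [f0 [t0 [f0c t0y]]]] := psurj y.
have [Q [i [j [ij _ jinj _ _]]]] := tensor_ex f f0c.
have z0 : zero_locus t0.
  apply: (zero_locus_inj (g := j)).
    apply: jinj => a b /eqP; rewrite -subr_eq0 -rmorphB => /eqP /(lr_field_inj Kf) /eqP.
    by rewrite subr_eq0 => /eqP.
  apply: (@zero_locus_inv _ (fmap i t)); last exact: zero_locus_fmap.
  by rewrite !kmor_nat ty t0y; apply: fmapC.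
move=> B g t1 t1y; have [Q' [i' [j' [ij' i'inj _ _ _]]]] := tensor_ex g f0c.
apply: (zero_locus_inj i'inj); apply: (@zero_locus_inv _ (fmap j' t0)); last exact: zero_locus_fmap.
by rewrite !kmor_nat t1y t0y; apply: fmapC.
Qed.

End Closed.
End Descent.

(** * Matrices of size 3; parabolic and Levi subgroups of GL_3 by entries *)

Definition o0 : 'I_3 := ord0.
Definition o1 : 'I_3 := Ordinal (isT : 1 < 3)%N.
Definition o2 : 'I_3 := ord_max.

Lemma ord3P (P : 'I_3 -> Prop) : P o0 -> P o1 -> P o2 -> forall i, P i.
Proof.
move=> P0 P1 P2 [[|[|[|//]]] h]; [move: P0|move: P1|move: P2];
  by congr (P _); apply: val_inj.
Qed.

Lemma sum3 (V : nmodType) (F : 'I_3 -> V) : \sum_(i < 3) F i = F o0 + F o1 + F o2.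
Proof.
rewrite !big_ord_recr big_ord0 /= add0r.
by congr (_ + _ + _); congr F; apply: val_inj.
Qed.

Lemma prod3 (R : comNzRingType) (F : 'I_3 -> R) : \prod_(i < 3) F i = F o0 * F o1 * F o2.
Proof.
rewrite !big_ord_recr big_ord0 /= mul1r.
by congr (_ * _ * _); congr F; apply: val_inj.
Qed.

Lemma mul3 (R : comNzRingType) (A B : 'M[R]_3) i j :
  (A *m B) i j = A i o0 * B o0 j + A i o1 * B o1 j + A i o2 * B o2 j.
Proof. by rewrite mxE sum3. Qed.

Section GL3.
Variable k : closedFieldType.
Notation kalg := (comAlgType k).
Implicit Types (R A B C K L Q T : kalg).

Lemma GL_eq n R (g h : GLmx n R) : mx g = mx h -> g = h.
Proof.
move=> gh; apply: val_inj; apply: injective_projections; first exact: gh.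
by change (imx g = imx h); rewrite -[imx g]mulmx1 -(mxK h) mulmxA -gh imxK mul1mx.
Qed.

Lemma mx_fmap R B (f : {lrmorphism R -> B}) (g : GL3 k R) i j :
  mx (fmap f g : GL3 k B) i j = f (mx g i j).
Proof. by rewrite /= mxE. Qed.

Lemma imx_fmap R B (f : {lrmorphism R -> B}) (g : GL3 k R) i j :
  imx (fmap f g : GL3 k B) i j = f (imx g i j).
Proof. by rewrite /= /imx /= mxE. Qed.

Lemma mx_imx R (g : GL3 k R) i j :
  mx g i o0 * imx g o0 j + mx g i o1 * imx g o1 j + mx g i o2 * imx g o2 j = (i == j)%:R.
Proof. by rewrite -mul3 mxK mxE. Qed.

Lemma imx_mx R (g : GL3 k R) i j :
  imx g i o0 * mx g o0 j + imx g i o1 * mx g o1 j + imx g i o2 * mx g o2 j = (i == j)%:R.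
Proof. by rewrite -mul3 imxK mxE. Qed.

(** For a block triangular matrix the diagonal blocks of the inverse are the inverses of the
    diagonal blocks. *)
Fact blk_subproof (R : kalg) (x : GL3 k R) :
  ((mx x o0 o2 = 0 /\ mx x o1 o2 = 0) \/ (mx x o2 o0 = 0 /\ mx x o2 o1 = 0)) ->
  (\matrix_(i < 3, j < 3) (if (i < 2)%N == (j < 2)%N then mx x i j else 0)) *m
  (\matrix_(i < 3, j < 3) (if (i < 2)%N == (j < 2)%N then imx x i j else 0)) = 1%:M.
Proof.
move=> h; apply/matrixP.
have XI := mx_imx x; have IX := imx_mx x.
case: h => [] [h0 h1].
  have E22 : mx x o2 o2 * imx x o2 o2 = 1.
    by have := IX o2 o2; rewrite h0 h1 !mulr0 !add0r mulrC.
  have z i : i != o2 -> imx x i o2 = 0.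
    move=> i2; have := IX i o2; rewrite h0 h1 !mulr0 !add0r (negPf i2) => E.
    by apply: (unit_cancel E22); rewrite mulrC E mulr0.
  apply: ord3P; apply: ord3P; rewrite mul3 !mxE /= ?mul0r ?mulr0 ?addr0 ?add0r //.
  - by have := XI o0 o0; rewrite h0 mul0r addr0.
  - by have := XI o0 o1; rewrite h0 mul0r addr0.
  - by have := XI o1 o0; rewrite h1 mul0r addr0.
  - by have := XI o1 o1; rewrite h1 mul0r addr0.
have E22 : mx x o2 o2 * imx x o2 o2 = 1.
  by have := XI o2 o2; rewrite h0 h1 !mul0r !add0r.
have z i : i != o2 -> imx x o2 i = 0.
  move=> i2; have := XI o2 i; rewrite h0 h1 !mul0r !add0r eq_sym (negPf i2) => E.
  by apply: (unit_cancel E22); rewrite E mulr0.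
apply: ord3P; apply: ord3P; rewrite mul3 !mxE /= ?mul0r ?mulr0 ?addr0 ?add0r //.
- by have := XI o0 o0; rewrite z // mulr0 addr0.
- by have := XI o0 o1; rewrite z // mulr0 addr0.
- by have := XI o1 o0; rewrite z // mulr0 addr0.
- by have := XI o1 o1; rewrite z // mulr0 addr0.
Qed.

Lemma mxM n R (g h : GLmx n R) : mx (glM g h) = mx g *m mx h. Proof. by []. Qed.
Lemma mxV n R (g : GLmx n R) : mx (glV g) = imx g. Proof. by []. Qed.
Lemma imxV n R (g : GLmx n R) : imx (glV g) = mx g. Proof. by []. Qed.
Definition muv R (a : GLmx 1 R) (i : 'I_3) : R := if (i < 2)%N then mx a 0 0 else 1.
Definition imuv R (a : GLmx 1 R) (i : 'I_3) : R := if (i < 2)%N then imx a 0 0 else 1.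

Lemma mx_mu R (a : GLmx 1 R) i j : mx (mu a) i j = muv a i *+ (i == j).
Proof. by rewrite /mu /mx /= !mxE eq_sym; case: eqP => // ->. Qed.

Lemma imx_mu R (a : GLmx 1 R) i j : imx (mu a) i j = imuv a i *+ (i == j).
Proof. by rewrite /mu /imx /= !mxE eq_sym; case: eqP => // ->. Qed.

Lemma mul_diag3 R (d : 'I_3 -> R) (A : 'M[R]_3) (D : 'M[R]_3) i j :
  (forall i j, D i j = d i *+ (i == j)) -> (D *m A) i j = d i * A i j.
Proof.
move=> DE; rewrite mxE (bigD1 i) //= DE eqxx big1 ?addr0 // => l li.
by rewrite DE eq_sym (negPf li) mul0r.
Qed.

Lemma mul_3diag R (d : 'I_3 -> R) (A : 'M[R]_3) (D : 'M[R]_3) i j :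
  (forall i j, D i j = d i *+ (i == j)) -> (A *m D) i j = A i j * d j.
Proof.
move=> DE; rewrite mxE (bigD1 j) //= DE eqxx big1 ?addr0 // => l lj.
by rewrite DE (negPf lj) mulr0.
Qed.

Lemma conj_Minus R (a : GLmx 1 R) (g : GL3 k R) i j :
  mx (conj_mu Minus a g) i j = imuv a i * mx g i j * muv a j.
Proof.
rewrite /conj_mu !mxM mxV (mul_3diag _ _ _ (mx_mu a)).
by rewrite (mul_diag3 _ _ _ (imx_mu a)).
Qed.

Lemma conj_Plus R (a : GLmx 1 R) (g : GL3 k R) i j :
  mx (conj_mu Plus a g) i j = muv a i * mx g i j * imuv a j.
Proof.
rewrite /conj_mu !mxM mxV (mul_3diag _ _ _ (imx_mu a)).
by rewrite (mul_diag3 _ _ _ (mx_mu a)).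
Qed.

Fact gscal_subproof R (c : k) : c != 0 ->
  ((c%:A : R)%:M : 'M_1) *m ((c^-1)%:A)%:M = 1%:M.
Proof. by move=> c0; rewrite -scalar_mxM -scalerAl mul1r scalerA divff // scale1r. Qed.
Definition gscal R (c : k) (c0 : c != 0) : GLmx 1 R := mkGL (gscal_subproof R c0).

Lemma mx_gscal R (c : k) (c0 : c != 0) : mx (gscal R c0) 0 0 = c%:A.
Proof. by rewrite /mx /= mxE. Qed.
Lemma imx_gscal R (c : k) (c0 : c != 0) : imx (gscal R c0) 0 0 = c^-1%:A.
Proof. by rewrite /imx /= mxE. Qed.

Lemma levi_entries R (l : GL3 k R) : levi l ->
  [/\ mx l o0 o2 = 0, mx l o1 o2 = 0, mx l o2 o0 = 0 & mx l o2 o1 = 0].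
Proof.
(* A scalar c of k other than 0 and 1 suffices: c and c - 1 are units in every k-algebra. *)
move=> Hl; have [c] := k_fresh ([:: 0; 1] : seq k); rewrite !inE negb_or => /andP[c0 c1].
have E i j := congr1 (fun g : GL3 k R => mx g i j) (Hl R (idfun : {lrmorphism R -> R}) (gscal R c0)).
have {}E i j : mx l i j * muv (gscal R c0) j = muv (gscal R c0) i * mx l i j.
  have := E i j; rewrite fmap_idE !mxM (mul_3diag _ _ _ (mx_mu (gscal R c0))).
  by rewrite (mul_diag3 _ _ _ (mx_mu (gscal R c0))).
have [y cy] : exists y : R, (c - 1)%:A * y = 1 by apply: scal_unit; rewrite subr_eq0.
rewrite scalerBl scale1r in cy.
have z (u : R) : c%:A * u = u -> u = 0.
  by move=> cu; apply: (unit_cancel cy); rewrite mulr0 mulrBl mul1r cu subrr.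
split; apply: z.
- by have := E o0 o2; rewrite /muv /= mx_gscal mulr1.
- by have := E o1 o2; rewrite /muv /= mx_gscal mulr1.
- by have := E o2 o0; rewrite /muv /= mx_gscal mul1r mulrC.
- by have := E o2 o1; rewrite /muv /= mx_gscal mul1r mulrC.
Qed.

(** The extended morphism evaluated at the coordinate of the affine line is a matrix of polynomials,
    with value 1 at 0, that interpolates the conjugates of [u]. *)
Lemma unip_poly s R (u : GL3 k R) : unip_radical s u -> exists G : 'I_3 -> 'I_3 -> pK R,
  (forall i j, pev (idfun : {lrmorphism R -> R}) 0 (G i j) = (i == j)%:R) /\
  forall (c : k) (c0 : c != 0) i j, pev (idfun : {lrmorphism R -> R}) c%:A (G i j) =
    mx (conj_mu s (gscal R c0) u) i j.
Proof.
move=> [F [Fn Fc F0]]; pose ev (x : R) := pev (idfun : {lrmorphism R -> R}) x.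
pose G := F (pK R) (pC R) (pX R).
have FE x : F R (idfun : {lrmorphism R -> R}) x = fmap (ev x) G.
  have := Fn (pK R) R (pC R) (ev x) (idfun : {lrmorphism R -> R}) (pX R).
  by rewrite {1}/ev pevX => -> // r /=; rewrite pCE /ev pevC.
exists (fun i j => mx G i j); split.
  by move=> i j; rewrite -[pev _ _ _](mx_fmap (ev 0)) -FE F0 // /mx /= mxE.
move=> c c0 i j; rewrite -[pev _ _ _](mx_fmap (ev c%:A)) -FE -(mx_gscal R c0) Fc.
by congr (mx (conj_mu _ _ _) _ _); apply: fmap_idE.
Qed.

Lemma pev_const R (G : pK R) (a : R) :
  (forall c : k, c != 0 -> pev (idfun : {lrmorphism R -> R}) c%:A G = a) ->
  pev (idfun : {lrmorphism R -> R}) 0 G = a.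
Proof.
move=> h; apply/eqP; rewrite -subr_eq0.
have E x : pev (idfun : {lrmorphism R -> R}) x (G - pC R a) = pev (idfun : {lrmorphism R -> R}) x G - a.
  by rewrite rmorphB /= pCE pevC.
rewrite -E; apply/eqP; apply: (inf_roots_ker (s := [:: 0])) => c.
by rewrite inE E => /h ->; rewrite subrr.
Qed.

(** A polynomial has no pole: G X takes the value a at all nonzero scalars, hence at 0, where it
    vanishes. *)
Lemma pev_pole R (G : pK R) (a : R) :
  (forall c : k, c != 0 -> pev (idfun : {lrmorphism R -> R}) c%:A G * c%:A = a) -> a = 0.
Proof.
move=> h; have := @pev_const R (G * pX R) a.
rewrite rmorphM /= pevX mulr0 => <- // c /h <-.
by rewrite rmorphM /= pevX.
Qed.

Lemma unip_entries s R (u : GL3 k R) : unip_radical s u ->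
  (forall i j : 'I_3, (i < 2)%N == (j < 2)%N -> mx u i j = (i == j)%:R) /\
  match s with Minus => mx u o0 o2 = 0 /\ mx u o1 o2 = 0
             | Plus => mx u o2 o0 = 0 /\ mx u o2 o1 = 0 end.
Proof.
move=> /unip_poly [G [G0 Gc]].
have ainv (c : k) : c != 0 -> (c^-1)%:A * c%:A = 1 :> R.
  by move=> c0; rewrite -scalerAl mul1r scalerA mulVf // scale1r.
have ainv' (c : k) : c != 0 -> c%:A * (c^-1)%:A = 1 :> R.
  by move=> c0; rewrite mulrC ainv.
have blk (i j : 'I_3) : (i < 2)%N == (j < 2)%N -> mx u i j = (i == j)%:R.
  move=> ij; rewrite -G0; apply/esym/pev_const => c c0; rewrite Gc.
  case: s {Gc}; [rewrite conj_Minus | rewrite conj_Plus]; rewrite /muv /imuv -(eqP ij);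
    case: (i < 2)%N; rewrite ?mulr1 ?mul1r // mx_gscal imx_gscal mulrAC.
    by rewrite ainv // mul1r.
  by rewrite ainv' // mul1r.
split=> //.
have key i j : (forall (c : k) (c0 : c != 0), mx (conj_mu s (gscal R c0) u) i j = (c^-1)%:A * mx u i j) ->
    mx u i j = 0.
  by move=> E; apply: (pev_pole (G := G i j)) => c c0; rewrite Gc E mulrAC ainv // mul1r.
case: s {Gc} key => key; split; apply: key => c c0.
- by rewrite conj_Minus /muv /imuv /= imx_gscal mulr1.
- by rewrite conj_Minus /muv /imuv /= imx_gscal mulr1.
- by rewrite conj_Plus /muv /imuv /= imx_gscal mul1r mulrC.
- by rewrite conj_Plus /muv /imuv /= imx_gscal mul1r mulrC.
Qed.

Definition blk (R : kalg) (M : 'M[R]_3) : 'M[R]_3 :=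
  \matrix_(i, j) (if (i < 2)%N == (j < 2)%N then M i j else 0).

Definition side_ok s R (x : GL3 k R) : Prop := match s with
  | Minus => mx x o0 o2 = 0 /\ mx x o1 o2 = 0
  | Plus => mx x o2 o0 = 0 /\ mx x o2 o1 = 0 end.

Lemma blk_mul s R (x : GL3 k R) : side_ok s x -> blk (mx x) *m blk (imx x) = 1%:M.
Proof. by move=> h; apply: blk_subproof; case: s h; [left|right]. Qed.

Definition off s (i j : 'I_3) : bool := match s with
  | Minus => (j < 2)%N && ~~ (i < 2)%N | Plus => (i < 2)%N && ~~ (j < 2)%N end.

Lemma off_sq s R (N N' : 'M[R]_3) : (forall i j, ~~ off s i j -> N i j = 0) ->
  (forall i j, ~~ off s i j -> N' i j = 0) -> N *m N' = 0.
Proof.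
move=> N0 N0'; apply/matrixP => i j; rewrite !mxE big1 // => l _.
case E : (off s i l); last by rewrite N0 ?mul0r ?E.
rewrite N0' ?mulr0 //; move: E; rewrite /off.
by case: s {N0 N0'} => /andP[h1 h2]; rewrite ?h1 ?(negPf h2) ?andbF.
Qed.

Fact uni_subproof s R (N : 'M[R]_3) : (forall i j, ~~ off s i j -> N i j = 0) ->
  (1%:M + N) *m (1%:M - N) = 1%:M.
Proof.
move=> N0; rewrite mulmxDl !mulmxBr !mul1mx mulmx1 (off_sq N0 N0).
by rewrite subr0 subrK.
Qed.
Definition uni s R (N : 'M[R]_3) (N0 : forall i j, ~~ off s i j -> N i j = 0) : GL3 k R :=
  mkGL (uni_subproof N0).

(** The extension to the affine line is a |-> l (1 + a (u - 1)). *)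
Lemma limit_of_block s R (l u : GL3 k R) :
  (forall i j : 'I_3, (i < 2)%N != (j < 2)%N -> mx l i j = 0) ->
  (forall i j, ~~ off s i j -> mx u i j = (i == j)%:R) ->
  limit_mu s (glM l u) l.
Proof.
move=> l0 u0.
have N0 A (f : {lrmorphism R -> A}) (a : A) i j : ~~ off s i j ->
    (a *: map_mx f (mx u - 1%:M)) i j = 0.
  by move=> h; rewrite !mxE u0 // subrr rmorph0 mulr0.
exists (fun A f a => glM (fmap f l) (uni (N0 A f a))); split.
- move=> A A' f h f' a ff; apply: GL_eq; apply/matrixP => i j.
  rewrite !mxE rmorph_sum; apply: eq_bigr => m _; rewrite !mxE rmorphM /= ff; congr (_ * _).
  by rewrite [in RHS]rmorphD [in RHS]rmorphM /= rmorph_nat ff.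
- move=> A f a; apply: GL_eq; apply/matrixP => i j.
  have aE : imx a 0 0 * mx a 0 0 = 1.
    by have := congr1 (fun M : 'M_1 => M 0 0) (imxK a); rewrite !mxE big_ord1.
  have key m : f (mx l i m) * ((m == j)%:R + mx a 0 0 * (f (mx u m j) - (m == j)%:R)) =
     (match s with Minus => imuv a i | Plus => muv a i end) * (f (mx l i m) * f (mx u m j)) *
     (match s with Minus => muv a j | Plus => imuv a j end).
    case: (eqVneq (i < 2)%N (m < 2)%N) => im; last by rewrite (l0 i m im) rmorph0 !(mul0r, mulr0).
    case E : (off s m j); last first.
      rewrite (u0 _ _ (negbT E)) rmorph_nat subrr mulr0 addr0.
      have [mj|] := eqVneq m j; last by rewrite !mulr0 mul0r.
      rewrite -mj /imuv /muv im; case: s {E u0 N0}; case: (m < 2)%N; rewrite !mulr1 ?mul1r //.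
        by rewrite mulrAC aE mul1r.
      by rewrite mulrAC (mulrC (mx a 0 0)) aE mul1r.
    have mj : (m == j) = false.
      by apply/negP => /eqP mj; move: E; rewrite mj /off; case: (s); case: (j < 2)%N.
    rewrite mj subr0 add0r /imuv /muv im; move: E; rewrite /off.
    by case: s {u0 N0} => /andP[-> /negPf ->]; rewrite ?mul1r ?mulr1; ring.
  have -> : mx (conj_mu s a (fmap f (glM l u : GL3 k R) : GL3 k A)) i j =
     (match s with Minus => imuv a i | Plus => muv a i end) * (\sum_m (f (mx l i m) * f (mx u m j))) *
     (match s with Minus => muv a j | Plus => imuv a j end).
    have -> : \sum_m f (mx l i m) * f (mx u m j) = mx (fmap f (glM l u : GL3 k R) : GL3 k A) i j.
      by rewrite mx_fmap mxM mxE rmorph_sum; apply: eq_bigr => m _; rewrite rmorphM.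
    by case: (s); [rewrite conj_Minus | rewrite conj_Plus].
  rewrite mxM mxE mulr_sumr mulr_suml; apply: eq_bigr => m _; rewrite -key mx_fmap; congr (_ * _).
  by rewrite /mx /= !mxE rmorphB rmorph_nat.
- move=> f fid; apply: GL_eq; apply/matrixP => i j.
  rewrite mxM mxE (bigD1 j) //= big1 => [|m mj]; last first.
    by rewrite [X in _ * X](_ : _ = 0) ?mulr0 // /mx /= !mxE (negPf mj) mul0r addr0.
  rewrite addr0 [X in _ * X](_ : _ = 1) ?mulr1; first by rewrite mx_fmap fid.
  by rewrite /mx /= !mxE eqxx mul0r addr0.
Qed.

End GL3.

(** * The zip group *)

Section Zip.
Variable k : closedFieldType.
Notation kalg := (comAlgType k).
Implicit Types (R A B C K L Q T : kalg).
Variable q : nat.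
Hypothesis q0 : (0 < q)%N.
Hypothesis frobD : forall R (a b : R), (a + b) ^+ q = a ^+ q + b ^+ q.

Definition same (i j : 'I_3) : bool := (i < 2)%N == (j < 2)%N.

Lemma levi_component_entries s R (x l : GL3 k R) : levi_component s x l ->
  [/\ forall i j, same i j -> mx x i j = mx l i j, side_ok s x &
      forall i j, ~~ same i j -> mx l i j = 0].
Proof.
move=> [/levi_entries [l02 l12 l20 l21] [u /unip_entries [ub us] ->]].
have l0 i j : ~~ same i j -> mx l i j = 0.
  by move: i j; apply: ord3P; apply: ord3P.
split=> //.
- move=> i j ij; rewrite mxM mxE (bigD1 j) //= ub // eqxx mulr1 big1 ?addr0 // => m mj.
  case E : (same m j); first by rewrite ub // (negPf mj) mulr0.
  by rewrite l0 ?mul0r //; apply: contraFN E => /eqP im; rewrite /same -im.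
- by case: s us => -[u1 u2]; rewrite /side_ok mxM !mul3 u1 u2 ?l02 ?l12 ?l20 ?l21 !mulr0 !mul0r !addr0.
Qed.

(** Together with [zip_of_entries] this describes E by matrix entries, which replaces limits and
    Levi components in the computations. *)
Lemma zip_entries R (x y : GL3 k R) : zip_group q x y ->
  [/\ side_ok Minus x, side_ok Plus y &
      forall i j, same i j -> mx y i j = mx x i j ^+ q].
Proof.
move=> [_ _ [l [m [/levi_component_entries [xl xs _] /levi_component_entries [ym ys _] lm]]]].
split=> // i j ij; rewrite ym // xl // lm mxE //.
Qed.

Lemma levi_split s R (x : GL3 k R) : side_ok s x -> exists l,
  [/\ levi_component s x l, parabolic s x & mx l = blk (mx x)].
Proof.
move=> xs; pose l : GL3 k R := mkGL (blk_mul xs).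
have lE i j : mx l i j = if same i j then mx x i j else 0 by rewrite /mx /= mxE.
pose u : GL3 k R := glM (glV l) x.
have vE i j : imx l i j = if same i j then imx x i j else 0 by rewrite /imx /= mxE.
have uE i j : ~~ off s i j -> mx u i j = (i == j)%:R.
  move=> oij; rewrite mxM mxV mxE.
  case ij : (same i j).
    have <- : (imx l *m mx l) i j = (i == j)%:R by rewrite imxK mxE.
    rewrite mxE; apply: eq_bigr => m _; rewrite lE.
    case jm : (same m j) => //; rewrite vE; case im : (same i m); last by rewrite !mul0r.
    by move: ij jm; rewrite /same (eqP im) => ->.
  have -> : (i == j) = false by apply/negP => /eqP E; move: ij; rewrite E /same eqxx.
  rewrite big1 // => m _; rewrite vE; case im : (same i m); last by rewrite mul0r.
  have -> : mx x m j = 0; last by rewrite mulr0.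
  have xs' := xs; move: oij ij im xs'; rewrite /off /same /side_ok; move: (s) => s'.
  by case: s'; move: i j m; apply: ord3P; apply: ord3P; apply: ord3P => //= _ _ _ [].
have xlu : x = glM l u.
  by apply: GL_eq; rewrite !mxM mxV mulmxA mxK mul1mx.
have lz (i j : 'I_3) : (i < 2)%N != (j < 2)%N -> mx l i j = 0.
  by move=> ij; rewrite lE /same (negPf ij).
exists l; split.
- split.
    move=> A f a; apply: GL_eq; apply/matrixP => i j.
    rewrite !mxM (mul_3diag _ _ _ (mx_mu a)) (mul_diag3 _ _ _ (mx_mu a)) mx_fmap.
    have [ij|ij] := eqVneq (i < 2)%N (j < 2)%N; last by rewrite lz // rmorph0 mul0r mulr0.
    by rewrite mulrC /muv ij.
  exists u => //; rewrite /unip_radical -[u](_ : glM (gl1 3 R) u = u); last first.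
    by apply: GL_eq; rewrite mxM /mx /= mul1mx.
  apply: limit_of_block => // i j ij; rewrite /mx /= mxE.
  by have [ij'|//] := eqVneq i j; rewrite ij' eqxx in ij.
- by exists l; rewrite {1}xlu; apply: limit_of_block.
- by apply/matrixP => i j; rewrite lE.
Qed.

Lemma zip_of_entries R (x y : GL3 k R) : side_ok Minus x -> side_ok Plus y ->
  (forall i j, same i j -> mx y i j = mx x i j ^+ q) -> zip_group q x y.
Proof.
move=> xs ys xy; have [l [xl xp lE]] := levi_split xs; have [m [ym yp mE]] := levi_split ys.
split=> //; exists l, m; split=> //; apply/matrixP => i j; rewrite mE /blk mxE [RHS]mxE lE /blk [in RHS]mxE -/(same i j).
by case: ifP => [/xy ->//|]; rewrite expr0n; case: q q0.
Qed.

Lemma expr0q R : (0 : R) ^+ q = 0. Proof. by rewrite expr0n; case: q q0. Qed.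

Lemma zipM R (x y x' y' : GL3 k R) : zip_group q x y -> zip_group q x' y' ->
  zip_group q (glM x x') (glM y y').
Proof.
move=> /zip_entries [xs ys xy] /zip_entries [xs' ys' xy'].
have [x02 x12] := xs; have [x02' x12'] := xs'; have [y20 y21] := ys; have [y20' y21'] := ys'.
apply: zip_of_entries.
- by split; rewrite mxM mul3 ?x02 ?x12 ?x02' ?x12' !mulr0 !mul0r !addr0.
- by split; rewrite mxM mul3 ?y20 ?y21 ?y20' ?y21' !mulr0 !mul0r !addr0.
- move=> i j; rewrite !mxM !mul3 !frobD !exprMn; move: i j; apply: ord3P; apply: ord3P => // _;
    by rewrite ?x02 ?x12 ?y20' ?y21' ?x02' ?x12' ?y20 ?y21 ?expr0q ?mulr0 ?mul0r ?addr0 ?add0r -?xy -?xy'.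
Qed.

(** Coordinates on E ([fl] true) and on E' ([fl] false): the entries of x, then the two entries of y
    outside the diagonal blocks, which together determine the pair. Nine coordinates in both cases
    allow one and the same polynomial ring. *)
Definition xm R (fl : bool) (c : 'I_9 -> R) : 'M[R]_3 := \matrix_(i, j)
  match nat_of_ord i, nat_of_ord j with
  | 0, 0 => c (inord 0) | 0, 1 => if fl then c (inord 1) else 0 | 0, _ => 0
  | 1, 0 => c (inord 2) | 1, 1 => c (inord 3) | 1, _ => 0
  | _, 0 => c (inord 4) | _, 1 => c (inord 5) | _, _ => c (inord 6)
  end.

Lemma map_xm R B (f : {lrmorphism R -> B}) fl (c : 'I_9 -> R) :
  map_mx f (xm fl c) = xm fl (f \o c).
Proof.
apply/matrixP; apply: ord3P; apply: ord3P; rewrite !mxE //= ?rmorph0 //.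
by case: fl; rewrite ?rmorph0.
Qed.

Lemma zip_univ R fl (c : 'I_9 -> R) d : \det (xm fl c) * d = 1 ->
  exists x y : GL3 k R, [/\ zip_group q x y, mx x = xm fl c, mx y o0 o2 = c (inord 7) &
    mx y o1 o2 = c (inord 8)].
Proof.
move=> cd; have E : xm fl c *m (d *: \adj (xm fl c)) = 1%:M.
  by rewrite -scalemxAr mul_mx_adj scale_scalar_mx mulrC cd.
pose x : GL3 k R := mkGL E.
have xs : side_ok Minus x by split; rewrite /mx /= !mxE.
pose l : GL3 k R := mkGL (blk_mul xs).
have lE i j : mx l i j = if same i j then mx x i j else 0 by rewrite /mx /= mxE.
have vE i j : imx l i j = if same i j then imx x i j else 0 by rewrite /imx /= mxE.
pose fr (M : 'M[R]_3) : 'M[R]_3 := map_mx (fun a => a ^+ q) M.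
have frM (M N : 'M[R]_3) : fr M *m fr N = fr (M *m N).
  by apply/matrixP => i j; rewrite [RHS]mxE !mul3 !mxE !frobD !exprMn.
have FF : fr (mx l) *m fr (imx l) = 1%:M.
  rewrite frM mxK; apply/matrixP => i j; rewrite !mxE.
  by case: (i == j); rewrite ?expr1n ?expr0q.
pose Bm : 'M[R]_3 := \matrix_(i, j) if off Plus i j then (if (i < 1)%N then c (inord 7) else c (inord 8)) else 0.
have Bo i j : ~~ off Plus i j -> Bm i j = 0 by move=> h; rewrite mxE (negPf h).
have FB : Bm *m (fr (imx l) *m Bm) = 0.
  apply: (off_sq (s := Plus)) => // i j ij; rewrite mxE big1 // => m _.
  case mj : (off Plus m j); last by rewrite Bo ?mulr0 ?mj.
  rewrite mxE vE; case im : (same i m); last by rewrite expr0q mul0r.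
  by move: ij mj; rewrite /off (eqP im) => /negPf ->.
(* The geometric series for the inverse of Fr(l) + Bm stops after the linear term because Bm
   Fr(l)^-1 Bm = 0. *)
have E2 : (fr (mx l) + Bm) *m (fr (imx l) - fr (imx l) *m Bm *m fr (imx l)) = 1%:M.
  rewrite mulmxDl !mulmxBr !mulmxA FF -(mulmxA Bm (fr (imx l)) Bm) FB mul0mx subr0 mul1mx.
  by rewrite subrK.
pose y : GL3 k R := mkGL E2.
have yE i j : mx y i j = mx l i j ^+ q + Bm i j by rewrite /mx /= !mxE.
exists x, y; split=> //.
- apply: zip_of_entries => //.
    by split; rewrite yE lE /= expr0q add0r Bo.
  move=> i j ij; rewrite yE lE ij Bo ?addr0 //.
  by move: ij; rewrite /same /off => /eqP ->; case: (j < 2)%N.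
- by rewrite yE lE /= expr0q add0r mxE.
- by rewrite yE lE /= expr0q add0r mxE.
Qed.

Lemma zip_coord R fl (x y : GL3 k R) : zip_group q x y -> (~~ fl -> mx x o0 o1 = 0) ->
  exists (c : 'I_9 -> R) d, [/\ \det (xm fl c) * d = 1, mx x = xm fl c, mx y o0 o2 = c (inord 7) &
    mx y o1 o2 = c (inord 8)].
Proof.
move=> /zip_entries [[x02 x12] _ _] xf.
pose c (l : 'I_9) : R := nth 0 [:: mx x o0 o0; mx x o0 o1; mx x o1 o0; mx x o1 o1;
  mx x o2 o0; mx x o2 o1; mx x o2 o2; mx y o0 o2; mx y o1 o2] l.
have xE : mx x = xm fl c.
  apply/matrixP; apply: ord3P; apply: ord3P; rewrite !mxE /c /= ?inordK //.
  by case: fl xf => [|->]; rewrite ?inordK.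
exists c, (\det (imx x)); rewrite -xE -det_mulmx mxK det1; split=> //; by rewrite /c inordK.
Qed.

Lemma zip_eq R (x y x' y' : GL3 k R) : zip_group q x y -> zip_group q x' y' ->
  mx x = mx x' -> mx y o0 o2 = mx y' o0 o2 -> mx y o1 o2 = mx y' o1 o2 -> x = x' /\ y = y'.
Proof.
move=> /zip_entries [_ [y20 y21] xy] /zip_entries [_ [y20' y21'] xy'] xx e0 e1.
split; apply: GL_eq => //; apply/matrixP => i j.
case ij : (same i j); first by rewrite xy // xy' // xx.
by move: i j ij; apply: ord3P; apply: ord3P => // _; rewrite ?y20 ?y21 ?y20' ?y21'.
Qed.

Lemma zip_fmap R B (f : {lrmorphism R -> B}) (x y : GL3 k R) : zip_group q x y ->
  zip_group q (fmap f x : GL3 k B) (fmap f y : GL3 k B).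
Proof.
move=> /zip_entries [[x02 x12] [y20 y21] xy]; apply: zip_of_entries.
- by split; rewrite mx_fmap ?x02 ?x12 rmorph0.
- by split; rewrite mx_fmap ?y20 ?y21 rmorph0.
- by move=> i j ij; rewrite !mx_fmap xy // rmorphXn.
Qed.

End Zip.

(** * The morphism to GL_3 and its vanishing loci *)

Section Charts.
Variable k : closedFieldType.
Notation kalg := (comAlgType k).
Implicit Types (R A B C D K L Q T : kalg).

Lemma fgen_surj A B (f : {lrmorphism A -> B}) : (forall y, exists x, f x = y) ->
  fgen (base A) -> fgen (base B).
Proof.
move=> fs [n [x Ax]]; exists n, (f \o x) => b; have [a <-] := fs b.
have [P <-] := Ax a; exists P.
elim/mpK_ind: P => [c|i|p q pE qE|p q pE qE].
- by rewrite mCE !mevC lr_base.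
- by rewrite !mevX.
- by rewrite !rmorphD /= pE qE.
- by rewrite !rmorphM /= pE qE.
Qed.

Lemma fgen_trans C D (f : {lrmorphism C -> D}) : fgen (base C) -> fgen f -> fgen (base D).
Proof.
move=> [m [y Cy]] [n [x Dx]].
pose z (i : 'I_(m + n)) : D := match split i with inl a => f (y a) | inr b => x b end.
exists (m + n)%N, z => d; have [P <-] := Dx d.
elim/mpK_ind: P => [c|i|p q [p' pE] [q' qE]|p q [p' pE] [q' qE]].
- rewrite mCE mevC; have [P <-] := Cy c.
  elim/mpK_ind: P => [c'|i|p q [p' pE] [q' qE]|p q [p' pE] [q' qE]].
  + by exists (mC _ _ c'); rewrite !mCE !mevC lr_base.
  + by exists 'X_(lshift n i); rewrite !mevX /z (unsplitK (inl i)).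
  + by exists (p' + q'); rewrite !rmorphD /= pE qE.
  + by exists (p' * q'); rewrite !rmorphM /= pE qE.
- by exists 'X_(rshift m i); rewrite !mevX /z (unsplitK (inr i)).
- by exists (p' + q'); rewrite !rmorphD /= pE qE.
- by exists (p' * q'); rewrite !rmorphM /= pE qE.
Qed.

Definition gl_coord R (g : GL3 k R) (l : 'I_18) : R :=
  if (l < 9)%N then mx g (inord (l %/ 3)) (inord (l %% 3))
  else imx g (inord ((l - 9) %/ 3)) (inord ((l - 9) %% 3)).

Lemma gl_coordE R (g : GL3 k R) (i j : 'I_3) :
  gl_coord g (inord (3 * i + j)) = mx g i j /\ gl_coord g (inord (9 + (3 * i + j))) = imx g i j.
Proof.
have h : (3 * i + j < 9)%N by case: i j => [[|[|[|//]]] ?] [[|[|[|//]]] ?].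
have h1 : ((3 * i + j) %/ 3)%N = i by rewrite mulnC divnMDl // divn_small ?addn0.
have h2 : ((3 * i + j) %% 3)%N = j by rewrite mulnC modnMDl modn_small.
rewrite /gl_coord !inordK; [|lia..].
rewrite h ltnNge leq_addr /= addKn h1 h2; split; congr (_ _ _ _); apply: val_inj; rewrite /= inordK //.
Qed.

(** The coordinate ring is taken as the polynomials in the 18 entries of g and its inverse modulo
    those that vanish at every point of GL_3; the factorization [f] is then immediate. *)
Lemma gl_universal : exists (G : kalg) (gam : GL3 k G), fgen (base G) /\
  forall R (g : GL3 k R), exists f : {lrmorphism G -> R}, fmap f gam = g.
Proof.
pose ev R (g : GL3 k R) : {lrmorphism mpK (kk k) 18 -> R} := mev (base R) (gl_coord g).
pose I (F : mpK (kk k) 18) := forall R (g : GL3 k R), ev R g F = 0.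
have II : ideal I.
  split; first by move=> R g; rewrite rmorph0.
  - by move=> a b ha hb R g; rewrite rmorphD /= ha hb addr0.
  - by move=> a b hb R g; rewrite rmorphM /= hb mulr0.
have I1 : ~ I 1.
  by move=> /(_ (kk k) (gl1 3 (kk k))); rewrite rmorph1; apply: kalg_nz1.
have [G [p [ps pk]]] := quot_ex II I1.
have [u [v uv]] : exists u v : 'I_3 -> 'I_3 -> 'I_18, forall R (g : GL3 k R) i j,
    gl_coord g (u i j) = mx g i j /\ gl_coord g (v i j) = imx g i j.
  exists (fun i j => inord (3 * i + j)), (fun i j => inord (9 + (3 * i + j))) => R g i j.
  exact: gl_coordE.
pose M : 'M[G]_3 := \matrix_(i, j) p 'X_(u i j).
pose N : 'M[G]_3 := \matrix_(i, j) p 'X_(v i j).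
have MN : M *m N = 1%:M.
  apply/matrixP => i j; rewrite mul3 !mxE -!rmorphM -!rmorphD -(rmorph_nat p).
  apply/eqP; rewrite -subr_eq0 -rmorphB; apply/eqP/pk => R g.
  rewrite rmorphB !rmorphD !rmorphM rmorph_nat /= /ev !mevX.
  have E l := uv R g i l; have E' l := uv R g l j.
  by rewrite !(E _).1 !(E' _).2 mx_imx subrr.
exists G, (mkGL MN); split.
  apply: (fgen_surj ps); exists 18%N, (fun i => 'X_i) => F; exists F.
  elim/mpK_ind: F => [c|i|a b aE bE|a b aE bE].
  - by rewrite mCE mevC baseE mpKA kkA.
  - by rewrite mevX.
  - by rewrite rmorphD /= aE bE.
  - by rewrite rmorphM /= aE bE.
move=> R g; have [|f fE] := quot_lift (g := ev R g) ps; first by move=> r /pk.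
exists f; apply: GL_eq; apply/matrixP => i j.
have [E _] := uv R g i j; rewrite mx_fmap -E -[gl_coord _ _](mevX (base R)) -/(ev R g) -fE.
by congr (f _); rewrite [LHS]mxE.
Qed.

Lemma finitely_presented_fgen A B (f : {lrmorphism A -> B}) : finitely_presented f -> fgen f.
Proof.
move=> [n [x [m [rel [h _]]]]]; exists n, x => b; have [P PE] := h b.
by exists P; rewrite mevE.
Qed.

Section X.
Variables (X : kfunctor k) (psi : kmor X (GL3 k)).
Hypothesis psi_smooth : smooth psi.

(** The given chart [V] of GL_3 is not known to be of finite type. It is replaced by a principal
    open subset [Gh] of the universal chart, which is, and over which the localized chart of X is
    generated by the same elements. *)
Lemma X_chart K (x : X K) : is_field K ->
  exists (U : subf X) A (a : X A), [/\ affine_open U a, fgen (base A) & U K x].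
Proof.
move=> Kf; have [lfp _] := psi_smooth.
have [U [A [a [V [B [b [phi [Ua Vb Ux ab phifp]]]]]]]] := lfp K x Kf.
have [n [xs Axs]] := finitely_presented_fgen phifp.
have [g gx] := affine_fact Ua Ux.
have [G [gam [Gf Gu]]] := gl_universal.
have [th thE] := Gu A (psi A a).
have gth : fmap (g \o th) gam = psi K x by rewrite -gx kmor_nat -thE fmapM.
have Vx : V K (fmap (g \o th) gam).
  by rewrite gth -gx kmor_nat ab fmapM; apply: affine_in.
have [h h0 hV] := open_at (affine_open_open Vb) Kf Vx.
have [Gh [i [_ [il _]]]] := loc_at Kf h0.
have [u hu] : exists u, i h * u = 1 by case: il.
have [be beE] : exists be : {lrmorphism B -> Gh}, fmap be b = fmap i gam.
  by apply: (affine_fact Vb); apply: hV; exists u.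
have [Ah [iA [gh [iAl ghE]]]] : exists L (i : {lrmorphism A -> L}) (h' : {lrmorphism L -> K}),
    is_loc (th h) i /\ forall r, h' (i r) = g r by apply: loc_at.
have [thh thhE] : exists e : {lrmorphism Gh -> Ah}, forall r, e (i r) = iA (th r).
  by apply: (@loc_lift _ _ _ _ _ _ (iA \o th) il); case: iAl.
have bb : thh \o be =1 iA \o phi.
  case: Vb => _ _; apply; rewrite -!fmapM beE fmapM -ab -thE fmapM.
  by apply: fmap_eq => r /=.
exists (fun R (x : X R) => exists f : {lrmorphism Ah -> R}, fmap f (fmap iA a) = x), Ah, (fmap iA a).
split; first exact: affine_loc Ua iAl.
  apply: (fgen_trans (f := thh)); first exact: fgen_loc il Gf.
  exists n, (iA \o xs) => z.
  have [m [r mr]] : exists m r, iA (th h) ^+ m * z = iA r by case: iAl.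
  have [P PE] := Axs r.
  have [P' P'E] : exists P', mev thh (iA \o xs) P' = iA r.
    rewrite -PE; elim/mpK_ind: (P) => [c|j|p q [p' pE] [q' qE]|p q [p' pE] [q' qE]].
    + by exists (mC _ _ (be c)); rewrite !mCE !mevC; apply: bb.
    + by exists 'X_j; rewrite !mevX.
    + by exists (p' + q'); rewrite !rmorphD /= pE qE.
    + by exists (p' * q'); rewrite !rmorphM /= pE qE.
  exists (mC _ _ (u ^+ m) * P'); rewrite rmorphM /= P'E mCE mevC -mr rmorphXn mulrA -exprMn /=.
  have -> : thh u * iA (th h) = 1 by rewrite -thhE -rmorphM mulrC hu rmorph1.
  by rewrite expr1n mul1r.
by exists gh; rewrite -gx; apply: fmapT.
Qed.

Variable J : seq ('I_3 * 'I_3).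
Definition zpts R : Type := {t : X R | all (fun ij => mx (psi R t) ij.1 ij.2 == 0) J}.

Lemma zpts_eq R (t t' : zpts R) : sval t = sval t' -> t = t'.
Proof.
case: t t' => [t h] [t' h'] /= E; case: _ / E h' => h'.
by congr exist; apply: bool_irrelevance.
Qed.

Fact zmap_subproof R B (f : {lrmorphism R -> B}) (t : zpts R) :
  all (fun ij => mx (psi B (fmap f (sval t))) ij.1 ij.2 == 0) J.
Proof.
apply/allP => ij ijJ; have /allP /(_ ij ijJ) /eqP h := svalP t.
by rewrite kmor_nat mx_fmap h rmorph0.
Qed.

Definition Zfun : kfunctor k.
Proof.
refine (@KFunctor k zpts (fun R B f t => exist _ (fmap f (sval t)) (zmap_subproof f t)) _ _).
- by move=> R f x fid; apply: zpts_eq; apply: fmap_id.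
- by move=> R B C f g h x e; apply: zpts_eq; apply: fmap_comp.
Defined.

Definition zval R (t : Zfun R) : X R := sval t.
Definition zmk R (t : X R) (h : all (fun ij => mx (psi R t) ij.1 ij.2 == 0) J) : Zfun R :=
  exist _ t h.

Lemma zval_fmap R B (f : {lrmorphism R -> B}) (t : Zfun R) : zval (fmap f t) = fmap f (zval t).
Proof. by []. Qed.

Lemma zval_inj R (t t' : Zfun R) : zval t = zval t' -> t = t'.
Proof. exact: zpts_eq. Qed.

Lemma zval0 R (t : Zfun R) ij : ij \in J -> mx (psi R (zval t)) ij.1 ij.2 = 0.
Proof. by move=> ijJ; have /allP /(_ ij ijJ) /eqP := svalP t. Qed.

Lemma zmkP R (t : X R) : (forall ij, ij \in J -> mx (psi R t) ij.1 ij.2 = 0) ->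
  exists z : Zfun R, zval z = t.
Proof.
move=> h; have H : all (fun ij => mx (psi R t) ij.1 ij.2 == 0) J.
  by apply/allP => ij /h ->.
by exists (zmk H).
Qed.

(** Smoothness over GL_3 allows prescribing the lifted matrix. Its determinant is a unit since it is
    one modulo a square-zero ideal: the approximate inverse d is corrected to d (1 + (1 - d det
    M)). *)
Lemma Z_lift A B (pi : {lrmorphism A -> B}) (x0 : Zfun B) (M : 'M[A]_3) :
  (forall r, exists s, pi s = r) -> (forall r s, pi r = 0 -> pi s = 0 -> r * s = 0) ->
  map_mx pi M = mx (psi B (zval x0)) -> (forall ij, ij \in J -> M ij.1 ij.2 = 0) ->
  exists x : Zfun A, fmap pi x = x0 /\ mx (psi A (zval x)) = M.
Proof.
move=> ps psq ME M0; have [_ fs] := psi_smooth.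
have [d0 d0E] : exists d0, \det (mx (psi B (zval x0))) * d0 = 1.
  by exists (\det (imx (psi B (zval x0)))); rewrite -det_mulmx mxK det1.
have [d dE] := ps d0.
have e0 : pi (1 - \det M * d) = 0.
  by rewrite rmorphB rmorph1 rmorphM /= -det_map_mx ME dE d0E subrr.
have ee := psq _ _ e0 e0.
have Md : \det M * (d * (1 + (1 - \det M * d))) = 1.
  rewrite mulrA; move: ee; set u := \det M * d => ee.
  by rewrite -[RHS]subr0 -[in RHS]ee; ring.
have E : M *m ((d * (1 + (1 - \det M * d))) *: \adj M) = 1%:M.
  by rewrite -scalemxAr mul_mx_adj scale_scalar_mx mulrC Md.
have [|x [xx0 xM]] := fs A B pi (zval x0) (mkGL E : GL3 k A) ps psq.
  by apply: GL_eq; rewrite -[LHS]ME; apply/matrixP => i j; rewrite mx_fmap.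
have [|z zx] := @zmkP A x; first by move=> ij ijJ; rewrite xM; apply: M0.
by exists z; split; [apply: zval_inj; rewrite zval_fmap zx | rewrite zx xM].
Qed.

Lemma Z_smooth : smooth_k Zfun.
Proof.
split.
  move=> A B pi x0 ps psq.
  pose lf r := proj1_sig (constructive_indefinite_description _ (ps r)).
  have lfE r : pi (lf r) = r by rewrite /lf; case: constructive_indefinite_description.
  pose M : 'M[A]_3 := \matrix_(i, j) if (i, j) \in J then 0 else lf (mx (psi B (zval x0)) i j).
  have [||x [xx0 _]] := @Z_lift A B pi x0 M ps psq.
  - apply/matrixP => i j; rewrite !mxE; case: ifP => [ijJ|_]; last by rewrite lfE.
    by rewrite rmorph0 (zval0 x0 ijJ).
  - by move=> [i j] ijJ; rewrite mxE ijJ.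
  - by exists x.
move=> K x Kf; have [U [A [a [Ua fA Ux]]]] := X_chart (zval x) Kf.
have [g gx] := affine_fact Ua Ux.
pose es := [seq mx (psi A a) ij.1 ij.2 | ij <- J].
have span0 R (f : {lrmorphism A -> R}) : (forall ij, ij \in J -> mx (psi R (fmap f a)) ij.1 ij.2 = 0) ->
    forall r, span es r -> f r = 0.
  move=> h; apply: span_sub.
    split; first exact: rmorph0.
    - by move=> u v; rewrite rmorphD /= => -> ->; rewrite addr0.
    - by move=> u v; rewrite rmorphM /= => ->; rewrite mulr0.
  by move=> _ /mapP[ij ijJ ->]; have := h ij ijJ; rewrite kmor_nat mx_fmap.
have s1 : ~ span es 1.
  move=> /(span0 K g) h; apply: (@kalg_nz1 k K); rewrite -[1](rmorph1 g); apply: h => ij ijJ.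
  by rewrite gx zval0.
have [Q [p [ps pk]]] := quot_ex (span_ideal es) s1.
have [z zE] : exists z : Zfun Q, zval z = fmap p a.
  apply: zmkP => ij ijJ; rewrite kmor_nat mx_fmap; apply/pk/span_mem.
  by apply/mapP; exists ij.
exists (fun R t => U R (zval t)), Q, z; split.
- split.
  + by move=> R t; have [I IE] := affine_open_open Ua (zval t); exists I.
  + move=> R t; split=> [|[f <-]]; last by rewrite zval_fmap zE fmapM; apply: affine_in.
    move=> /(affine_fact Ua) [f fE].
    have [|h hE] := quot_lift (g := f) ps.
      by move=> r /pk; apply: span0 => ij ijJ; rewrite fE zval0.
    by exists h; apply: zval_inj; rewrite zval_fmap zE -fE; apply: fmapT.
  + move=> R f f' /(congr1 (@zval R)); rewrite !zval_fmap zE !fmapM => E.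
    by apply: (lr_surj_eq ps); case: Ua => _ _; apply.
- exact: fgen_surj ps fA.
- by [].
Qed.

Lemma entry_locfun i j : locfun (fun R (t : Zfun R) => True) (fun R t => mx (psi R (zval t)) i j).
Proof. by move=> R B f x _; rewrite zval_fmap kmor_nat mx_fmap. Qed.

(** The tangent vector that moves only the entry (i, j) stays in the locus of [J], and the entry has
    derivative 1 along it. *)
Lemma entry_nz K (x : Zfun K) i j : is_field K -> (i, j) \notin J ->
  ~ near x (fun R t => mx (psi R (zval t)) i j = 0).
Proof.
move=> Kf ijJ [V [Vo Vx V0]].
have [T [p [ps pk]]] := trunc_ex K 1.
have [|e eE] := @quot_lift k _ _ _ p (pev (idfun : {lrmorphism K -> K}) 0) ps.
  by move=> r /pk /(_ 0%N isT); rewrite pevE map_poly_id // horner_coef0.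
have es r : exists s, e s = r by exists (p (pC K r)); rewrite eE pCE pevC.
have e0 z : e z = 0 -> exists2 r : {poly K}, p r = z & r`_0 = 0.
  have [r <-] := ps z; rewrite eE pevE map_poly_id // horner_coef0 => r0; by exists r.
have esq u v : e u = 0 -> e v = 0 -> u * v = 0.
  move=> /e0 [r <- r0] /e0 [s <- s0]; rewrite -(rmorphM p); apply/(pk (r * s)) => l l1.
  case: l l1 => [|[|//]] _; first by rewrite coef0M r0 mul0r.
  by rewrite coefM big_ord_recl big_ord1 /= r0 s0 mul0r mulr0 addr0.
pose M : 'M[T]_3 := \matrix_(i', j') p (pC K (mx (psi K (zval x)) i' j') + ((i', j') == (i, j))%:R * pX K).
have [||y [yx yM]] := @Z_lift T K e x M es esq.
- apply/matrixP => i' j'; rewrite !mxE eE rmorphD rmorphM /= pCE pevC pevX mulr0 addr0 //.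
- move=> [i' j'] h; rewrite mxE /= (zval0 x h) rmorph0 add0r.
  by case: eqP => [E|_]; [rewrite -E h in ijJ | rewrite mul0r rmorph0].
have Vy : V T y.
  apply: (nilp_open Vo es); last by rewrite yx.
  by move=> r r0; exists 2%N; rewrite expr2; apply: esq.
have := V0 _ _ Vy; rewrite yM mxE eqxx mul1r => /pk /(_ 1%N isT).
by rewrite pCE coefD coefC coefX add0r; exact: kalg_nz1.
Qed.

End X.
End Charts.

(** * Weights *)

Section ZPow.
Variable R : comNzRingType.
Implicit Types a b c d : R.

(** The argument [b] stands for the inverse of [a]; carrying it along gives negative powers in any
    commutative ring. *)
Definition zpow a b (n : int) : R := match n with Posz n => a ^+ n | Negz n => b ^+ n.+1 end.

Lemma zpow_sub a b (m n : nat) : a * b = 1 -> zpow a b (m%:Z - n%:Z) = a ^+ m * b ^+ n.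
Proof.
move=> ab; have [nm|mn] := leqP n m.
  by rewrite -(subnK nm) PoszD addrK /= exprD -mulrA -exprMn ab expr1n mulr1.
have -> : m%:Z - n%:Z = Negz (n - m).-1 by rewrite NegzE prednK ?subn_gt0 //; lia.
rewrite /= prednK ?subn_gt0 // -[in RHS](subnK (ltnW mn)) exprD mulrCA -exprMn ab expr1n mulr1 //.
Qed.

Lemma int_diff (z : int) : exists m n : nat, z = m%:Z - n%:Z.
Proof.
case: z => n; first by exists n, 0%N; rewrite subr0.
by exists 0%N, n.+1; rewrite sub0r NegzE.
Qed.

Lemma zpowD a b m n : a * b = 1 -> zpow a b (m + n) = zpow a b m * zpow a b n.
Proof.
move=> ab; have [m1 [m2 ->]] := int_diff m; have [n1 [n2 ->]] := int_diff n.
have -> : m1%:Z - m2%:Z + (n1%:Z - n2%:Z) = (m1 + n1)%N%:Z - (m2 + n2)%N%:Z by lia.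
by rewrite !zpow_sub // !exprD mulrACA.
Qed.

Lemma zpowMl a b c d n : zpow (a * c) (b * d) n = zpow a b n * zpow c d n.
Proof. by case: n => n /=; rewrite exprMn. Qed.

Lemma zpowMn a b m (n : nat) : a * b = 1 -> zpow a b (m * n%:Z) = zpow a b m ^+ n.
Proof.
move=> ab; elim: n => [|n IH]; first by rewrite mulr0 expr0.
by rewrite intS mulrDr mulr1 zpowD // IH exprS.
Qed.

Lemma zpowMz a b m n : a * b = 1 -> zpow (zpow a b m) (zpow a b (- m)) n = zpow a b (m * n).
Proof.
move=> ab; case: n => n /=; first by rewrite -zpowMn.
by rewrite -zpowMn // NegzE mulNr mulrN.
Qed.

Lemma zpowN a b m : a * b = 1 -> zpow a b m * zpow a b (- m) = 1.
Proof. by move=> ab; rewrite -zpowD // subrr. Qed.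

Lemma inv_unique a b c : a * b = 1 -> a * c = 1 -> b = c.
Proof. by move=> ab ac; rewrite -[b]mulr1 -ac mulrA [b * a]mulrC ab mul1r. Qed.

End ZPow.

Section Weights.
Variable k : closedFieldType.
Notation kalg := (comAlgType k).
Implicit Types (R A B C D K L Q T : kalg).

Definition ch R (x : GL3 k R) (a b c : int) : R :=
  zpow (mx x o0 o0) (imx x o0 o0) a * zpow (mx x o1 o1) (imx x o1 o1) b *
  zpow (mx x o2 o2) (imx x o2 o2) c.

Lemma character_ch R (x : GL3 k R) a b c : character (weight a b c) x = ch x a b c.
Proof. by rewrite /character prod3 /weight !mxE. Qed.

Lemma det3E (R : comNzRingType) (M : 'M[R]_3) : \det M =
  M o0 o0 * (M o1 o1 * M o2 o2 - M o1 o2 * M o2 o1)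
  - M o0 o1 * (M o1 o0 * M o2 o2 - M o1 o2 * M o2 o0)
  + M o0 o2 * (M o1 o0 * M o2 o1 - M o1 o1 * M o2 o0).
Proof.
have e : forall F : nat -> nat -> R, \det (\matrix_(i < 3, j < 3) F i j) =
    F 0 0 * (F 1 1 * F 2 2 - F 1 2 * F 2 1) - F 0 1 * (F 1 0 * F 2 2 - F 1 2 * F 2 0)
    + F 0 2 * (F 1 0 * F 2 1 - F 1 1 * F 2 0).
  move=> F; rewrite (expand_det_row _ 0) !big_ord_recl !big_ord0 /cofactor.
  rewrite !(expand_det_row _ 0) !big_ord_recl !big_ord0 /cofactor !det_mx11 !mxE /= /bump /=.
  by ring.
have -> : M = \matrix_(i < 3, j < 3) M (inord i) (inord j).
  by apply/matrixP => i j; rewrite mxE !inord_val.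
rewrite (e (fun i j => M (inord i) (inord j))) !mxE.
have i0 : inord 0 = o0 by apply: val_inj; rewrite /= inordK.
have i1 : inord 1 = o1 by apply: val_inj; rewrite /= inordK.
have i2 : inord 2 = o2 by apply: val_inj; rewrite /= inordK.
by rewrite !inord_val ?i0 ?i1 ?i2.
Qed.

Section Borel.
Variables (R : kalg) (x : GL3 k R).
Hypothesis xi : forall i, mx x i i * imx x i i = 1.

Lemma chD a b c a' b' c' : ch x (a + a') (b + b') (c + c') = ch x a b c * ch x a' b' c'.
Proof. by rewrite /ch !zpowD //; ring. Qed.

Lemma chX a b c (n : nat) : ch x (a * n%:Z) (b * n%:Z) (c * n%:Z) = ch x a b c ^+ n.
Proof. by rewrite /ch !zpowMn // !exprMn. Qed.

Lemma chN a b c : ch x a b c * ch x (- a) (- b) (- c) = 1.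
Proof. by rewrite -chD !subrr /ch /= !mulr1. Qed.

Lemma chZ a b c n : zpow (ch x a b c) (ch x (- a) (- b) (- c)) n = ch x (a * n) (b * n) (c * n).
Proof. by rewrite /ch !zpowMl !zpowMz. Qed.

End Borel.

Variable q : nat.
Hypothesis q0 : (0 < q)%N.

(** The relations that enter the entries of x g y^-1 for (x, y) in E'. *)
Record flag_pair R (x y : GL3 k R) : Prop := FlagPair {
  fp_x : [/\ mx x o0 o1 = 0, mx x o0 o2 = 0 & mx x o1 o2 = 0];
  fp_u : forall i, mx x i i * imx x i i = 1;
  fp_v : [/\ imx y o0 o1 = 0, imx y o2 o0 = 0 & imx y o2 o1 = 0];
  fp_q : forall i, imx y i i = imx x i i ^+ q }.

Lemma flag_pairP R (x y : GL3 k R) : zip_group_flag q x y -> flag_pair x y.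
Proof.
move=> [/zip_entries [[x02 x12] [y20 y21] yx] xb].
have x01 : mx x o0 o1 = 0 by apply: xb.
have xu : forall i, mx x i i * imx x i i = 1.
  have u0 : mx x o0 o0 * imx x o0 o0 = 1.
    by have := mx_imx x o0 o0; rewrite x01 x02 !mul0r !addr0.
  have u1 : mx x o1 o1 * imx x o1 o1 = 1.
    have v01 : imx x o0 o1 = 0.
      have := mx_imx x o0 o1; rewrite x01 x02 !mul0r !addr0 /= => h.
      by rewrite -[LHS]mul1r -u0 mulrAC h mul0r.
    by have := mx_imx x o1 o1; rewrite v01 x12 mulr0 mul0r add0r addr0.
  have u2 : mx x o2 o2 * imx x o2 o2 = 1.
    by have := imx_mx x o2 o2; rewrite x02 x12 !mulr0 !add0r mulrC.
  by elim/ord3P.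
have y01 : mx y o0 o1 = 0 by rewrite yx // x01 expr0n eqn0Ngt q0.
have yu i : mx y i i * imx x i i ^+ q = 1.
  by rewrite yx /same ?eqxx // -exprMn xu expr1n.
have c0 i a : a * mx y i i = 0 -> a = 0.
  by move=> h; rewrite -[a]mulr1 -(yu i) mulrA h mul0r.
have v21 : imx y o2 o1 = 0.
  apply: (c0 o1); have := imx_mx y o2 o1.
  by rewrite y01 y21 !mulr0 add0r addr0.
have v20 : imx y o2 o0 = 0.
  apply: (c0 o0); have := imx_mx y o2 o0.
  by rewrite v21 y20 mulr0 mul0r !addr0.
have v01 : imx y o0 o1 = 0.
  apply: (c0 o1); have := imx_mx y o0 o1.
  by rewrite y01 y21 !mulr0 add0r addr0.
split=> //; elim/ord3P; apply: inv_unique (yu _).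
- by have := imx_mx y o0 o0; rewrite v01 y20 mulr0 mul0r !addr0 mulrC.
- by have := imx_mx y o1 o1; rewrite y01 y21 !mulr0 add0r addr0 mulrC.
- by have := imx_mx y o2 o2; rewrite v20 v21 !mul0r !add0r mulrC.
Qed.

Section Action.
Variables (R : kalg) (x y g : GL3 k R).
Hypothesis fp : flag_pair x y.
Let g' := mx (glM (glM x g) (glV y)).

Let ch1 a b (n : nat) : a * b = 1 -> a * b ^+ n = zpow a b (1 - n%:Z) :> R.
Proof. by move=> ab; rewrite (zpow_sub 1) // expr1. Qed.

Let zpq i : zpow (mx x i i) (imx x i i) (- q%:Z) = imx x i i ^+ q.
Proof. by have [_ u _ _] := fp; rewrite -[- _]add0r (zpow_sub 0) // mul1r. Qed.

Let zp1 i : zpow (mx x i i) (imx x i i) 1 = mx x i i.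
Proof. by []. Qed.

Let zp0 i : zpow (mx x i i) (imx x i i) 0 = 1.
Proof. by []. Qed.

Let gE i j : g' i j = (mx x i o0 * mx g o0 o0 + mx x i o1 * mx g o1 o0 + mx x i o2 * mx g o2 o0) * imx y o0 j
  + (mx x i o0 * mx g o0 o1 + mx x i o1 * mx g o1 o1 + mx x i o2 * mx g o2 o1) * imx y o1 j
  + (mx x i o0 * mx g o0 o2 + mx x i o1 * mx g o1 o2 + mx x i o2 * mx g o2 o2) * imx y o2 j.
Proof. by rewrite /g' !mxM mxV !mul3. Qed.

(** The semi-invariants of this section: g_01 and det g everywhere, g_00 and g_11 on the divisor
    g_01 = 0, and g_02 and g_21 only where moreover g_00, respectively g_11, vanishes. *)
Lemma act01 : g' o0 o1 = ch x 1 (- q%:Z) 0 * mx g o0 o1.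
Proof.
have [[x01 x02 x12] u [v01 v20 v21] vq] := fp.
by rewrite gE x01 x02 v01 v21 vq /ch zpq zp1 zp0; ring.
Qed.

Lemma act00 : mx g o0 o1 = 0 -> g' o0 o0 = ch x (1 - q%:Z) 0 0 * mx g o0 o0.
Proof.
have [[x01 x02 x12] u [v01 v20 v21] vq] := fp => g01.
by rewrite gE x01 x02 v20 g01 vq /ch -ch1 // !zp0; ring.
Qed.

Lemma act11 : mx g o0 o1 = 0 -> g' o1 o1 = ch x 0 (1 - q%:Z) 0 * mx g o1 o1.
Proof.
have [[x01 x02 x12] u [v01 v20 v21] vq] := fp => g01.
by rewrite gE x12 v01 v21 g01 vq /ch -ch1 // !zp0; ring.
Qed.

Lemma act02 : mx g o0 o0 = 0 -> mx g o0 o1 = 0 -> g' o0 o2 = ch x 1 0 (- q%:Z) * mx g o0 o2.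
Proof.
have [[x01 x02 x12] u [v01 v20 v21] vq] := fp => g00 g01.
by rewrite gE x01 x02 g00 g01 vq /ch zpq zp1 !zp0; ring.
Qed.

Lemma act21 : mx g o0 o1 = 0 -> mx g o1 o1 = 0 -> g' o2 o1 = ch x 0 (- q%:Z) 1 * mx g o2 o1.
Proof.
have [[x01 x02 x12] u [v01 v20 v21] vq] := fp => g01 g11.
by rewrite gE g11 g01 v01 v21 vq /ch zpq zp1 !zp0; ring.
Qed.

Lemma act_det : \det g' = ch x (1 - q%:Z) (1 - q%:Z) (1 - q%:Z) * \det (mx g).
Proof.
have [[x01 x02 x12] u [v01 v20 v21] vq] := fp.
rewrite /g' !mxM mxV !det_mulmx [\det (mx x)]det3E [\det (imx y)]det3E x01 x02 x12 v01 v20 v21 !vq.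
by rewrite /ch -!ch1 //; ring.
Qed.

End Action.
End Weights.

(** * Universal points of the zip group *)

Section Universal.
Variable k : closedFieldType.
Notation kalg := (comAlgType k).
Implicit Types (R A B C D K L Q T : kalg).

Definition invertible R (r : R) : Prop := exists y, r * y = 1.

Lemma invertibleM R (a b : R) : invertible a -> invertible b -> invertible (a * b).
Proof. by move=> [a' aE] [b' bE]; exists (a' * b'); rewrite mulrACA aE bE mulr1. Qed.

Lemma invertibleX R (a : R) n : invertible a -> invertible (a ^+ n).
Proof.
move=> au; elim: n => [|n IH]; first by exists 1; rewrite mulr1.
by rewrite exprS; apply: invertibleM.
Qed.

Lemma invertible_map R B (f : {lrmorphism R -> B}) (a : R) : invertible a -> invertible (f a).
Proof. by move=> [b ab]; exists (f b); rewrite -rmorphM ab rmorph1. Qed.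

Lemma invertible_nz K (a : K) : invertible a -> a <> 0.
Proof. by move=> [b ab] a0; apply: (@kalg_nz1 k K); rewrite -ab a0 mul0r. Qed.

Lemma invertible_inj R (u a : R) : invertible u -> u * a = 0 -> a = 0.
Proof. by move=> [v uv] ua; rewrite -[a]mul1r -uv mulrAC ua mul0r. Qed.

Lemma invertible_factor R (a b : R) : invertible (a * b) -> invertible a.
Proof. by move=> [c abc]; exists (b * c); rewrite mulrA. Qed.

(* [i] is a localization at some multiplicative set *)
Definition locz B L (i : {lrmorphism B -> L}) : Prop :=
  (forall z, exists u b, invertible (i u) /\ i u * z = i b) /\
  (forall b, i b = 0 -> exists u, invertible (i u) /\ u * b = 0).

Lemma locz_loc B L (s : B) (i : {lrmorphism B -> L}) : is_loc s i -> locz i.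
Proof.
move=> [shear iz ik]; split=> [z|b].
  have [n [r E]] := iz z; exists (s ^+ n), r; rewrite rmorphXn /=; split=> //.
  exact: invertibleX.
by move=> /ik [n E]; exists (s ^+ n); rewrite rmorphXn /=; split=> //; apply: invertibleX.
Qed.

Lemma locz_comp B C L (i : {lrmorphism B -> C}) (j : {lrmorphism C -> L}) :
  locz i -> locz j -> locz (j \o i).
Proof.
move=> [i1 i2] [j1 j2]; split=> [z|b /= /j2 [u [uu]]].
  have [u [c [uu uz]]] := j1 z.
  have [v [b [vu vc]]] := i1 c; have [w [d [wu wd]]] := i1 u.
  have E : j (i (v * d)) = j (i v) * (j (i w) * j u) by rewrite !rmorphM /= -wd rmorphM.
  exists (v * d), (w * b); rewrite /= E; split.
    by apply: invertibleM; [exact: invertible_map | apply: invertibleM => //; exact: invertible_map].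
  by rewrite rmorphM rmorphM /= -vc rmorphM /= -uz; ring.
have [w [d [wu wd]]] := i1 u => ub.
have : i (d * b) = 0 by rewrite rmorphM /= -wd -mulrA ub mulr0.
move=> /i2 [v [vu vb]]; exists (v * d); rewrite -mulrA; split=> //=.
rewrite rmorphM rmorphM /= -wd rmorphM /=; apply: invertibleM; first exact: invertible_map.
by apply: invertibleM => //; exact: invertible_map.
Qed.

Definition nzd R (e : R) : Prop := forall z, e * z = 0 -> z = 0.

Lemma nzdM R (a b : R) : nzd a -> nzd b -> nzd (a * b).
Proof. by move=> ha hb z; rewrite -mulrA => /ha /hb. Qed.

Lemma nzdX R (a : R) n : nzd a -> nzd (a ^+ n).
Proof.
move=> ha; elim: n => [|n IH]; first by move=> z; rewrite mul1r.
by rewrite exprS; apply: nzdM.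
Qed.

Lemma nzd_locz B L (i : {lrmorphism B -> L}) e : locz i -> nzd e -> nzd (i e).
Proof.
move=> [i1 i2] eN z; have [u [b [uu uz]]] := i1 z => ez.
have : i (e * b) = 0 by rewrite rmorphM /= -uz mulrCA ez mulr0.
move=> /i2 [v [vu]]; rewrite mulrCA => /eN vb.
apply: (invertible_inj uu); rewrite uz; apply: (invertible_inj vu).
by rewrite -rmorphM vb rmorph0.
Qed.

Lemma nzd_mC A n (e : A) : nzd e -> nzd (mC A n e).
Proof.
move=> eN z; rewrite mCE => ez; apply/mpolyP => m; rewrite mcoeff0.
by apply: eN; rewrite -mcoeffCM ez mcoeff0.
Qed.

Lemma is_loc_id K (s : K) : invertible s -> is_loc s (idfun : {lrmorphism K -> K}).
Proof.
move=> shear; split=> //= [z|r ->]; first by exists 0%N, z; rewrite mul1r.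
by exists 0%N; rewrite mulr0.
Qed.

Variable q : nat.

(** The E-torsor of [zeta] reduced to the action and the smooth equivariant map to GL_3; orbits and
    local sections enter later as hypotheses on the maps to [S] and to the flag space. *)
Record zipact := ZipAct {
  zX :> kfunctor k;
  zA : forall R, GL3 k R -> GL3 k R -> zX R -> zX R;
  zpsi : kmor zX (GL3 k);
  zq0 : (0 < q)%N;
  zfrob : forall R (a b : R), (a + b) ^+ q = a ^+ q + b ^+ q;
  zsmooth : smooth zpsi;
  zact1 : forall R (t : zX R), zA (gl1 3 R) (gl1 3 R) t = t;
  zactM : forall R (x y x' y' : GL3 k R) (t : zX R), zip_group q x y -> zip_group q x' y' ->
     zA (glM x x') (glM y y') t = zA x y (zA x' y' t);
  zact_map : forall R B (f : {lrmorphism R -> B}) (x y : GL3 k R) (t : zX R),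
     zip_group q x y -> fmap f (zA x y t) = zA (fmap f x : GL3 k B) (fmap f y : GL3 k B) (fmap f t);
  zpsi_act : forall R (x y : GL3 k R) (t : zX R), zip_group q x y ->
     zpsi R (zA x y t) = glM (glM x (zpsi R t)) (glV y) }.

Variable X : zipact.
Notation psi := (zpsi X).

Definition in_flag fl R (x y : GL3 k R) : Prop :=
  if fl then zip_group q x y else zip_group_flag q x y.

Lemma in_flag_zip fl R (x y : GL3 k R) : in_flag fl x y -> zip_group q x y.
Proof. by case: fl => // -[]. Qed.

Lemma in_flag_map fl R B (f : {lrmorphism R -> B}) (x y : GL3 k R) :
  in_flag fl x y -> in_flag fl (fmap f x : GL3 k B) (fmap f y : GL3 k B).
Proof.
have q0 := zq0 X.
case: fl => /= [h|[h b]]; first exact: zip_fmap.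
by split; [exact: zip_fmap | move=> i j ij; rewrite mx_fmap b // rmorph0].
Qed.

Lemma in_flag_x01 R (x y : GL3 k R) : zip_group q x y -> mx x o0 o1 = 0 -> zip_group_flag q x y.
Proof.
move=> h x01; split=> //; have [[x02 x12] _ _] := zip_entries h.
by elim/ord3P; elim/ord3P.
Qed.

(** Every pair over an A-algebra is a specialization of one over a localization of A[X_1, ..., X_9].
    Nonzero divisors of [A] remain so there; thus factors such as g_00 can be cancelled at the
    universal pair even if they are zero divisors after specialization. *)
Lemma univ_pair fl A R (g : {lrmorphism A -> R}) (x y : GL3 k R) : in_flag fl x y ->
  exists L (i : {lrmorphism mpK A 9 -> L}) (h : {lrmorphism L -> R}) (x' y' : GL3 k L),
    [/\ exists s, is_loc s i, forall r, h (i (mC A 9 r)) = g r, in_flag fl x' y', fmap h x' = x & fmap h y' = y].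
Proof.
have q0 := zq0 X; have frobD := zfrob X.
move=> xy; have xyz := in_flag_zip xy.
have x01 : ~~ fl -> mx x o0 o1 = 0 by case: fl xy => //= -[_ b] _; apply: b.
have [c [d [cd xE y02 y12]]] := zip_coord xyz x01.
pose ev : {lrmorphism mpK A 9 -> R} := mev g c.
pose Xv (l : 'I_9) : mpK A 9 := 'X_l.
pose s : mpK A 9 := \det (xm fl Xv).
have sE : ev s = \det (xm fl c).
  rewrite /s -det_map_mx map_xm; congr (\det _); apply/matrixP => a b.
  by rewrite !mxE; case: (nat_of_ord a) => [|[|?]]; case: (nat_of_ord b) => [|[|?]] //;
    rewrite /= ?mevX //; case: fl {xy x01 s cd xE sE} => //=; rewrite mevX.
have sn n : s ^+ n <> 0.
  move=> sn0; apply: (@invertible_nz R (\det (xm fl c) ^+ n)); first by apply: invertibleX; exists d.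
  by rewrite -sE -rmorphXn /= sn0 rmorph0.
have [L [i il]] := loc_ex sn.
have [h hE] : exists h : {lrmorphism L -> R}, forall r, h (i r) = ev r.
  by apply: (loc_lift il); exists d; rewrite sE.
have [d' dE'] : exists d', \det (xm fl (i \o Xv)) * d' = 1.
  by case: il => -[d' d'E] _ _; exists d'; rewrite -map_xm det_map_mx.
have [x' [y' [z' x'E y02' y12']]] := zip_univ q0 frobD dE'.
have hx : map_mx h (mx x') = mx x.
  rewrite x'E xE map_xm; apply/matrixP => a b; rewrite !mxE.
  by case: (nat_of_ord a) => [|[|?]]; case: (nat_of_ord b) => [|[|?]] //;
    rewrite /= ?hE /ev ?mevX //; case: fl {xy x01 s cd xE sE sn il dE' x'E} => //=; rewrite hE /ev mevX.
have [ex ey] : fmap h x' = x /\ fmap h y' = y.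
  apply: (zip_eq (zip_fmap q0 h z') xyz).
  - by [].
  - by rewrite mx_fmap y02' y02 /= hE /ev mevX.
  - by rewrite mx_fmap y12' y12 /= hE /ev mevX.
exists L, i, h, x', y'; split=> //.
- by exists s.
- by move=> r; rewrite hE mCE /ev mevC.
- case: (fl) x'E => //= x'E; apply: in_flag_x01 => //.
  by rewrite x'E mxE.
Qed.

(** Localizes the universal algebra [L] until [V] holds there and not only after specialization to
    [R]; the price is a localization of [R]. *)
Lemma univ_open (Y : kfunctor k) B L R K (i : {lrmorphism B -> L}) (h : {lrmorphism L -> R})
    (ka : {lrmorphism R -> K}) (V : subf Y) (y : Y L) : locz i -> is_field K -> open_sub V ->
  V R (fmap h y) -> exists2 s : R, ka s <> 0 & forall R' (j : {lrmorphism R -> R'}), is_loc s j ->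
    exists L' (l : {lrmorphism L -> L'}) (h' : {lrmorphism L' -> R'}),
      [/\ locz (l \o i), forall r, h' (l r) = j (h r) & V L' (fmap l y)].
Proof.
move=> il Kf Vo Vy.
have Vk : V K (fmap (ka \o h) y) by rewrite -fmapM; apply: open_fmap.
have [s s0 sV] := open_at Vo Kf Vk.
have [L' [l [_ [ll _]]]] := loc_at Kf s0.
exists (h s) => // R' j jl.
have [h' h'E] : exists h' : {lrmorphism L' -> R'}, forall r, h' (l r) = j (h r).
  by apply: (@loc_lift _ _ _ _ _ _ (j \o h) ll); case: jl.
exists L', l, h'; split=> //; first exact: locz_comp il (locz_loc ll).
by apply: sV; case: ll.
Qed.

(** The entry is nowhere locally zero and charts are locally domains. *)
Lemma chart_nzd J (U : subf (Zfun psi J)) A (a : Zfun psi J A) i j : affine_open U a ->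
  (i, j) \notin J -> nzd (mx (psi A (zval a)) i j).
Proof.
move=> Ua ijJ z ez; have [phi [phiU phiE]] := mk_locfun z Ua.
have Zs := Z_smooth (zsmooth X) J.
rewrite -phiE; apply: (nzd_loc Zs (affine_open_open Ua)
  (locfun_sub (fun R x _ => I) (@entry_locfun _ _ psi J i j)) phiU) (affine_self Ua).
  by move=> K x Kf _; apply: (entry_nz (zsmooth X)).
move=> R y /(affine_fact Ua) [f <-].
rewrite phiU; last exact: affine_self Ua.
by rewrite entry_locfun // phiE -rmorphM ez rmorph0.
Qed.

End Universal.

Section Pull.
Variable k : closedFieldType.
Notation kalg := (comAlgType k).
Implicit Types (R A B C D K L Q T : kalg).

Lemma open_pull (Y Z : kfunctor k) (iota : kmor Y Z) (V : subf Z) : open_sub V ->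
  open_sub (fun R (y : Y R) => V R (iota R y)).
Proof.
by move=> Vo R y; have [I IE] := Vo R (iota R y); exists I => B f; rewrite kmor_nat IE.
Qed.

Lemma near_pull (Y Z : kfunctor k) (iota : kmor Y Z) K (x : Y K) (Q : forall R, Z R -> Prop) :
  near (iota K x) Q -> near x (fun R y => Q R (iota R y)).
Proof.
move=> [V [Vo Vx VQ]]; exists (fun R y => V R (iota R y)).
by split=> //; [exact: open_pull | move=> R y; exact: VQ].
Qed.

Lemma nfun_pull (Y Z : kfunctor k) (iota : kmor Y Z) K (x : Y K) phi :
  nfun (iota K x) phi -> nfun x (fun R y => phi R (iota R y)).
Proof.
move=> [V [Vo Vx VQ]]; exists (fun R y => V R (iota R y)).
by split=> //; [exact: open_pull | move=> R B f y Vy; rewrite kmor_nat VQ].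
Qed.

(** Brings relations from A[X_1, ..., X_n] back to [A]: one compares coefficients at a monomial
    where the denominator has a coefficient that does not vanish at [g]. *)
Lemma coef_pt A K n (g : {lrmorphism A -> K}) (h : {lrmorphism mpK A n -> K}) (u : mpK A n) :
  (forall r, h (mC A n r) = g r) -> h u <> 0 -> exists m, g ((u : {mpoly A[n]})@_m) <> 0.
Proof.
move=> hg hu; apply: NNPP => H; apply: hu.
rewrite [u](mpolyE (u : {mpoly A[n]})) (big_morph h (rmorphD h) (rmorph0 h)).
apply: big1 => m _.
transitivity (h (mC A n ((u : {mpoly A[n]})@_m) * ('X_[m] : {mpoly A[n]}))).
  by congr (h _); rewrite mCE mul_mpolyC.
rewrite rmorphM /= hg (_ : g _ = 0) ?mul0r //.
by apply: NNPP => h0; apply: H; exists m.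
Qed.

End Pull.

(** * Factorizations on the divisor g_01 = 0 *)

Section Factor.
Variable k : closedFieldType.
Notation kalg := (comAlgType k).
Implicit Types (R A B C K L Q T : kalg).
Variables (q : nat) (X : zipact k q).
Notation psi := (zpsi X).
Variable F : forall R, X R -> R.
Hypothesis Fn : locfun (fun R (t : X R) => True) F.
Variables a1 a2 a3 : int.
Hypothesis Fw : forall R (x y : GL3 k R) (t : X R), zip_group_flag q x y ->
  F (zA x y t) = ch x a1 a2 a3 * F t.

(** The boolean selects g_00 ([false]) or g_11 ([true]), and at the same time the curve on which
    this entry vanishes. *)
Definition dg (b : bool) : 'I_3 := if b then o1 else o0.
Definition ent b R (t : X R) : R := mx (psi R t) (dg b) (dg b).
Definition mon (m : bool -> nat) R (t : X R) : R := ent false t ^+ m false * ent true t ^+ m true.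
Notation D := (Zfun psi [:: (o0, o1)]).
(** The weight of [mon m] on the divisor g_01 = 0. *)
Definition chm (m : bool -> nat) R (x : GL3 k R) : R :=
  ch x ((1 - q%:Z) * (m false)%:Z) ((1 - q%:Z) * (m true)%:Z) 0.

Lemma monE b m R (t : X R) : mon m t = ent b t ^+ m b * ent (~~ b) t ^+ m (~~ b).
Proof. by case: b; rewrite /mon 1?mulrC. Qed.

Lemma ent_map b R B (f : {lrmorphism R -> B}) (t : X R) : ent b (fmap f t) = f (ent b t).
Proof. by rewrite /ent kmor_nat mx_fmap. Qed.

Lemma mon_map m R B (f : {lrmorphism R -> B}) (t : X R) : mon m (fmap f t) = f (mon m t).
Proof. by rewrite /mon !ent_map rmorphM !rmorphXn. Qed.

Lemma F_map R B (f : {lrmorphism R -> B}) (t : X R) : F (fmap f t) = f (F t).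
Proof. exact: Fn. Qed.

Lemma D0 R (t : D R) : mx (psi R (zval t)) o0 o1 = 0.
Proof. by apply: (zval0 t (ij := (o0, o1))); rewrite inE. Qed.

Lemma D_mk R (t : X R) : mx (psi R t) o0 o1 = 0 -> exists y : D R, zval y = t.
Proof. by move=> h; apply: zmkP => ij; rewrite inE => /eqP ->. Qed.

Lemma mon_act m R (x y : GL3 k R) (t : X R) : zip_group_flag q x y -> mx (psi R t) o0 o1 = 0 ->
  mon m (zA x y t) = chm m x * mon m t.
Proof.
move=> xy t0; have fp := flag_pairP (zq0 X) xy; have [_ u _ _] := fp.
rewrite /mon /ent zpsi_act; last by case: xy.
rewrite (act00 fp t0) (act11 fp t0) [X in X * _]exprMn [X in _ * X]exprMn -!chX // mulrACA -chD //.
by rewrite /chm !mul0r add0r !addr0.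
Qed.

Lemma act_D R (x y : GL3 k R) (t : X R) : zip_group_flag q x y -> mx (psi R t) o0 o1 = 0 ->
  mx (psi R (zA x y t)) o0 o1 = 0.
Proof.
move=> xy t0; rewrite zpsi_act; last by case: xy.
by rewrite (act01 _ (flag_pairP (zq0 X) xy)) t0 mulr0.
Qed.

Definition mon_locfun m : locfun (fun R (t : D R) => True) (fun R t => mon m (zval t)).
Proof. by move=> R B f x _; rewrite zval_fmap mon_map. Qed.

Definition F_locfun : locfun (fun R (t : D R) => True) (fun R t => F (zval t)).
Proof. by move=> R B f x _; rewrite zval_fmap F_map. Qed.

Lemma mon_nzd m (U : subf D) A (a : D A) : affine_open U a -> nzd (mon m (zval a)).
Proof. by move=> Ua; apply: nzdM; apply: nzdX; apply: (chart_nzd Ua). Qed.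

Let Ds : smooth_k D := Z_smooth (zsmooth X) _.

Lemma mon_cancel m (W : subf D) (phi : forall R, D R -> R) : open_sub W -> locfun W phi ->
  (forall R (y : D R), W R y -> mon m (zval y) * phi R y = 0) ->
  forall R (y : D R), W R y -> phi R y = 0.
Proof.
move=> Wo pW; apply: (nzd_loc Ds Wo (locfun_sub (fun R x _ => I) (@mon_locfun m)) pW) => K x Kf Wx.
have [U [A [a [g [Ua fA _ Wa ga]]]]] := chart_near Ds Kf Wo Wx.
rewrite -ga => /(near_chart0 g Ua Kf Wa Wo) [].
  exact: (locfun_sub (fun R x _ => I) (@mon_locfun m)).
by move=> s s0; rewrite mulrC => /(mon_nzd Ua) s00; apply: s0; rewrite s00 rmorph0.
Qed.

(* Near [x], [F] factors as [g_00^(m false) g_11^(m true) f'] on the divisor g_01 = 0. *)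
Definition factors_near m K (x : D K) : Prop :=
  exists2 f', nfun x f' & near x (fun R y => F (zval y) = mon m (zval y) * f' R y).

Lemma nfun_near K (x : D K) (f' : forall R, D R -> R) (Q : forall R, D R -> Prop) :
  nfun x f' -> near x Q -> exists V : subf D,
    [/\ open_sub V, V K x, locfun V f' & forall R y, V R y -> Q R y].
Proof.
move=> [V [Vo Vx Vf]] [W [Wo Wx WQ]]; exists (fun R y => V R y /\ W R y); split=> //.
- exact: open_cap.
- by move=> R B f y [/Vf].
- by move=> R y [_ /WQ].
Qed.

Lemma fac_uniq m (V V' : subf D) (f' f'' : forall R, D R -> R) R (y : D R) :
  open_sub V -> open_sub V' -> locfun V f' -> locfun V' f'' ->
  (forall R (y : D R), V R y -> F (zval y) = mon m (zval y) * f' R y) ->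
  (forall R (y : D R), V' R y -> F (zval y) = mon m (zval y) * f'' R y) ->
  V R y -> V' R y -> f' R y = f'' R y.
Proof.
move=> Vo Vo' Vf Vf' VF VF' Vy Vy'; apply/eqP; rewrite -subr_eq0; apply/eqP.
apply: (@mon_cancel m (fun R y => V R y /\ V' R y) (fun R y => f' R y - f'' R y)) => //.
- exact: open_cap.
- by move=> B C f z [Vz Vz']; rewrite rmorphB /= Vf // Vf'.
- by move=> B z [Vz Vz']; rewrite mulrBr -VF // -VF' // subrr.
Qed.

Lemma fac_chartP m (U : subf D) A (a : D A) K (g : {lrmorphism A -> K}) :
  affine_open U a -> is_field K ->
  factors_near m (fmap g a) <-> exists s b, g s <> 0 /\ s * F (zval a) = mon m (zval a) * b.
Proof.
move=> Ua Kf; split.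
  move=> [f' fn fF]; have [V [Vo Vx Vf VF]] := nfun_near fn fF.
  have [s s0 sV] := open_at Vo Kf Vx.
  have [L [i [h [il hE]]]] := loc_at Kf s0.
  have VL : V L (fmap i a) by apply: sV; case: il.
  have E := VF _ _ VL; rewrite zval_fmap F_map mon_map in E.
  have [n [b bE]] : exists n b, i s ^+ n * f' L (fmap i a) = i b by case: il => _ h' _; apply: h'.
  have [|n' E'] := loc_inj (a := s ^+ n * F (zval a)) (b := mon m (zval a) * b) il.
    by rewrite [LHS]rmorphM [RHS]rmorphM rmorphXn /= E -bE mulrCA.
  exists (s ^+ (n' + n)), (s ^+ n' * b); split; first by rewrite rmorphXn /= => /(fieldX Kf).
  by rewrite exprD -mulrA E' mulrCA.
move=> [s [b [s0 E]]]; have [L [i [h [il hE]]]] := loc_at Kf s0.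
have UL := affine_loc Ua il.
have [y sy] : exists y, i s * y = 1 by case: il.
have [f' [f'U f'E]] := mk_locfun (y * i b) UL.
have xE : fmap g a = fmap h (fmap i a) by rewrite fmapM; apply: fmap_eq => r /=.
have Ux := affine_in h UL; rewrite -xE in Ux.
exists f'; first by eexists; split; [exact: affine_open_open UL | exact: Ux | exact: f'U].
eexists; split; [exact: affine_open_open UL | exact: Ux |].
move=> R _ [f <-]; rewrite f'U; last exact: affine_self UL.
rewrite !zval_fmap !F_map !mon_map f'E -rmorphM; congr (f _).
by rewrite mulrCA -rmorphM -E rmorphM mulrA [y * _]mulrC sy mul1r.
Qed.

(** The weight (b_1, b_2, a_3) of the cofactor of [mon m] in [F]. *)
Definition chf (m : bool -> nat) R (x : GL3 k R) : R :=
  ch x (a1 + (q%:Z - 1) * (m false)%:Z) (a2 + (q%:Z - 1) * (m true)%:Z) a3.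

(** Semi-invariance of the cofactor. Over [R] the monomial may be a zero divisor, so the identity is
    proved at the universal pair over the chart, where the monomial can be cancelled, and then
    specialized. *)
Lemma transport0 m (U : subf D) A (a : D A) R (g : {lrmorphism A -> R}) (x y : GL3 k R)
    (V V' : subf D) (f' f1 : forall R, D R -> R) (t' : D R) :
  affine_open U a -> V A a -> open_sub V -> open_sub V' -> locfun V f' -> locfun V' f1 ->
  (forall R (y : D R), V R y -> F (zval y) = mon m (zval y) * f' R y) ->
  (forall R (y : D R), V' R y -> F (zval y) = mon m (zval y) * f1 R y) ->
  zip_group_flag q x y -> zval t' = zA x y (zval (fmap g a)) -> V' R t' ->
  f1 R t' = chf m x * f' R (fmap g a).
Proof.
move=> Ua Va Vo Vo' Vf Vf' VF VF' xy t'E Vt'.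
have [L [i [h [x' [y' [[sd /locz_loc il] hE xy' hx hy]]]]]] := univ_pair X g (xy : in_flag q false x y).
pose aL : D L := fmap (i \o mC A 9) a.
have [aL' aLE] : exists z : D L, zval z = zA x' y' (zval aL).
  by apply: D_mk; apply: act_D => //; apply: D0.
have hL' : fmap h aL' = t'.
  apply: zval_inj; rewrite zval_fmap aLE zact_map; last by case: xy'.
  rewrite hx hy t'E; congr (zA _ _ _); rewrite -!zval_fmap; congr zval.
  exact: fmapT.
apply: local_eq_loc => K ka Kf; rewrite -hL' in Vt'.
have [s s0 sP] := univ_open ka il Kf Vo' Vt'; exists s => // R' j jl.
have [L' [l [h' [lil h'E VL']]]] := sP R' j jl.
have VL : V L' (fmap l aL) by rewrite /aL fmapM; apply: open_fmap.
have xy'' : zip_group_flag q (fmap l x' : GL3 k L') (fmap l y' : GL3 k L').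
  exact: (in_flag_map X (fl := false) l xy').
have [_ u _ _] := flag_pairP (zq0 X) xy''.
have E' := VF' _ _ VL'.
have zE : zval (fmap l aL') = zA (fmap l x' : GL3 k L') (fmap l y' : GL3 k L') (zval (fmap l aL)).
  by rewrite zval_fmap aLE zact_map //; case: xy'.
have nz : nzd (mon m (zval (fmap l aL))).
  rewrite zval_fmap /aL zval_fmap !mon_map.
  exact: (nzd_locz lil (nzd_mC (mon_nzd (m := m) Ua))).
rewrite zE Fw // VF // mon_act // ?D0 // in E'.
have E2 : ch (fmap l x' : GL3 k L') a1 a2 a3 * f' L' (fmap l aL) =
          chm m (fmap l x' : GL3 k L') * f1 L' (fmap l aL').
  apply/eqP; rewrite -subr_eq0; apply/eqP; apply: nz.
  by rewrite mulrBr mulrCA E' -mulrA [X in _ - X]mulrCA subrr.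
have E3 : f1 L' (fmap l aL') = chf m (fmap l x' : GL3 k L') * f' L' (fmap l aL).
  have cN := chN u ((1 - q%:Z) * (m false)%:Z) ((1 - q%:Z) * (m true)%:Z) 0.
  have -> : chf m (fmap l x' : GL3 k L') = ch (fmap l x' : GL3 k L') a1 a2 a3 *
     ch (fmap l x' : GL3 k L') (- ((1 - q%:Z) * (m false)%:Z)) (- ((1 - q%:Z) * (m true)%:Z)) (- 0).
    rewrite -chD // /chf; congr ch; ring.
  by rewrite mulrAC E2 mulrAC /chm cN mul1r.
have aV : V L aL by apply: open_fmap.
have mE (c1 c2 c3 : int) : ch x c1 c2 c3 = h (ch x' c1 c2 c3).
  rewrite -hx /ch !rmorphM /=; congr (_ * _ * _); rewrite mx_fmap imx_fmap.
  - by case: c1 => n /=; rewrite rmorphXn.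
  - by case: c2 => n /=; rewrite rmorphXn.
  - by case: c3 => n /=; rewrite rmorphXn.
have mE' (c1 c2 c3 : int) : ch (fmap l x' : GL3 k L') c1 c2 c3 = l (ch x' c1 c2 c3).
  rewrite /ch !rmorphM /=; congr (_ * _ * _); rewrite mx_fmap imx_fmap.
  - by case: c1 => n /=; rewrite rmorphXn.
  - by case: c2 => n /=; rewrite rmorphXn.
  - by case: c3 => n /=; rewrite rmorphXn.
have V1 : V' R t' by rewrite -hL'.
have e1 : j (f1 R t') = h' (f1 L' (fmap l aL')).
  rewrite -(Vf' _ _ j) // -(Vf' _ _ h') // -hL'; congr (f1 _ _); apply: fmapC => r; exact/esym/h'E.
have e2 : j (f' R (fmap g a)) = h' (f' L' (fmap l aL)).
  rewrite -(Vf _ _ j) //; last exact: open_fmap.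
  rewrite -(Vf _ _ h') //.
  congr (f' _ _); rewrite /aL !fmapM; apply: fmap_eq => r /=; by rewrite h'E hE.
rewrite rmorphM /= e1 e2 E3 rmorphM /=; congr (_ * _).
by rewrite /chf mE mE' h'E.
Qed.

Lemma transport m R (x y : GL3 k R) (V V' : subf D) (f' f1 : forall R, D R -> R) (t t' : D R) :
  open_sub V -> open_sub V' -> locfun V f' -> locfun V' f1 ->
  (forall R (y : D R), V R y -> F (zval y) = mon m (zval y) * f' R y) ->
  (forall R (y : D R), V' R y -> F (zval y) = mon m (zval y) * f1 R y) ->
  zip_group_flag q x y -> zval t' = zA x y (zval t) -> V R t -> V' R t' ->
  f1 R t' = chf m x * f' R t.
Proof.
move=> Vo Vo' Vf Vf' VF VF' xy t'E Vt Vt'; apply: local_eq_loc => K ka Kf.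
have Vk : V K (fmap ka t) by apply: open_fmap.
have [U [A [a [g [Ua _ _ Va gE]]]]] := chart_near Ds Kf Vo Vk.
have Uk : U K (fmap ka t) by rewrite -gE; apply: affine_in.
have [s s0 sU] := open_at (affine_open_open Ua) Kf Uk; exists s => // R' j jl.
have [g' g'E] : exists g' : {lrmorphism A -> R'}, fmap g' a = fmap j t.
  by apply: (affine_fact Ua); apply: sU; case: jl.
have xy' : zip_group_flag q (fmap j x : GL3 k R') (fmap j y : GL3 k R').
  exact: (in_flag_map X (fl := false) j xy).
rewrite rmorphM /= -Vf // -Vf' // -g'E.
have -> : j (chf m x) = chf m (fmap j x : GL3 k R').
  rewrite /chf /ch !rmorphM /=; congr (_ * _ * _); rewrite mx_fmap imx_fmap; case: (X in zpow _ _ X) => n /=; by rewrite rmorphXn.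
apply: (transport0 Ua Va Vo Vo' Vf Vf' VF VF' xy') => //.
- by rewrite zval_fmap t'E zact_map ?g'E //; case: xy.
- exact: open_fmap.
Qed.

(** A factorization near the translate gives one over a localization of A[X_1, ..., X_9]; after
    denominators are cleared, the coefficients of a suitable monomial form a factorization over [A]
    near the original point. *)
Lemma fac_sat m K (x y : GL3 k K) (t t' : D K) : is_field K -> zip_group_flag q x y ->
  zval t' = zA x y (zval t) -> factors_near m t' -> factors_near m t.
Proof.
move=> Kf xy t'E [f1 f1n f1F]; have [V' [Vo' Vx' Vf' VF']] := nfun_near f1n f1F.
have [U [A [a [g [Ua _ _ _ gE]]]]] := chart_near Ds Kf (@open_full _ _) (I : (fun R (y : D R) => True) K t).
have [L [i [h [x' [y' [[sd /locz_loc il] hE xy' hx hy]]]]]] := univ_pair X g (xy : in_flag q false x y).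
pose aL : D L := fmap (i \o mC A 9) a.
have [aL' aLE] : exists z : D L, zval z = zA x' y' (zval aL).
  by apply: D_mk; apply: act_D => //; apply: D0.
have hL' : fmap h aL' = t'.
  apply: zval_inj; rewrite zval_fmap aLE zact_map; last by case: xy'.
  rewrite hx hy t'E -gE; congr (zA _ _ _); rewrite -!zval_fmap; congr zval.
  exact: fmapT.
rewrite -hL' in Vx'.
have [s s0 sP] := univ_open (idfun : {lrmorphism K -> K}) il Kf Vo' Vx'.
have [s' ss'] := Kf s (introN eqP s0).
have [L' [l [h' [lil h'E VL']]]] := sP K idfun (is_loc_id (ex_intro _ s' ss')).
have xy'' : zip_group_flag q (fmap l x' : GL3 k L') (fmap l y' : GL3 k L').
  exact: (in_flag_map X (fl := false) l xy').
have [_ u _ _] := flag_pairP (zq0 X) xy''.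
have E' := VF' _ _ VL'.
have zE : zval (fmap l aL') = zA (fmap l x' : GL3 k L') (fmap l y' : GL3 k L') (zval (fmap l aL)).
  by rewrite zval_fmap aLE zact_map //; case: xy'.
rewrite zE Fw // mon_act // ?D0 // zval_fmap /aL zval_fmap !F_map !mon_map in E'.
have cN := chN u a1 a2 a3.
set c := ch _ a1 a2 a3 in E' cN; set cn := ch _ _ _ _ in cN.
have {}E' : (l \o i) (mC A 9 (F (zval a))) = (l \o i) (mC A 9 (mon m (zval a))) *
    (cn * chm m (fmap l x' : GL3 k L') * f1 L' (fmap l aL')).
  move: E'; rewrite /= => E'; rewrite -[LHS]mul1r -cN [c * cn]mulrC -[LHS]mulrA E'; ring.
set z := cn * _ * _ in E'.
have [i1 i2] := lil; have [v [b [vu vz]]] := i1 z.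
have [w [wu wE]] : exists u, invertible ((l \o i) u) /\ u * (v * mC A 9 (F (zval a)) - mC A 9 (mon m (zval a)) * b) = 0.
  by apply: i2; move: (mon m (zval a)) E' vz => M /= E' vz; rewrite rmorphB !rmorphM /= rmorphB !rmorphM /= E' -vz; ring.
have eh r : (h' \o (l \o i)) (mC A 9 r) = g r by rewrite /= h'E /= hE.
have nz : (h' \o (l \o i)) (w * v) <> 0.
  rewrite rmorphM; apply: invertible_nz; apply: invertibleM; exact: (invertible_map h').
have [mm mmE] := coef_pt eh nz.
rewrite -gE; apply/(fac_chartP _ _ Ua Kf).
exists ((w * v : {mpoly A[9]})@_mm), ((w * b : {mpoly A[9]})@_mm); split=> //.
have : (w * v : {mpoly A[9]}) * (F (zval a))%:MP = (mon m (zval a))%:MP * (w * b : {mpoly A[9]}).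
  move/eqP: wE; rewrite mulrBr subr_eq0 !mCE => /eqP; rewrite mulrA => ->; ring.
by move=> /(congr1 (mcoeff mm)); rewrite mulrC !mcoeffCM mulrC.
Qed.

End Factor.

(** * The curves g_00 = 0 and g_11 = 0 in the divisor g_01 = 0 *)

Section Curve.
Variable k : closedFieldType.
Notation kalg := (comAlgType k).
Implicit Types (R A B C K L Q T : kalg).
Variables (q : nat) (X : zipact k q).
Notation psi := (zpsi X).
Notation D := (Zfun psi [:: (o0, o1)]).
Notation curve b := (Zfun psi [:: (o0, o1); (dg b, dg b)]).
Let Ds : smooth_k D := Z_smooth (zsmooth X) _.
Let Cs b : smooth_k (curve b) := Z_smooth (zsmooth X) _.

Fact iota_subproof b R (z : curve b R) :
  all (fun ij => mx (psi R (zval z)) ij.1 ij.2 == 0) [:: (o0, o1)].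
Proof. by rewrite /= andbT; have := svalP z => /= /andP[]. Qed.

Definition iota b : kmor (curve b) D.
Proof.
refine (@KMor k (curve b) D (fun R z => zmk (iota_subproof z)) _).
by move=> R B f z; apply: zval_inj.
Defined.

Lemma zval_iota b R (z : curve b R) : zval (iota b R z) = zval z.
Proof. by []. Qed.

Lemma curve0 b R (z : curve b R) : ent b (zval z) = 0.
Proof. by apply: (zval0 z (ij := (dg b, dg b))); rewrite !inE eqxx orbT. Qed.

Lemma curve_mk b R (y : D R) : ent b (zval y) = 0 -> exists z : curve b R, iota b R z = y.
Proof.
move=> y0; have [|z zE] := @zmkP k X psi [:: (o0, o1); (dg b, dg b)] R (zval y).
  by move=> ij; rewrite !inE => /orP[] /eqP -> //; apply: D0.
by exists z; apply: zval_inj.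
Qed.

Lemma iota_inj b R (z z' : curve b R) : iota b R z = iota b R z' -> z = z'.
Proof. by move=> /(congr1 (@zval _ _ _ _ R)) E; apply: zval_inj. Qed.

Lemma ent_locfun J b : locfun (fun R (t : Zfun psi J R) => True) (fun R t => ent b (zval t)).
Proof. by move=> R B f x _; rewrite zval_fmap ent_map. Qed.

Lemma full_nfun (Y : kfunctor k) phi K (x : Y K) : locfun (fun _ _ => True) phi -> nfun x phi.
Proof. by move=> h; eexists; split; [exact: open_full | exact: I | exact: h]. Qed.

(** In a chart [A] the curve is A/(e), and a function on A/(e) that does not vanish at the point
    lifts to [A]. *)
Lemma near_push b K (x : curve b K) (P : forall R, curve b R -> Prop) : is_field K -> near x P ->
  near (iota b K x) (fun R y => forall z : curve b R, iota b R z = y -> P R z).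
Proof.
move=> Kf [V [Vo Vx VP]].
have [U [A [a [g [Ua _ _ _ ga]]]]] := chart_near Ds Kf (@open_full _ _)
  (I : (fun R (y : D R) => True) K (iota b K x)).
pose e := ent b (zval a); pose J r := exists c, r = c * e.
have ge : g e = 0 by rewrite -ent_map -zval_fmap ga zval_iota curve0.
have JI : ideal J.
  split; first by exists 0; rewrite mul0r.
  - by move=> _ _ [c ->] [d ->]; exists (c + d); rewrite mulrDl.
  - by move=> c _ [d ->]; exists (c * d); rewrite mulrA.
have J1 : ~ J 1.
  by move=> [c E]; apply: (@kalg_nz1 k K); rewrite -(rmorph1 g) E rmorphM /= ge mulr0.
have [Q [p [ps pk]]] := quot_ex JI J1.
have pe : p e = 0 by apply/pk; exists 1; rewrite mul1r.
have [|z0 z0E] := @curve_mk b Q (fmap p a); first by rewrite zval_fmap ent_map.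
have lift B (f : {lrmorphism A -> B}) : f e = 0 -> exists h : {lrmorphism Q -> B}, forall r, h (p r) = f r.
  by move=> fe; apply: (quot_lift ps) => r /pk [c ->]; rewrite rmorphM /= fe mulr0.
have [g' g'E] := lift K g ge.
have xE : x = fmap g' z0.
  apply: iota_inj; rewrite -ga kmor_nat z0E fmapM; apply: fmap_eq => r /=; exact/esym/g'E.
rewrite xE in Vx; have [s0 s00 s0V] := open_at Vo Kf Vx.
have [s sE] := ps s0; rewrite -ga.
apply: (near_chart (s := s) Ua Kf); first by rewrite -g'E sE.
move=> L i il R f z zE; apply: VP.
have fe : f (i e) = 0.
  by rewrite -!ent_map -!zval_fmap -zE zval_iota curve0.
have [h hE] := lift R (f \o i) fe.
have -> : z = fmap h z0.
  apply: iota_inj; rewrite zE kmor_nat z0E !fmapM; apply: fmap_eq => r /=; exact/esym/hE.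
apply: s0V; case: il => -[y sy] _ _; exists (f y).
by rewrite -sE hE /= -rmorphM sy rmorph1.
Qed.

Lemma near_pow (Y : kfunctor k) K (x : Y K) (phi : forall R, Y R -> R) n : smooth_k Y -> is_field K ->
  nfun x phi -> near x (fun R y => phi R y ^+ n = 0) -> near x (fun R y => phi R y = 0).
Proof.
move=> Ys Kf pn; elim: n => [|n IH] h.
  by have /= := near_pt h; rewrite expr0 => /(@kalg_nz1 k K).
have [||//|//] := dom_near Ys Kf (phi := phi) (chi := fun R y => phi R y ^+ n) pn.
- by case: pn => V [Vo Vx Vf]; exists V; split=> // R B f y Vy; rewrite Vf // rmorphXn.
- by apply: near_imp h => R y; rewrite exprS.
Qed.

Lemma ent_nz b K (x : curve b K) : is_field K -> ~ near x (fun R y => ent (~~ b) (zval y) = 0).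
Proof. by move=> Kf; apply: (entry_nz (zsmooth X)) => //; case: b x. Qed.

Variable F : forall R, X R -> R.
Hypothesis Fn : locfun (fun R (t : X R) => True) F.

Definition single_exp (b : bool) (n : nat) : bool -> nat := fun c => if c == b then n else 0%N.
Definition incr_exp (b : bool) (m : bool -> nat) : bool -> nat := fun c => (m c + (c == b))%N.

Lemma mon_incr b m R (t : X R) : mon (incr_exp b m) t = ent b t * mon m t.
Proof.
by rewrite !(monE b) /incr_exp eqxx addn1 exprS; case: b => /=; rewrite addn0 mulrA.
Qed.

Lemma mon_single b n R (t : X R) : mon (single_exp b n) t = ent b t ^+ n.
Proof. by rewrite (monE b) /single_exp eqxx; case: b; rewrite /= expr0 mulr1. Qed.

Lemma fac_div b m K (x : curve b K) (f' : forall R, D R -> R) : is_field K -> nfun (iota b K x) f' ->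
  near (iota b K x) (fun R y => F (zval y) = mon m (zval y) * f' R y) ->
  near x (fun R z => f' R (iota b R z) = 0) -> factors_near F (incr_exp b m) (iota b K x).
Proof.
move=> Kf fn fF /(near_push Kf) f0.
have [|||chi chin chiE] := @div_near k D Ds K (iota b K x) (fun R y => ent b (zval y)) f' Kf.
- exact/full_nfun/ent_locfun.
- by [].
- by apply: near_imp f0 => R y h /curve_mk [z zE]; rewrite -zE; apply: h.
- exists chi => //; apply: near_imp (near_and fF chiE) => R y [-> ->].
  by rewrite mon_incr mulrA [mon m _ * _]mulrC.
Qed.

Variable m : bool -> nat.
Hypothesis Fm : forall K (y : D K), is_field K -> ent false (zval y) = 0 -> ent true (zval y) = 0 ->
  factors_near F m y.
Variable b : bool.

Lemma Fm_curve K (x : curve b K) : is_field K -> ent (~~ b) (zval x) = 0 -> factors_near F m (iota b K x).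
Proof.
by move=> Kf x0; apply: Fm => //; move: (curve0 x) x0; rewrite zval_iota; case: b x.
Qed.

Lemma fac_single K (y : D K) : is_field K -> factors_near F m y -> factors_near F (single_exp b (m b)) y.
Proof.
move=> Kf; have [U [A [a [g [Ua _ _ _ <-]]]]] := chart_near Ds Kf (@open_full _ _)
  (I : (fun R (y : D R) => True) K y).
move=> /(fac_chartP Fn _ _ Ua Kf) [s [c [s0 E]]]; apply/(fac_chartP Fn _ _ Ua Kf).
exists s, (ent (~~ b) (zval a) ^+ m (~~ b) * c); split=> //.
by rewrite E mon_single (monE b) mulrA.
Qed.

Lemma fac_of_single K (y : D K) : is_field K -> ent (~~ b) (zval y) <> 0 ->
  factors_near F (single_exp b (m b)) y -> factors_near F m y.
Proof.
move=> Kf; have [U [A [a [g [Ua _ _ _ <-]]]]] := chart_near Ds Kf (@open_full _ _)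
  (I : (fun R (y : D R) => True) K y).
rewrite zval_fmap ent_map => e0.
move=> /(fac_chartP Fn _ _ Ua Kf) [s [c [s0 E]]]; apply/(fac_chartP Fn _ _ Ua Kf).
exists (ent (~~ b) (zval a) ^+ m (~~ b) * s), c; split.
  rewrite rmorphM rmorphXn /= => /(fieldM Kf) [/(fieldX Kf)|] //.
by rewrite -mulrA E mon_single (monE b) mulrCA mulrA.
Qed.

(** At such a point the other entry is invertible by [Fm_curve], so only the exponent of [ent b]
    matters. Let n be the last exponent for which [F] factors, with cofactor f'. Then f' is not
    locally zero on the curve, and this persists nearby by [zero_closed]; a factorization with
    exponent m b > n would make f' vanish on the curve. *)
Lemma notfac_near K (x : curve b K) : is_field K -> ~ factors_near F m (iota b K x) ->
  exists V : subf (curve b), [/\ open_sub V, V K x & forall K' (x' : curve b K'), is_field K' ->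
    V K' x' -> ~ factors_near F m (iota b K' x')].
Proof.
move=> Kf nF; have e0 : ent (~~ b) (zval x) <> 0 by move=> /(Fm_curve Kf).
pose y := iota b K x; have e1 : ent (~~ b) (zval y) <> 0 by [].
have [|n nn nmin] := @nat_min (fun n => ~ factors_near F (single_exp b n) y).
  by exists (m b) => /(fac_of_single Kf e1).
case: n nn nmin => [|n] nn nmin.
  case: nn; exists (fun R y => F (zval y)); first exact/full_nfun/F_locfun.
  exists (fun _ _ => True); split=> // [|R z _]; first exact: open_full.
  by rewrite mon_single expr0 mul1r.
have nm : (n < m b)%N.
  by rewrite ltnNge; apply/negP => mn; apply: (nmin (m b)) => // /(fac_of_single Kf e1).
have [f' fn fF] : factors_near F (single_exp b n) y by apply: NNPP; apply: nmin.
have f0 : ~ near x (fun R z => f' R (iota b R z) = 0).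
  move=> h; apply: nn; have [f1 f1n f1F] := fac_div Kf fn fF h; exists f1 => //.
  by apply: near_imp f1F => R t ->; rewrite mon_incr !mon_single exprS.
have [V [Vo Vx VF]] := zero_closed (Cs b) Kf (nfun_pull fn) f0.
have [W [Wo Wx Wf WF]] := nfun_near fn fF.
exists (fun R z => V R z /\ W R (iota b R z)); split=> //.
  by apply: open_cap => //; apply: open_pull.
move=> K' x' Kf' [Vx' Wx'] /(fac_single Kf') [f2 f2n f2F]; apply: (VF K' x' Kf' Vx').
have [W2 [Wo2 Wx2 Wf2 WF2]] := nfun_near f2n f2F.
apply: (near_imp _ (near_pull (iota := iota b) (Q := fun R t => W R t /\ W2 R t) _)); last first.
  by exists (fun R t => W R t /\ W2 R t); split=> //; apply: open_cap.
move=> R z [Wz W2z].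
rewrite (@fac_uniq _ _ _ F (single_exp b n) W W2 f' (fun R t => ent b (zval t) ^+ (m b - n) * f2 R t)) //.
- by rewrite zval_iota curve0 expr0n subn_eq0 leqNgt nm mul0r.
- by move=> B C f t W2t; rewrite zval_fmap ent_map Wf2 // rmorphM rmorphXn.
- by move=> B t W2t; rewrite WF2 // !mon_single mulrA -exprD subnKC // ltnW.
Qed.

End Curve.

(** * Invariant functions on the closures of the strata of length 1 *)

Section Step.
Variable k : closedFieldType.
Notation kalg := (comAlgType k).
Implicit Types (R A B C K L Q T : kalg).
Variables (q : nat) (X : zipact k q).
Notation psi := (zpsi X).
Notation D := (Zfun psi [:: (o0, o1)]).
Notation curve b := (Zfun psi [:: (o0, o1); (dg b, dg b)]).
Notation iota := (iota X).
Variable F : forall R, X R -> R.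
Hypothesis Fn : locfun (fun R (t : X R) => True) F.
Variables a1 a2 a3 : int.
Hypothesis Fw : forall R (x y : GL3 k R) (t : X R), zip_group_flag q x y ->
  F (zA x y t) = ch x a1 a2 a3 * F t.
Variables (Fl : kfunctor k) (pi : kmor X Fl).
Hypothesis pir : forall R (t t' : X R), pi R t = pi R t' <->
  exists x y, zip_group_flag q x y /\ t' = zA x y t.
Hypothesis psurj : forall R (s : Fl R), exists (R' : kalg) (f : {lrmorphism R -> R'})
  (t : X R'), fppf_cover f /\ pi R' t = fmap f s.
Variable m : bool -> nat.
Hypothesis Fm : forall K (y : D K), is_field K -> ent false (zval y) = 0 -> ent true (zval y) = 0 ->
  factors_near F m y.
Variables (b : bool) (N M : nat) (u : forall R, curve b R -> R) (chu : forall R, GL3 k R -> R).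
Hypothesis M0 : (0 < M)%N.
Hypothesis un : locfun (fun _ _ => True) u.
Hypothesis uu : forall R (z : curve b R), invertible (u z).
Hypothesis u_act : forall R (x y : GL3 k R) (z z' : curve b R), zip_group_flag q x y ->
  zval z' = zA x y (zval z) -> u z' = chu x * u z.
Hypothesis wt : forall R (x y : GL3 k R), zip_group_flag q x y ->
  chf q a1 a2 a3 m x ^+ N * chu x * chm q (single_exp (~~ b) M) x = 1.

Let Ds : smooth_k D := Z_smooth (zsmooth X) _.
Let Cs : smooth_k (curve b) := Z_smooth (zsmooth X) _.

(* The function on the curve that descends to the flag space: where [F] does not factor, a locus
   that is open in the curve, it is set to 0. *)
Definition factored_value R (z : curve b R) (r : R) : Prop := exists (V : subf D) (f' : forall R, D R -> R),
  [/\ open_sub V, locfun V f', forall R y, V R y -> F (zval y) = mon m (zval y) * f' R y,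
      V R (iota b R z) & r = f' R (iota b R z) ^+ N * u z * ent (~~ b) (zval z) ^+ M].

Definition unfactored_value R (z : curve b R) (r : R) : Prop := exists V : subf (curve b),
  [/\ open_sub V, V R z, forall K (x : curve b K), is_field K -> V K x -> ~ factors_near F m (iota b K x)
    & r = 0].

Lemma field_pt R : exists K (g : {lrmorphism R -> K}), is_field K.
Proof.
have [||K [g [Kf _ _]]] := @field_pt_max k R (fun r => r = 0); last by exists K, g.
  by split=> // [? ? -> ->|? ? ->]; rewrite ?addr0 ?mulr0.
by move/(@kalg_nz1 k R).
Qed.

Lemma factored_value_Fac R (z : curve b R) r K (g : {lrmorphism R -> K}) : factored_value z r ->
  factors_near F m (iota b K (fmap g z)).
Proof.
move=> [V [f' [Vo Vf VF Vz _]]]; exists f'; exists V; split=> //; rewrite kmor_nat; exact: open_fmap.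
Qed.

Lemma unfactored_value_notFac R (z : curve b R) r K (g : {lrmorphism R -> K}) : is_field K -> unfactored_value z r ->
  ~ factors_near F m (iota b K (fmap g z)).
Proof. by move=> Kf [V [Vo Vz VF _]]; apply: VF => //; apply: open_fmap. Qed.

Lemma curve_value_map R B (f : {lrmorphism R -> B}) (z : curve b R) r : factored_value z r \/ unfactored_value z r ->
  factored_value (fmap f z) (f r) \/ unfactored_value (fmap f z) (f r).
Proof.
case=> [[V [f' [Vo Vf VF Vz ->]]]|[V [Vo Vz VF ->]]]; [left|right].
  exists V, f'; split=> //; first by rewrite kmor_nat; apply: open_fmap.
  by rewrite kmor_nat Vf // un // zval_fmap ent_map !rmorphM !rmorphXn.
by exists V; split; rewrite ?rmorph0 //; apply: open_fmap.
Qed.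

Lemma curve_value_uniq R (z : curve b R) r r' : factored_value z r \/ unfactored_value z r -> factored_value z r' \/ unfactored_value z r' -> r = r'.
Proof.
have [K [g Kf]] := field_pt R.
case=> [h1|h1] [h2|h2].
- move: h1 h2 => [V [f' [Vo Vf VF Vz ->]]] [V' [f1 [Vo' Vf' VF' Vz' ->]]].
  by rewrite (fac_uniq Vo Vo' Vf Vf' VF VF' Vz Vz').
- by case: (unfactored_value_notFac (g := g) Kf h2); apply: factored_value_Fac h1.
- by case: (unfactored_value_notFac (g := g) Kf h1); apply: factored_value_Fac h2.
- by move: h1 h2 => [? [_ _ _ ->]] [? [_ _ _ ->]].
Qed.

Lemma curve_value_local R (z : curve b R) K (g : {lrmorphism R -> K}) : is_field K ->
  exists2 s, g s <> 0 & forall L (i : {lrmorphism R -> L}), invertible (i s) ->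
    (exists r, factored_value (fmap i z) r) \/ unfactored_value (fmap i z) 0.
Proof.
move=> Kf; have [Fz|nFz] := classic (factors_near F m (iota b K (fmap g z))).
  move: Fz => [f' fn fF]; have [V [Vo Vx Vf VF]] := nfun_near fn fF.
  rewrite kmor_nat in Vx; have [s s0 sV] := open_at Vo Kf Vx; exists s => // L i iu.
  by left; eexists; exists V, f'; split=> //; rewrite kmor_nat; apply: sV.
have [V [Vo Vx VF]] := notfac_near Fn Fm Kf nFz.
have [s s0 sV] := open_at Vo Kf Vx; exists s => // L i iu.
by right; exists V; split=> //; apply: sV.
Qed.

Lemma curve_value_glue : exists h : forall R, curve b R -> R, locfun (fun _ _ => True) h /\
  forall R (z : curve b R) r, factored_value z r \/ unfactored_value z r -> h R z = r.
Proof.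
apply: (glue (Psi := fun R z r => factored_value z r \/ unfactored_value z r)).
- by move=> R B f y r; apply: curve_value_map.
- by move=> R y r r'; apply: curve_value_uniq.
- move=> R y K g Kf; have [s s0 sP] := curve_value_local y g Kf; exists s => // L i il.
  by have [|[r h]|h] := sP L i; [by case: il | exists r; left | exists 0; right].
Qed.

Lemma factored_value_act R (x y : GL3 k R) (z z' : curve b R) r r' : zip_group_flag q x y ->
  zval z' = zA x y (zval z) -> factored_value z r -> factored_value z' r' -> r' = r.
Proof.
move=> xy zz' [V [f' [Vo Vf VF Vz ->]]] [V' [f1 [Vo' Vf' VF' Vz' ->]]].
have tE : zval (iota b R z') = zA x y (zval (iota b R z)) by [].
rewrite (transport Fw Vo Vo' Vf Vf' VF VF' xy tE Vz Vz') (u_act xy zz').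
rewrite -[ent _ _ ^+ M]mon_single zz' (mon_act _ xy); last exact: (D0 (iota b R z)).
rewrite mon_single [X in X * _ * _]exprMn; have := wt xy.
move: (_ ^+ N) (chu x) (chm _ _ _) (_ ^+ N) (u z) (_ ^+ M) => w1 w2 w3 c1 c2 c3 E.
by rewrite -[RHS]mul1r -E; ring.
Qed.

Lemma curve_act R (x y : GL3 k R) (z z' : curve b R) K (g : {lrmorphism R -> K}) :
  is_field K -> zip_group_flag q x y -> zval z' = zA x y (zval z) ->
  factors_near F m (iota b K (fmap g z')) -> factors_near F m (iota b K (fmap g z)).
Proof.
move=> Kf xy zz'; apply: (fac_sat Fn Fw Kf (in_flag_map X (fl := false) g xy)).
rewrite !zval_iota !zval_fmap zz' zact_map //; by case: xy.
Qed.

(** E' respects both kinds of value: the weights in the product cancel by [wt], and factoring itself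
    is invariant by [fac_sat], so the two cases never mix within an orbit. *)
Lemma curve_value_inv (h : forall R, curve b R -> R) : locfun (fun _ _ => True) h ->
  (forall R (z : curve b R) r, factored_value z r \/ unfactored_value z r -> h R z = r) ->
  forall R (z z' : curve b R), pi R (zval z) = pi R (zval z') -> h R z = h R z'.
Proof.
move=> hn hT R z z' E; have [x [y [xy zz']]] := (pir _ _).1 E.
have [x' [y' [xy' z'z]]] := (pir _ _).1 (esym E).
apply: local_eq_loc => K ka Kf.
have [s s0 sP] := curve_value_local z ka Kf; have [s' s'0 s'P] := curve_value_local z' ka Kf.
exists (s * s') => [|L i [iu _ _]]; first by rewrite rmorphM => /(fieldM Kf) [].
have iu1 : invertible (i s) by apply: (invertible_factor (b := i s')); rewrite -rmorphM.
have iu2 : invertible (i s') by apply: (invertible_factor (b := i s)); rewrite mulrC -rmorphM.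
rewrite -!hn //; have [K1 [g Kf1]] := field_pt L.
have xyi := in_flag_map X (fl := false) i xy; have xyi' := in_flag_map X (fl := false) i xy'.
have zzi : zval (fmap i z') = zA (fmap i x : GL3 k L) (fmap i y : GL3 k L) (zval (fmap i z)).
  by rewrite !zval_fmap zz' zact_map //; case: xy.
have zzi' : zval (fmap i z) = zA (fmap i x' : GL3 k L) (fmap i y' : GL3 k L) (zval (fmap i z')).
  by rewrite !zval_fmap z'z zact_map //; case: xy'.
have [[r h1]|h1] := sP L i iu1; have [[r' h2]|h2] := s'P L i iu2.
- rewrite (hT _ _ _ (or_introl h1)) (hT _ _ _ (or_introl h2)).
  by rewrite (factored_value_act xyi zzi h1 h2).
- case: (unfactored_value_notFac (g := g) Kf1 h2); apply: (curve_act Kf1 xyi' zzi'); exact: factored_value_Fac h1.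
- case: (unfactored_value_notFac (g := g) Kf1 h1); apply: (curve_act Kf1 xyi zzi); exact: factored_value_Fac h2.
- by rewrite (hT _ _ _ (or_intror h1)) (hT _ _ _ (or_intror h2)).
Qed.

Variable St : subf Fl.
Hypothesis pc : pseudo_complete (reduced_closure St).
Hypothesis St1 : forall K (y : Fl K), is_field K -> St y -> exists K' (f : {lrmorphism K -> K'}) (t : X K'),
  [/\ is_field K', pi K' t = fmap f y, mx (psi K' t) o0 o1 = 0 & ent b t = 0].
Hypothesis St2 : forall K (t : X K), is_field K -> mx (psi K t) o0 o1 = 0 -> ent b t = 0 ->
  ent (~~ b) t <> 0 -> St (pi K t).

Lemma closed_map (Y : kfunctor k) (Z : subf Y) R B (f : {lrmorphism R -> B}) (y : Y R) :
  closed_sub Z -> Z R y -> Z B (fmap f y).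
Proof.
move=> Zc Zy; have [I IE] := Zc R y; apply/IE => r Ir.
have := (IE R (idfun : {lrmorphism R -> R})).1; rewrite fmap_idE => /(_ Zy r Ir) /= ->.
exact: rmorph0.
Qed.

Lemma nil_of_fields R (w : R) : (forall K (g : {lrmorphism R -> K}), is_field K -> g w = 0) ->
  exists n, w ^+ n = 0.
Proof.
move=> h; apply: NNPP => H; have [|L [i [[y wy] _ _]]] := @loc_ex _ R w.
  by move=> n wn; apply: H; exists n.
have [K [g Kf]] := field_pt L; apply: (@kalg_nz1 k K).
by have /= gw := h K (g \o i) Kf; rewrite -(rmorph1 g) -wy rmorphM /= gw mul0r.
Qed.

(** Locally a domain, hence locally reduced. *)
Lemma nil_near (U : subf (curve b)) A (a : curve b A) K (g : {lrmorphism A -> K}) (w t : A) n :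
  affine_open U a -> fgen (base A) -> is_field K -> g t <> 0 -> t * w ^+ n = 0 ->
  exists2 s, g s <> 0 & s * w = 0.
Proof.
move=> Ua fA Kf; elim: n t => [|n IH] t t0.
  by rewrite mulr1 => t00; case: t0; rewrite t00 rmorph0.
rewrite exprS mulrCA => /(chart_domain g Cs Ua fA Kf) [//|[s s0]].
by rewrite mulrA; apply: IH; rewrite rmorphM => /(fieldM Kf) [].
Qed.

(** The curve is reduced, and the part over the stratum, where the other entry e is invertible, is
    dense in it: if r is an equation of a closed subscheme containing the stratum, then e r is
    nilpotent, hence locally 0, and e is a nonzero divisor. *)
Lemma curve_closure R (z : curve b R) : reduced_closure St (pi R (zval z)).
Proof.
move=> Z Zc StZ.
have chart U A (a : curve b A) : affine_open U a -> fgen (base A) -> Z A (pi A (zval a)).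
  move=> Ua fA; have [I IE] := Zc A (pi A (zval a)).
  rewrite -[pi A _]fmap_idE; apply/IE => r Ir /=.
  pose w := ent (~~ b) (zval a) * r.
  have [K h Kf|n wn] := @nil_of_fields A w.
    rewrite /w rmorphM /= -ent_map; have [->|e0] := classic (ent (~~ b) (fmap h (zval a)) = 0).
      by rewrite mul0r.
    have /(IE K h).1 hI : Z K (fmap h (pi A (zval a))).
      rewrite -kmor_nat; apply: (StZ K _ Kf); apply: St2 => //; rewrite -zval_fmap.
        exact: (D0 (iota b K (fmap h a))).
      exact: curve0.
    by rewrite hI // mulr0.
  apply: local_eq => K g Kf; have [||s s0 swap] := @nil_near U A a K g w 1 n Ua fA Kf.
    by rewrite rmorph1; apply: kalg_nz1.
    by rewrite mul1r.
  exists s => //; rewrite mulr0; apply: (chart_nzd Ua (i := dg (~~ b)) (j := dg (~~ b))).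
    by case: b.
  by rewrite -[RHS]swap /w /ent; ring.
have [Iz IE] := Zc R (pi R (zval z)).
rewrite -[pi R _]fmap_idE; apply/IE => r Ir /=.
apply: local_eq_loc => K ka Kf.
have [U [A [a [g [Ua fA _ _ ga]]]]] := chart_near Cs Kf (@open_full _ _)
  (I : (fun R (y : curve b R) => True) K (fmap ka z)).
have Uz : U K (fmap ka z) by rewrite -ga; apply: affine_in.
have [s s0 sU] := open_at (affine_open_open Ua) Kf Uz; exists s => // L i [iu _ _].
have [g' g'E] := affine_fact Ua (sU _ i iu).
have := closed_map g' Zc (chart _ _ _ Ua fA).
by rewrite -kmor_nat -zval_fmap g'E zval_fmap kmor_nat => /(IE L i).1 /(_ r Ir) ->; rewrite rmorph0.
Qed.

Let e1 R (t : X R) : R := mx (psi R t) o0 o1.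

Fact e1n : locfun (fun _ _ => True) e1.
Proof. by move=> R B f t _; rewrite /e1 kmor_nat mx_fmap. Qed.

Fact e2n : locfun (fun _ _ => True) (fun R (t : X R) => ent b t).
Proof. by move=> R B f t _; rewrite ent_map. Qed.

Fact e1i R (t t' : X R) : pi R t = pi R t' -> exists a, e1 t' = a * e1 t.
Proof.
move=> /pir [x [y [xy ->]]]; exists (ch x 1 (- q%:Z) 0).
by rewrite /e1 zpsi_act ?(act01 _ (flag_pairP (zq0 X) xy)) //; case: xy.
Qed.

Fact e2i R (t t' : X R) : pi R t = pi R t' -> exists a c, ent b t' = a * e1 t + c * ent b t.
Proof.
move=> /pir [x [y [xy ->]]]; have [[x01 x02 x12] _ [v01 v20 v21] _] := flag_pairP (zq0 X) xy.
rewrite /ent /e1 zpsi_act; last by case: xy.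
rewrite !mxM mxV !mul3; case: b => /=.
  exists (mx x o1 o0 * imx y o1 o1), (mx x o1 o1 * imx y o1 o1); rewrite x12 v01 v21; ring.
exists (mx x o0 o0 * imx y o1 o0), (mx x o0 o0 * imx y o0 o0); rewrite x01 x02 v20; ring.
Qed.

Let ZI := zero_image pi e1 (fun R (t : X R) => ent b t).

(** The opposite inclusion: the curve descends to a closed subscheme of the flag space that contains
    the stratum. So fibres over the closure lie in the curve, and functions on the curve descend to
    the closure. *)
Lemma closure_ZI R (y : Fl R) : reduced_closure St y -> ZI y.
Proof.
apply; first exact: (zero_image_closed psurj e1n e2n e1i e2i).
move=> K x Kf /(St1 Kf) [K' [f [t [Kf' tx t01 tb]]]].
by apply: (zero_image_field psurj e1n e2n e1i e2i Kf tx).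
Qed.

Lemma factors_step K (y : D K) : is_field K -> ent false (zval y) = 0 -> ent true (zval y) = 0 ->
  factors_near F (incr_exp b m) y.
Proof.
move=> Kf y0 y1; have [h [hn hT]] := curve_value_glue; have hi := curve_value_inv hn hT.
have [|x xy] := @curve_mk k q X b K y; first by case: (b).
pose ZX : subf X := fun R t => exists z : curve b R, zval z = t.
(* The function on the curve, transferred to X; outside the curve its value is an arbitrary choice,
   which descent over [ZX] does not see. *)
pose phi R (t : X R) : R := epsilon (inhabits 0) (fun r => exists2 z : curve b R, zval z = t & r = h R z).
have phiE R (z : curve b R) : phi R (zval z) = h R z.
  rewrite /phi; have [] := epsilon_spec (inhabits 0) (fun r : R => exists2 z' : curve b R, zval z' = zval z & r = h R z').
    by exists (h R z), z.
  by move=> z' /(@zval_inj _ _ _ _ R) -> ->.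
have [||H Hn Hp] := @descend_on k X Fl pi psurj ZX phi.
- by move=> B C f _ [z <-]; rewrite -zval_fmap !phiE hn.
- by move=> B _ _ [z <-] [z' <-] E; rewrite !phiE; apply: hi.
have ZXe R (t : X R) : zero_locus e1 (fun R (t : X R) => ent b t) t -> ZX R t.
  move=> [t0 tb]; have [y' y'E] := D_mk t0; have [|z zE] := @curve_mk k q X b R y'.
    by rewrite y'E.
  by exists z; rewrite -y'E -zE.
have HZ R (z : curve b R) : H R (pi R (zval z)) = h R z.
  rewrite Hp ?phiE // => B f t' E; apply: ZXe; apply: (closure_ZI (curve_closure z)) E.
have [|U [c [Uo Ux Uc]]] := pc (h := H) _ Kf (curve_closure x).
  by move=> R C f t /closure_ZI tZ; apply: Hn => B g t' E; apply: ZXe; apply: tZ E.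
have Fy := Fm Kf y0 y1; rewrite -xy in Fy *.
have [f' fn fF] := Fy; have [V [Vo Vx Vf VF]] := nfun_near fn fF.
have hV R (z : curve b R) : V R (iota b R z) ->
    h R z = f' R (iota b R z) ^+ N * u z * ent (~~ b) (zval z) ^+ M.
  by move=> Vz; apply: hT; left; exists V, f'.
(* The function is constant near the image of x, and the constant is 0 because x lies over F1, where
   the other entry vanishes, and M > 0. *)
have cA : c%:A = 0 :> K.
  rewrite -(Uc _ _ (curve_closure x) Ux) HZ hV // -(zval_iota x) xy.
  have -> : ent (~~ b) (zval y) = 0 by case: (b).
  by rewrite expr0n eqn0Ngt M0 mulr0.
have c0 : c = 0.
  apply/eqP/negPn/negP => /(scal_unit K) [d cd]; apply: (@kalg_nz1 k K).
  by rewrite -cd cA mul0r.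
have nx : near x (fun R z => f' R (iota b R z) ^+ N * ent (~~ b) (zval z) ^+ M = 0).
  exists (fun R z => U R (pi R (zval z)) /\ V R (iota b R z)); split=> //.
    apply: open_cap; last exact: open_pull.
    by move=> R z; have [I IE] := Uo R (pi R (zval z)); exists I => B f; rewrite -IE zval_fmap kmor_nat.
  move=> R z [Uz Vz]; apply: (invertible_inj (uu z)).
  by rewrite mulrA [u z * _]mulrC -hV // -HZ Uc ?c0 ?scale0r //; apply: curve_closure.
(* f'^N times a power of the other entry vanishes near x; the curve is locally a domain on which
   that entry is not locally zero, so f' vanishes on it. *)
apply: (fac_div Kf fn fF); apply: (near_pow (n := N) Cs Kf); first exact: nfun_pull.
have pown (W : subf (curve b)) (f1 : forall R, curve b R -> R) n : locfun W f1 ->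
    locfun W (fun R z => f1 R z ^+ n).
  by move=> Wf R B f z Wz; rewrite Wf // rmorphXn.
have fnN : nfun x (fun R z => f' R (iota b R z) ^+ N).
  by have [W [Wo Wx Wf]] := nfun_pull fn; exists W; split=> //; apply: pown.
have [//|h1] := dom_near Cs Kf fnN (full_nfun x (pown _ _ M (@ent_locfun _ _ _ _ (~~ b)))) nx.
by case: (ent_nz Kf (near_pow Cs Kf (full_nfun x (@ent_locfun _ _ _ _ (~~ b))) h1)).
Qed.

End Step.

(** * Semi-invariant units on the curves *)

Section Units.
Variable k : closedFieldType.
Notation kalg := (comAlgType k).
Implicit Types (R A B C K L Q T : kalg).
Variables (q : nat) (X : zipact k q).
Notation psi := (zpsi X).
Notation D := (Zfun psi [:: (o0, o1)]).
Notation curve b := (Zfun psi [:: (o0, o1); (dg b, dg b)]).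

Lemma zpow_map R B (f : {lrmorphism R -> B}) (a c : R) n : zpow (f a) (f c) n = f (zpow a c n).
Proof. by case: n => n /=; rewrite rmorphXn. Qed.

(* The entry of [g] that is invertible on [curve b], and its inverse. *)
Definition eps (b : bool) R (t : X R) : R := if b then mx (psi R t) o2 o1 else mx (psi R t) o0 o2.
Definition epsi (b : bool) R (t : X R) : R := if b then imx (psi R t) o1 o2 else imx (psi R t) o2 o0.

Lemma epsK b R (z : curve b R) : eps b (zval z) * epsi b (zval z) = 1.
Proof.
have := curve0 z; have := D0 (iota X b R z); rewrite zval_iota /eps /epsi /ent; move: (zval z) => t.
case: (b) => /= h01 h; [have := imx_mx (psi R t) o1 o1 | have := mx_imx (psi R t) o0 o0].
  by rewrite h01 h !mulr0 !add0r mulrC.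
by rewrite h01 h !mul0r !add0r.
Qed.

Lemma detK R (g : GL3 k R) : \det (mx g) * \det (imx g) = 1.
Proof. by rewrite -det_mulmx mxK det1. Qed.

(** The weight of the n-th power of [eps b] on [curve b]. *)
Definition ew (b : bool) R (x : GL3 k R) (n : int) : R :=
  if b then ch x 0 (- q%:Z * n) n else ch x n 0 (- q%:Z * n).

Lemma eps_act b R (x y : GL3 k R) (z z' : curve b R) n : zip_group_flag q x y ->
  zval z' = zA x y (zval z) ->
  zpow (eps b (zval z')) (epsi b (zval z')) n = ew b x n * zpow (eps b (zval z)) (epsi b (zval z)) n.
Proof.
move=> xy zz'; have fp := flag_pairP (zq0 X) xy; have [_ u _ _] := fp.
have E : eps b (zval z') = ew b x 1 * eps b (zval z).
  rewrite zz' /eps /ew zpsi_act; last by case: xy.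
  have := curve0 z; have := D0 (iota X b R z); rewrite zval_iota /ent; move: (zval z) => t.
  case: (b) => /= h01 h; first by rewrite (act21 fp h01 h) mulr1.
  by rewrite (act02 fp h h01) mulr1.
have wi : ew b x 1 * ew b x (- 1) = 1.
  rewrite /ew; case: (b); rewrite -chD // ?subrr ?addr0 ?mulr1 ?mulrN1 ?subrr /ch /= ?mulr1 //.
have E' : epsi b (zval z') = ew b x (- 1) * epsi b (zval z).
  apply: inv_unique (epsK z') _; rewrite E mulrACA wi epsK mulr1 //.
rewrite E E' zpowMl; congr (_ * _); rewrite /ew; case: (b); rewrite !mulr1 mulrN1.
  by rewrite -{2}[0]oppr0 (chZ u) mul0r mul1r.
by rewrite -{2}[0]oppr0 (chZ u) mul0r mul1r.
Qed.

Lemma det_act R (x y : GL3 k R) (t : X R) n : zip_group_flag q x y ->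
  zpow (\det (mx (psi R (zA x y t)))) (\det (imx (psi R (zA x y t)))) n =
  ch x ((1 - q%:Z) * n) ((1 - q%:Z) * n) ((1 - q%:Z) * n) *
  zpow (\det (mx (psi R t))) (\det (imx (psi R t))) n.
Proof.
move=> xy; have fp := flag_pairP (zq0 X) xy; have [_ u _ _] := fp.
have E := act_det (psi R t) fp; rewrite -zpsi_act in E; last by case: xy.
have wi := chN u (1 - q%:Z) (1 - q%:Z) (1 - q%:Z).
rewrite E -(chZ u) -zpowMl; congr zpow.
by apply: inv_unique (detK _) _; rewrite E mulrACA wi detK mulr1.
Qed.

End Units.

(** * Choice of exponents and vanishing near F1 *)

Section Vanish.
Variable k : closedFieldType.
Notation kalg := (comAlgType k).
Implicit Types (R A B C K L Q T : kalg).
Variables (q : nat) (X : zipact k q).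
Notation psi := (zpsi X).
Notation D := (Zfun psi [:: (o0, o1)]).
Notation curve b := (Zfun psi [:: (o0, o1); (dg b, dg b)]).
Variable F : forall R, X R -> R.
Hypothesis Fn : locfun (fun R (t : X R) => True) F.
Variables a1 a2 a3 : int.
Hypothesis Fw : forall R (x y : GL3 k R) (t : X R), zip_group_flag q x y ->
  F (zA x y t) = ch x a1 a2 a3 * F t.
Variables (Fl : kfunctor k) (pi : kmor X Fl).
Hypothesis pir : forall R (t t' : X R), pi R t = pi R t' <->
  exists x y, zip_group_flag q x y /\ t' = zA x y t.
Hypothesis psurj : forall R (s : Fl R), exists (R' : kalg) (f : {lrmorphism R -> R'})
  (t : X R'), fppf_cover f /\ pi R' t = fmap f s.
Variable St : bool -> subf Fl.
Hypothesis pc : forall b, pseudo_complete (reduced_closure (St b)).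
Hypothesis St1 : forall b K (y : Fl K), is_field K -> St b y -> exists K' (f : {lrmorphism K -> K'}) (t : X K'),
  [/\ is_field K', pi K' t = fmap f y, mx (psi K' t) o0 o1 = 0 & ent b t = 0].
Hypothesis St2 : forall b K (t : X K), is_field K -> mx (psi K t) o0 o1 = 0 -> ent b t = 0 ->
  ent (~~ b) t <> 0 -> St b (pi K t).

Definition factors_on_F1 (m : bool -> nat) : Prop := forall K (y : D K), is_field K ->
  ent false (zval y) = 0 -> ent true (zval y) = 0 -> factors_near F m y.

(** The unit is the product of the powers [al] of [eps] and [ga] of det; the hypothesis says that
    its weight cancels those of f'^N and of the M-th power of the other entry. *)
Lemma factors_step_weight b m (N M : nat) (al ga : int) : (0 < M)%N -> factors_on_F1 m ->
  (forall R (x : GL3 k R), (forall i, mx x i i * imx x i i = 1) ->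
     chf q a1 a2 a3 m x ^+ N * (ew q b x al *
       ch x ((1 - q%:Z) * ga) ((1 - q%:Z) * ga) ((1 - q%:Z) * ga)) * chm q (single_exp (~~ b) M) x = 1) ->
  factors_on_F1 (incr_exp b m).
Proof.
move=> M0 Fm wt; pose d R (t : X R) := zpow (\det (mx (psi R t))) (\det (imx (psi R t))) ga.
pose u R (z : curve b R) : R := zpow (eps b (zval z)) (epsi b (zval z)) al * d R (zval z).
pose chu R (x : GL3 k R) := ew q b x al * ch x ((1 - q%:Z) * ga) ((1 - q%:Z) * ga) ((1 - q%:Z) * ga).
have un : locfun (fun _ _ => True) u.
  move=> R B f z _; rewrite /u /d /eps /epsi zval_fmap kmor_nat rmorphM /= -!zpow_map -!det_map_mx.
  by congr (_ * _); move: (zval z) => t; case: (b); congr (zpow _ _ _); exact: mx_fmap || exact: imx_fmap.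
have uu R (z : curve b R) : invertible (u R z).
  by apply: invertibleM; eexists; apply: zpowN; [exact: epsK | exact: detK].
have ua R (x y : GL3 k R) (z z' : curve b R) : zip_group_flag q x y -> zval z' = zA x y (zval z) ->
    u R z' = chu R x * u R z.
  by move=> xy zz'; rewrite /u /chu (eps_act _ xy zz') /d zz' (det_act _ _ xy) mulrACA.
have ww R (x y : GL3 k R) : zip_group_flag q x y ->
    chf q a1 a2 a3 m x ^+ N * chu R x * chm q (single_exp (~~ b) M) x = 1.
  by move=> xy; apply: wt; case: (flag_pairP (zq0 X) xy).
have S := @factors_step k q X F Fn a1 a2 a3 Fw Fl pi pir psurj m Fm b N M u chu M0 un uu ua ww (St b).
by move=> K y; apply: S; [exact: pc | exact: St1 | exact: St2].
Qed.

Lemma factors_step_any m : 0 < a1 - a3 -> factors_on_F1 m -> (1 < q)%N -> exists b, factors_on_F1 (incr_exp b m).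
Proof.
move=> a13 Fm q1.
(* On g_00 = 0 the first and third components of the weight give (q+1) al = - N (b_1 - a_3), on g_11
   = 0 the second and third give (q+1) al = - N (a_3 - b_2). With N = q^2 - 1 the numbers al and ga
   are integers, and the remaining component yields [Ma], respectively [Mb], as the exponent M. *)
pose N := (q ^ 2 - 1)%N.
have NE : N%:Z = q%:Z ^+ 2 - 1.
  by rewrite /N -subzn ?expn_gt0 ?(ltnW q1) // -!mulnn PoszM expr2.
pose b1 := a1 + (q%:Z - 1) * (m false)%:Z; pose b2 := a2 + (q%:Z - 1) * (m true)%:Z.
have b13 : 0 < b1 - a3.
  have : 0 <= (q%:Z - 1) * (m false)%:Z by apply: mulr_ge0 => //; rewrite subr_ge0 lez_nat ltnW.
  by rewrite /b1; lia.
(* Ma + (q+1) Mb = (q^2+q+1)(b1 - a3) > 0, so Ma > 0 or Mb > 0 *)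
pose Ma := (q%:Z + 1) * b2 - q%:Z * b1 - a3; pose Mb := (q%:Z + 1) * b1 - q%:Z * a3 - b2.
have MM : Ma + (q%:Z + 1) * Mb = (q%:Z ^+ 2 + q%:Z + 1) * (b1 - a3) by rewrite /Ma /Mb; ring.
have [Mag|Mal] := boolP (0 < Ma).
  have [M ME] : exists M : nat, Ma = M%:Z by exists `|Ma|%N; rewrite gtz0_abs.
  exists false; apply: (@factors_step_weight false m N M (- ((q%:Z - 1) * (b1 - a3))) (q%:Z * b1 + a3)) => //.
    by move: Mag; rewrite ME.
  move=> R x u; rewrite /chf -chX // /ew /chm -!chD // /single_exp /= NE -ME -/b1 -/b2.
  suff [-> -> ->] : [/\ b1 * (q%:Z ^+ 2 - 1) + (- ((q%:Z - 1) * (b1 - a3)) + (1 - q%:Z) * (q%:Z * b1 + a3)) + (1 - q%:Z) * 0%N%:Z = 0,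
    b2 * (q%:Z ^+ 2 - 1) + (0 + (1 - q%:Z) * (q%:Z * b1 + a3)) + (1 - q%:Z) * Ma = 0 &
    a3 * (q%:Z ^+ 2 - 1) + (- q%:Z * (- ((q%:Z - 1) * (b1 - a3))) + (1 - q%:Z) * (q%:Z * b1 + a3)) + 0 = 0].
    by rewrite /ch /= !mulr1.
  by rewrite /Ma; split; ring.
have Mbg : 0 < Mb.
  have h : 0 < (q%:Z ^+ 2 + q%:Z + 1) * (b1 - a3).
    by apply: mulr_gt0 => //; apply: ltr_wpDl => //; rewrite addr_ge0 ?sqr_ge0.
  rewrite -(pmulr_rgt0 _ (_ : 0 < q%:Z + 1)); last by rewrite ltr_wpDl.
  by move: h Mal; rewrite -MM; lia.
have [M ME] : exists M : nat, Mb = M%:Z by exists `|Mb|%N; rewrite gtz0_abs.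
exists true; apply: (@factors_step_weight true m N M (- ((q%:Z - 1) * (a3 - b2))) (q%:Z * a3 + b2)) => //.
  by move: Mbg; rewrite ME.
move=> R x u; rewrite /chf -chX // /ew /chm -!chD // /single_exp /= NE -ME -/b1 -/b2.
suff [-> -> ->] : [/\ b1 * (q%:Z ^+ 2 - 1) + (0 + (1 - q%:Z) * (q%:Z * a3 + b2)) + (1 - q%:Z) * Mb = 0,
  b2 * (q%:Z ^+ 2 - 1) + (- q%:Z * (- ((q%:Z - 1) * (a3 - b2))) + (1 - q%:Z) * (q%:Z * a3 + b2)) + (1 - q%:Z) * 0%N%:Z = 0 &
  a3 * (q%:Z ^+ 2 - 1) + (- ((q%:Z - 1) * (a3 - b2)) + (1 - q%:Z) * (q%:Z * a3 + b2)) + 0 = 0].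
  by rewrite /ch /= !mulr1.
by rewrite /Mb; split; ring.
Qed.

(** Each step raises one of the two exponents, but not a chosen one; only their sum is under
    control. *)
Lemma factors_on_F1_ex n : 0 < a1 - a3 -> (1 < q)%N -> exists2 m, (m false + m true)%N = n & factors_on_F1 m.
Proof.
move=> a13 q1; elim: n => [|n [m mn Fm]].
  exists (fun _ => 0%N) => // K y Kf _ _; exists (fun R y => F (zval y)); first exact/full_nfun/F_locfun.
  exists (fun _ _ => True); split=> // [|R z _]; first exact: open_full.
  by rewrite /mon !expr0 !mul1r.
have [b Fb] := factors_step_any a13 Fm q1; exists (incr_exp b m) => //.
by rewrite /incr_exp -mn; case: (b) => /=; rewrite ?addn0 ?addn1 // addnS.
Qed.

Lemma F_vanish K (y : D K) : 0 < a1 - a3 -> (1 < q)%N -> is_field K ->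
  ent false (zval y) = 0 -> ent true (zval y) = 0 -> near y (fun R t => F (zval t) = 0).
Proof.
move=> a13 q1 Kf y0 y1.
have Ds : smooth_k D := Z_smooth (zsmooth X) _.
have krull b : (forall n, exists2 m, (n <= m b)%N & factors_on_F1 m) -> near y (fun R t => F (zval t) = 0).
  move=> h; apply: (krull_near Ds Kf (e := fun R t => ent b (zval t)) (phi := fun R t => F (zval t))).
  - exact/full_nfun/ent_locfun.
  - exact/full_nfun/F_locfun.
  - by case: b h.
  - move=> n; have [m nm /(_ K y Kf y0 y1) [f' fn fF]] := h n.
    exists (fun R t => ent b (zval t) ^+ (m b - n) * ent (~~ b) (zval t) ^+ m (~~ b) * f' R t).
      have [V [Vo Vy Vf]] := fn; exists V; split=> // R B f t Vt.
      by rewrite zval_fmap !ent_map Vf // !rmorphM !rmorphXn.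
    apply: near_imp fF => R t ->; rewrite (monE b) !mulrA -exprD subnKC //.
(* Either the exponent of g_00 is unbounded, or it stays below some n0, and then total degree n0 + n
   makes the exponent of g_11 at least n. *)
have [h|h] := classic (forall n, exists2 m, (n <= m false)%N & factors_on_F1 m); first exact: krull h.
have [n0 n0P] := not_all_ex_not _ _ h.
apply: (krull true) => n; have [m mn Fm] := factors_on_F1_ex (n0 + n) a13 q1; exists m => //.
have [mf|mf] := leqP n0 (m false); first by case: n0P; exists m.
by move: mf mn; lia.
Qed.

End Vanish.

(** * Bruhat cells *)

Section Cells.
Variable k : closedFieldType.
Notation kalg := (comAlgType k).
Implicit Types (R A B C K L Q T : kalg).

(* [curve b] is the closure of the preimage of the stratum of [wof b]. *)
Definition wof (b : bool) : 'S_3 := if b then s1 else s2.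

Lemma inord1 : inord 1 = o1 :> 'I_3. Proof. by apply: val_inj; rewrite /= inordK. Qed.

Lemma s1E : [/\ s1 o0 = o1, s1 o1 = o0 & s1 o2 = o2].
Proof. by rewrite /s1 inord1; split; rewrite permE. Qed.

Lemma s2E : [/\ s2 o0 = o0, s2 o1 = o2 & s2 o2 = o1].
Proof. by rewrite /s2 inord1; split; rewrite permE. Qed.

Lemma w0E : [/\ w0 o0 = o2, w0 o1 = o1 & w0 o2 = o0].
Proof. by split; rewrite permE; apply: val_inj. Qed.

Lemma zE : [/\ zperm o0 = o1, zperm o1 = o2 & zperm o2 = o0].
Proof.
have [a0 a1 a2] := s1E; have [b0 b1 b2] := w0E.
by split; rewrite /zperm permM ?a0 ?a1 ?a2 ?b0 ?b1 ?b2.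
Qed.

Lemma zVE : [/\ (zperm^-1)%g o0 = o2, (zperm^-1)%g o1 = o0 & (zperm^-1)%g o2 = o1].
Proof. by have [z0 z1 z2] := zE; split; [rewrite -z2 | rewrite -z0 | rewrite -z1]; rewrite permK. Qed.

Lemma weyl_length_wof b : weyl_length (wof b) = 1%N.
Proof.
rewrite /weyl_length; pose p : 'I_3 * 'I_3 := if b then (o0, o1) else (o1, o2).
transitivity #|[set p]|; last exact: cards1.
apply: eq_card => -[i j]; rewrite !inE /= /p /wof.
have [a0 a1 a2] := s1E; have [b0 b1 b2] := s2E.
by move: i j; case: b {p}; elim/ord3P; elim/ord3P; rewrite ?a0 ?a1 ?a2 ?b0 ?b1 ?b2.
Qed.

Lemma cell_entry w R (g : GL3 k R) : flag_cell w g -> exists b b' : GL3 k R, [/\ borel b, borel b' &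
  forall i j, mx g i j = mx b i o0 * mx b' (w o0) (zperm j) + mx b i o1 * mx b' (w o1) (zperm j) +
    mx b i o2 * mx b' (w o2) (zperm j)].
Proof.
move=> [b [b' [bb bb' gE]]]; exists b, b'; split=> // i j.
by rewrite gE -col_permE mxE -mulmxA mul3 -row_permE !mxE.
Qed.

Lemma cell_in b R (g : GL3 k R) : flag_cell (wof b) g ->
  mx g o0 o1 = 0 /\ mx g (dg b) (dg b) = 0.
Proof.
move=> /cell_entry [x [y [xb yb gE]]]; have [z0 z1 z2] := zE.
have [a0 a1 a2] := s1E; have [b0 b1 b2] := s2E.
have [x01 x02 x12] : [/\ mx x o0 o1 = 0, mx x o0 o2 = 0 & mx x o1 o2 = 0] by split; apply: xb.
have [y01 y02 y12] : [/\ mx y o0 o1 = 0, mx y o0 o2 = 0 & mx y o1 o2 = 0] by split; apply: yb.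
by rewrite !gE z1; case: b {gE} => /=; rewrite ?a0 ?a1 ?b0 ?b1 ?z0 ?z1 x01 x02 ?x12 ?y01 ?y02 ?y12;
  split; ring.
Qed.

Lemma cell_w0s2 R (g : GL3 k R) : flag_cell (w0 * s2)%g g -> mx g o0 o1 = 0.
Proof.
move=> /cell_entry [x [y [xb yb gE]]]; have [z0 z1 z2] := zE.
have [c0 c1 c2] := w0E; have [b0 b1 b2] := s2E.
rewrite gE z1 !permM c0 b2 (xb o0 o1) // (xb o0 o2) // (yb o1 o2) //; ring.
Qed.

Definition perm_gl R (s : 'S_3) : GL3 k R.
Proof. by apply: (@mkGL k 3 R (perm_mx s) (perm_mx s^-1)%g); rewrite -perm_mxM mulgV perm_mx1. Defined.

Lemma perm_glE R (s : 'S_3) i j : mx (perm_gl R s) i j = (s i == j)%:R.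
Proof. by rewrite /perm_gl /mx /= !mxE. Qed.

Lemma mul_perm_gl R (A : 'M[R]_3) (s : 'S_3) i j :
  (A *m mx (perm_gl R s)) i j = A i ((s^-1)%g j) /\ (A *m imx (perm_gl R s)) i j = A i (s j).
Proof.
have E t : (A *m perm_mx (t^-1)%g) i j = A i (t j) by rewrite -col_permE mxE.
by split; [have := E (s^-1)%g; rewrite invgK | apply: E].
Qed.

Fact elem_subproof R (c : R) (r s : 'I_3) : r != s ->
  (1%:M + c *: delta_mx r s) *m (1%:M - c *: delta_mx r s) = 1%:M.
Proof.
move=> rs; rewrite mulmxDl !mulmxBr !mul1mx mulmx1 -scalemxAl -scalemxAr.
by rewrite mul_delta_mx_cond eq_sym (negbTE rs) mulr0n !scaler0 subr0 subrK.
Qed.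

(** An explicit Bruhat decomposition: one column operation, with the nonzero entry as pivot, makes g
    z b'^-1 w^-1 lower triangular. *)
Lemma cell_out b K (g : GL3 k K) : is_field K -> mx g o0 o1 = 0 -> mx g (dg b) (dg b) = 0 ->
  mx g (dg (~~ b)) (dg (~~ b)) <> 0 -> flag_cell (wof b) g.
Proof.
move=> Kf g01 gb gnb; have [v vE] := Kf _ (introN eqP gnb).
pose c := v * (if b then mx g o0 o2 else mx g o1 o0).
pose r := if b then o1 else o2; pose s := if b then o0 else o1.
have rs : r != s by rewrite /r /s; case: (b).
pose b' : GL3 k K := mkGL (elem_subproof c rs).
pose x : GL3 k K := glM (glM (glM g (perm_gl K zperm)) (glV b')) (glV (perm_gl K (wof b))).
have xE i j : mx x i j = mx g i ((zperm^-1)%g (wof b j)) - (wof b j == s)%:R * c * mx g i ((zperm^-1)%g r).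
  rewrite /x !mxM !mxV (@mul_perm_gl K _ _ _ _).2 [imx b']/imx /= mulmxBr mulmx1 mxE (@mul_perm_gl K _ _ _ _).1.
  congr (_ + _); rewrite mxE -scalemxAr mxE mul3 !(@mul_perm_gl K _ _ _ _).1 !mxE.
  congr (- _); rewrite [in RHS]mulrAC [RHS]mulrC; congr (c * _).
  move: (wof b j == s) => t; rewrite /r; case: (b); case: t; rewrite /= ?andbF ?andbT /= ?mulr0 ?mulr1 ?add0r ?addr0 ?mul0r ?mul1r //.
rewrite /flag_cell; exists x, b'; split.
- have [z0 z1 z2] := zVE; have [c0 c1 c2] := s1E; have [d0 d1 d2] := s2E.
  have xz : [/\ mx x o0 o1 = 0, mx x o0 o2 = 0 & mx x o1 o2 = 0].
    rewrite !xE /r /s /c; case: (b) gb vE => /= gb vE; rewrite ?c0 ?c1 ?c2 ?d0 ?d1 ?d2 ?z0 ?z1 ?z2 /= ?g01 ?gb.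
      split; rewrite ?mulr0 ?mul0r ?subr0 // ?mul1r mulrAC [v * _]mulrC vE mul1r subrr //.
    split; rewrite ?mulr0 ?mul0r ?subr0 // ?mul1r mulrAC [v * _]mulrC vE mul1r subrr //.
  by case: xz => x01 x02 x12; elim/ord3P; elim/ord3P.
- move=> i j ij; rewrite /b' /mx /= !mxE.
  have -> : (i == j) = false by apply/negbTE; apply: contraTneq ij => ->; rewrite ltnn.
  suff -> : (i == r) && (j == s) = false by rewrite mulr0 addr0.
  by apply/negbTE; apply/andP => -[/eqP ir /eqP js]; move: ij; rewrite ir js /r /s; case: (b).
- have e1 : imx (perm_gl K (wof b)) *m perm_mx (wof b) = 1%:M by exact: (imxK (perm_gl K (wof b))).
  have e2 : mx (perm_gl K zperm) *m perm_mx (zperm^-1)%g = 1%:M by exact: (mxK (perm_gl K zperm)).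
  rewrite /x !mxM !mxV -!mulmxA (mulmxA (imx (perm_gl _ _))) e1 mul1mx.
  by rewrite (mulmxA (imx b')) imxK mul1mx e2 mulmx1.
Qed.

End Cells.

(** * Divisibility along the orbits of the zip group *)

Section OrbitDivisibility.
Variable k : closedFieldType.
Notation kalg := (comAlgType k).
Implicit Types (R A B C K L Q T : kalg).

Definition dvd R (b a : R) : Prop := exists c, a = c * b.

Lemma dvd_ideal R (a b : R) : ideal (fun j => dvd b (j * a)).
Proof.
split; first by exists 0; rewrite !mul0r.
- by move=> j j' [c E] [c' E']; exists (c + c'); rewrite !mulrDl E E'.
- by move=> d j [c E]; exists (d * c); rewrite -!mulrA E.
Qed.

Lemma dvd_map R B (f : {lrmorphism R -> B}) (a b : R) : dvd b a -> dvd (f b) (f a).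
Proof. by move=> [c ->]; exists (f c); rewrite rmorphM. Qed.

Lemma dvd_clear R L (s a b : R) (i : {lrmorphism R -> L}) : is_loc s i -> dvd (i b) (i a) ->
  exists n, dvd b (s ^+ n * a).
Proof.
move=> il [c ab]; have [n [d dE]] : exists n r, i s ^+ n * c = i r by case: il.
have [|n' E] := loc_inj (a := s ^+ n * a) (b := d * b) il.
  by rewrite !rmorphM rmorphXn /= ab -dE mulrA.
by exists (n' + n)%N, (s ^+ n' * d); rewrite exprD -!mulrA E.
Qed.

Lemma dvd_local R (a b : R) : (forall K (g : {lrmorphism R -> K}), is_field K ->
  exists2 s, g s <> 0 & forall L (i : {lrmorphism R -> L}), is_loc s i -> dvd (i b) (i a)) ->
  dvd b a.
Proof.
move=> h; suff : dvd b (1 * a) by rewrite mul1r.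
apply: (unit_ideal_local (dvd_ideal a b)) => K g Kf.
have [s s0 sP] := h K g Kf; have [L [i [h' [il _]]]] := loc_at Kf s0.
have [n ab] := dvd_clear il (sP L i il); exists (s ^+ n) => //.
by rewrite rmorphXn /= => /(fieldX Kf).
Qed.

Lemma dvd_unit R (u v a b : R) : invertible u -> invertible v -> dvd b a -> dvd (u * b) (v * a).
Proof. by move=> [u' uE] _ [c ->]; exists (v * c * u'); rewrite -[in LHS](mul1r b) -uE; ring. Qed.

Variables (q : nat) (X : zipact k q).
Notation psi := (zpsi X).
Let q0 : (0 < q)%N := zq0 X.
Let frobD := @zfrob k q X.

Lemma o01 : o0 != o1. Proof. by []. Qed.
(** The root subgroup of L that E has in addition to E'; the partner of [elem w] in the second
    factor is [elem (w ^+ q)]. *)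
Definition elem R (w : R) : GL3 k R := mkGL (elem_subproof w o01).

Lemma elemE R (w : R) i j : mx (elem w) i j = (i == j)%:R + w * ((i == o0) && (j == o1))%:R.
Proof. by rewrite /elem /mx /= !mxE. Qed.

Lemma elem_map R B (f : {lrmorphism R -> B}) (w : R) : fmap f (elem w) = elem (f w).
Proof. by apply: GL_eq; apply/matrixP => i j; rewrite mx_fmap !elemE rmorphD rmorphM /= !rmorph_nat. Qed.

Lemma elem_zip R (w : R) : zip_group q (elem w) (elem (w ^+ q)).
Proof.
apply: (zip_of_entries q0); rewrite /= ?elemE /=; try (by split; rewrite mulr0 addr0).
elim/ord3P; elim/ord3P; rewrite // !elemE /= => _;
  by rewrite ?mulr0 ?mulr1 ?addr0 ?add0r ?expr1n // expr0n eqn0Ngt q0.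
Qed.

Lemma elemM R (w w' : R) : w + w' = 0 -> glM (elem w) (elem w') = gl1 3 R.
Proof.
move=> ww; apply: GL_eq; apply/matrixP => i j; rewrite mxM mul3 !elemE [RHS]mxE.
have -> : w = - w' by apply/eqP; rewrite -addr_eq0 ww.
by move: i j; elim/ord3P; elim/ord3P => /=; ring.
Qed.

Lemma frobN R (w : R) : (- w) ^+ q + w ^+ q = 0.
Proof. by rewrite -frobD addNr expr0n eqn0Ngt q0. Qed.

Definition shear R (w : R) (t : X R) : X R := zA (elem w) (elem (w ^+ q)) t.

Lemma shear_map R B (f : {lrmorphism R -> B}) (w : R) (t : X R) : fmap f (shear w t) = shear (f w) (fmap f t).
Proof. by rewrite /shear zact_map ?elem_map ?rmorphXn //; exact: elem_zip. Qed.

Lemma shear0 R (t : X R) : shear 0 t = t.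
Proof.
rewrite /shear expr0n eqn0Ngt q0 /=.
have -> : elem 0 = gl1 3 R by apply: GL_eq; apply/matrixP => i j; rewrite elemE mul0r addr0 [RHS]mxE.
exact: zact1.
Qed.

Definition e01 R (t : X R) : R := mx (psi R t) o0 o1.

Lemma e01_map R B (f : {lrmorphism R -> B}) (t : X R) : e01 (fmap f t) = f (e01 t).
Proof. by rewrite /e01 kmor_nat mx_fmap. Qed.

Lemma e01_su R (w : R) (t : X R) : let m i j := mx (psi R t) i j in
  e01 (shear w t) = m o0 o1 + m o1 o1 * w - m o0 o0 * w ^+ q - m o1 o0 * w ^+ q.+1.
Proof.
rewrite /= /e01 /shear zpsi_act; last exact: elem_zip.
rewrite !mxM mxV !mul3 !elemE /= /imx /= !mxE /= exprS; ring.
Qed.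

Lemma e01_act R (x y : GL3 k R) (t : X R) : zip_group_flag q x y ->
  e01 (zA x y t) = ch x 1 (- q%:Z) 0 * e01 t.
Proof.
move=> xy; rewrite /e01 zpsi_act; last by case: xy.
by rewrite (act01 _ (flag_pairP q0 xy)).
Qed.

Variable F : forall R, X R -> R.
Hypothesis Fn : locfun (fun R (t : X R) => True) F.
Variables a1 a2 a3 : int.
Hypothesis Fw : forall R (x y : GL3 k R) (t : X R), zip_group_flag q x y ->
  F (zA x y t) = ch x a1 a2 a3 * F t.

(* Divisibility of [F] by [g_01] on the translates of [t] by the universal unipotent matrix
   [1 + u E_01], over [R[u]]. *)
Definition generic_dvd R (t : X R) : Prop :=
  dvd (e01 (shear (pX R) (fmap (pC R) t))) (F (shear (pX R) (fmap (pC R) t))).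

Lemma generic_dvd_shear R B (t : X R) (f : {lrmorphism R -> B}) w : generic_dvd t ->
  dvd (e01 (shear w (fmap f t))) (F (shear w (fmap f t))).
Proof.
move=> /(dvd_map (pev f w)); rewrite -e01_map -Fn // shear_map pevX.
suff -> : fmap (pev f w) (fmap (pC R) t) = fmap f t by [].
by apply: fmapT => r; rewrite pCE pevC.
Qed.

Lemma zip_row0 R (x y : GL3 k R) : zip_group q x y ->
  mx x o0 o0 * imx x o0 o0 + mx x o0 o1 * imx x o1 o0 = 1.
Proof.
by move=> /zip_entries [[x02 _] _ _]; have := mx_imx x o0 o0; rewrite x02 mul0r addr0.
Qed.

Lemma ch_unit R (x y : GL3 k R) a b c : zip_group_flag q x y -> invertible (ch x a b c).
Proof.
by move=> /(flag_pairP q0) [_ u _ _]; exists (ch x (- a) (- b) (- c)); apply: chN.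
Qed.

(** If x_00 is invertible, (x, y) is an element of E' times the shear by w = x_01 / x_00, and E'
    changes [F] and g_01 by units only. *)
Lemma dvd_act R (x y : GL3 k R) (t : X R) : zip_group q x y -> invertible (mx x o0 o0) ->
  (forall w, dvd (e01 (shear w t)) (F (shear w t))) -> dvd (e01 (zA x y t)) (F (zA x y t)).
Proof.
move=> xy [v xv] h; pose w := v * mx x o0 o1.
have zw := elem_zip (- w); have z' := zipM q0 frobD xy zw.
have E : zA x y t = zA (glM x (elem (- w))) (glM y (elem ((- w) ^+ q))) (shear w t).
  rewrite /shear -zactM //; last exact: elem_zip.
  congr (zA _ _ _); apply: GL_eq; rewrite !mxM -!mulmxA -!mxM elemM ?addNr ?frobN // /gl1 /mx /= mulmx1 //.
have f' : zip_group_flag q (glM x (elem (- w))) (glM y (elem ((- w) ^+ q))).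
  apply: (in_flag_x01 z'); rewrite mxM mul3 !elemE /= /w.
  have [[x02 _] _ _] := zip_entries xy; rewrite x02.
  transitivity (mx x o0 o1 - (mx x o0 o0 * v) * mx x o0 o1); first by ring.
  by rewrite xv mul1r subrr.
rewrite E Fw // e01_act //; apply: dvd_unit (h w); exact: ch_unit f'.
Qed.

Variables (S : kfunctor k) (p : kmor X S).
Hypothesis pr : forall R (t t' : X R), p R t = p R t' <->
  exists x y, zip_group q x y /\ t' = zA x y t.

(** Quantified over base changes and fibres of [p], hence a property of the image of [t] in [S]. *)
Definition orbit_dvd R (t : X R) : Prop := forall B (f : {lrmorphism R -> B}) (t' : X B),
  p B t' = p B (fmap f t) -> dvd (e01 t') (F t').

Lemma orbit_dvd_p R (t t' : X R) : p R t = p R t' -> orbit_dvd t -> orbit_dvd t'.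
Proof. by move=> E h B f t1 E1; apply: (h B f); rewrite E1 !kmor_nat E. Qed.

(** Translation by the reflection of L, a matrix fixed by Frobenius; multiplying x by it exchanges
    x_00 and x_01. *)
Definition swap R (t : X R) : X R := zA (perm_gl R s1) (perm_gl R s1) t.

Lemma swap_zip R : zip_group q (perm_gl R s1) (perm_gl R s1).
Proof.
have [c0 c1 c2] := s1E; have E := perm_glE R s1.
apply: (zip_of_entries q0); rewrite /= ?E ?c0 ?c1 ?c2 //.
elim/ord3P; elim/ord3P; rewrite // !E ?c0 ?c1 ?c2 /= => _;
  by rewrite ?expr1n // expr0n eqn0Ngt q0.
Qed.

Lemma swap_map R B (f : {lrmorphism R -> B}) (t : X R) : fmap f (swap t) = swap (fmap f t).
Proof.
rewrite /swap zact_map; last exact: swap_zip.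
suff -> : fmap f (perm_gl R s1) = perm_gl B s1 :> GL3 k B by [].
by apply: GL_eq; apply/matrixP => i j; rewrite mx_fmap !perm_glE rmorph_nat.
Qed.

(* For (x, y) in E the entry x_00 or x_01 is locally invertible; modulo E', the element (x, y) is a
   shear in the first case and a shear after a swap in the second. *)
Lemma orbit_dvd_of_generic R (t : X R) : generic_dvd t -> generic_dvd (swap t) -> orbit_dvd t.
Proof.
move=> h0 h1 B f t' /esym /pr [x [y [xy ->]]].
apply: dvd_local => K g Kf; have x0 := zip_row0 xy.
have [g0|g0] := classic (g (mx x o0 o0) = 0); [exists (mx x o0 o1) | exists (mx x o0 o0)] => //.
- move=> g1; apply: (@kalg_nz1 k K); rewrite -(rmorph1 g) -x0 rmorphD !rmorphM /=.
  by rewrite g0 g1 !mul0r addr0.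
- move=> L i [iu _ _]; rewrite -e01_map -Fn // zact_map //.
  have xyi := zip_fmap q0 i xy; have zs := swap_zip L.
  pose sigma := perm_gl L s1.
  have ss : mx sigma *m mx sigma = 1%:M.
    by rewrite /sigma /mx /= -perm_mxM tperm2 perm_mx1.
  have E : zA (fmap i x : GL3 k L) (fmap i y : GL3 k L) (fmap i (fmap f t)) =
      zA (glM (fmap i x : GL3 k L) sigma) (glM (fmap i y : GL3 k L) sigma) (swap (fmap i (fmap f t))).
    rewrite /swap -zactM //; last exact: (zipM q0 frobD).
    by congr (zA _ _ _); apply: GL_eq; rewrite !mxM -mulmxA ss mulmx1.
  rewrite E; apply: dvd_act; first exact: (zipM q0 frobD).
    have [c0 c1 c2] := s1E.
    by rewrite mxM (mul_perm_gl _ _ _ _).1 /s1 tpermV -/s1 c0 mx_fmap.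
  by move=> w; rewrite -!swap_map fmapM; exact: generic_dvd_shear.
- move=> L i [iu _ _]; rewrite -e01_map -Fn // zact_map //.
  apply: dvd_act; [exact: zip_fmap | by rewrite mx_fmap |].
  by move=> w; rewrite fmapM; exact: generic_dvd_shear.
Qed.

(** Where x_00 vanishes, g_01 of the translate becomes x_01 g_10 (y^-1)_01, a product of three
    units, and so it divides everything nearby. *)
Lemma orbit_dvd_of_m10 R (t : X R) : generic_dvd t -> invertible (mx (psi R t) o1 o0) -> orbit_dvd t.
Proof.
move=> h0 h1 B f t' /esym /pr [x [y [xy ->]]].
apply: dvd_local => K g Kf; have x0 := zip_row0 xy.
have [g0|g0] := classic (g (mx x o0 o0) = 0); last first.
  exists (mx x o0 o0) => // L i [iu _ _]; rewrite -e01_map -Fn // zact_map //.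
  apply: dvd_act; [exact: zip_fmap | by rewrite mx_fmap |].
  by move=> w; rewrite fmapM; exact: generic_dvd_shear.
exists (e01 (zA x y (fmap f t))); last first.
  by move=> L i [[v iv] _ _]; exists (i (F (zA x y (fmap f t))) * v); rewrite -mulrA [v * _]mulrC iv mulr1.
rewrite -e01_map zact_map //; have xyg := zip_fmap q0 g xy.
move: (fmap g x : GL3 k K) (fmap g y : GL3 k K) (mx_fmap g x o0 o0) (mx_fmap g x o0 o1) xyg (zip_row0 xyg).
rewrite g0 => x' y' x00 _ xy' r0; rewrite x00 mul0r add0r in r0.
have [[x02 x12] [y20 y21] yE] := zip_entries xy'.
have f0 : (0 : K) ^+ q = 0 by rewrite expr0n eqn0Ngt q0.
have cancel (a b c : K) : a * b = 1 -> a * c = 0 -> c = 0.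
  by move=> ab ac; rewrite -[c]mul1r -ab mulrAC ac mul0r.
have v21 : imx y' o2 o1 = 0.
  have E1 := mx_imx y' o2 o1; have E2 := mx_imx y' o2 o2.
  by rewrite y20 y21 !mul0r !add0r in E1 E2; apply: cancel E2 E1.
have v11 : imx y' o1 o1 = 0.
  have := mx_imx y' o0 o1; rewrite v21 mulr0 addr0 (yE o0 o0) // (yE o0 o1) // x00 f0 mul0r add0r.
  by apply: (cancel _ (imx x' o1 o0 ^+ q)); rewrite -exprMn r0 expr1n.
have v01 : mx x' o1 o0 ^+ q * imx y' o0 o1 = 1.
  by have := mx_imx y' o1 o1; rewrite v11 v21 !mulr0 !addr0 (yE o1 o0).
rewrite /e01 zpsi_act // !mxM mxV !mul3 x00 x02 v21 v11 !kmor_nat !mx_fmap => E.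
have [d dE] := h1.
have g1 : g (f (mx (psi R t) o1 o0)) * g (f d) = 1 by rewrite -!rmorphM dE !rmorph1.
apply: (@kalg_nz1 k K).
have : mx x' o0 o1 * g (f (mx (psi R t) o1 o0)) * imx y' o0 o1 = 0 by rewrite -[RHS]E; ring.
move=> E'; transitivity ((mx x' o0 o1 * g (f (mx (psi R t) o1 o0)) * imx y' o0 o1) *
  (imx x' o1 o0 * g (f d) * mx x' o1 o0 ^+ q)); last by rewrite E' mul0r.
transitivity ((mx x' o0 o1 * imx x' o1 o0) * (g (f (mx (psi R t) o1 o0)) * g (f d)) *
  (mx x' o1 o0 ^+ q * imx y' o0 o1)); first by rewrite r0 g1 v01 !mulr1.
by ring.
Qed.

(** McCoy's theorem for g_01 + g_11 u - g_00 u^q - g_10 u^(q+1), whose exponents are distinct since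
    q > 1: an element killed by the upper left 2 x 2 block of an invertible 3 x 3 matrix is 0. *)
Lemma e01_nzd R (t : X R) : (1 < q)%N -> nzd (e01 (shear (pX R) (fmap (pC R) t))).
Proof.
move=> q1; set P := e01 _ => Q PQ; apply/polyP => l; rewrite coef0.
pose m i j := mx (psi R t) i j.
have PE : P = (m o0 o1)%:P + (m o1 o1)%:P * 'X - (m o0 o0)%:P * 'X^q - (m o1 o0)%:P * 'X^(q.+1) :> {poly R}.
  by rewrite /P e01_su kmor_nat !mx_fmap !pCE.
have cE i : (P : {poly R})`_i = m o0 o1 *+ (i == 0)%N + m o1 o1 *+ (i == 1)%N - m o0 o0 *+ (i == q) - m o1 o0 *+ (i == q.+1).
  by rewrite PE !coefB coefD coefC !coefCM coefX !coefXn !mulr_natr; case: (i == 0%N); rewrite ?mulr1n.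
apply: (@mccoy R (fun r => r = 0) P Q).
- by split=> // [? ? -> ->|? ? ->]; rewrite ?addr0 ?mulr0.
- move=> r h.
  have [q00 q10 qs0 qs1] : [/\ (0 == q)%N = false, (1 == q)%N = false, (q.+1 == 0)%N = false & (q.+1 == 1)%N = false].
    by move: q1; clear; case: q => [|[|?]].
  have qq : (q == q.+1) = false by rewrite eqn_leq ltnn andbF.
  have qq' : (q.+1 == q) = false by rewrite eq_sym.
  have c01 : m o0 o1 * r = 0 by have := h 0%N; rewrite cE q00 !eqxx /= !mulr0n !subr0 addr0 mulr1n.
  have c11 : m o1 o1 * r = 0 by have := h 1%N; rewrite cE q10 eqxx /= eqSS q00 !mulr0n !subr0 add0r mulr1n.
  have c00 : m o0 o0 * r = 0.
    have := h q; rewrite cE eqxx qq [q == 0%N]eq_sym q00 [q == 1%N]eq_sym q10 !mulr0n addr0 add0r subr0 mulr1n.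
    by move/eqP; rewrite mulNr oppr_eq0 => /eqP.
  have c10 : m o1 o0 * r = 0.
    have := h q.+1; rewrite cE eqxx qq' qs0 qs1 !mulr0n addr0 subr0 add0r mulr1n.
    by move/eqP; rewrite mulNr oppr_eq0 => /eqP.
  (* After multiplication by r the upper left block of the identity is the column (g_02, g_12) times
     a row of the inverse. It has rank one, and its vanishing 2 x 2 minor gives r = 0. *)
  have H (i j : 'I_3) : m i o0 * r = 0 -> m i o1 * r = 0 ->
      m i o2 * imx (psi R t) o2 j * r = (i == j)%:R * r.
    rewrite -(mx_imx (psi R t) i j) /m => h0 h1.
    by rewrite !mulrDl [X in X + _ + _]mulrAC h0 [X in _ + X + _]mulrAC h1 !mul0r !add0r.
  have E00 := H o0 o0 c00 c01; have E01 := H o0 o1 c00 c01; have E11 := H o1 o1 c10 c11.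
  rewrite /= !mul1r ?mul0r in E00 E01 E11.
  rewrite -E00 -E11.
  transitivity (m o1 o2 * imx (psi R t) o2 o0 * (m o0 o2 * imx (psi R t) o2 o1 * r)); first by ring.
  by rewrite E01 mulr0.
- by move=> i; rewrite PQ coef0.
Qed.

End OrbitDivisibility.

(* The matrix of multiplication by [j] on [A[u]/(H)] becomes triangular with
   constant diagonal when [H] becomes a power of [u]. *)
Lemma det_kill (A K : comNzRingType) (g : {rmorphism A -> K}) n (H j f : {poly A}) :
  H \is monic -> size H = n.+2 -> (forall l, (l < n.+1)%N -> g H`_l = 0) ->
  (exists c, j * f = c * H) ->
  exists d, g d = g j`_0 ^+ n.+1 /\ exists c, d%:P * f = c * H.
Proof.
move=> Hm Hs H0 [c0 jf].
pose Q k := Pdiv.Ring.rdivp (j * 'X^k) H; pose r k := Pdiv.Ring.rmodp (j * 'X^k) H.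
have E k : j * 'X^k = Q k * H + r k by exact: Pdiv.RingMonic.rdivp_eq.
have rs k : (size (r k) <= n.+1)%N.
  by rewrite -ltnS -Hs; apply: Pdiv.Ring.ltn_rmodpN0; rewrite -size_poly_eq0 Hs.
pose N : 'M[A]_n.+1 := \matrix_(k, l) (r k)`_l.
have rE (k : 'I_n.+1) : r k = \sum_(l < n.+1) (N k l)%:P * 'X^l.
  rewrite -[LHS]coefK; rewrite (poly_def _ _) (big_ord_widen _ (fun i => (r k)`_i *: 'X^i) (rs k)).
  rewrite big_mkcond; apply: eq_bigr => l _; rewrite mxE mul_polyC.
  by case: ltnP => // h; rewrite nth_default ?scale0r.
have gr (k l : nat) : (l < n.+1)%N -> g (r k)`_l = if (l < k)%N then 0 else g j`_(l - k).
  move=> ln; have -> : r k = j * 'X^k - Q k * H by rewrite E addrC addrA addNr add0r.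
  rewrite coefB rmorphB coefMXn coefM rmorph_sum big1 ?subr0 => [|i _]; first by case: ifP; rewrite ?rmorph0.
  by rewrite rmorphM /= H0 ?mulr0 // (leq_ltn_trans _ ln) // leq_subr.
exists (\det N); split.
  rewrite -det_map_mx -det_tr det_trig.
    rewrite (eq_bigr (fun _ => g j`_0)) ?prodr_const ?card_ord // => i _.
    by rewrite !mxE gr // ltnn subnn.
  by apply/is_trig_mxP => i l il; rewrite !mxE gr ?il.
(* The first row of adj(N) N = det N writes the constant det N through the remainders [r k] of j
   X^k, and each [r k] times f is a multiple of H. *)
have -> : (\det N)%:P = \sum_(k < n.+1) (\adj N ord0 k)%:P * r k.
  transitivity (\sum_(l < n.+1) ((\adj N *m N) ord0 l)%:P * 'X^l).
    rewrite mul_adj_mx (bigD1 ord0) //= mxE eqxx mulr1n expr0 mulr1 big1 ?addr0 // => l l0.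
    by rewrite mxE eq_sym (negbTE l0) mul0r.
  transitivity (\sum_(l < n.+1) \sum_(k < n.+1) (\adj N ord0 k)%:P * ((N k l)%:P * 'X^l)).
    apply: eq_bigr => l _; rewrite mxE rmorph_sum /= mulr_suml; apply: eq_bigr => k _.
    by rewrite polyCM mulrA.
  by rewrite exchange_big; apply: eq_bigr => k _; rewrite rE mulr_sumr.
exists (\sum_(k < n.+1) (\adj N ord0 k)%:P * ('X^k * c0 - Q k * f)).
rewrite !mulr_suml; apply: eq_bigr => k _; rewrite -!mulrA; congr (_ * _).
have -> : r k = j * 'X^k - Q k * H by rewrite E addrC addrA addNr add0r.
rewrite mulrBl mulrAC jf mulrBl; congr (_ - _); ring.
Qed.

(** * Elimination of the unipotent parameter near F1 *)

Section NearF1.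
Variable k : closedFieldType.
Notation kalg := (comAlgType k).
Implicit Types (R A B C K L Q T : kalg).
Variables (q : nat) (X : zipact k q).
Notation psi := (zpsi X).
Notation D := (Zfun psi [:: (o0, o1)]).
Let q0 : (0 < q)%N := zq0 X.

Lemma X_smooth_k : smooth_k X.
Proof.
have [lft _] := Z_smooth (zsmooth X) [::]; split.
  move=> A B pi x0 ps psq; have [|z zE] := @zmkP k X psi [::] B x0; first by [].
  by have [x xE] := lft A B pi z ps psq; exists (zval x); rewrite -zval_fmap xE.
move=> K x Kf; exact: (X_chart (zsmooth X) x Kf).
Qed.

Variable F : forall R, X R -> R.
Hypothesis Fn : locfun (fun R (t : X R) => True) F.
Variables a1 a2 a3 : int.
Hypothesis Fw : forall R (x y : GL3 k R) (t : X R), zip_group_flag q x y ->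
  F (zA x y t) = ch x a1 a2 a3 * F t.
Variables (S : kfunctor k) (p : kmor X S).
Hypothesis pr : forall R (t t' : X R), p R t = p R t' <->
  exists x y, zip_group q x y /\ t' = zA x y t.

Definition generic_shear R (t : X R) : X (pK R) := shear (pX R) (fmap (pC R) t).

Definition generic_dvd_by R (s : R) (t : X R) : Prop := dvd (e01 (generic_shear t)) (pC R s * F (generic_shear t)).

Lemma generic_dvd_by_ideal R (t : X R) : ideal (fun s => generic_dvd_by s t).
Proof.
have [h0 hD hM] := dvd_ideal (F (generic_shear t)) (e01 (generic_shear t)).
split; first by rewrite /generic_dvd_by rmorph0.
- by move=> a b ha hb; rewrite /generic_dvd_by rmorphD; apply: hD.
- by move=> a b hb; rewrite /generic_dvd_by rmorphM; apply: hM.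
Qed.

Lemma generic_dvd_by1 R (t : X R) : generic_dvd_by 1 t <-> generic_dvd F t.
Proof. by rewrite /generic_dvd_by rmorph1 mul1r. Qed.

Definition pmap R B (f : {lrmorphism R -> B}) : {lrmorphism pK R -> pK B} := pev (pC B \o f) (pX B).

Lemma pmapC R B (f : {lrmorphism R -> B}) a : pmap f (pC R a) = pC B (f a).
Proof. by rewrite /pmap pCE pevC. Qed.

Lemma pmapE R B (f : {lrmorphism R -> B}) (c : pK R) :
  pmap f c = map_poly f (c : {poly R}) :> {poly B}.
Proof.
elim/pK_ind: c => [|c a IH]; first by rewrite rmorph0 map_poly0.
rewrite rmorphD rmorphM /= IH pmapC /pmap pevX.
by rewrite rmorphD rmorphM /= map_polyX !pCE map_polyC.
Qed.

Lemma generic_shear_map R B (f : {lrmorphism R -> B}) (t : X R) : fmap (pmap f) (generic_shear t) = generic_shear (fmap f t).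
Proof.
by rewrite /generic_shear shear_map /pmap pevX; congr shear; apply: fmapC => a; rewrite /= [in LHS]pCE pevC.
Qed.

Lemma generic_dvd_by_map R B (f : {lrmorphism R -> B}) s (t : X R) : generic_dvd_by s t -> generic_dvd_by (f s) (fmap f t).
Proof. by move=> /(dvd_map (pmap f)); rewrite rmorphM /= pmapC -e01_map -Fn // generic_shear_map. Qed.

Lemma generic_dvd_of_by R (s : R) (t : X R) : invertible s -> generic_dvd_by s t -> generic_dvd F t.
Proof.
move=> [v sv] h; apply/generic_dvd_by1; rewrite -sv mulrC.
by have [_ _ hM] := generic_dvd_by_ideal t; apply: hM.
Qed.

Lemma generic_dvd_near (U : subf X) A (a : X A) K (g : {lrmorphism A -> K}) (s : A) :
  affine_open U a -> is_field K -> g s <> 0 -> generic_dvd_by s a -> near (fmap g a) (fun R t => generic_dvd F t).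
Proof.
move=> Ua Kf s0 h; apply: (near_chart Ua Kf s0) => L i [iu _ _] R f.
by rewrite fmapM; apply: (generic_dvd_of_by (s := f (i s))); [apply: (invertible_map f) | apply: (generic_dvd_by_map (f \o i))].
Qed.

Hypothesis F0 : forall K (y : D K), is_field K -> ent false (zval y) = 0 -> ent true (zval y) = 0 ->
  near y (fun R t => F (zval t) = 0).

Lemma m10_nz R (g : GL3 k R) : mx g o0 o0 = 0 -> mx g o0 o1 = 0 -> mx g o1 o1 = 0 -> invertible (mx g o1 o0).
Proof.
move=> g00 g01 g11; have h0 := mx_imx g o0 o0; have h1 := mx_imx g o0 o1; have h2 := mx_imx g o1 o1.
rewrite g00 g01 g11 !mul0r !add0r ?addr0 /= in h0 h1 h2.
exists (imx g o0 o1); rewrite -[RHS]h2.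
have -> : imx g o2 o1 = 0; last by rewrite mulr0 addr0.
by rewrite -[LHS]mul1r -[1]h0 mulrAC h1 mul0r.
Qed.

(** At a point over F1 the polynomial g_01(u) reduces to - g_10 u^(q+1) with g_10 invertible, so up
    to a unit it is monic with lower coefficients vanishing at the point. [F] vanishes on A[u]/(H)
    near u = 0, that is, after multiplication by some j; [det_kill] replaces j by its norm d, an
    element of [A] that does not vanish at the point. *)
Lemma orbit_dvd_near_F1 K (x : X K) : is_field K -> e01 x = 0 -> ent false x = 0 -> ent true x = 0 ->
  near x (fun R t => orbit_dvd F p t).
Proof.
move=> Kf x01 x00 x11.
pose W R (t : X R) := True /\ exists v, mx (psi R t) o1 o0 * v = 1.
have mlf : locfun (fun _ _ => True) (fun R (t : X R) => mx (psi R t) o1 o0).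
  by move=> R B f t _; rewrite kmor_nat mx_fmap.
have Wo : open_sub W := open_unit (@open_full _ _) mlf.
have Wx : W K x by split=> //; apply: m10_nz.
suff Dx : near x (fun R t => generic_dvd F t).
  have Wn : near x W by exists W.
  by apply: near_imp (near_and Dx Wn) => R t [h [_ u]]; apply: (orbit_dvd_of_m10 Fn Fw pr).
have [U [A [a [g [Ua fA _ [_ Wa] ga]]]]] := chart_near X_smooth_k Kf Wo Wx.
have gm i j : g (mx (psi A a) i j) = mx (psi K x) i j by rewrite -ga kmor_nat mx_fmap.
have [v av] := Wa; pose H := e01 (generic_shear a); pose m i j := mx (psi A a) i j.
pose pg : {lrmorphism pK A -> K} := pev g 0.
have pgt : fmap pg (generic_shear a) = x.
  rewrite /generic_shear shear_map /pg pevX -[RHS]ga -[RHS]shear0; congr shear.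
  by apply: fmapT => r; rewrite pCE pevC.
have JI : ideal (fun r => dvd H r).
  split; first by exists 0; rewrite mul0r.
  - by move=> _ _ [c ->] [d ->]; exists (c + d); rewrite mulrDl.
  - by move=> c _ [d ->]; exists (c * d); rewrite mulrA.
have pgH : pg H = 0 by rewrite /H -e01_map pgt.
have J1 : ~ dvd H 1.
  by move=> [c E]; apply: (@kalg_nz1 k K); rewrite -(rmorph1 pg) E rmorphM /= pgH mulr0.
have [B [pB [ps pk]]] := quot_ex JI J1.
have [G GE] : exists G : {lrmorphism B -> K}, forall r, G (pB r) = pg r.
  by apply: (quot_lift ps) => r /pk [c ->]; rewrite rmorphM /= pgH mulr0.
(* The universal shear of the chart, restricted to A[u]/(H), is a point of the divisor D. *)
have [y yE] : exists y : D B, zval y = fmap pB (generic_shear a).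
  by apply: D_mk; rewrite -/(e01 _) e01_map; apply/pk; exists 1; rewrite mul1r.
have yx : zval (fmap G y) = x by rewrite zval_fmap yE -pgt; apply: fmapT.
have [|s s0 sF] := near_at (Q := fun R t => F (zval t) = 0) Kf (g := G) (y := y).
  by apply: F0 => //; rewrite yx.
have [L [i [_ [il _]]]] := loc_at Kf s0.
have [n sn] : exists n, s ^+ n * F (zval y) = 0.
  case: (il) => iu _ ik; apply: ik; have := sF L i iu.
  by rewrite zval_fmap Fn.
have [j jE] := ps (s ^+ n).
have j0 : pg j <> 0 by rewrite -GE jE rmorphXn /= => /(fieldX Kf).
have jF : dvd H (j * F (generic_shear a)).
  by apply/pk; rewrite rmorphM /= jE -Fn // -yE.
pose H1 : {poly A} := - (v%:P * (H : {poly A})).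
have HE : (H : {poly A}) = (m o0 o1)%:P + (m o1 o1)%:P * 'X - (m o0 o0)%:P * 'X^q - (m o1 o0)%:P * 'X^(q.+1).
  by rewrite /H /generic_shear e01_su kmor_nat !mx_fmap !pCE.
pose r : {poly A} := v%:P * ((m o0 o0)%:P * 'X^q - (m o1 o1)%:P * 'X - (m o0 o1)%:P).
have H1E : H1 = 'X^(q.+1) + r.
  have vm : v%:P * (m o1 o0)%:P = 1 :> {poly A} by rewrite -polyCM mulrC av polyC1.
  by rewrite /H1 HE /r -[X in _ = X + _]mul1r -vm; ring.
have rs : (size r < q.+2)%N.
  rewrite /r -[v%:P * _]/(v%:P * _) mul_polyC (leq_ltn_trans (size_scale_leq _ _)) // ltnS.
  apply: leq_trans (size_polyD _ _) _; rewrite geq_max size_polyN (leq_trans (size_polyC_leq1 _)) // andbT.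
  apply: leq_trans (size_polyD _ _) _; rewrite geq_max size_polyN !mul_polyC.
  rewrite (leq_trans (size_scale_leq _ _)) ?size_polyXn //= (leq_trans (size_scale_leq _ _)) // size_polyX ltnS //.
have Hs : size H1 = q.+2 by rewrite H1E size_polyDl size_polyXn.
have Hm : H1 \is monic by rewrite monicE H1E lead_coefDl ?size_polyXn // lead_coefXn.
have Hl l : (l < q.+1)%N -> g H1`_l = 0.
  move=> lq; rewrite H1E coefD coefXn (ltn_eqF lq) add0r /r coefCM !coefB !coefCM coefC.
  have z00 : g (m o0 o0) = 0 by rewrite gm.
  have z11 : g (m o1 o1) = 0 by rewrite gm.
  have z01 : g (m o0 o1) = 0 by rewrite gm.
  by rewrite !rmorphM !rmorphB !rmorphM /= z00 z11; case: (l == 0%N); rewrite ?z01 ?rmorph0; ring.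
have HH1 : H = - ((m o1 o0)%:P * H1) :> {poly A}.
  by rewrite /H1 mulrN opprK mulrA -polyCM av mul1r.
have [|d [gd [c dF]]] := @det_kill A K g q H1 j (F (generic_shear a)) Hm Hs Hl.
  by have [c cE] := jF; exists (- (c * (m o1 o0)%:P)); rewrite [LHS]cE HH1; ring.
rewrite -ga; apply: (generic_dvd_near (s := d) Ua Kf).
  have -> : g d = g (j : {poly A})`_0 ^+ q.+1 by [].
  move/(fieldX Kf) => h; apply: j0.
  by rewrite /pg pevE horner_coef0 coef_map.
exists (- (c * v%:P)); rewrite pCE [LHS]dF -/H /H1; ring.
Qed.

End NearF1.

(** * Divisibility along orbits is open, closed and E-invariant *)

Section Clopen.
Variable k : closedFieldType.
Notation kalg := (comAlgType k).
Implicit Types (R A B C K L Q T : kalg).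

Lemma mC_map_coef A B n (f : {lrmorphism A -> B}) (P : mpK A n) m :
  (mev (mC B n \o f) (fun l => 'X_l : mpK B n) P : {mpoly B[n]})@_m = f (P : {mpoly A[n]})@_m.
Proof.
rewrite -mcoeff_map_mpoly; congr (_ @_ m); rewrite mevE /map_mpoly /mmap.
by apply: eq_bigr => l _; rewrite /= mCE.
Qed.

Variables (q : nat) (X : zipact k q).
Notation psi := (zpsi X).
Let q0 : (0 < q)%N := zq0 X.

(** The elements of E near (x, y) that move the chart into [V], cut out by one function [s] on the
    coordinate space of E over [A]. *)
Lemma univ_open_pt A K (g : {lrmorphism A -> K}) (a : X A) (x y : GL3 k K) (V : subf X) :
  zip_group q x y -> is_field K -> open_sub V -> V K (zA x y (fmap g a)) ->
  exists (s : mpK A 9) (ev : {lrmorphism mpK A 9 -> K}),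
    [/\ forall r, ev (mC A 9 r) = g r, ev s <> 0 & forall B (f : {lrmorphism mpK A 9 -> B}),
        invertible (f s) -> exists x' y' : GL3 k B, zip_group q x' y' /\
          V B (zA x' y' (fmap (f \o mC A 9) a))].
Proof.
move=> xy Kf Vo Vx.
have [L [i [h [x' [y' [[s0 il] hE xy' hx hy]]]]]] := univ_pair X g (xy : in_flag q true x y).
have Vh : V K (fmap h (zA x' y' (fmap (i \o mC A 9) a))).
  rewrite zact_map // hx hy; suff -> : fmap h (fmap (i \o mC A 9) a) = fmap g a by [].
  exact: fmapT.
have [s s00 sV] := open_at Vo Kf Vh.
have [u [c [uu uc]]] := (locz_loc il).1 s.
have u0 : invertible (i s0) by case: il.
have hc : h (i c) <> 0.
  by rewrite -uc rmorphM /= => /(fieldM Kf) [/(invertible_nz (invertible_map h uu))|].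
exists (s0 * c), (h \o i); split=> //=.
  by rewrite !rmorphM /= => /(fieldM Kf) [/(invertible_nz (invertible_map h u0))|].
move=> B f; rewrite rmorphM => fu.
have fs0 := invertible_factor fu; rewrite mulrC in fu; have fc := invertible_factor fu.
have [e eE] := loc_lift (g := f) il fs0.
have us : invertible (e s).
  apply: (invertible_factor (b := e (i u))); have -> : e s * e (i u) = f c by rewrite mulrC -eE -uc rmorphM.
  exact: fc.
exists (fmap e x'), (fmap e y'); split; first exact: (zip_fmap q0).
have := sV B e us; rewrite zact_map //.
suff -> : fmap e (fmap (i \o mC A 9) a) = fmap (f \o mC A 9) a by [].
by rewrite fmapM; apply: fmap_eq => r; exact: eE.
Qed.

Variable F : forall R, X R -> R.
Hypothesis Fn : locfun (fun R (t : X R) => True) F.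
Variables a1 a2 a3 : int.
Hypothesis Fw : forall R (x y : GL3 k R) (t : X R), zip_group_flag q x y ->
  F (zA x y t) = ch x a1 a2 a3 * F t.
Variables (S : kfunctor k) (p : kmor X S).
Hypothesis pr : forall R (t t' : X R), p R t = p R t' <->
  exists x y, zip_group q x y /\ t' = zA x y t.
Hypothesis q1 : (1 < q)%N.

Lemma p_generic_shear R (t : X R) : p _ (generic_shear t) = p _ (fmap (pC R) t).
Proof. by apply/esym/pr; exists (elem (pX R)), (elem (pX R ^+ q)); split=> //; exact: (elem_zip X). Qed.

Lemma p_swap R (t : X R) : p R (swap t) = p R t.
Proof. by apply/esym/pr; exists (perm_gl R s1), (perm_gl R s1); split=> //; exact: (swap_zip X). Qed.

Lemma p_generic_shear_swap R (t : X R) : p _ (generic_shear (swap t)) = p _ (fmap (pC R) t).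
Proof. by rewrite p_generic_shear swap_map p_swap. Qed.

Lemma orbit_dvd_clear A (a : X A) (s : A) (t : X (pK A)) : (forall n, s ^+ n <> 0) ->
  (forall B (h : {lrmorphism A -> B}), invertible (h s) -> orbit_dvd F p (fmap h a)) ->
  p _ t = p _ (fmap (pC A) a) -> exists n, dvd (e01 t) (pC A (s ^+ n) * F t).
Proof.
move=> sn h tE; have [|L [i il]] := @loc_ex k _ (pC A s).
  move=> n /(congr1 (pev (idfun : {lrmorphism A -> A}) 0)).
  by rewrite rmorphXn rmorph0 /= pCE pevC; apply: sn.
have [|n E] := @dvd_clear k (pK A) L (pC A s) (F t) (e01 t) i il.
  rewrite -e01_map -Fn //; apply: (h L (i \o pC A) _ L idfun); first by case: il.
  by rewrite fmap_idE -fmapM kmor_nat tE -kmor_nat.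
by exists n; rewrite rmorphXn.
Qed.

Lemma orbit_dvd_near (U : subf X) A (a : X A) K (g : {lrmorphism A -> K}) (s s' : A) :
  affine_open U a -> is_field K -> g s <> 0 -> g s' <> 0 -> generic_dvd_by F s a -> generic_dvd_by F s' (swap a) ->
  near (fmap g a) (fun R t => orbit_dvd F p t).
Proof.
move=> Ua Kf s0 s'0 h h'; apply: (near_chart (s := s * s') Ua Kf).
  by rewrite rmorphM /= => /(fieldM Kf) [].
move=> L i [iu _ _] R f; have iu' := invertible_map f iu.
have u1 : invertible (f (i s)) by apply: (invertible_factor (b := f (i s'))); rewrite -!rmorphM.
have u2 : invertible (f (i s')) by apply: (invertible_factor (b := f (i s))); rewrite -!rmorphM mulrC.
rewrite fmapM; apply: (orbit_dvd_of_generic Fn Fw pr).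
  by apply: (generic_dvd_of_by u1); apply: (generic_dvd_by_map Fn (f \o i)).
by rewrite -swap_map; apply: (generic_dvd_of_by u2); apply: (generic_dvd_by_map Fn (f \o i)).
Qed.

(* The divisor has unit content, so a factor coming from the base can be cancelled. *)
Lemma generic_dvd_cancel (U : subf X) A (a t : X A) K (g : {lrmorphism A -> K}) (j : A) :
  affine_open U a -> fgen (base A) -> is_field K -> generic_dvd_by F j t ->
  ~ (exists2 s, g s <> 0 & s * j = 0) -> exists2 s, g s <> 0 & generic_dvd_by F s t.
Proof.
move=> Ua fA Kf [c jc] jn.
have cj l : exists d, (c : {poly A})`_l = d * j.
  have [[d dj]|j1] := classic (exists d, 1 = d * j).
    by exists ((c : {poly A})`_l * d); rewrite -mulrA -dj mulr1.
  have [||Q [f [fs fk]]] := @quot_ex k A (fun r => exists d, r = d * j).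
  - split; first by exists 0; rewrite mul0r.
    + by move=> _ _ [d ->] [e ->]; exists (d + e); rewrite mulrDl.
    + by move=> e _ [d ->]; exists (e * d); rewrite mulrA.
  - by [].
  have fj : f j = 0 by apply/fk; exists 1; rewrite mul1r.
  apply/fk; rewrite -coef_map -pmapE.
  suff -> : pmap f c = 0 by rewrite coef0.
  apply: (e01_nzd (t := fmap f t) q1); rewrite -/(generic_shear _) -generic_shear_map e01_map mulrC -rmorphM -jc.
  by rewrite rmorphM /= pmapC fj rmorph0 mul0r.
pose d l := proj1_sig (constructive_indefinite_description _ (cj l)).
have dE l : (c : {poly A})`_l = d l * j by rewrite /d; case: constructive_indefinite_description.
pose c' : pK A := \poly_(l < size (c : {poly A})) d l.
have cE : c = pC A j * c'.
  apply/polyP => l; rewrite pCE coefCM coef_poly; case: ltnP => h; first by rewrite dE mulrC.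
  by rewrite nth_default ?mulr0.
pose w : pK A := F (generic_shear t) - c' * e01 (generic_shear t).
have jw : pC A j * w = 0 by rewrite /w mulrBr jc cE mulrA subrr.
have wl l : exists2 s, g s <> 0 & s * (w : {poly A})`_l = 0.
  have : j * (w : {poly A})`_l = 0 by rewrite -coefCM -pCE jw coef0.
  by move=> /(chart_domain g (X_smooth_k X) Ua fA Kf) [].
have [s s0 sw0] : exists2 s, g s <> 0 & forall l, (l < size (w : {poly A}))%N -> s * (w : {poly A})`_l = 0.
  elim: (size _) => [|n [s s0 sP]]; first by exists 1 => //; rewrite rmorph1; exact: kalg_nz1.
  have [s' s'0 s'P] := wl n; exists (s * s').
    by rewrite rmorphM /= => /(fieldM Kf) [].
  move=> l; rewrite ltnS leq_eqVlt => /orP[/eqP ->|/sP E]; first by rewrite -mulrA s'P mulr0.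
  by rewrite mulrAC E mul0r.
exists s => //; exists (pC A s * c'); apply/eqP; rewrite -mulrA -subr_eq0 -mulrBr -/w.
apply/eqP/polyP => l; rewrite coef0 pCE coefCM; have [/sw0 //|h] := ltnP l (size (w : {poly A})).
by rewrite nth_default ?mulr0.
Qed.

(** Consider the ideal of the j for which j F is divisible by g_01 at the universal shear of the
    chart, and the same ideal after the swap. If both contain an element that is not locally 0, it
    can be cancelled and divisibility holds near x. Otherwise one of the ideals is killed by some s,
    and divisibility fails wherever s is invertible. *)
Lemma orbit_dvd_clopen K (x : X K) : is_field K -> ~ near x (fun R t => orbit_dvd F p t) ->
  exists V : subf X, [/\ open_sub V, V K x & forall K' (x' : X K'), is_field K' -> V K' x' ->
    ~ near x' (fun R t => orbit_dvd F p t)].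
Proof.
move=> Kf nD; have [U [A [a [g [Ua fA An _ ga]]]]] := chart_near (X_smooth_k X) Kf (@open_full _ _)
  (I : (fun R (y : X R) => True) K x).
have kill (t : X A) : (p _ (generic_shear t) = p _ (fmap (pC A) a)) ->
    (forall j, generic_dvd_by F j t -> exists2 s, g s <> 0 & s * j = 0) ->
    exists V : subf X, [/\ open_sub V, V K x & forall K' (x' : X K'), is_field K' -> V K' x' ->
      ~ near x' (fun R t => orbit_dvd F p t)].
  move=> tE /(noeth_kill An Kf (generic_dvd_by_ideal F t)) [s s0 sP].
  have [L [i [h [il hE]]]] := loc_at Kf s0; have Ua' := affine_loc Ua il.
  exists (fun R (x : X R) => exists f : {lrmorphism L -> R}, fmap f (fmap i a) = x); split.
  - exact: affine_open_open Ua'.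
  - by exists h; rewrite -ga; apply: fmapT.
  - move=> K' _ Kf' [f <-]; rewrite fmapM => /(near_at Kf') [s' s'0 s'P].
    have [n /sP E] := orbit_dvd_clear (field_pow_nz Kf' s'0) s'P tE.
    have /(fieldM Kf') : f (i s) * f (i s') ^+ n = 0 by rewrite -!rmorphXn -!rmorphM E !rmorph0.
    case; last by move/(fieldX Kf').
    by apply: invertible_nz; apply: (invertible_map f); case: il.
have [h1|h1] := classic (forall j, generic_dvd_by F j a -> exists2 s, g s <> 0 & s * j = 0).
  by apply: (kill a) => //; exact: p_generic_shear.
have [h2|h2] := classic (forall j, generic_dvd_by F j (swap a) -> exists2 s, g s <> 0 & s * j = 0).
  by apply: (kill (swap a)) => //; exact: p_generic_shear_swap.
case: nD; rewrite -ga.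
have cancel t : ~ (forall j, generic_dvd_by F j t -> exists2 s, g s <> 0 & s * j = 0) ->
    exists2 s, g s <> 0 & generic_dvd_by F s t.
  move=> /not_all_ex_not [j H]; have [jt jn] := imply_to_and _ _ H.
  exact: (generic_dvd_cancel Ua fA Kf jt jn).
have [s s0 sD] := cancel a h1; have [s' s'0 s'D] := cancel (swap a) h2.
exact: (orbit_dvd_near Ua Kf s0 s'0 sD s'D).
Qed.

(** Divisibility holds after moving the chart by the elements of E where [s] is invertible; being a
    property of orbits, it holds for the universal shears over the localization of
    A[u][X_1, ..., X_9] at s. Coefficients at a monomial where s^n has a coefficient nonzero at the
    point bring it back to A[u]. *)
Lemma orbit_dvd_sat K (x x' : X K) : is_field K -> p K x = p K x' ->
  near x (fun R t => orbit_dvd F p t) -> near x' (fun R t => orbit_dvd F p t).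
Proof.
move=> Kf /esym /pr [ex [ey [exy xE]]] [V [Vo Vx VD]].
have [U [A [a [g [Ua fA An _ ga]]]]] := chart_near (X_smooth_k X) Kf (@open_full _ _)
  (I : (fun R (y : X R) => True) K x').
rewrite xE -ga in Vx; have [s [ev [evC s0 sP]]] := univ_open_pt exy Kf Vo Vx.
pose A9 := mpK A 9; pose B9 := mpK (pK A) 9.
pose io : {lrmorphism A9 -> B9} := mev (mC (pK A) 9 \o pC A) (fun l => 'X_l : B9).
pose h9 : {lrmorphism B9 -> K} := mev (pev g 0) (fun l => ev 'X_l).
have h9E r : h9 (io r) = ev r.
  have E : h9 \o io =1 ev.
    apply: mpK_eq => [c|l]; rewrite /= /io /h9.
      by rewrite mevC /= mCE mevC pCE pevC -evC mCE.
    by rewrite !mevX.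
  exact: E.
have st : h9 (io s) <> 0 by rewrite h9E.
have [B [iB [_ [iBl _]]]] := loc_at Kf st.
have DB : orbit_dvd F p (fmap (iB \o io \o mC A 9) a).
  have [|ex' [ey' [exy' Vb]]] := sP B (iB \o io); first by case: iBl.
  by apply: orbit_dvd_p (VD _ _ Vb); apply/esym/pr; exists ex', ey'.
have get (t : X (pK A)) : p _ t = p _ (fmap (pC A) a) -> exists2 r, g r <> 0 & dvd (e01 t) (pC A r * F t).
  move=> tE; have [|n [c cE]] := @dvd_clear k B9 B (io s) (mC _ 9 (F t)) (mC _ 9 (e01 t)) iB iBl.
    have := DB B idfun (fmap (iB \o mC (pK A) 9) t); rewrite fmap_idE e01_map Fn //; apply.
    rewrite kmor_nat tE -kmor_nat; congr (p _ _); rewrite fmapM; apply: fmap_eq => r /=.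
    by rewrite /io [in RHS]mCE mevC.
  have evn : ev (s ^+ n) <> 0 by rewrite rmorphXn /= => /(fieldX Kf).
  have [m gm] := coef_pt evC evn; exists ((s ^+ n : {mpoly A[9]})@_m) => //.
  exists ((c : {mpoly (pK A)[9]})@_m).
  have := congr1 (fun P : {mpoly (pK A)[9]} => P@_m) cE.
  rewrite -rmorphXn !mCE [in LHS]mulrC mcoeffCM [in LHS]mulrC [in RHS]mulrC mcoeffCM [in RHS]mulrC /= => <-.
  by rewrite /io mC_map_coef.
have [r r0 rD] := get _ (p_generic_shear a); have [r' r'0 r'D] := get _ (p_generic_shear_swap a).
by rewrite -ga; apply: (orbit_dvd_near Ua Kf r0 r'0 rD r'D).
Qed.

End Clopen.

(** * Connected components *)

Section Components.
Variable k : closedFieldType.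
Notation kalg := (comAlgType k).
Implicit Types (R A B C K L Q T : kalg).

Lemma open_field (Y : kfunctor k) (U : subf Y) K K' (f : {lrmorphism K -> K'}) (y : Y K) :
  open_sub U -> is_field K -> is_field K' -> U K y <-> U K' (fmap f y).
Proof.
move=> Uo Kf Kf'; split; first exact: open_fmap.
have [I IE] := Uo K y => /IE /(unit_ideal_field _ _ Kf') [r Ir r0].
rewrite -[y]fmap_idE; apply/IE/(unit_ideal_field _ _ Kf); exists r => //= r00.
by apply: r0; rewrite r00 rmorph0.
Qed.

(** The union of all connected sets through s. The smallest candidate is [Ps], the points that no
    open subset separates from s, which is insensitive to field extension. *)
Lemma component_ex (S : kfunctor k) K0 (s : S K0) : is_field K0 ->
  exists C : subf S, connected_component C /\ C K0 s.
Proof.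
move=> Kf0; pose Ps : subf S := fun K x => forall U : subf S, open_sub U -> U K x <-> U K0 s.
have Psc : connected_set Ps.
  split; first by move=> K K' f x Kf Kf'; split=> h U Uo;
    [rewrite -(open_field f x Uo Kf Kf') | rewrite (open_field f x Uo Kf Kf')]; apply: h.
    by exists K0, s.
  move=> U V Uo Vo _ [K [x [Kf xs Ux]]] [K' [x' [Kf' xs' Vx']]].
  by exists K0, s; split=> //; split; [apply/(xs U Uo) | apply/(xs' V Vo)].
pose C : subf S := fun K x => exists A : subf S, [/\ connected_set A, A K0 s & A K x].
have Cs : C K0 s by exists Ps.
exists C; split=> //; split; last first.
  by move=> A Ac CA K x Kf Ax; exists A; split=> //; apply: CA.
split.
- move=> K K' f x Kf Kf'; split=> -[A [Ac As Ax]]; exists A; split=> //.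
    by case: Ac => Ap _ _; apply/(Ap K K' f x Kf Kf').
  by case: Ac => Ap _ _; apply/(Ap K K' f x Kf Kf').
- by exists K0, s.
- move=> U V Uo Vo cov [K [x [Kf [A [Ac As Ax]] Ux]]] [K' [x' [Kf' [A' [Ac' As' Ax']] Vx']]].
  have sub (Z : subf S) : connected_set Z -> Z K0 s -> meets Z U -> meets Z V ->
      meets C (fun K x => U K x /\ V K x).
    move=> Zc Zs ZU ZV; case: (Zc) => _ _ /(_ U V Uo Vo) [|//|//|L [y [Lf Zy UVy]]].
      by move=> L y Lf Zy; apply: cov => //; exists Z.
    by exists L, y; split=> //; exists Z.
  have [Us|Vs] := cov K0 s Kf0 Cs.
    by apply: (sub A') => //; [exists K0, s | exists K', x'].
  by apply: (sub A) => //; [exists K, x | exists K0, s].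
Qed.

Variables (X S : kfunctor k) (p : kmor X S).
Hypothesis psurj : forall R (s : S R), exists (R' : kalg) (f : {lrmorphism R -> R'})
  (t : X R'), fppf_cover f /\ p R' t = fmap f s.
Variable P : forall R, X R -> Prop.
Hypothesis P_clopen : forall K (x : X K), is_field K -> ~ near x P -> exists V : subf X,
  [/\ open_sub V, V K x & forall K' (x' : X K'), is_field K' -> V K' x' -> ~ near x' P].
Hypothesis P_sat : forall K (x x' : X K), is_field K -> p K x = p K x' -> near x P -> near x' P.
Hypothesis P_meets : forall C : subf S, connected_component C ->
  exists K (x : X K), [/\ is_field K, C K (p K x) & near x P].

Let on R (t : X R) := forall K (g : {lrmorphism R -> K}), is_field K -> near (fmap g t) P.
Let offp R (t : X R) := forall K (g : {lrmorphism R -> K}), is_field K -> ~ near (fmap g t) P.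

Let on_map R B (f : {lrmorphism R -> B}) (t : X R) : on t -> on (fmap f t).
Proof. by move=> h K g Kf; rewrite fmapM; apply: h. Qed.

Let off_map R B (f : {lrmorphism R -> B}) (t : X R) : offp t -> offp (fmap f t).
Proof. by move=> h K g Kf; rewrite fmapM; apply: h. Qed.

Let has_pt R : exists K (g : {lrmorphism R -> K}), is_field K.
Proof.
have [||K [g [Kf _ _]]] := @field_pt_max k R (fun r => r = 0); last by exists K, g.
  by split=> // [? ? -> ->|? ? ->]; rewrite ?addr0 ?mulr0.
by move/(@kalg_nz1 k R).
Qed.

Let on_local R (t : X R) K (g : {lrmorphism R -> K}) : is_field K ->
  exists2 s, g s <> 0 & forall L (i : {lrmorphism R -> L}), invertible (i s) ->
    on (fmap i t) \/ offp (fmap i t).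
Proof.
move=> Kf; have [h|h] := classic (near (fmap g t) P).
  have [V [Vo Vx VP]] := near_near h; have [s s0 sV] := open_at Vo Kf Vx.
  by exists s => // L i iu; left=> K' g' Kf'; apply: VP; apply: open_fmap => //; apply: sV.
have [V [Vo Vx VP]] := P_clopen Kf h; have [s s0 sV] := open_at Vo Kf Vx.
by exists s => // L i iu; right=> K' g' Kf'; apply: VP => //; apply: open_fmap => //; apply: sV.
Qed.

Let on_inv R (t t' : X R) : p R t = p R t' -> on t -> offp t' -> False.
Proof.
move=> E h h'; have [K [g Kf]] := has_pt R; apply: (h' K g Kf).
by apply: (P_sat (x := fmap g t)) => //; [rewrite !kmor_nat E | apply: h].
Qed.

(** The function that is 1 where [P] holds locally and 0 elsewhere glues, since both loci are open,
    and descends to [S]. If it were 0 at some point, the component through that point would meet two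
    disjoint open sets that cover it. *)
Lemma all_of_clopen K (x : X K) : is_field K -> near x P.
Proof.
move=> Kf; apply: NNPP => nx.
pose Psi R (t : X R) (r : R) := (on t /\ r = 1) \/ (offp t /\ r = 0).
have [|||ep [epn epE]] := @glue k X Psi.
- move=> R B f y r [[h ->]|[h ->]]; [left | right]; rewrite ?rmorph1 ?rmorph0; split=> //.
    exact: on_map.
  exact: off_map.
- move=> R y r r' [[h ->]|[h ->]] [[h' ->]|[h' ->]] //.
    by case: (on_inv (t := y) (t' := y)).
  by case: (on_inv (t := y) (t' := y)).
- move=> R y L g Lf; have [s s0 sP] := on_local y g Lf; exists s => // T i [iu _ _].
  by have [h|h] := sP T i iu; [exists 1; left | exists 0; right].
have [|eS eSn eSE] := @descend_fun k X S p psurj ep epn.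
  move=> R t t' E; apply: local_eq_loc => L g Lf.
  have [s s0 sP] := on_local t g Lf; have [s' s'0 s'P] := on_local t' g Lf.
  exists (s * s') => [|T i [iu _ _]]; first by rewrite rmorphM => /(fieldM Lf) [].
  have iu1 : invertible (i s) by apply: (invertible_factor (b := i s')); rewrite -rmorphM.
  have iu2 : invertible (i s') by apply: (invertible_factor (b := i s)); rewrite mulrC -rmorphM.
  have E' : p T (fmap i t) = p T (fmap i t') by rewrite !kmor_nat E.
  rewrite -!epn //; have [h|h] := sP T i iu1; have [h'|h'] := s'P T i iu2.
  - by rewrite (epE _ _ 1) ?(epE _ (fmap i t') 1) //; left.
  - by case: (on_inv E').
  - by case: (on_inv (esym E')).
  - by rewrite (epE _ _ 0) ?(epE _ (fmap i t') 0) //; right.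
have ep01 L (t : X L) : is_field L -> (near t P /\ ep L t = 1) \/ (~ near t P /\ ep L t = 0).
  move=> Lf; have [h|h] := classic (near t P); [left | right]; split=> //; apply: epE; [left | right];
    split=> // T g Tf; first exact: near_fmap.
  by move/(near_fmapP Lf Tf).
pose U1 : subf S := fun R s => True /\ exists y, eS R s * y = 1.
pose U0 : subf S := fun R s => True /\ exists y, (1 - eS R s) * y = 1.
have U1o : open_sub U1 := open_unit (@open_full _ _) eSn.
have U0o : open_sub U0.
  apply: (open_unit (phi := fun R s => 1 - eS R s) (@open_full _ _)) => R B f s _.
  by rewrite eSn // rmorphB rmorph1.
have [C [Cc Cx]] := component_ex (p K x) Kf.
have [K' [x' [Kf' Cx' nx']]] := P_meets Cc.
have [[_ _ Ccon] _] := Cc.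
have [|||L [s [Lf _ [[_ u0] [_ u1]]]]] := Ccon U0 U1 U0o U1o.
- move=> L s Lf _; have [e0|e0] := classic (eS L s = 0).
    by left; split=> //; exists 1; rewrite e0 subr0 mulr1.
  by right; split=> //; apply: Lf; apply/eqP.
- exists K, (p K x); split=> //; split=> //; exists 1.
  by rewrite eSE; have [[]|[_ ->]] // := ep01 K x Kf; rewrite subr0 mulr1.
- exists K', (p K' x'); split=> //; split=> //; exists 1.
  by rewrite eSE; have [[_ ->]|[]] // := ep01 K' x' Kf'; rewrite mulr1.
have [B [f [t [_ tE]]]] := psurj s; have [T [g Tf]] := has_pt B.
have E : eS T (fmap (g \o f) s) = ep T (fmap g t) by rewrite -fmapM -tE -kmor_nat eSE.
have {u1} /invertible_nz := invertible_map (g \o f) u1; have {u0} /invertible_nz := invertible_map (g \o f) u0.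
have {}E : g (f (eS L s)) = ep T (fmap g t) by rewrite -E eSn.
rewrite /= rmorphB rmorphB !rmorph1 /= !E; have [[_ ->]|[_ ->]] := ep01 T (fmap g t) Tf; rewrite ?subrr => h0 h1;
  by [case: h0 | case: h1].
Qed.

End Components.

(** * Divisibility by the partial Hasse invariant *)

Section Final.
Variable k : closedFieldType.
Notation kalg := (comAlgType k).
Implicit Types (R A B C K L Q T : kalg).

Lemma frobenius_add p r : prime p -> p \in [pchar k] -> forall R (a b : R),
  (a + b) ^+ (p ^ r) = a ^+ (p ^ r) + b ^+ (p ^ r).
Proof.
move=> pp pk R a b; apply: exprDn_pchar.
by rewrite pnatX pnatE // (pchar_lalg R) pk.
Qed.

Lemma borelV R (x : GL3 k R) : borel x -> borel (glV x).
Proof.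
move=> xb; have x01 := xb o0 o1 isT; have x02 := xb o0 o2 isT; have x12 := xb o1 o2 isT.
have u0 : invertible (mx x o0 o0).
  by exists (imx x o0 o0); have := mx_imx x o0 o0; rewrite x01 x02 !mul0r !addr0.
have v1 : imx x o0 o1 = 0.
  by apply: (invertible_inj u0); have := mx_imx x o0 o1; rewrite x01 x02 !mul0r !addr0.
have v2 : imx x o0 o2 = 0.
  by apply: (invertible_inj u0); have := mx_imx x o0 o2; rewrite x01 x02 !mul0r !addr0.
have u1 : invertible (mx x o1 o1).
  by exists (imx x o1 o1); have := mx_imx x o1 o1; rewrite v1 x12 mulr0 mul0r add0r addr0.
have v12 : imx x o1 o2 = 0.
  by apply: (invertible_inj u1); have := mx_imx x o1 o2; rewrite v2 x12 mulr0 mul0r add0r addr0.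
by elim/ord3P; elim/ord3P.
Qed.

Lemma parabolic1 R : parabolic Minus (gl1 3 R).
Proof.
have [|l [_ h _]] := @levi_split k Minus R (gl1 3 R); last exact: h.
by rewrite /gl1 /mx /= !mxE.
Qed.

Lemma fmap_gl1 R B (f : {lrmorphism R -> B}) : fmap f (gl1 3 R : GL3 k R) = gl1 3 B.
Proof.
by apply: GL_eq; apply/matrixP => i j; rewrite mx_fmap /gl1 /mx /= !mxE rmorph_nat.
Qed.

(** Modulo [Ha] the universal matrix is a zero of [Ha], so it lies in the reduced closure of the
    cell; there g_01 vanishes, because g_01 = 0 is a closed condition that holds on the cell. *)
Lemma hasse_dvd q lam (Ha : kmor (GL3 k) (A1 k)) : partial_hasse_invariant q s2 lam Ha ->
  forall R (g : GL3 k R), dvd (Ha R g : R) (mx g o0 o1).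
Proof.
move=> [_ Ha0]; have [G [gam [_ Gu]]] := gl_universal k.
suff [c cE] : dvd (Ha G gam : G) (mx gam o0 o1).
  move=> R g; have [f fE] := Gu R g; exists (f c).
  by rewrite -fE mx_fmap kmor_nat cE rmorphM.
have [|H1] := classic (dvd (Ha G gam : G) 1).
  by move=> [c cE]; exists (mx gam o0 o1 * c); rewrite -mulrA -cE mulr1.
have [||Q [f [fs fk]]] := @quot_ex k G (fun r => dvd (Ha G gam : G) r).
- split; first by exists 0; rewrite mul0r.
  + by move=> _ _ [c ->] [d ->]; exists (c + d); rewrite mulrDl.
  + by move=> c _ [d ->]; exists (c * d); rewrite mulrA.
- by [].
apply/fk; rewrite -mx_fmap; have /(Ha0 Q _) h : Ha Q (fmap f gam) = 0 :> Q.
  by rewrite kmor_nat; apply/fk; exists 1; rewrite mul1r.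
apply: (h (fun R g => mx g o0 o1 = 0)).
  move=> R g; exists (fun r => r = mx g o0 o1) => B e; rewrite mx_fmap.
  by split=> [E r ->|->].
by move=> K x _; apply: cell_w0s2.
Qed.

End Final.

Theorem theorem4p2p4 (p r : nat) (k : closedFieldType)
    (S : kfunctor k) (zeta : gzip_map (p ^ r)%N S)
    (Fl : kfunctor k) (pi : kmor (zt zeta) Fl)
    (Ha : kmor (GL3 k) (A1 k)) (a1 a2 a3 : int)
    (f : forall R : comAlgType k, zt zeta R -> GL3 k R -> R) :
  prime p -> (0 < r)%N -> algebraic_closure_Fq p (p ^ r) k ->
  is_scheme S ->
  zip_smooth zeta ->
  zip_surjective_on_components zeta ->
  is_flag_space pi ->
  length1_strata_pseudo_complete pi ->
  partial_hasse_invariant (p ^ r) s2 (weight 1 (- (p ^ r)%:Z) 0) Ha ->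
  V_I_section (weight a1 a2 a3) f ->
  a1 - a3 > 0 ->
  divisible_by (weight a1 a2 a3) (weight 1 (- (p ^ r)%:Z) 0) f Ha.
Proof.
move=> pp r0 [pk _] _ zs surj [_ [_ _ _ pir [_ psurj]]] pc hHa [fn fB fE] a13.
have q1 : (1 < p ^ r)%N by rewrite -(exp1n r) ltn_exp2r // prime_gt1.
have [act1 actM actn pr [_ Ssurj]] := zt_torsor zeta.
pose X := ZipAct (ltnW q1) (frobenius_add r pp pk) zs act1 actM actn (@zmor_equiv _ _ _ zeta).
pose F (R : comAlgType k) (t : X R) : R := to_flag f t.
have Fn : locfun (fun R (t : X R) => True) F.
  by move=> R B g t _; rewrite /F /to_flag -fn ?fmap_gl1 //; exact: parabolic1.
have Fw (R : comAlgType k) (x y : GL3 k R) (t : X R) : zip_group_flag (p ^ r) x y ->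
    F R (zA x y t) = ch x a1 a2 a3 * F R t.
  move=> [xy xb]; rewrite /F /to_flag /= fE //; last exact: parabolic1.
  have -> : glM (glV x) (gl1 3 R) = glM (gl1 3 R) (glV x).
    by apply: GL_eq; rewrite !mxM /gl1 /mx /= mulmx1 mul1mx.
  rewrite fB; [|exact: parabolic1 | exact: borelV].
  have -> : glV (glV x) = x by apply: GL_eq; rewrite !mxV imxV.
  by rewrite character_ch.
have F0 (K : comAlgType k) (y : Zfun (zpsi X) [:: (o0, o1)] K) : is_field K ->
    ent false (zval y) = 0 -> ent true (zval y) = 0 -> near y (fun R t => F R (zval t) = 0).
  apply: (F_vanish Fn Fw pir psurj (St := fun b => flag_stratum pi (wof b))) => //.
  - by move=> b; apply: pc; apply: weyl_length_wof.
  - move=> b L z Lf [L' [g [t [Lf' tz /cell_in [t01 tb]]]]]; by exists L', g, t.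
  - move=> b L t Lf t01 tb tnb; exists L, idfun, t; rewrite fmap_idE; split=> //.
    exact: cell_out.
have near_all (K : comAlgType k) (x : X K) : is_field K -> near x (fun R t => orbit_dvd F (zproj zeta) t).
  apply: (all_of_clopen Ssurj (P := fun R t => orbit_dvd F (zproj zeta) t)).
  - exact: (orbit_dvd_clopen Fn Fw pr q1).
  - exact: (orbit_dvd_sat Fn Fw pr).
  - move=> C Cc; have Kf : is_field (kk k) := @field_kk k.
    (* The permutation matrix of z^-1 lies in B B z^-1, the cell of F1; by condition (b) every
       component has a point above it. *)
    have [K' [g [t [Kf' Ct tE]]]] := surj C Cc _ (perm_gl (kk k) (zperm^-1)%g) Kf.
    have [z0 z1 z2] := zVE.
    have psiE i j : mx (zpsi X K' t) i j = g ((((zperm^-1)%g i) == j)%:R).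
      by rewrite [zpsi X K' t]tE mx_fmap perm_glE.
    exists K', t; split=> //; apply: (orbit_dvd_near_F1 Fn Fw pr F0 Kf').
    + by rewrite /e01 psiE z0 rmorph0.
    + by rewrite /ent psiE z0 rmorph0.
    + by rewrite /ent psiE z1 rmorph0.
have div_all (R : comAlgType k) (t : X R) : dvd (e01 t) (F R t).
  apply: dvd_local => K g Kf; have [s s0 sP] := near_at Kf (near_all K (fmap g t) Kf).
  exists s => // L i [iu _ _]; rewrite -e01_map -Fn //.
  by have := sP L i iu L idfun (fmap i t); rewrite fmap_idE; apply.
(* At a point t the value of [Ha] may be a zero divisor, so a quotient of [F] by it is not unique.
   At the universal shear it divides a nonzero divisor; the quotient [c] is then unique, hence
   functorial in t, and its value at u = 0 is the section sought. *)
have HaN (R : comAlgType k) (t : X R) : nzd (Ha _ (zpsi X _ (generic_shear t)) : pK R).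
  move=> c Hc; have [v vE] := hasse_dvd hHa (zpsi X _ (generic_shear t)).
  by apply: (e01_nzd (t := t) q1); rewrite /e01 -/(generic_shear t) vE -mulrA Hc mulr0.
have ex (R : comAlgType k) (t : X R) : exists c : pK R, F _ (generic_shear t) = c * Ha _ (zpsi X _ (generic_shear t)).
  have [v vE] := hasse_dvd hHa (zpsi X _ (generic_shear t)); have [c ->] := div_all _ (generic_shear t).
  by exists (c * v); rewrite /e01 vE mulrA.
pose c (R : comAlgType k) (t : X R) := proj1_sig (constructive_indefinite_description _ (ex R t)).
have cE (R : comAlgType k) (t : X R) : F _ (generic_shear t) = c R t * Ha _ (zpsi X _ (generic_shear t)).
  by rewrite /c; case: constructive_indefinite_description.
have c_map (R B : comAlgType k) (g : {lrmorphism R -> B}) (t : X R) : c B (fmap g t) = pmap g (c R t).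
  apply/eqP; rewrite -subr_eq0; apply/eqP; apply: (HaN B (fmap g t)).
  have e : Ha _ (zpsi X _ (generic_shear (fmap g t))) = pmap g (Ha _ (zpsi X _ (generic_shear t)) : pK R).
    by rewrite -generic_shear_map kmor_nat; exact: (kmor_nat Ha).
  rewrite mulrBr mulrC -cE e -generic_shear_map (Fn _ _ (pmap g)) // cE.
  by rewrite (rmorphM (pmap g)) mulrC subrr.
pose h0 (R : comAlgType k) (t : X R) : R := pev (idfun : {lrmorphism R -> R}) 0 (c R t).
have h0n (R B : comAlgType k) (g : {lrmorphism R -> B}) (t : X R) : h0 B (fmap g t) = g (h0 R t).
  rewrite /h0 c_map.
  have E : pev (idfun : {lrmorphism B -> B}) 0 \o pmap g =1 g \o pev (idfun : {lrmorphism R -> R}) 0.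
    apply: pK_eq => [b|] /=; rewrite /pmap ?pevC ?pevX ?rmorph0 /= ?pCE ?pevC ?pevX //.
  exact: E.
have h0E (R : comAlgType k) (t : X R) : F R t = h0 R t * (Ha R (zpsi X R t) : R).
  have E : fmap (pev (idfun : {lrmorphism R -> R}) 0) (generic_shear t) = t.
    rewrite /generic_shear shear_map pevX -[RHS]shear0; congr shear; rewrite -[RHS]fmap_idE.
    by apply: fmapT => b; rewrite pCE pevC.
  rewrite -[in LHS]E Fn // cE rmorphM /= -/(h0 R t); congr (_ * _).
  by rewrite -[RHS]/(Ha R _) -{2}E kmor_nat [RHS]kmor_nat.
exists (KMor (Y := A1 k) h0n); last exact: h0E.
move=> R x y t0 xy; have [xyz _] := xy; pose t : X R := t0; rewrite -/t.
have fp := flag_pairP (ltnW q1) xy; have [_ u _ _] := fp.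
have [Hac _] := hHa.
have -> : weight a1 a2 a3 - weight 1 (- (p ^ r)%:Z) 0 = weight (a1 - 1) (a2 - - (p ^ r)%:Z) (a3 - 0).
  by apply/rowP; elim/ord3P; rewrite !mxE.
rewrite character_ch /=.
pose xx := fmap (pC R) x : GL3 k (pK R); pose yy := fmap (pC R) y : GL3 k (pK R).
have xyy : zip_group_flag (p ^ r) xx yy := in_flag_map X (fl := false) (pC R) xy.
have [_ uu _ _] := flag_pairP (ltnW q1) xyy.
have E1 := Fw _ xx yy (generic_shear t) xyy.
have Hx := Hac _ xx yy (zpsi X _ (generic_shear t)) xyy; rewrite character_ch in Hx.
have zz := zpsi_act (generic_shear t) (proj1 xyy).
rewrite h0E zz (h0E _ (generic_shear t)) [Ha _ _]Hx in E1.
(* Semi-invariance of the quotient is also proved at the universal shear, where [Ha] can be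
   cancelled, and then specialized to u = 0. *)
have E2 : ch xx 1 (- (p ^ r)%:Z) 0 * h0 _ (zA xx yy (generic_shear t)) = ch xx a1 a2 a3 * h0 _ (generic_shear t).
  apply/eqP; rewrite -subr_eq0; apply/eqP; apply: (HaN R t).
  rewrite mulrBr; apply/eqP; rewrite subr_eq0; apply/eqP.
  by rewrite mulrC [RHS]mulrC -[RHS]mulrA -E1; ring.
have E3 : fmap (pev (idfun : {lrmorphism R -> R}) 0) (generic_shear t) = t.
  rewrite /generic_shear shear_map pevX -[RHS]shear0; congr shear; rewrite -[RHS]fmap_idE.
  by apply: fmapT => b; rewrite pCE pevC.
have Ex (z : GL3 k R) : fmap (pev (idfun : {lrmorphism R -> R}) 0) (fmap (pC R) z : GL3 k (pK R)) = z.
  by rewrite -[RHS]fmap_idE; apply: fmapT => b; rewrite pCE pevC.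
have ch0 d1 d2 d3 : pev (idfun : {lrmorphism R -> R}) 0 (ch xx d1 d2 d3) = ch x d1 d2 d3.
  rewrite /ch !rmorphM /= -!zpow_map -!mx_fmap -!imx_fmap /xx Ex //.
pose ev0 : {lrmorphism pK R -> R} := pev (idfun : {lrmorphism R -> R}) 0.
have E4 : ev0 (ch xx 1 (- (p ^ r)%:Z) 0) * ev0 (h0 _ (zA xx yy (generic_shear t))) =
    ev0 (ch xx a1 a2 a3) * ev0 (h0 _ (generic_shear t)) by rewrite -!rmorphM E2.
rewrite !ch0 -!h0n zact_map in E4; last by case: xyy.
rewrite /xx /yy !Ex E3 in E4.
have cN := chN u 1 (- (p ^ r)%:Z) 0.
rewrite (chD u) -[LHS]mul1r -cN mulrAC.
transitivity (ch x 1 (- (p ^ r)%:Z) 0 * h0 R (zA x y t) * ch x (-1) (- - (p ^ r)%:Z) (- 0)); first by [].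
by rewrite E4 mulrAC.
Qed.
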